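(* Let $E \subset T$. There exists $f \in H^\infty$ whose radial limit exists at exactly the points of $T \setminus E$ (i.e. $\lim_{r\to1^-} f(r\zeta)$ exists for $\zeta \in T\setminus E$ and fails to exist for $\zeta \in E$) if and only if $E$ is a $G_{\delta\sigma}$ subset of $T$ of Lebesgue measure zero.
   Context: $\Delta = \{z \in \mathbb{C} : |z|<1\}$ is the open unit disc and $T = \{|z|=1\}$ is the unit circle. $H^\infty$ denotes the space of bounded analytic functions on $\Delta$. For $f\in H^\infty$ and $\zeta\in T$, the radial limit of $f$ at $\zeta$ is $\lim_{r\to1^-} f(r\zeta)$ (finite). A $G_\delta$ subset of $T$ is a countable intersection of relatively open subsets of $T$; a $G_{\delta\sigma}$ set is a countable union of $G_\delta$ sets. Measure on $T$ is Lebesgue (arc-length) measure. *)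

(* Defs.v *)
From Stdlib Require Import Reals.
Open Scope R_scope.

Definition Cx : Type := (R * R)%type.

Definition Cadd (z w : Cx) : Cx := (fst z + fst w, snd z + snd w).
Definition Csub (z w : Cx) : Cx := (fst z - fst w, snd z - snd w).
Definition Cmul (z w : Cx) : Cx :=
  (fst z * fst w - snd z * snd w, fst z * snd w + snd z * fst w).
Definition Cscal (r : R) (z : Cx) : Cx := (r * fst z, r * snd z).
Definition Cnorm (z : Cx) : R := sqrt (fst z * fst z + snd z * snd z).

Definition disc (z : Cx) : Prop := Cnorm z < 1.
Definition circle (z : Cx) : Prop := Cnorm z = 1.

Definition C_differentiable_at (f : Cx -> Cx) (z : Cx) : Prop :=
  exists l : Cx, forall eps : R, 0 < eps -> exists delta : R, 0 < delta /\
    forall h : Cx, Cnorm h < delta ->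
      Cnorm (Csub (Csub (f (Cadd z h)) (f z)) (Cmul l h)) <= eps * Cnorm h.

(* H^infty: bounded analytic (holomorphic) functions on the disc
   (values of f outside the disc are irrelevant) *)
Definition Hinf (f : Cx -> Cx) : Prop :=
  (forall z, disc z -> C_differentiable_at f z) /\
  (exists M : R, forall z, disc z -> Cnorm (f z) <= M).

Definition radial_limit_exists (f : Cx -> Cx) (zeta : Cx) : Prop :=
  exists L : Cx, forall eps : R, 0 < eps -> exists r0 : R, r0 < 1 /\
    forall r : R, r0 < r < 1 -> Cnorm (Csub (f (Cscal r zeta)) L) < eps.

Definition rel_open_T (U : Cx -> Prop) : Prop :=
  (forall z, U z -> circle z) /\
  (forall z, U z -> exists delta : R, 0 < delta /\
     forall w, circle w -> Cnorm (Csub w z) < delta -> U w).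

Definition G_delta_T (E : Cx -> Prop) : Prop :=
  exists U : nat -> Cx -> Prop, (forall n, rel_open_T (U n)) /\
    forall z, E z <-> (circle z /\ forall n, U n z).

Definition G_delta_sigma_T (E : Cx -> Prop) : Prop :=
  exists G : nat -> Cx -> Prop, (forall n, G_delta_T (G n)) /\
    forall z, E z <-> exists n, G n z.

Definition null_T (E : Cx -> Prop) : Prop :=
  forall eps : R, 0 < eps -> exists a b : nat -> R,
    (forall n, a n <= b n) /\
    (forall N, sum_f_R0 (fun n => b n - a n) N < eps) /\
    (forall z, E z -> exists n t, a n < t < b n /\ z = (cos t, sin t)).

(* Main.v *)
Require Import Defs.
From Stdlib Require Import Reals Lra Lia Classical ClassicalEpsilon Arith ZArith Cantor Ranalysis5.
From Coquelicot Require Import Coquelicot.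
Open Scope R_scope.

(** Necessity is Fatou's theorem together with Cauchy's criterion. The integrals of [f (R e^{iu})] over arcs converge, as
[R] tends to [1], to increments of a Lipschitz function on the circle; such a function is differentiable almost everywhere,
and at a point of differentiability Poisson's formula, integrated by parts, gives the radial limit.

Sufficiency follows Kolesnikov. For a null set [E] inside an open set [V] of the circle there is a bounded analytic [F] with
[Re F >= 0] that has radial limits everywhere, is small on the radii ending outside [V], and has [Re F >= 1/5] near the end
of every radius ending in [E]. It is the average of the functions [S_X / (1 + S_X)], with [S_X] the Cauchy transform of [X],
over a chain of open sets [E <= W <= X <= V] that is dense for a relation [thin] ensuring that for two consecutive sets
[X <= X'] of any stage of the construction, [S_X] has radial limits (possibly infinite) off [X'] and in [X]; thus at a given
point a single link of the chain can fail to have a limit, and its weight tends to [0].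

Given a null [G_delta] set [G], the intersection of decreasing open sets [V_n], summing such functions for [G] and [V_n] yields
[F] with [Re F >= 0] whose radial limit is infinite on [G] and finite elsewhere. Then [exp (i Log (1 + F))] is bounded, has
radial limits off [G], and oscillates by a fixed amount on the radii ending in [G]. A rapidly convergent series of such
functions treats a countable union of such sets. *)

(** The obstacle is that the function attached to a null set must have radial limits at every point
    of the circle, not at almost every one. Inside an open set and off its closure its Cauchy
    transform behaves well; on the boundary Fatou's theorem still allows a null set of bad points.
    But a null set can be covered by arcs so short that the radii ending outside a prescribed open
    set hardly feel them, so bad points can be confined to the gap between two sets, and that gap
    can be subdivided again. A real part of size [/ 5] on a set of measure zero is possible because,
    near an interior point of [X], the complement of [X] receives at most about half of the integral
    of the real part of the kernel, however small [X] is. The limit on the [G_delta] has to be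
    infinite, not merely large, so that the logarithm of the modulus runs through infinitely many
    periods and a limit turns into an oscillation. Only Riemann integrals are used: integrals over
    open sets are limits over dyadic cells, and differentiability almost everywhere comes from the
    mean square variation of dyadic slopes. *)

(** * Complex differentiability *)

Definition cdiff (f : C -> C) (z : C) : Prop :=
  @ex_derive C_AbsRing (AbsRing_NormedModule C_AbsRing) f z.

(** The derivative over [C_AbsRing] brings the algebraic rules with it; the epsilon form is the
    shape of [C_differentiable_at] and the one suited to direct estimates. *)
Lemma is_derive_C_eps (f : C -> C) (z l : C) :
  @is_derive C_AbsRing (AbsRing_NormedModule C_AbsRing) f z l <->
  (forall eps, 0 < eps -> exists delta, 0 < delta /\ forall h : C, Cmod h < delta ->
     Cmod (f (z + h) - f z - l * h)%C <= eps * Cmod h).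
Proof.
split.
- intros [_ H] eps Heps.
  destruct (H z (fun P HP => HP) (mkposreal eps Heps)) as [d Hd].
  exists d; split; [apply cond_pos|]. intros h Hh.
  specialize (Hd (z + h)%C).
  assert (B : @ball (AbsRing_UniformSpace C_AbsRing) z d (z + h)%C).
  { change (Cmod ((z + h) - z)%C < d). replace ((z + h) - z)%C with h by ring. exact Hh. }
  specialize (Hd B).
  change (Cmod ((f (z + h) - f z) - ((z + h) - z) * l)%C <= eps * Cmod ((z + h) - z)%C) in Hd.
  replace ((z + h) - z)%C with h in Hd by ring.
  replace (f (z + h) - f z - l * h)%C with (f (z + h) - f z - h * l)%C by ring. exact Hd.
- intros H. split; [apply is_linear_scal_l|].
  intros x Hx.
  assert (E : z = x).
  { apply (@is_filter_lim_locally_unique C_AbsRing (AbsRing_NormedModule C_AbsRing)). exact Hx. }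
  subst x. intros eps. destruct (H eps (cond_pos eps)) as [d [Hd Hd']].
  exists (mkposreal d Hd).
  assert (G : forall y : C, Cmod (y - z)%C < d -> Cmod ((f y - f z) - (y - z) * l)%C <= eps * Cmod (y - z)%C).
  { intros y Hy. specialize (Hd' (y - z)%C Hy).
    replace (z + (y - z))%C with y in Hd' by ring.
    replace ((f y - f z) - (y - z) * l)%C with (f y - f z - l * (y - z))%C by ring. exact Hd'. }
  exact G.
Qed.

Lemma cdiff_eps (f : C -> C) (z : C) : cdiff f z <->
  exists l : C, forall eps, 0 < eps -> exists delta, 0 < delta /\ forall h : C, Cmod h < delta ->
     Cmod (f (z + h) - f z - l * h)%C <= eps * Cmod h.
Proof.
split; intros [l Hl]; exists l; apply is_derive_C_eps; exact Hl.
Qed.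

Lemma cdiff_const c z : cdiff (fun _ => c) z.
Proof. apply ex_derive_const. Qed.
Lemma cdiff_id z : cdiff (fun w => w) z.
Proof. apply ex_derive_id. Qed.
Lemma cdiff_plus f g z : cdiff f z -> cdiff g z -> cdiff (fun w => f w + g w)%C z.
Proof. intros Hf Hg. exact (@ex_derive_plus C_AbsRing (AbsRing_NormedModule C_AbsRing) f g z Hf Hg). Qed.
Lemma cdiff_minus f g z : cdiff f z -> cdiff g z -> cdiff (fun w => f w - g w)%C z.
Proof. intros Hf Hg. exact (@ex_derive_minus C_AbsRing (AbsRing_NormedModule C_AbsRing) f g z Hf Hg). Qed.
Lemma cdiff_mult f g z : cdiff f z -> cdiff g z -> cdiff (fun w => f w * g w)%C z.
Proof.
intros [l Hl] [m Hm]. eexists.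
exact (@is_derive_mult C_AbsRing f g z l m Hl Hm Cmult_comm).
Qed.
Lemma cdiff_comp f g z : cdiff f (g z) -> cdiff g z -> cdiff (fun w => f (g w)) z.
Proof. intros Hf Hg. exact (@ex_derive_comp C_AbsRing (AbsRing_NormedModule C_AbsRing) f g z Hf Hg). Qed.

Lemma Cmod_minus_sym x y : Cmod (x - y)%C = Cmod (y - x)%C.
Proof. rewrite <- Cmod_opp. f_equal. ring. Qed.

Lemma Cmod_rev_triangle x y : Cmod x - Cmod y <= Cmod (x - y)%C.
Proof.
assert (H := Cmod_triangle (x - y) y). replace (x - y + y)%C with x in H by ring. lra.
Qed.

Lemma Cmod_minus_le x y : Cmod (x - y)%C <= Cmod x + Cmod y.
Proof.
assert (H := Cmod_triangle x (- y)). rewrite Cmod_opp in H. exact H.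
Qed.

Lemma cdiff_inv_id (z : C) : z <> 0 -> cdiff (fun w => / w)%C z.
Proof.
intros Hz. apply cdiff_eps. exists (- / (z * z))%C. intros eps Heps.
assert (Hm : 0 < Cmod z) by (apply Cmod_gt_0; exact Hz).
set (m := Cmod z) in *.
(* The remainder is [h^2 / (z^2 (z + h))], and for [|h| < m / 2] its denominator has modulus at
   least [m^3 / 2]. *)
exists (Rmin (m / 2) (eps * m ^ 3 / 2)).
assert (Hm3 : 0 < m ^ 3) by (apply pow_lt; exact Hm).
split. { apply Rmin_pos; nra. }
intros h Hh.
assert (H1 : Cmod h < m / 2) by (eapply Rlt_le_trans; [exact Hh | apply Rmin_l]).
assert (H2 : Cmod h < eps * m ^ 3 / 2) by (eapply Rlt_le_trans; [exact Hh | apply Rmin_r]).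
assert (Hzh : m / 2 <= Cmod (z + h)%C).
{ assert (T := Cmod_rev_triangle z (- h)). rewrite Cmod_opp in T.
  replace (z - - h)%C with (z + h)%C in T by ring. unfold m in *. lra. }
assert (Nzh : (z + h)%C <> 0) by (apply Cmod_gt_0; lra).
replace (/ (z + h) - / z - - / (z * z) * h)%C with (h * h * / (z * z * (z + h)))%C by (field; auto).
assert (Nn : (z * z * (z + h))%C <> 0) by (apply Cmod_gt_0; rewrite !Cmod_mult; fold m; apply Rmult_lt_0_compat; nra).
rewrite !Cmod_mult, Cmod_inv by exact Nn. rewrite !Cmod_mult. fold m.
assert (Hh0 := Cmod_ge_0 h).
apply (Rmult_le_reg_r (m * m * Cmod (z + h)%C)); [nra|].
replace (Cmod h * Cmod h * / (m * m * Cmod (z + h)%C) * (m * m * Cmod (z + h)%C)) with (Cmod h * Cmod h)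
  by (field; nra).
assert (Cmod h <= eps * (m * m * Cmod (z + h)%C)).
{ assert (eps * (m * m * (m / 2)) <= eps * (m * m * Cmod (z + h)%C)).
  { apply Rmult_le_compat_l; [lra|]. apply Rmult_le_compat_l; nra. } simpl in H2. nra. }
nra.
Qed.

Lemma cdiff_inv (f : C -> C) z : cdiff f z -> f z <> 0 -> cdiff (fun w => / f w)%C z.
Proof.
intros Hf Hz. apply (cdiff_comp (fun w => / w)%C f); [apply cdiff_inv_id|]; assumption.
Qed.
Lemma cdiff_div (f g : C -> C) z : cdiff f z -> cdiff g z -> g z <> 0 -> cdiff (fun w => f w / g w)%C z.
Proof. intros. apply cdiff_mult; [|apply cdiff_inv]; assumption. Qed.

Lemma cdiff_ext_loc f g z r : 0 < r -> (forall w, Cmod (w - z)%C < r -> f w = g w) -> cdiff f z -> cdiff g z.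
Proof.
intros Hr E Hf. apply cdiff_eps. apply cdiff_eps in Hf. destruct Hf as [l Hl]. exists l.
intros eps Heps. destruct (Hl eps Heps) as [d [Hd Hd']]. exists (Rmin d r).
split; [apply Rmin_pos; assumption|]. intros h Hh.
rewrite <- !E.
- apply Hd'. eapply Rlt_le_trans; [exact Hh|apply Rmin_l].
- replace (z - z)%C with (RtoC 0) by ring. rewrite Cmod_0. exact Hr.
- replace (z + h - z)%C with h by ring. eapply Rlt_le_trans; [exact Hh|apply Rmin_r].
Qed.

Lemma cdiff_continuous f z : cdiff f z ->
  forall eps, 0 < eps -> exists d, 0 < d /\ forall w, Cmod (w - z)%C < d -> Cmod (f w - f z)%C < eps.
Proof.
intros Hf eps Heps. apply cdiff_eps in Hf. destruct Hf as [l Hl].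
destruct (Hl 1 Rlt_0_1) as [d [Hd Hd']].
assert (Hl0 := Cmod_ge_0 l).
exists (Rmin d (eps / (Cmod l + 2))).
assert (0 < eps / (Cmod l + 2)) by (apply Rdiv_lt_0_compat; lra).
split; [apply Rmin_pos; assumption|]. intros w Hw.
assert (H1 : Cmod (w - z)%C < d) by (eapply Rlt_le_trans; [exact Hw|apply Rmin_l]).
assert (H2 : Cmod (w - z)%C < eps / (Cmod l + 2)) by (eapply Rlt_le_trans; [exact Hw|apply Rmin_r]).
specialize (Hd' _ H1). replace (z + (w - z))%C with w in Hd' by ring.
assert (T := Cmod_triangle (f w - f z - l * (w - z)) (l * (w - z))).
replace (f w - f z - l * (w - z) + l * (w - z))%C with (f w - f z)%C in T by ring.
rewrite Cmod_mult in T.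
assert (Cmod (w - z)%C * (Cmod l + 2) < eps).
{ apply (Rmult_lt_compat_r (Cmod l + 2)) in H2; [|lra].
  replace (eps / (Cmod l + 2) * (Cmod l + 2)) with eps in H2 by (field; lra). exact H2. }
assert (0 <= Cmod (w - z)%C) by apply Cmod_ge_0. nra.
Qed.

(** * Curves and their integrals *)

Definition Ccont (g : R -> C) (t : R) : Prop :=
  continuous (fun s => fst (g s)) t /\ continuous (fun s => snd (g s)) t.

Lemma continuous_eps (u : R -> R) t : continuous u t <->
  forall eps, 0 < eps -> exists d, 0 < d /\ forall s, Rabs (s - t) < d -> Rabs (u s - u t) < eps.
Proof.
split.
- intros H eps He. apply (proj1 (filterlim_locally _ _)) with (eps := mkposreal eps He) in H.
  destruct H as [d Hd]. exists d. split; [apply cond_pos|]. intros s Hs. apply Hd. exact Hs.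
- intros H. apply filterlim_locally. intros eps. destruct (H eps (cond_pos eps)) as [d [Hd Hd']].
  exists (mkposreal d Hd). intros s Hs. apply Hd'. exact Hs.
Qed.

Lemma Rabs_fst_le z : Rabs (fst z) <= Cmod z.
Proof. eapply Rle_trans; [apply Rmax_l | apply (Rmax_Cmod z)]. Qed.
Lemma Rabs_snd_le z : Rabs (snd z) <= Cmod z.
Proof. eapply Rle_trans; [apply Rmax_r | apply (Rmax_Cmod z)]. Qed.
Lemma Cmod_le_abs z : Cmod z <= Rabs (fst z) + Rabs (snd z).
Proof.
unfold Cmod. apply Rsqr_incr_0_var.
- rewrite Rsqr_sqrt by nra. unfold Rsqr. rewrite <- (pow2_abs (fst z)), <- (pow2_abs (snd z)).
  assert (0 <= Rabs (fst z)) by apply Rabs_pos. assert (0 <= Rabs (snd z)) by apply Rabs_pos. nra.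
- assert (0 <= Rabs (fst z)) by apply Rabs_pos. assert (0 <= Rabs (snd z)) by apply Rabs_pos. lra.
Qed.

Lemma Ccont_eps (g : R -> C) t : Ccont g t <->
  forall eps, 0 < eps -> exists d, 0 < d /\ forall s, Rabs (s - t) < d -> Cmod (g s - g t)%C < eps.
Proof.
split.
- intros [H1 H2] eps He.
  apply continuous_eps with (eps := eps / 2) in H1; [|lra].
  apply continuous_eps with (eps := eps / 2) in H2; [|lra].
  destruct H1 as [d1 [D1 H1]]. destruct H2 as [d2 [D2 H2]].
  exists (Rmin d1 d2). split; [apply Rmin_pos; assumption|]. intros s Hs.
  assert (A1 := H1 s (Rlt_le_trans _ _ _ Hs (Rmin_l _ _))).
  assert (A2 := H2 s (Rlt_le_trans _ _ _ Hs (Rmin_r _ _))).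
  eapply Rle_lt_trans; [apply Cmod_le_abs|]. cbn [fst snd Cminus Cplus Copp]. unfold Rminus in A1, A2. lra.
- intros H. split; apply continuous_eps; intros eps He; destruct (H eps He) as [d [D Hd]];
  exists d; split; auto; intros s Hs; specialize (Hd s Hs);
  (eapply Rle_lt_trans; [|exact Hd]); [apply (Rabs_fst_le (g s - g t)%C)|apply (Rabs_snd_le (g s - g t)%C)].
Qed.

Lemma Ccont_const c t : Ccont (fun _ => c) t.
Proof. split; apply continuous_const. Qed.
Lemma Ccont_plus f g t : Ccont f t -> Ccont g t -> Ccont (fun s => f s + g s)%C t.
Proof. intros [a b] [c d]; split; [exact (continuous_plus _ _ _ a c)|exact (continuous_plus _ _ _ b d)]. Qed.
Lemma Ccont_minus f g t : Ccont f t -> Ccont g t -> Ccont (fun s => f s - g s)%C t.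
Proof. intros [a b] [c d]; split; [exact (continuous_minus _ _ _ a c)|exact (continuous_minus _ _ _ b d)]. Qed.
Lemma Ccont_mult f g t : Ccont f t -> Ccont g t -> Ccont (fun s => f s * g s)%C t.
Proof.
intros [a b] [c d]; split.
- exact (continuous_minus _ _ _ (continuous_mult (K:=R_AbsRing) _ _ _ a c) (continuous_mult (K:=R_AbsRing) _ _ _ b d)).
- exact (continuous_plus _ _ _ (continuous_mult (K:=R_AbsRing) _ _ _ a d) (continuous_mult (K:=R_AbsRing) _ _ _ b c)).
Qed.
Lemma Ccont_RtoC (u : R -> R) t : continuous u t -> Ccont (fun s => RtoC (u s)) t.
Proof. intros H; split; [exact H|apply continuous_const]. Qed.
Lemma Ccont_comp (f : C -> C) (g : R -> C) t : cdiff f (g t) -> Ccont g t -> Ccont (fun s => f (g s)) t.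
Proof.
intros Hf Hg. apply Ccont_eps. intros eps He.
destruct (cdiff_continuous _ _ Hf eps He) as [d [D Hd]].
destruct (proj1 (Ccont_eps _ _) Hg d D) as [d' [D' Hd']].
exists d'; split; auto.
Qed.
Lemma Ccont_inv (g : R -> C) t : g t <> 0 -> Ccont g t -> Ccont (fun s => / g s)%C t.
Proof. intros Hn Hg. apply (Ccont_comp (fun w => / w)%C); auto. apply cdiff_inv_id; auto. Qed.
Lemma Ccont_real_comp (g : R -> C) (u : R -> R) t : Ccont g (u t) -> continuous u t -> Ccont (fun s => g (u s)) t.
Proof.
intros [a b] Hu; split; [exact (continuous_comp u (fun s => fst (g s)) t Hu a)|exact (continuous_comp u (fun s => snd (g s)) t Hu b)].
Qed.

(** Taken componentwise so that the real theory of [RInt] applies; integrability is secured by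
    [CcontOn] where it matters. *)
Definition CInt (g : R -> C) (a b : R) : C :=
  (RInt (fun t => fst (g t)) a b, RInt (fun t => snd (g t)) a b).

Definition CcontOn (g : R -> C) a b := forall t, a <= t <= b -> Ccont g t.

Lemma CcontOn_sub g a b c d : a <= c -> d <= b -> CcontOn g a b -> CcontOn g c d.
Proof. intros H1 H2 H t Ht. apply H; lra. Qed.

Lemma CInt_ex g a b : a <= b -> CcontOn g a b ->
  ex_RInt (fun t => fst (g t)) a b /\ ex_RInt (fun t => snd (g t)) a b.
Proof.
intros Hab H. split; apply (ex_RInt_continuous (V:=R_CompleteNormedModule)); intros z Hz;
  rewrite Rmin_left, Rmax_right in Hz by lra; apply H; exact Hz.
Qed.

Lemma CInt_plus f g a b : a <= b -> CcontOn f a b -> CcontOn g a b ->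
  CInt (fun t => f t + g t)%C a b = (CInt f a b + CInt g a b)%C.
Proof.
intros Hab Hf Hg. destruct (CInt_ex f a b Hab Hf), (CInt_ex g a b Hab Hg).
apply injective_projections; simpl.
- apply (RInt_plus (V:=R_CompleteNormedModule)); auto.
- apply (RInt_plus (V:=R_CompleteNormedModule)); auto.
Qed.
Lemma CInt_minus f g a b : a <= b -> CcontOn f a b -> CcontOn g a b ->
  CInt (fun t => f t - g t)%C a b = (CInt f a b - CInt g a b)%C.
Proof.
intros Hab Hf Hg. destruct (CInt_ex f a b Hab Hf), (CInt_ex g a b Hab Hg).
apply injective_projections; simpl.
- apply (RInt_minus (V:=R_CompleteNormedModule)); auto.
- apply (RInt_minus (V:=R_CompleteNormedModule)); auto.
Qed.
Lemma CInt_cmul c g a b : a <= b -> CcontOn g a b ->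
  CInt (fun t => c * g t)%C a b = (c * CInt g a b)%C.
Proof.
intros Hab Hg. destruct (CInt_ex g a b Hab Hg) as [E1 E2].
assert (S1 : forall k u, ex_RInt u a b -> RInt (fun t => k * u t) a b = k * RInt u a b).
{ intros k u Hu. apply (RInt_scal (V:=R_CompleteNormedModule) u a b k Hu). }
assert (S2 : forall k u, ex_RInt u a b -> ex_RInt (fun t => k * u t) a b).
{ intros k u Hu. apply (ex_RInt_scal (V:=R_NormedModule) u a b k Hu). }
apply injective_projections; simpl.
- rewrite <- (S1 (fst c) _ E1), <- (S1 (snd c) _ E2).
  apply (RInt_minus (V:=R_CompleteNormedModule)); auto.
- rewrite <- (S1 (snd c) _ E1), <- (S1 (fst c) _ E2).
  apply (RInt_plus (V:=R_CompleteNormedModule)); auto.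
Qed.
Lemma CInt_Chasles g a b c : a <= b -> b <= c -> CcontOn g a c ->
  CInt g a c = (CInt g a b + CInt g b c)%C.
Proof.
intros Hab Hbc H.
destruct (CInt_ex g a b Hab), (CInt_ex g b c Hbc); try (eapply CcontOn_sub; [| |exact H]; lra).
apply injective_projections; simpl; symmetry; apply (RInt_Chasles (V:=R_CompleteNormedModule)); auto.
Qed.
Lemma CInt_ext f g a b : a <= b -> (forall t, a < t < b -> f t = g t) -> CInt f a b = CInt g a b.
Proof.
intros Hab H. apply injective_projections; simpl; apply (RInt_ext (V:=R_CompleteNormedModule)); intros x Hx;
 rewrite Rmin_left, Rmax_right in Hx by lra; rewrite H; auto.
Qed.
Lemma CInt_const c a b : CInt (fun _ => c) a b = (RtoC (b - a) * c)%C.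
Proof.
apply injective_projections; simpl; rewrite (RInt_const (V:=R_CompleteNormedModule)); simpl;
 unfold scal; simpl; unfold mult; simpl; ring.
Qed.

(** Bounding the two components separately would lose a constant. The norm of the product module is
    [Cmod], so the estimate for vector-valued integrals gives the sharp bound. *)
Lemma CInt_bound g a b M : a <= b -> CcontOn g a b -> (forall t, a <= t <= b -> Cmod (g t) <= M) ->
  Cmod (CInt g a b) <= (b - a) * M.
Proof.
intros Hab Hc HM. destruct (CInt_ex g a b Hab Hc) as [E1 E2].
assert (K : forall x : R * R, norm (V := prod_NormedModule R_AbsRing R_NormedModule R_NormedModule) x = Cmod x).
{ intros x. change (sqrt (Rabs (fst x) ^ 2 + Rabs (snd x) ^ 2) = sqrt (fst x ^ 2 + snd x ^ 2)).
  rewrite !pow2_abs. reflexivity. }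
rewrite <- K.
apply (norm_RInt_le_const (V := prod_NormedModule R_AbsRing R_NormedModule R_NormedModule) g); auto.
- intros x Hx. rewrite K. auto.
- apply (is_RInt_fct_extend_pair (U:=R_NormedModule) (V:=R_NormedModule)).
  + apply (RInt_correct (V:=R_CompleteNormedModule)); auto.
  + apply (RInt_correct (V:=R_CompleteNormedModule)); auto.
Qed.

Definition Cderiv (g : R -> C) (t : R) (v : C) : Prop :=
  is_derive (fun s => fst (g s)) t (fst v) /\ is_derive (fun s => snd (g s)) t (snd v).

Lemma CInt_deriv g g' a b : a <= b -> (forall t, a <= t <= b -> Cderiv g t (g' t)) -> CcontOn g' a b ->
  CInt g' a b = (g b - g a)%C.
Proof.
intros Hab Hd Hc.
apply injective_projections; simpl; apply (is_RInt_unique (V:=R_CompleteNormedModule));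
 [apply (is_RInt_derive (V:=R_CompleteNormedModule) (fun t => fst (g t)))|apply (is_RInt_derive (V:=R_CompleteNormedModule) (fun t => snd (g t)))];
 intros x Hx; rewrite Rmin_left, Rmax_right in Hx by lra; try apply Hd; try apply Hc; auto.
Qed.

Lemma Cderiv_const c t : Cderiv (fun _ => c) t 0.
Proof. split; apply (is_derive_const (V:=R_NormedModule)). Qed.
Lemma Cderiv_plus f g t u v : Cderiv f t u -> Cderiv g t v -> Cderiv (fun s => f s + g s)%C t (u + v)%C.
Proof. intros [a b] [c d]; split; [exact (is_derive_plus _ _ _ _ _ a c)|exact (is_derive_plus _ _ _ _ _ b d)]. Qed.
Lemma Cderiv_minus f g t u v : Cderiv f t u -> Cderiv g t v -> Cderiv (fun s => f s - g s)%C t (u - v)%C.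
Proof. intros [a b] [c d]; split; [exact (is_derive_minus _ _ _ _ _ a c)|exact (is_derive_minus _ _ _ _ _ b d)]. Qed.
Lemma is_derive_Rmult (f g : R -> R) t u v : is_derive f t u -> is_derive g t v ->
  is_derive (fun s => f s * g s) t (u * g t + f t * v).
Proof. intros a b. exact (is_derive_mult (K:=R_AbsRing) _ _ _ _ _ a b Rmult_comm). Qed.
Lemma Cderiv_mult f g t u v : Cderiv f t u -> Cderiv g t v -> Cderiv (fun s => f s * g s)%C t (u * g t + f t * v)%C.
Proof.
intros [a b] [c d]; split; cbn [fst snd Cmult Cplus].
- replace (fst u * fst (g t) - snd u * snd (g t) + (fst (f t) * fst v - snd (f t) * snd v)) with
   (minus (fst u * fst (g t) + fst (f t) * fst v) (snd u * snd (g t) + snd (f t) * snd v)) by (unfold minus, plus, opp; simpl; ring).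
  exact (is_derive_minus _ _ _ _ _ (is_derive_Rmult _ _ _ _ _ a c) (is_derive_Rmult _ _ _ _ _ b d)).
- replace (fst u * snd (g t) + snd u * fst (g t) + (fst (f t) * snd v + snd (f t) * fst v)) with
   (plus (fst u * snd (g t) + fst (f t) * snd v) (snd u * fst (g t) + snd (f t) * fst v)) by (unfold minus, plus, opp; simpl; ring).
  exact (is_derive_plus _ _ _ _ _ (is_derive_Rmult _ _ _ _ _ a d) (is_derive_Rmult _ _ _ _ _ b c)).
Qed.
Lemma Cderiv_RtoC (u : R -> R) (t v : R) : is_derive u t v -> Cderiv (fun s => RtoC (u s)) t (RtoC v).
Proof. intros H; split; [exact H|exact (is_derive_const (K:=R_AbsRing) (V:=R_NormedModule) 0 t)]. Qed.
Lemma Cderiv_cont f t u : Cderiv f t u -> Ccont f t.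
Proof.
intros [a b]; split;
[apply (ex_derive_continuous (V:=R_NormedModule) (fun s => fst (f s))); eexists; exact a
|apply (ex_derive_continuous (V:=R_NormedModule) (fun s => snd (f s))); eexists; exact b].
Qed.
Lemma Cderiv_eq f t u v : u = v -> Cderiv f t u -> Cderiv f t v.
Proof. intros ->; auto. Qed.

(** * Goursat's lemma and Cauchy's formula *)

Lemma nested_intervals (x y : nat -> R) : (forall n, x n <= x (S n)) -> (forall n, y (S n) <= y n) ->
  (forall n, x n <= y n) -> exists t, forall n, x n <= t <= y n.
Proof.
intros Hx Hy Hxy.
assert (Ix : forall n k, x n <= x (n + k)%nat).
{ intros n k; induction k; [rewrite Nat.add_0_r; lra|]. rewrite Nat.add_succ_r. eapply Rle_trans; [exact IHk|apply Hx]. }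
assert (Iy : forall n k, y (n + k)%nat <= y n).
{ intros n k; induction k; [rewrite Nat.add_0_r; lra|]. rewrite Nat.add_succ_r. eapply Rle_trans; [apply Hy|exact IHk]. }
assert (C : forall n m, x n <= y m).
{ intros n m. eapply Rle_trans; [apply (Ix n m)|]. eapply Rle_trans; [apply Hxy|]. rewrite Nat.add_comm. apply Iy. }
destruct (completeness (fun r => exists n, r = x n)) as [t [Ht1 Ht2]].
- exists (y O). intros r [n ->]. apply C.
- exists (x O). exists O; reflexivity.
- exists t. intros n; split.
  + apply Ht1. exists n; reflexivity.
  + apply Ht2. intros r [m ->]. apply C.
Qed.

Section Bisection.
Variables (I : R -> R -> R -> R -> C) (a b c d : R).
Hypotheses (Hab : a <= b) (Hcd : c <= d).
Hypothesis split1 : forall x m y u v, a <= x <= m -> m <= y <= b -> c <= u <= v -> v <= d ->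
  I x y u v = (I x m u v + I m y u v)%C.
Hypothesis split2 : forall x y u m v, a <= x <= y -> y <= b -> c <= u <= m -> m <= v <= d ->
  I x y u v = (I x y u m + I x y m v)%C.

Let hw (n : nat) := (b - a) / 2 ^ n.
Let kw (n : nat) := (d - c) / 2 ^ n.

(** Only the lower left corner of the current rectangle is carried along, since its sides are [hw n]
    and [kw n]. A quarter is chosen by two halvings, each keeping a half on which [|I|] is at least
    half as large. *)
Let step (n : nat) (p : R * R) : R * R :=
  let x := fst p in let u := snd p in
  let x' := if Rle_dec (Cmod (I x (x + hw n) u (u + kw n)) / 2) (Cmod (I x (x + hw (S n)) u (u + kw n)))
            then x else x + hw (S n) in
  let u' := if Rle_dec (Cmod (I x' (x' + hw (S n)) u (u + kw n)) / 2) (Cmod (I x' (x' + hw (S n)) u (u + kw (S n))))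
            then u else u + kw (S n) in
  (x', u').

Fixpoint corner (n : nat) : R * R := match n with O => (a, c) | S n => step n (corner n) end.

Let hw_half n : hw n = 2 * hw (S n).
Proof. unfold hw. simpl. field. apply pow_nonzero; lra. Qed.
Let kw_half n : kw n = 2 * kw (S n).
Proof. unfold kw. simpl. field. apply pow_nonzero; lra. Qed.
Let hw_pos n : 0 <= hw n.
Proof. unfold hw. apply Rdiv_le_0_compat; [lra|apply pow_lt; lra]. Qed.
Let kw_pos n : 0 <= kw n.
Proof. unfold kw. apply Rdiv_le_0_compat; [lra|apply pow_lt; lra]. Qed.

Lemma corner_step_spec n : let x := fst (corner n) in let u := snd (corner n) in
  let x' := fst (corner (S n)) in let u' := snd (corner (S n)) in
  a <= x -> x + hw n <= b -> c <= u -> u + kw n <= d ->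
  (x <= x' <= x + hw (S n)) /\ (u <= u' <= u + kw (S n)) /\
  Cmod (I x (x + hw n) u (u + kw n)) / 4 <= Cmod (I x' (x' + hw (S n)) u' (u' + kw (S n))).
Proof.
intros x u x' u' H1 H2 H3 H4.
assert (Hp := hw_pos (S n)). assert (Kp := kw_pos (S n)).
assert (Hh := hw_half n). assert (Kh := kw_half n).
change x' with (fst (step n (corner n))). change u' with (snd (step n (corner n))).
unfold step. fold x u. cbn [fst snd].
set (x1 := if Rle_dec (Cmod (I x (x + hw n) u (u + kw n)) / 2) (Cmod (I x (x + hw (S n)) u (u + kw n)))
            then x else x + hw (S n)).
assert (A1 : x <= x1 <= x + hw (S n) /\ Cmod (I x (x + hw n) u (u + kw n)) / 2 <= Cmod (I x1 (x1 + hw (S n)) u (u + kw n))).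
{ unfold x1. destruct (Rle_dec _ _) as [L|L]; [split; [lra|exact L]|]. split; [lra|].
  rewrite (split1 x (x + hw (S n)) (x + hw n) u (u + kw n)) in L |- * by lra.
  assert (T := Cmod_triangle (I x (x + hw (S n)) u (u + kw n)) (I (x + hw (S n)) (x + hw n) u (u + kw n))).
  replace (x + hw (S n) + hw (S n)) with (x + hw n) by lra. lra. }
clearbody x1.
set (u1 := if Rle_dec (Cmod (I x1 (x1 + hw (S n)) u (u + kw n)) / 2) (Cmod (I x1 (x1 + hw (S n)) u (u + kw (S n))))
            then u else u + kw (S n)).
assert (A2 : u <= u1 <= u + kw (S n) /\ Cmod (I x1 (x1 + hw (S n)) u (u + kw n)) / 2 <= Cmod (I x1 (x1 + hw (S n)) u1 (u1 + kw (S n)))).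
{ unfold u1. destruct (Rle_dec _ _) as [L|L]; [split; [lra|exact L]|]. split; [lra|].
  rewrite (split2 x1 (x1 + hw (S n)) u (u + kw (S n)) (u + kw n)) in L |- * by lra.
  assert (T := Cmod_triangle (I x1 (x1 + hw (S n)) u (u + kw (S n))) (I x1 (x1 + hw (S n)) (u + kw (S n)) (u + kw n))).
  replace (u + kw (S n) + kw (S n)) with (u + kw n) by lra. lra. }
clearbody u1. split; [tauto|]. split; [tauto|]. lra.
Qed.

Lemma corner_bounds n : a <= fst (corner n) /\ fst (corner n) + hw n <= b /\
  c <= snd (corner n) /\ snd (corner n) + kw n <= d /\
  Cmod (I a b c d) / 4 ^ n <= Cmod (I (fst (corner n)) (fst (corner n) + hw n) (snd (corner n)) (snd (corner n) + kw n)).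
Proof.
induction n as [|n [H1 [H2 [H3 [H4 H5]]]]].
- simpl. unfold hw, kw. simpl. replace (a + (b - a) / 1) with b by field. replace (c + (d - c) / 1) with d by field.
  repeat split; lra.
- destruct (corner_step_spec n H1 H2 H3 H4) as [K1 [K2 K3]].
  assert (Hh := hw_half n). assert (Kh := kw_half n).
  repeat split; try lra.
  eapply Rle_trans; [|exact K3].
  replace (Cmod (I a b c d) / 4 ^ S n) with (Cmod (I a b c d) / 4 ^ n / 4) by (simpl; field; apply pow_nonzero; lra).
  lra.
Qed.

(** Goursat's bisection, stated for an abstract additive function of rectangles: on the nested
    rectangles [|I|] stays above [|I a b c d| / 4^n], while near their common point it is small
    compared with the squared sum of the sides, which also decreases like [4^-n]. *)
Lemma additive_rectangle_zero :
  (forall t th, a <= t <= b -> c <= th <= d -> forall eps, 0 < eps -> exists delta, 0 < delta /\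
     forall x y u v, a <= x <= t -> t <= y <= b -> c <= u <= th -> th <= v <= d ->
       y - x < delta -> v - u < delta -> Cmod (I x y u v) <= eps * ((y - x) + (v - u)) ^ 2) ->
  I a b c d = 0.
Proof.
intros loc.
assert (N1 : exists t, forall n, fst (corner n) <= t <= fst (corner n) + hw n).
{ apply nested_intervals; intros n; assert (Hh := hw_half n); assert (P := hw_pos (S n));
  destruct (corner_bounds n) as [H1 [H2 [H3 [H4 _]]]]; destruct (corner_step_spec n H1 H2 H3 H4) as [K1 [K2 _]]; lra. }
assert (N2 : exists t, forall n, snd (corner n) <= t <= snd (corner n) + kw n).
{ apply nested_intervals; intros n; assert (Hh := kw_half n); assert (P := kw_pos (S n));
  destruct (corner_bounds n) as [H1 [H2 [H3 [H4 _]]]]; destruct (corner_step_spec n H1 H2 H3 H4) as [K1 [K2 _]]; lra. }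
destruct N1 as [t Ht]. destruct N2 as [th Hth].
assert (B0 := corner_bounds 0).
apply Cmod_eq_0.
destruct (Rle_lt_or_eq_dec 0 (Cmod (I a b c d)) (Cmod_ge_0 _)) as [P|P]; [exfalso|symmetry; exact P].
set (s := (b - a) + (d - c)).
assert (Hs : 0 <= s) by (unfold s; lra).
(* Chosen so that [eps * s^2] is less than [|I a b c d|]; the [+ 1] covers a degenerate rectangle
   with [s = 0]. *)
set (eps := Cmod (I a b c d) / (2 * (s ^ 2 + 1))).
assert (Hden : 0 < 2 * (s ^ 2 + 1)) by nra.
assert (Heps : 0 < eps) by (apply Rdiv_lt_0_compat; assumption).
assert (Hta : a <= t <= b). { specialize (Ht O). unfold hw in Ht. simpl in Ht. lra. }
assert (Htc : c <= th <= d). { specialize (Hth O). unfold kw in Hth. simpl in Hth. lra. }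
destruct (loc t th Hta Htc eps Heps) as [delta [D Hd]].
destruct (pow_lt_1_zero (/2)) with (y := delta / (s + 1)) as [n Hn].
{ rewrite Rabs_pos_eq; lra. } { apply Rdiv_lt_0_compat; lra. }
specialize (Hn n (le_n n)). rewrite Rabs_pos_eq in Hn by (apply pow_le; lra).
rewrite pow_inv in Hn.
assert (P2 : 0 < 2 ^ n) by (apply pow_lt; lra).
assert (Hi : 0 < / 2 ^ n) by (apply Rinv_0_lt_compat; exact P2).
assert (Hw : s * / 2 ^ n < delta).
{ apply (Rmult_lt_compat_r (s + 1)) in Hn; [|lra]. replace (delta / (s + 1) * (s + 1)) with delta in Hn by (field; lra). nra. }
destruct (corner_bounds n) as [H1 [H2 [H3 [H4 H5]]]].
specialize (Hd (fst (corner n)) (fst (corner n) + hw n) (snd (corner n)) (snd (corner n) + kw n)).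
specialize (Ht n). specialize (Hth n).
assert (E1 : hw n = (b - a) * / 2 ^ n) by reflexivity.
assert (E2 : kw n = (d - c) * / 2 ^ n) by reflexivity.
unfold s in Hw.
assert (0 <= (b - a) * / 2 ^ n) by (apply Rmult_le_pos; lra).
assert (0 <= (d - c) * / 2 ^ n) by (apply Rmult_le_pos; lra).
assert (Hd' := Hd ltac:(lra) ltac:(lra) ltac:(lra) ltac:(lra) ltac:(lra) ltac:(lra)).
replace (fst (corner n) + hw n - fst (corner n) + (snd (corner n) + kw n - snd (corner n))) with (s * / 2 ^ n) in Hd'
 by (unfold s; rewrite E1, E2; ring).
assert (F : Cmod (I a b c d) / 4 ^ n <= eps * (s * / 2 ^ n) ^ 2) by lra.
replace ((s * / 2 ^ n) ^ 2) with (s ^ 2 / 4 ^ n) in F.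
2: { replace (4 ^ n) with (2 ^ n * 2 ^ n) by (rewrite <- Rpow_mult_distr; f_equal; lra). field. lra. }
assert (P4 : 0 < 4 ^ n) by (apply pow_lt; lra).
apply (Rmult_le_compat_r (4 ^ n)) in F; [|lra].
replace (Cmod (I a b c d) / 4 ^ n * 4 ^ n) with (Cmod (I a b c d)) in F by (field; lra).
replace (eps * (s ^ 2 / 4 ^ n) * 4 ^ n) with (eps * s ^ 2) in F by (field; lra).
assert (eps * (2 * (s ^ 2 + 1)) = Cmod (I a b c d)) by (unfold eps; field; lra).
nra.
Qed.

End Bisection.

Definition cis (t : R) : C := (cos t, sin t).

Lemma Cmod_cis t : Cmod (cis t) = 1.
Proof. unfold Cmod, cis; simpl. replace (_ + _) with 1; [apply sqrt_1|]. generalize (sin2_cos2 t). unfold Rsqr. lra. Qed.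

Lemma cis_neq0 t : cis t <> 0.
Proof. apply Cmod_gt_0. rewrite Cmod_cis. lra. Qed.

Lemma cis_deriv t : Cderiv cis t (Ci * cis t)%C.
Proof.
split; simpl.
- replace (0 * cos t - 1 * sin t) with (- sin t) by ring. apply is_derive_Reals. apply derivable_pt_lim_cos.
- replace (0 * sin t + 1 * cos t) with (cos t) by ring. apply is_derive_Reals. apply derivable_pt_lim_sin.
Qed.
Lemma cis_cont t : Ccont cis t.
Proof. eapply Cderiv_cont, cis_deriv. Qed.

Lemma cis_add s t : cis (s + t) = (cis s * cis t)%C.
Proof. apply injective_projections; simpl; [rewrite cos_plus; ring|rewrite sin_plus; ring]. Qed.

Lemma cis_inv t : cis (- t) = (/ cis t)%C.
Proof.
assert (H : (cis (- t) * cis t)%C = 1).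
{ rewrite <- cis_add. replace (- t + t) with 0 by ring. unfold cis. rewrite cos_0, sin_0. reflexivity. }
rewrite <- (Cmult_1_l (/ cis t)), <- H. field. apply cis_neq0.
Qed.

Lemma cis_lipschitz s t : Cmod (cis s - cis t)%C <= Rabs (s - t).
Proof.
assert (G : forall s t, t <= s -> Cmod (cis s - cis t)%C <= s - t).
{ clear. intros s t H.
  rewrite <- (CInt_deriv cis (fun u => Ci * cis u)%C t s H (fun u _ => cis_deriv u)).
  - rewrite <- (Rmult_1_r (s - t)). apply CInt_bound; auto.
    + intros u _. apply Ccont_mult; [apply Ccont_const|apply cis_cont].
    + intros u _. rewrite Cmod_mult, Cmod_Ci, Cmod_cis. lra.
  - intros u _. apply Ccont_mult; [apply Ccont_const|apply cis_cont]. }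
destruct (Rle_dec t s).
- rewrite Rabs_pos_eq by lra. apply G; lra.
- rewrite Cmod_minus_sym, Rabs_left by lra. replace (- (s - t)) with (t - s) by ring. apply G; lra.
Qed.

(* The homothety centred at [p] carries the unit circle to smaller circles enclosing [p]. *)
Definition homothety (p : C) (t th : R) : C := (p + RtoC t * (cis th - p))%C.

Section Goursat.
Variables (F : C -> C) (p : C) (a b c d : R).
Hypotheses (Ha : 0 <= a) (Hab : a <= b) (Hcd : c <= d).
Notation gam := (homothety p).
Hypothesis HF : forall t th, a <= t <= b -> c <= th <= d -> cdiff F (gam t th).

Let gt (th : R) : C := (cis th - p)%C.
Let gth (t th : R) : C := (RtoC t * (Ci * cis th))%C.

Let gam_t t th : Cderiv (fun s => gam s th) t (gt th).
Proof.
unfold homothety. eapply Cderiv_eq; [|apply Cderiv_plus; [apply Cderiv_const|apply Cderiv_mult; [apply Cderiv_RtoC, (is_derive_id (K:=R_AbsRing))|apply Cderiv_const]]].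
unfold gt. change (RtoC one) with (RtoC 1). ring.
Qed.
Let gam_th t th : Cderiv (fun s => gam t s) th (gth t th).
Proof.
unfold homothety. eapply Cderiv_eq; [|apply Cderiv_plus; [apply Cderiv_const|apply Cderiv_mult; [apply Cderiv_const|apply Cderiv_minus; [apply cis_deriv|apply Cderiv_const]]]].
unfold gth. ring.
Qed.
Let gth_cont t th : Ccont (gth t) th.
Proof. unfold gth. apply Ccont_mult; [apply Ccont_const|]. apply Ccont_mult; [apply Ccont_const|apply cis_cont]. Qed.

(** The integral of [f dz] along the image under [homothety p] of the positively oriented boundary
    of a parameter rectangle. With this parametrization circles around [p] are coordinate lines, so
    no deformation of rectangles into circles is required. *)
Definition boundary_integral (f : C -> C) x y u v : C :=
  (CInt (fun th => f (gam y th) * gth y th) u v - CInt (fun th => f (gam x th) * gth x th) u v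
   - CInt (fun t => f (gam t v) * gt v) x y + CInt (fun t => f (gam t u) * gt u) x y)%C.

Let curve_cont_th (f : C -> C) t th : cdiff f (gam t th) -> Ccont (fun s => f (gam t s) * gth t s)%C th.
Proof.
intros H. apply Ccont_mult; [|apply gth_cont]. apply Ccont_comp; [exact H|]. eapply Cderiv_cont, gam_th.
Qed.
Let curve_cont_t (f : C -> C) t th : cdiff f (gam t th) -> Ccont (fun s => f (gam s th) * gt th)%C t.
Proof.
intros H. apply Ccont_mult; [|apply Ccont_const]. apply (Ccont_comp f (fun s => gam s th)); [exact H|]. eapply Cderiv_cont, gam_t.
Qed.

(** The quadratic primitive [P] turns each side into a difference of corner values, and these
    cancel. *)
Lemma boundary_integral_affine (f0 l z0 : C) x y u v : x <= y -> u <= v ->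
  boundary_integral (fun z => f0 + l * (z - z0))%C x y u v = 0.
Proof.
intros Hxy Huv.
assert (Hl : forall z, cdiff (fun z => f0 + l * (z - z0))%C z).
{ intros z. apply cdiff_plus; [apply cdiff_const|]. apply cdiff_mult; [apply cdiff_const|].
  apply cdiff_minus; [apply cdiff_id|apply cdiff_const]. }
set (P := fun z : C => (f0 * z + l / RtoC 2 * ((z - z0) * (z - z0)))%C).
assert (HP : forall g t w, Cderiv g t w -> Cderiv (fun s => P (g s)) t ((f0 + l * (g t - z0)) * w)%C).
{ intros g t w H. unfold P.
  eapply Cderiv_eq; [|apply Cderiv_plus; [apply Cderiv_mult; [apply Cderiv_const|exact H]|apply Cderiv_mult; [apply Cderiv_const|
    apply Cderiv_mult; (apply Cderiv_minus; [exact H|apply Cderiv_const])]]].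
  cbv beta. field. }
assert (T : forall th, CInt (fun t => (f0 + l * (gam t th - z0)) * gt th)%C x y = (P (gam y th) - P (gam x th))%C).
{ intros th. apply (CInt_deriv (fun t => P (gam t th))); [exact Hxy| |].
  - intros t _. exact (HP (fun s => gam s th) t _ (gam_t t th)).
  - intros t _. apply (curve_cont_t (fun z => f0 + l * (z - z0))%C). apply Hl. }
assert (S : forall t, CInt (fun th => (f0 + l * (gam t th - z0)) * gth t th)%C u v = (P (gam t v) - P (gam t u))%C).
{ intros t. apply (CInt_deriv (fun th => P (gam t th))); [exact Huv| |].
  - intros th _. exact (HP (fun s => gam t s) th _ (gam_th t th)).
  - intros th _. apply (curve_cont_th (fun z => f0 + l * (z - z0))%C). apply Hl. }
unfold boundary_integral. rewrite !T, !S. ring.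
Qed.

Let L := 1 + Cmod p + b.

Let gt_bound th : Cmod (gt th) <= L.
Proof. unfold gt, L. eapply Rle_trans; [apply Cmod_minus_le|]. rewrite Cmod_cis. lra. Qed.
Let gth_bound t th : a <= t <= b -> Cmod (gth t th) <= L.
Proof.
intros Ht. unfold gth, L. rewrite !Cmod_mult, Cmod_Ci, Cmod_cis, Cmod_R, Rabs_pos_eq by lra.
assert (0 <= Cmod p) by apply Cmod_ge_0. lra.
Qed.
Let gam_lip t th t' th' : a <= t' <= b -> Cmod (gam t th - gam t' th')%C <= L * (Rabs (t - t') + Rabs (th - th')).
Proof.
intros Ht. unfold homothety.
replace (p + t * (cis th - p) - (p + t' * (cis th' - p)))%C with
  (RtoC (t - t') * gt th + RtoC t' * (cis th - cis th'))%C by (unfold gt; rewrite RtoC_minus; ring).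
eapply Rle_trans; [apply Cmod_triangle|]. rewrite !Cmod_mult, !Cmod_R, (Rabs_pos_eq t') by lra.
assert (A := gt_bound th). assert (B := cis_lipschitz th th').
assert (0 <= Cmod p) by apply Cmod_ge_0. assert (b <= L) by (unfold L; lra).
assert (0 <= Rabs (t - t')) by apply Rabs_pos. assert (0 <= Rabs (th - th')) by apply Rabs_pos.
assert (0 <= Cmod (cis th - cis th')%C) by apply Cmod_ge_0.
nra.
Qed.

(** Near a point [F] is affine up to an error [E] small compared with the distance. The affine part
    contributes nothing, and integrating [E] over a perimeter of the same order as the distance
    gives the quadratic smallness required by the bisection. *)
Lemma boundary_integral_zero : boundary_integral F a b c d = 0.
Proof.
assert (C1 : forall t u v, a <= t <= b -> c <= u -> v <= d -> CcontOn (fun th => F (gam t th) * gth t th)%C u v).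
{ intros t u v Ht Hu Hv s Hs. apply curve_cont_th. apply HF; lra. }
assert (C2 : forall th x y, c <= th <= d -> a <= x -> y <= b -> CcontOn (fun t => F (gam t th) * gt th)%C x y).
{ intros t u v Ht Hu Hv s Hs. apply curve_cont_t. apply HF; lra. }
apply (additive_rectangle_zero (boundary_integral F)); auto.
- intros x m y u v H1 H2 H3 H4. unfold boundary_integral.
  rewrite (CInt_Chasles (fun t => F (gam t v) * gt v)%C x m y) by (try apply C2; lra).
  rewrite (CInt_Chasles (fun t => F (gam t u) * gt u)%C x m y) by (try apply C2; lra). ring.
- intros x y u m v H1 H2 H3 H4. unfold boundary_integral.
  rewrite (CInt_Chasles (fun t => F (gam y t) * gth y t)%C u m v) by (try apply C1; lra).
  rewrite (CInt_Chasles (fun t => F (gam x t) * gth x t)%C u m v) by (try apply C1; lra). ring.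
- intros t th Ht Hth eps Heps.
  destruct (proj1 (cdiff_eps _ _) (HF t th Ht Hth)) as [l Hl].
  assert (HL : 0 < L) by (unfold L; assert (T := Cmod_ge_0 p); lra).
  (* One factor [L] turns parameter distances into distances in the plane, the other bounds the
     speed of the sides; the [2] accounts for the perimeter [2 * s]. *)
  destruct (Hl (eps / (2 * L ^ 2))) as [del [D Hdel]].
  { apply Rdiv_lt_0_compat; [lra|]. nra. }
  exists (del / (2 * L)). split; [apply Rdiv_lt_0_compat; lra|].
  intros x y u v H1 H2 H3 H4 H5 H6.
  set (z0 := gam t th) in *. set (f0 := F z0) in *.
  set (E := fun z : C => (F z - (f0 + l * (z - z0)))%C).
  set (s := (y - x) + (v - u)).
  assert (Hlc : forall z, cdiff (fun z => f0 + l * (z - z0))%C z).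
  { intros z. apply cdiff_plus; [apply cdiff_const|]. apply cdiff_mult; [apply cdiff_const|].
    apply cdiff_minus; [apply cdiff_id|apply cdiff_const]. }
  assert (HE : forall t' th', x <= t' <= y -> u <= th' <= v -> Cmod (E (gam t' th')) <= eps / (2 * L) * s).
  { intros t' th' Ht' Hth'.
    assert (G := gam_lip t' th' t th Ht). fold z0 in G.
    assert (R1 : Rabs (t' - t) <= y - x) by (apply Rabs_le; lra).
    assert (R2 : Rabs (th' - th) <= v - u) by (apply Rabs_le; lra).
    assert (G' : Cmod (gam t' th' - z0)%C <= L * s) by (unfold s; nra).
    assert (Q : Cmod (gam t' th' - z0)%C < del).
    { eapply Rle_lt_trans; [exact G'|]. unfold s.
      replace del with (L * (del / (2 * L) + del / (2 * L))) by (field; lra). apply Rmult_lt_compat_l; lra. }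
    specialize (Hdel _ Q). replace (z0 + (gam t' th' - z0))%C with (gam t' th') in Hdel by ring.
    replace (E (gam t' th')) with (F (gam t' th') - F z0 - l * (gam t' th' - z0))%C by (unfold E, f0; ring).
    eapply Rle_trans; [exact Hdel|].
    replace (eps / (2 * L) * s) with (eps / (2 * L ^ 2) * (L * s)) by (field; lra).
    apply Rmult_le_compat_l; [|exact G']. left; apply Rdiv_lt_0_compat; nra. }
  assert (CE : forall t' th', a <= t' <= b -> c <= th' <= d -> cdiff E (gam t' th')).
  { intros. unfold E. apply cdiff_minus; [apply HF; lra|apply Hlc]. }
  assert (EQ : boundary_integral F x y u v = boundary_integral E x y u v).
  { rewrite <- (Cplus_0_r (boundary_integral E x y u v)).
    rewrite <- (boundary_integral_affine f0 l z0 x y u v) by lra.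
    unfold boundary_integral.
    assert (S1 : forall t', x <= t' <= y -> CInt (fun th => F (gam t' th) * gth t' th)%C u v =
       (CInt (fun th => E (gam t' th) * gth t' th)%C u v + CInt (fun th => (f0 + l * (gam t' th - z0)) * gth t' th)%C u v)%C).
    { intros t' Ht'. rewrite <- CInt_plus; [|lra| |].
      - apply CInt_ext; [lra|]. intros. unfold E. ring.
      - intros w Hw. apply curve_cont_th. apply CE; lra.
      - intros w Hw. apply (curve_cont_th (fun z => f0 + l * (z - z0))%C). apply Hlc. }
    assert (S2 : forall th', u <= th' <= v -> CInt (fun t => F (gam t th') * gt th')%C x y =
       (CInt (fun t => E (gam t th') * gt th')%C x y + CInt (fun t => (f0 + l * (gam t th' - z0)) * gt th')%C x y)%C).
    { intros th' Ht'. rewrite <- CInt_plus; [|lra| |].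
      - apply CInt_ext; [lra|]. intros. unfold E. ring.
      - intros w Hw. apply curve_cont_t. apply CE; lra.
      - intros w Hw. apply (curve_cont_t (fun z => f0 + l * (z - z0))%C). apply Hlc. }
    rewrite !S1, !S2 by lra. ring. }
  rewrite EQ. unfold boundary_integral.
  assert (Hs : 0 <= s) by (unfold s; lra).
  assert (B1 : forall t', x <= t' <= y -> Cmod (CInt (fun th => E (gam t' th) * gth t' th)%C u v) <= (v - u) * (eps / 2 * s)).
  { intros t' Ht'. apply CInt_bound; [lra| |].
    - intros w Hw. apply curve_cont_th. apply CE; lra.
    - intros w Hw. rewrite Cmod_mult. replace (eps / 2 * s) with (eps / (2 * L) * s * L) by (field; lra).
      apply Rmult_le_compat; try apply Cmod_ge_0; [apply HE; lra|apply gth_bound; lra]. }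
  assert (B2 : forall th', u <= th' <= v -> Cmod (CInt (fun t => E (gam t th') * gt th')%C x y) <= (y - x) * (eps / 2 * s)).
  { intros th' Ht'. apply CInt_bound; [lra| |].
    - intros w Hw. apply curve_cont_t. apply CE; lra.
    - intros w Hw. rewrite Cmod_mult. replace (eps / 2 * s) with (eps / (2 * L) * s * L) by (field; lra).
      apply Rmult_le_compat; try apply Cmod_ge_0; [apply HE; lra|apply gt_bound]. }
  eapply Rle_trans; [apply Cmod_triangle|].
  eapply Rle_trans; [apply Rplus_le_compat_r, Cmod_minus_le|].
  eapply Rle_trans; [apply Rplus_le_compat_r, Rplus_le_compat_r, Cmod_minus_le|].
  assert (b1 := B1 y ltac:(lra)). assert (b2 := B1 x ltac:(lra)).
  assert (b3 := B2 u ltac:(lra)). assert (b4 := B2 v ltac:(lra)).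
  fold s. replace (eps * s ^ 2) with ((v - u) * (eps / 2 * s) + (v - u) * (eps / 2 * s) + (y - x) * (eps / 2 * s) + (y - x) * (eps / 2 * s)) by (unfold s; field).
  lra.
Qed.

End Goursat.

Ltac ccont := lazymatch goal with
 | |- Ccont (fun s => Cplus _ _) _ => apply Ccont_plus; ccont
 | |- Ccont (fun s => Cminus _ _) _ => apply Ccont_minus; ccont
 | |- Ccont (fun s => Cmult _ _) _ => apply Ccont_mult; ccont
 | |- _ => first [solve [auto] | apply Ccont_const]
 end.

(** * The Cauchy kernel and Cauchy's formula on the unit circle *)

Definition cauchy_kernel (z : C) (s : R) : C := (/ (1 - z * cis (- s)))%C.

Lemma cauchy_den_bound z s : 1 - Cmod z <= Cmod (1 - z * cis (- s))%C.
Proof. assert (T := Cmod_rev_triangle 1 (z * cis (- s))). rewrite Cmod_mult, Cmod_cis, Cmod_1 in T. lra. Qed.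
Lemma cauchy_den_neq0 z s : Cmod z < 1 -> (1 - z * cis (- s))%C <> 0.
Proof. intros H. apply Cmod_gt_0. assert (T := cauchy_den_bound z s). lra. Qed.
Lemma cauchy_kernel_bound z s : Cmod z < 1 -> Cmod (cauchy_kernel z s) <= / (1 - Cmod z).
Proof.
intros H. unfold cauchy_kernel. rewrite Cmod_inv by (apply cauchy_den_neq0; exact H).
apply Rinv_le_contravar; [lra|apply cauchy_den_bound].
Qed.
Lemma continuous_opp_id t : continuous (fun s : R => - s) t.
Proof. apply (continuous_opp (V:=R_NormedModule) (fun s => s)). apply continuous_id. Qed.
Lemma cis_opp_cont t : Ccont (fun s => cis (- s)) t.
Proof. apply Ccont_real_comp; [apply cis_cont|apply continuous_opp_id]. Qed.
Lemma cauchy_kernel_cont z t : Cmod z < 1 -> Ccont (cauchy_kernel z) t.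
Proof.
intros H. apply Ccont_inv; [apply cauchy_den_neq0; exact H|].
apply Ccont_minus; [apply Ccont_const|apply Ccont_mult; [apply Ccont_const|apply cis_opp_cont]].
Qed.

Lemma cis_opp_PI : cis (- PI) = cis PI.
Proof. unfold cis. rewrite cos_neg, sin_neg, sin_PI. f_equal. ring. Qed.


Lemma eq_of_Cmod_le (x y : C) : (forall eps, 0 < eps -> Cmod (x - y)%C <= eps) -> x = y.
Proof.
intros H. assert (E : (x - y)%C = 0).
{ apply Cmod_eq_0. apply Rle_antisym; [|apply Cmod_ge_0]. apply le_epsilon. intros eps He. specialize (H eps He). lra. }
replace x with ((x - y) + y)%C by ring. rewrite E. ring.
Qed.

Lemma homothety_Cmod p t th : Cmod p < 1 -> 0 <= t <= 1 -> Cmod (homothety p t th) <= 1.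
Proof.
intros Hp Ht. unfold homothety. replace (p + t * (cis th - p))%C with (RtoC (1 - t) * p + RtoC t * cis th)%C
  by (rewrite RtoC_minus; ring).
eapply Rle_trans; [apply Cmod_triangle|]. rewrite !Cmod_mult, Cmod_cis, !Cmod_R, !Rabs_pos_eq by lra. nra.
Qed.

Section CauchyCircle.
Variables (g : C -> C) (R0 : R) (p : C).
Hypotheses (HR0 : 1 < R0) (Hg : forall z, Cmod z < R0 -> cdiff g z) (Hp : Cmod p < 1).

Let J (t : R) := CInt (fun th => g (homothety p t th) * cauchy_kernel p th)%C (- PI) PI.

Let hom_cont t th : Ccont (homothety p t) th.
Proof.
unfold homothety. apply Ccont_plus; [apply Ccont_const|apply Ccont_mult; [apply Ccont_const|]].
apply Ccont_minus; [apply cis_cont|apply Ccont_const].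
Qed.

Let J_cont t : 0 <= t <= 1 -> CcontOn (fun th => g (homothety p t th) * cauchy_kernel p th)%C (- PI) PI.
Proof.
intros Ht s _. apply Ccont_mult; [|apply cauchy_kernel_cont; exact Hp].
apply Ccont_comp; [|apply hom_cont]. apply Hg. eapply Rle_lt_trans; [apply homothety_Cmod|]; assumption.
Qed.

(** The vanishing of the boundary integral is applied to [g z / (z - p)] between the circles of
    parameters [t] and 1. The two radial sides coincide because [cis (- PI) = cis PI], and on each
    circle [dz / (z - p)] equals [Ci * cauchy_kernel p th] times [d th]. *)
Let J_const t : 0 < t <= 1 -> J 1 = J t.
Proof.
intros Ht. assert (PP := PI_RGT_0).
assert (B := boundary_integral_zero (fun z => g z / (z - p))%C p t 1 (- PI) PI).
specialize (B ltac:(lra) ltac:(lra) ltac:(lra)).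
assert (NE : forall s th, t <= s -> (homothety p s th - p)%C <> 0).
{ intros s th Hs. unfold homothety. apply Cmod_gt_0. replace (p + s * (cis th - p) - p)%C with (RtoC s * (cis th - p))%C by ring.
  rewrite Cmod_mult, Cmod_R, Rabs_pos_eq by lra. assert (T := Cmod_rev_triangle (cis th) p). rewrite Cmod_cis in T.
  apply Rmult_lt_0_compat; lra. }
assert (Z : boundary_integral p (fun z : C => (g z / (z - p))%C) t 1 (- PI) PI = 0).
{ apply B. intros s th Hs _. apply cdiff_div.
  - apply Hg. eapply Rle_lt_trans; [apply homothety_Cmod; [exact Hp|lra]|lra].
  - apply cdiff_minus; [apply cdiff_id|apply cdiff_const].
  - apply NE. lra. }
unfold boundary_integral in Z.
assert (E : CInt (fun s => g (homothety p s PI) / (homothety p s PI - p) * (cis PI - p))%C t 1 =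
            CInt (fun s => g (homothety p s (-PI)) / (homothety p s (-PI) - p) * (cis (-PI) - p))%C t 1).
{ apply CInt_ext; [lra|]. intros. unfold homothety. rewrite cis_opp_PI. reflexivity. }
rewrite E in Z.
assert (K : forall s, t <= s <= 1 -> CInt (fun th => g (homothety p s th) / (homothety p s th - p) * (s * (Ci * cis th)))%C (- PI) PI = (Ci * J s)%C).
{ intros s Hs. unfold J. rewrite <- CInt_cmul; [|lra|apply J_cont; lra].
  apply CInt_ext; [lra|]. intros th _. unfold cauchy_kernel.
  assert (N1 := NE s th ltac:(lra)).
  assert (N2 := cauchy_den_neq0 p th Hp). rewrite cis_inv in *.
  assert (N3 := cis_neq0 th).
  unfold homothety in *.
  assert (Q1 : (p + s * (cis th - p) - p)%C = (RtoC s * (cis th - p))%C) by ring.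
  rewrite Q1 in *.
  assert (N4 : RtoC s <> 0) by (intros Q; rewrite Q in N1; apply N1; ring).
  assert (N5 : (cis th - p)%C <> 0) by (intros Q; rewrite Q in N1; apply N1; ring).
  field. repeat split; auto. }
rewrite !K in Z by lra.
assert (Y : (Ci * (J 1 - J t))%C = 0) by (rewrite <- Z; ring).
apply eq_of_Cmod_le. intros eps He.
assert (W : Cmod (Ci * (J 1 - J t))%C = Cmod (J 1 - J t)%C) by (rewrite Cmod_mult, Cmod_Ci; ring).
rewrite <- W, Y, Cmod_0. lra.
Qed.

(** As [t] tends to 0 the circle shrinks to [p], and [g] may be replaced by [g p]. The integral of
    the kernel remains as a factor, since its evaluation relies on the case [p = 0] of this very
    identity. *)
Lemma cauchy_circle_aux :
  CInt (fun th => g (cis th) * cauchy_kernel p th)%C (- PI) PI = (g p * CInt (cauchy_kernel p) (- PI) PI)%C.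
Proof.
assert (PP := PI_RGT_0).
transitivity (J 1).
{ apply CInt_ext; [lra|]. intros th _. unfold homothety. f_equal. f_equal. ring. }
apply eq_of_Cmod_le. intros eps He.
set (M := / (1 - Cmod p)).
assert (HM : 0 < M) by (apply Rinv_0_lt_compat; lra).
destruct (cdiff_continuous g p (Hg p ltac:(lra)) (eps / (2 * PI * M))) as [d [D Hd]].
{ apply Rdiv_lt_0_compat; [lra|]. apply Rmult_lt_0_compat; lra. }
set (t := Rmin 1 (d / 4)).
assert (Ht : 0 < t <= 1) by (unfold t; split; [apply Rmin_pos; lra|apply Rmin_l]).
assert (Ht2 : t <= d / 4) by apply Rmin_r.
rewrite (J_const t Ht). unfold J.
rewrite <- CInt_cmul by (try lra; intros s _; apply cauchy_kernel_cont; exact Hp).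
rewrite <- CInt_minus; [|lra|apply J_cont; lra|].
2: { intros s _. apply Ccont_mult; [apply Ccont_const|apply cauchy_kernel_cont; exact Hp]. }
replace eps with ((PI - - PI) * (eps / (2 * PI * M) * M)) by (field; split; lra).
apply CInt_bound; [lra| |].
- intros s Hs. apply Ccont_minus; [apply (J_cont t ltac:(lra) s Hs)|].
  apply Ccont_mult; [apply Ccont_const|apply cauchy_kernel_cont; exact Hp].
- intros s Hs.
  replace (g (homothety p t s) * cauchy_kernel p s - g p * cauchy_kernel p s)%C with
    ((g (homothety p t s) - g p) * cauchy_kernel p s)%C by ring.
  rewrite Cmod_mult. apply Rmult_le_compat; try apply Cmod_ge_0.
  + left. apply Hd. unfold homothety. replace (p + t * (cis s - p) - p)%C with (RtoC t * (cis s - p))%C by ring.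
    rewrite Cmod_mult, Cmod_R, Rabs_pos_eq by lra.
    assert (T := Cmod_minus_le (cis s) p). rewrite Cmod_cis in T. assert (0 <= Cmod (cis s - p)%C) by apply Cmod_ge_0. nra.
  + apply cauchy_kernel_bound; exact Hp.
Qed.
End CauchyCircle.

Lemma cauchy_kernel_0 s : cauchy_kernel 0 s = 1.
Proof. unfold cauchy_kernel. replace (1 - 0 * cis (- s))%C with (RtoC 1) by ring. rewrite <- RtoC_inv by lra. f_equal. field. Qed.

Lemma mean_value g R0 : 1 < R0 -> (forall z, Cmod z < R0 -> cdiff g z) ->
  CInt (fun th => g (cis th)) (- PI) PI = (RtoC (2 * PI) * g 0)%C.
Proof.
intros H1 H2. assert (PP := PI_RGT_0).
assert (T := cauchy_circle_aux g R0 0 H1 H2). rewrite Cmod_0 in T. specialize (T Rlt_0_1).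
assert (E : CInt (cauchy_kernel 0) (- PI) PI = RtoC (2 * PI)).
{ rewrite (CInt_ext _ (fun _ => RtoC 1)); [|lra|intros; apply cauchy_kernel_0].
  rewrite CInt_const. rewrite Cmult_1_r. f_equal. ring. }
rewrite E in T. rewrite Cmult_comm, <- T. apply CInt_ext; [lra|]. intros. rewrite cauchy_kernel_0. ring.
Qed.

Lemma CInt_conj g a b : a <= b -> CcontOn g a b -> CInt (fun t => Cconj (g t)) a b = Cconj (CInt g a b).
Proof.
intros Hab Hg. destruct (CInt_ex g a b Hab Hg). apply injective_projections; simpl; [reflexivity|].
apply (RInt_opp (V:=R_CompleteNormedModule)); auto.
Qed.

Lemma cis_conj t : Cconj (cis t) = cis (- t).
Proof. unfold cis, Cconj. simpl. rewrite cos_neg, sin_neg. reflexivity. Qed.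

(** On the circle the conjugate of the kernel is [1 / (1 - conj p * w)], which is holomorphic in the
    disc of radius [2 / (1 + |p|) > 1] and equals 1 at 0, so the mean value property applies to
    it. *)
Lemma cauchy_kernel_total p : Cmod p < 1 -> CInt (cauchy_kernel p) (- PI) PI = RtoC (2 * PI).
Proof.
intros Hp. assert (PP := PI_RGT_0). assert (P0 := Cmod_ge_0 p).
set (q := fun w : C => (/ (1 - Cconj p * w))%C).
assert (NE : forall w, Cmod w < 2 / (1 + Cmod p) -> (1 - Cconj p * w)%C <> 0).
{ intros w Hw. apply Cmod_gt_0. assert (T := Cmod_rev_triangle 1 (Cconj p * w)).
  rewrite Cmod_mult, Cmod_conj, Cmod_1 in T.
  assert (Cmod p * Cmod w < 1); [|lra].
  assert (2 / (1 + Cmod p) * (1 + Cmod p) = 2) by (field; lra).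
  assert (W0 := Cmod_ge_0 w).
  destruct (Req_dec (Cmod p) 0) as [E|E]; [rewrite E; lra|].
  assert (Cmod p * Cmod w < Cmod p * (2 / (1 + Cmod p))) by (apply Rmult_lt_compat_l; lra).
  assert (0 < 2 / (1 + Cmod p)) by (apply Rdiv_lt_0_compat; lra). nra. }
assert (T := mean_value q (2 / (1 + Cmod p))).
assert (E : CInt (fun th => q (cis th)) (- PI) PI = RtoC (2 * PI)).
{ rewrite T.
  - unfold q. replace (1 - Cconj p * 0)%C with (RtoC 1) by ring. rewrite <- RtoC_inv, <- RtoC_mult by lra. f_equal. field.
  - apply (Rmult_lt_reg_r (1 + Cmod p)); [lra|]. field_simplify; lra.
  - intros z Hz. apply cdiff_inv; [|apply NE; exact Hz]. apply cdiff_minus; [apply cdiff_const|].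
    apply cdiff_mult; [apply cdiff_const|apply cdiff_id]. }
replace (RtoC (2 * PI)) with (Cconj (RtoC (2 * PI))) by (apply injective_projections; simpl; ring).
rewrite <- E. rewrite <- CInt_conj; [|lra|].
- apply CInt_ext; [lra|]. intros th _. unfold q, cauchy_kernel.
  rewrite <- cis_conj. rewrite Cinv_conj.
  + f_equal. rewrite Cminus_conj, Cmult_conj. rewrite Cconj_conj. f_equal. apply injective_projections; simpl; ring.
  + apply NE. rewrite Cmod_cis. apply (Rmult_lt_reg_r (1 + Cmod p)); [lra|]. field_simplify; lra.
- intros s _. apply Ccont_inv.
  + apply NE. rewrite Cmod_cis. apply (Rmult_lt_reg_r (1 + Cmod p)); [lra|]. field_simplify; lra.
  + apply Ccont_minus; [apply Ccont_const|apply Ccont_mult; [apply Ccont_const|apply cis_cont]].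
Qed.

Lemma cauchy_circle g R0 p : 1 < R0 -> (forall z, Cmod z < R0 -> cdiff g z) -> Cmod p < 1 ->
  CInt (fun th => g (cis th) * cauchy_kernel p th)%C (- PI) PI = (RtoC (2 * PI) * g p)%C.
Proof.
intros H1 H2 H3. rewrite (cauchy_circle_aux g R0 p H1 H2 H3), cauchy_kernel_total by exact H3. ring.
Qed.

(** Writing [k] for [cauchy_kernel] at a fixed [t], the error of the linear approximation is exactly
    [h^2 * cis (- t)^2 * k(z)^2 * k(z + h)]. With [m = 1 - |z|] and [|h| < m / 2] this is at most
    [2 |h|^2 / m^3], uniformly in [t]. *)
Lemma cauchy_integral_cdiff phi a b M z : a <= b -> CcontOn phi a b -> (forall t, a <= t <= b -> Cmod (phi t) <= M) ->
  Cmod z < 1 -> cdiff (fun w => CInt (fun t => phi t * cauchy_kernel w t)%C a b) z.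
Proof.
intros Hab Hphi HM Hz. apply cdiff_eps.
assert (KC : forall w t, Cmod w < 1 -> Ccont (cauchy_kernel w) t) by (intros; apply cauchy_kernel_cont; assumption).
assert (CC := cis_opp_cont).
exists (CInt (fun t => phi t * (cis (- t) * (cauchy_kernel z t * cauchy_kernel z t)))%C a b).
intros eps He.
set (m := 1 - Cmod z). assert (Hm : 0 < m) by (unfold m; lra).
assert (M0 : 0 <= M) by (eapply Rle_trans; [apply Cmod_ge_0|apply (HM a); lra]).
set (K := (b - a) * M * 2 / m ^ 3).
assert (Hm3 : 0 < m ^ 3) by (apply pow_lt; lra).
assert (HK : 0 <= K). { unfold K. apply Rdiv_le_0_compat; [|exact Hm3]. apply Rmult_le_pos; [|lra]. apply Rmult_le_pos; lra. }
exists (Rmin (m / 2) (eps / (K + 1))).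
split. { apply Rmin_pos; [lra|]. apply Rdiv_lt_0_compat; lra. }
intros h Hh.
assert (H1 : Cmod h < m / 2) by (eapply Rlt_le_trans; [exact Hh|apply Rmin_l]).
assert (H2 : Cmod h < eps / (K + 1)) by (eapply Rlt_le_trans; [exact Hh|apply Rmin_r]).
assert (Hzh : Cmod (z + h)%C < 1). { assert (T := Cmod_triangle z h). unfold m in *. lra. }
rewrite <- CInt_minus; [|exact Hab| |];
 [|intros s Hs; apply Ccont_mult; auto|intros s Hs; apply Ccont_mult; auto].
rewrite (Cmult_comm _ h), <- CInt_cmul; [|exact Hab|intros s Hs; ccont].
rewrite <- CInt_minus; [|exact Hab| |].
2: { intros s Hs. apply Ccont_minus; apply Ccont_mult; auto. }
2: { intros s Hs. ccont. }
assert (B : Cmod (CInt (fun t => phi t * cauchy_kernel (z + h) t - phi t * cauchy_kernel z t -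
    h * (phi t * (cis (- t) * (cauchy_kernel z t * cauchy_kernel z t))))%C a b) <= (b - a) * (M * (Cmod h * Cmod h * (/ m * / m * (2 * / m))))).
{ apply CInt_bound; [exact Hab| |].
  - intros s Hs. ccont.
  - intros t Ht.
    replace (phi t * cauchy_kernel (z + h) t - phi t * cauchy_kernel z t - h * (phi t * (cis (- t) * (cauchy_kernel z t * cauchy_kernel z t))))%C
     with (phi t * (h * h * (cis (- t) * cis (- t)) * (cauchy_kernel z t * cauchy_kernel z t * cauchy_kernel (z + h) t)))%C.
    2: { unfold cauchy_kernel. assert (N1 := cauchy_den_neq0 z t Hz). assert (N2 := cauchy_den_neq0 (z + h) t Hzh).
         field. split; auto. }
    assert (k1 := cauchy_kernel_bound z t Hz). fold m in k1.
    assert (k2 := cauchy_kernel_bound (z + h) t Hzh).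
    assert (k3 : Cmod (cauchy_kernel (z + h) t) <= 2 * / m).
    { eapply Rle_trans; [exact k2|]. replace (2 * / m) with (/ (m / 2)) by (field; lra).
      apply Rinv_le_contravar; [lra|]. assert (T := Cmod_triangle z h). unfold m in *. lra. }
    rewrite !Cmod_mult, !Cmod_cis, !Rmult_1_r.
    assert (P1 := Cmod_ge_0 h). assert (P2 := Cmod_ge_0 (cauchy_kernel z t)).
    assert (P3 := Cmod_ge_0 (cauchy_kernel (z + h) t)). assert (P4 := Cmod_ge_0 (phi t)).
    assert (0 < / m) by (apply Rinv_0_lt_compat; lra).
    apply Rmult_le_compat; auto.
    { repeat apply Rmult_le_pos; auto. }
    apply Rmult_le_compat_l; [apply Rmult_le_pos; auto|].
    apply Rmult_le_compat; auto; [apply Rmult_le_pos; auto|].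
    apply Rmult_le_compat; auto. }
eapply Rle_trans; [exact B|].
replace ((b - a) * (M * (Cmod h * Cmod h * (/ m * / m * (2 * / m))))) with (K * Cmod h * Cmod h) by (unfold K; field; lra).
apply Rmult_le_compat_r; [apply Cmod_ge_0|].
apply (Rmult_lt_compat_r (K + 1)) in H2; [|lra]. replace (eps / (K + 1) * (K + 1)) with eps in H2 by (field; lra).
assert (P1 := Cmod_ge_0 h). nra.
Qed.

(** * Locally uniform limits of holomorphic functions *)

Lemma CcontOn_bounded g a b : a <= b -> CcontOn g a b -> exists M, forall t, a <= t <= b -> Cmod (g t) <= M.
Proof.
intros Hab Hg. destruct (CInt_ex g a b Hab Hg) as [E1 E2].
destruct (ex_RInt_ub _ _ _ E1) as [M1 H1]. destruct (ex_RInt_ub _ _ _ E2) as [M2 H2].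
exists (M1 + M2). intros t Ht. rewrite Rmin_left, Rmax_right in H1, H2 by lra.
eapply Rle_trans; [apply Cmod_le_abs|]. apply Rplus_le_compat; [apply (H1 t Ht)|apply (H2 t Ht)].
Qed.

Lemma cdiff_scale_arg f c z : cdiff f (c * z)%C -> cdiff (fun w => f (c * w)%C) z.
Proof. intros H. apply (cdiff_comp f (fun w => c * w)%C); [exact H|]. apply cdiff_mult; [apply cdiff_const|apply cdiff_id]. Qed.

(** Cauchy's formula on a circle of radius [r] between [|z0|] and 1 passes to the uniform limit.
    Near [z0] the limit is therefore a Cauchy integral of a continuous function, and such integrals
    are differentiable. *)
Theorem weierstrass_limit (fn : nat -> C -> C) (f : C -> C) :
  (forall n z, Cmod z < 1 -> cdiff (fn n) z) ->
  (forall R0, 0 < R0 < 1 -> forall eps, 0 < eps -> exists N, forall n, (N <= n)%nat -> forall z, Cmod z <= R0 ->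
     Cmod (fn n z - f z)%C <= eps) ->
  forall z, Cmod z < 1 -> cdiff f z.
Proof.
intros Hfn Hlim z0 Hz0. assert (PP := PI_RGT_0).
set (r := (1 + Cmod z0) / 2).
assert (Z0 := Cmod_ge_0 z0).
assert (Hr : 0 < r < 1) by (unfold r; lra).
assert (Hzr : Cmod z0 < r) by (unfold r; lra).
assert (Crc : forall t, Cmod (RtoC r * cis t)%C = r) by (intros; rewrite Cmod_mult, Cmod_cis, Cmod_R, Rabs_pos_eq; lra).
assert (cn : forall n t, Ccont (fun s => fn n (RtoC r * cis s)%C) t).
{ intros n t. apply (Ccont_comp (fn n) (fun s => RtoC r * cis s)%C); [apply Hfn; rewrite Crc; lra|].
  apply Ccont_mult; [apply Ccont_const|apply cis_cont]. }
assert (cf : forall t, Ccont (fun s => f (RtoC r * cis s)%C) t).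
{ intros t. apply Ccont_eps. intros eps He.
  destruct (Hlim r Hr (eps / 3) ltac:(lra)) as [N HN]. specialize (HN N (le_n N)).
  destruct (proj1 (Ccont_eps _ _) (cn N t) (eps / 3) ltac:(lra)) as [d [D Hd]].
  exists d; split; auto. intros s Hs. specialize (Hd s Hs).
  assert (A := HN (RtoC r * cis s)%C ltac:(rewrite Crc; lra)).
  assert (B := HN (RtoC r * cis t)%C ltac:(rewrite Crc; lra)).
  rewrite Cmod_minus_sym in A.
  set (x := (RtoC r * cis s)%C) in *. set (y := (RtoC r * cis t)%C) in *.
  replace (f x - f y)%C with ((f x - fn N x) + (fn N x - fn N y) + (fn N y - f y))%C by ring.
  eapply Rle_lt_trans; [apply Cmod_triangle|].
  assert (T := Cmod_triangle (f x - fn N x) (fn N x - fn N y)). lra. }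
assert (rep : forall n z, Cmod z < r -> CInt (fun t => fn n (RtoC r * cis t)%C * cauchy_kernel (/ RtoC r * z)%C t)%C (- PI) PI = (RtoC (2 * PI) * fn n z)%C).
{ intros n z Hz.
  assert (Nr : RtoC r <> 0) by (intros Q; apply RtoC_inj in Q; lra).
  assert (T := cauchy_circle (fun w => fn n (RtoC r * w)%C) (/ r) (/ RtoC r * z)%C).
  cbv beta in T. replace (RtoC r * (/ RtoC r * z))%C with z in T by (field; exact Nr).
  apply T.
  - rewrite <- Rinv_1. apply Rinv_lt_contravar; lra.
  - intros w Hw. apply cdiff_scale_arg. apply Hfn. rewrite Cmod_mult, Cmod_R, Rabs_pos_eq by lra.
    apply (Rmult_lt_compat_l r) in Hw; [|lra]. rewrite Rinv_r in Hw; lra.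
  - rewrite Cmod_mult, Cmod_inv, Cmod_R, Rabs_pos_eq by (try exact Nr; lra).
    apply (Rmult_lt_reg_l r); [lra|]. rewrite <- Rmult_assoc, Rinv_r; lra. }
assert (kz : forall z, Cmod z < r -> Cmod (/ RtoC r * z)%C < 1).
{ intros z Hz. rewrite Cmod_mult, Cmod_inv, Cmod_R, Rabs_pos_eq by (try (intros Q; apply RtoC_inj in Q; lra); lra).
    apply (Rmult_lt_reg_l r); [lra|]. rewrite <- Rmult_assoc, Rinv_r; lra. }
assert (repf : forall z, Cmod z < r -> CInt (fun t => f (RtoC r * cis t)%C * cauchy_kernel (/ RtoC r * z)%C t)%C (- PI) PI = (RtoC (2 * PI) * f z)%C).
{ intros z Hz. apply eq_of_Cmod_le. intros eps He.
  set (k := / (1 - Cmod (/ RtoC r * z)%C)).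
  assert (Hk : 0 < k) by (apply Rinv_0_lt_compat; specialize (kz z Hz); lra).
  destruct (Hlim r Hr (eps / (2 * PI * (k + 1)))) as [N HN].
  { apply Rdiv_lt_0_compat; [lra|]. apply Rmult_lt_0_compat; lra. }
  specialize (HN N (le_n N)).
  set (del := eps / (2 * PI * (k + 1))) in *.
  replace (CInt (fun t => f (RtoC r * cis t)%C * cauchy_kernel (/ RtoC r * z)%C t)%C (- PI) PI - RtoC (2 * PI) * f z)%C with
   ((CInt (fun t => f (RtoC r * cis t)%C * cauchy_kernel (/ RtoC r * z)%C t)%C (- PI) PI - RtoC (2 * PI) * fn N z) + RtoC (2 * PI) * (fn N z - f z))%C by ring.
  eapply Rle_trans; [apply Cmod_triangle|].
  rewrite Cmod_mult, Cmod_R, Rabs_pos_eq by lra.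
  assert (A := HN z ltac:(lra)).
  rewrite <- (rep N z Hz).
  rewrite <- CInt_minus; [|lra| |].
  2: { intros s _; apply Ccont_mult; [apply cf|apply cauchy_kernel_cont; apply kz; exact Hz]. }
  2: { intros s _; apply Ccont_mult; [apply cn|apply cauchy_kernel_cont; apply kz; exact Hz]. }
  assert (B : Cmod (CInt (fun t => f (RtoC r * cis t)%C * cauchy_kernel (/ RtoC r * z)%C t - fn N (RtoC r * cis t)%C * cauchy_kernel (/ RtoC r * z)%C t)%C (- PI) PI) <= (PI - - PI) * (del * k)).
  { apply CInt_bound; [lra| |].
    - intros s _. apply Ccont_minus; (apply Ccont_mult; [first [exact (cf s)|exact (cn N s)]|apply cauchy_kernel_cont; apply kz; exact Hz]).
    - intros t _.
      set (x := (RtoC r * cis t)%C) in *. set (y := (/ RtoC r * z)%C) in *.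
      replace (f x * cauchy_kernel y t - fn N x * cauchy_kernel y t)%C with ((f x - fn N x) * cauchy_kernel y t)%C by ring.
      rewrite Cmod_mult. apply Rmult_le_compat; try apply Cmod_ge_0.
      + rewrite Cmod_minus_sym. apply HN. unfold x. rewrite Crc. lra.
      + unfold y, k. apply cauchy_kernel_bound. apply kz; exact Hz. }
  assert (E : (PI - - PI) * (del * k) + 2 * PI * del = eps) by (unfold del; field; split; lra).
  nra. }
apply (cdiff_ext_loc (fun z => / RtoC (2 * PI) * CInt (fun t => f (RtoC r * cis t)%C * cauchy_kernel (/ RtoC r * z)%C t) (- PI) PI)%C f z0 (r - Cmod z0)).
- lra.
- intros w Hw. assert (Hw' : Cmod w < r). { assert (T := Cmod_rev_triangle w z0). lra. }
  rewrite (repf w Hw'). field. intros Q; apply RtoC_inj in Q; lra.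
- apply cdiff_mult; [apply cdiff_const|].
  destruct (CcontOn_bounded (fun t => f (RtoC r * cis t)%C) (- PI) PI ltac:(lra) (fun t _ => cf t)) as [M HM].
  apply (cdiff_scale_arg (fun w => CInt (fun t => f (RtoC r * cis t)%C * cauchy_kernel w t)%C (- PI) PI)).
  apply (cauchy_integral_cdiff (fun t => f (RtoC r * cis t)%C) _ _ M); auto; [lra|intros s _; apply cf].
Qed.

(** * Finite sums and null sets of the line *)

Fixpoint rsum (f : nat -> R) (n : nat) : R := match n with O => 0 | S n => rsum f n + f n end.

Lemma rsum_ext f g n : (forall i, (i < n)%nat -> f i = g i) -> rsum f n = rsum g n.
Proof. induction n; intros H; simpl; [reflexivity|]. rewrite IHn, H; auto. Qed.
Lemma rsum_le f g n : (forall i, (i < n)%nat -> f i <= g i) -> rsum f n <= rsum g n.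
Proof. induction n; intros H; simpl; [lra|]. apply Rplus_le_compat; auto. Qed.
Lemma rsum_plus f g n : rsum (fun i => f i + g i) n = rsum f n + rsum g n.
Proof. induction n; simpl; [ring|]. rewrite IHn. ring. Qed.
Lemma rsum_scal c f n : rsum (fun i => c * f i) n = c * rsum f n.
Proof. induction n; simpl; [ring|]. rewrite IHn. ring. Qed.
Lemma rsum_const c n : rsum (fun _ => c) n = INR n * c.
Proof. induction n; [simpl; ring|]. rewrite S_INR. simpl. rewrite IHn. ring. Qed.
Lemma rsum_nonneg f n : (forall i, (i < n)%nat -> 0 <= f i) -> 0 <= rsum f n.
Proof. intros H. rewrite <- (Rmult_0_r (INR n)), <- rsum_const. apply rsum_le. exact H. Qed.
Lemma rsum_mono f n m : (n <= m)%nat -> (forall i, 0 <= f i) -> rsum f n <= rsum f m.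
Proof. intros H Hf. induction H; simpl; [lra|]. specialize (Hf m). lra. Qed.
Lemma rsum_term f n i : (i < n)%nat -> (forall j, (j < n)%nat -> 0 <= f j) -> f i <= rsum f n.
Proof.
induction n; intros Hi Hf; [lia|]. simpl. destruct (Nat.eq_dec i n) as [->|].
- assert (T := rsum_nonneg f n (fun j Hj => Hf j ltac:(lia))). lra.
- assert (T := IHn ltac:(lia) (fun j Hj => Hf j ltac:(lia))). specialize (Hf n ltac:(lia)). lra.
Qed.
Lemma rsum_sum_f_R0 f n : sum_f_R0 f n = rsum f (S n).
Proof. induction n; simpl; [ring|]. rewrite IHn. reflexivity. Qed.
Lemma rsum_double f n : rsum f (2 * n) = rsum (fun i => f (2 * i)%nat + f (2 * i + 1)%nat) n.
Proof.
induction n; [reflexivity|]. replace (2 * S n)%nat with (S (S (2 * n))) by lia. cbn [rsum]. rewrite IHn.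
replace (S (2 * n)) with (2 * n + 1)%nat by lia. ring.
Qed.
Lemma rsum_double_pow f n : rsum f (2 ^ S n) = rsum (fun i => f (2 * i)%nat + f (2 * i + 1)%nat) (2 ^ n).
Proof. rewrite Nat.pow_succ_r'. apply rsum_double. Qed.

(** A pair with Cantor code below [N] has both coordinates below [N], so the first [N] pairs lie in
    the square of side [N]. [chi M] restricts [g] to the pairs with code below [M]. *)
Lemma rsum_pairing (g : nat -> nat -> R) N : (forall j i, 0 <= g j i) ->
  rsum (fun n => g (fst (of_nat n)) (snd (of_nat n))) N <= rsum (fun j => rsum (g j) N) N.
Proof.
intros Hg.
set (chi := fun M j i => if lt_dec (to_nat (j, i)) M then g j i else 0).
assert (Hchi : forall M j i, 0 <= chi M j i). { intros. unfold chi. destruct (lt_dec _ _); [apply Hg|lra]. }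
assert (G : forall M, (M <= N)%nat -> rsum (fun n => g (fst (of_nat n)) (snd (of_nat n))) M <= rsum (fun j => rsum (chi M j) N) N).
{ induction M; intros HM.
  - simpl. apply rsum_nonneg. intros; apply rsum_nonneg; intros; apply Hchi.
  - simpl rsum at 1. destruct (of_nat M) as [j0 i0] eqn:E. cbn [fst snd].
    assert (EM : to_nat (j0, i0) = M) by (rewrite <- E; apply cancel_to_of).
    assert (NN := to_nat_non_decreasing j0 i0).
    set (dlt := fun j i => if Nat.eq_dec (to_nat (j, i)) M then g j i else 0).
    assert (Hd : forall j i, 0 <= dlt j i). { intros. unfold dlt. destruct (Nat.eq_dec _ _); [apply Hg|lra]. }
    assert (S1 : rsum (fun j => rsum (chi (S M) j) N) N = rsum (fun j => rsum (chi M j) N) N + rsum (fun j => rsum (dlt j) N) N).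
    { rewrite <- rsum_plus. apply rsum_ext. intros j _. rewrite <- rsum_plus. apply rsum_ext. intros i _.
      unfold chi, dlt. destruct (lt_dec (to_nat (j, i)) (S M)), (lt_dec (to_nat (j, i)) M), (Nat.eq_dec (to_nat (j, i)) M); try lia; ring. }
    rewrite S1. apply Rplus_le_compat; [apply IHM; lia|].
    eapply Rle_trans; [|apply (rsum_term (fun j => rsum (dlt j) N) N j0); [lia|intros; apply rsum_nonneg; intros; apply Hd]].
    eapply Rle_trans; [|apply (rsum_term (dlt j0) N i0); [lia|intros; apply Hd]].
    unfold dlt. destruct (Nat.eq_dec _ _); [lra|contradiction]. }
eapply Rle_trans; [apply G; lia|].
apply rsum_le. intros j _. apply rsum_le. intros i _. unfold chi. destruct (lt_dec _ _); [lra|apply Hg].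
Qed.

Definition null_line (A : R -> Prop) : Prop :=
  forall eps, 0 < eps -> exists a b : nat -> R, (forall n, a n <= b n) /\
    (forall N, rsum (fun n => b n - a n) N <= eps) /\ (forall x, A x -> exists n, a n < x < b n).

Lemma null_of_double_cover (A : R -> Prop) :
  (forall eps, 0 < eps -> exists a b : nat -> nat -> R, (forall j i, a j i <= b j i) /\
    (forall J K, rsum (fun j => rsum (fun i => b j i - a j i) K) J <= eps) /\
    (forall x, A x -> exists j i, a j i < x < b j i)) -> null_line A.
Proof.
intros H eps He. destruct (H eps He) as [a [b [H1 [H2 H3]]]].
exists (fun n => a (fst (of_nat n)) (snd (of_nat n))), (fun n => b (fst (of_nat n)) (snd (of_nat n))).
split; [|split].
- intros n. apply H1.
- intros N. eapply Rle_trans; [apply (rsum_pairing (fun j i => b j i - a j i)); intros j i; specialize (H1 j i); lra|apply H2].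
- intros x Hx. destruct (H3 x Hx) as [j [i Hji]]. exists (to_nat (j, i)). rewrite cancel_of_to. exact Hji.
Qed.

Lemma rsum_geom_half J : rsum (fun j => / 2 ^ S j) J <= 1.
Proof.
assert (rsum (fun j => / 2 ^ S j) J = 1 - / 2 ^ J).
{ induction J; simpl; [field|]. simpl in IHJ. rewrite IHJ. field. apply pow_nonzero; lra. }
assert (0 < / 2 ^ J) by (apply Rinv_0_lt_compat, pow_lt; lra). lra.
Qed.

Lemma null_line_union (A : nat -> R -> Prop) : (forall j, null_line (A j)) -> null_line (fun x => exists j, A j x).
Proof.
intros H. apply null_of_double_cover. intros eps He.
assert (P : forall j, exists ab : (nat -> R) * (nat -> R), (forall n, fst ab n <= snd ab n) /\
    (forall N, rsum (fun n => snd ab n - fst ab n) N <= eps * / 2 ^ S j) /\ (forall x, A j x -> exists n, fst ab n < x < snd ab n)).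
{ intros j. assert (0 < / 2 ^ S j) by (apply Rinv_0_lt_compat, pow_lt; lra).
  destruct (H j (eps * / 2 ^ S j)) as [a [b T]]; [nra|]. exists (a, b). exact T. }
apply choice in P. destruct P as [ab P].
exists (fun j => fst (ab j)), (fun j => snd (ab j)). split; [|split].
- intros j i. apply P.
- intros J K. eapply Rle_trans; [apply rsum_le; intros j _; apply P|].
  rewrite rsum_scal. assert (T := rsum_geom_half J). nra.
- intros x [j Hj]. destruct (P j) as [_ [_ P3]]. destruct (P3 x Hj) as [n Hn]. exists j, n. exact Hn.
Qed.

Lemma null_line_mono (A B : R -> Prop) : (forall x, A x -> B x) -> null_line B -> null_line A.
Proof. intros H HB eps He. destruct (HB eps He) as [a [b [H1 [H2 H3]]]]. exists a, b. auto. Qed.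

Lemma null_line_singleton (y : R) : null_line (fun x => x = y).
Proof.
intros eps He. exists (fun n => match n with O => y - eps / 2 | _ => y end), (fun n => match n with O => y + eps / 2 | _ => y end).
split; [|split].
- intros [|n]; lra.
- intros N. destruct N; [simpl; lra|].
  assert (E : forall N, rsum (fun n => match n with O => y + eps / 2 | _ => y end - match n with O => y - eps / 2 | _ => y end) (S N) = eps).
  { induction N0 as [|k IHk]; [simpl; lra|]. change (rsum ?f (S (S k))) with (rsum f (S k) + f (S k)). rewrite IHk. simpl. lra. }
  rewrite E. lra.
- intros x ->. exists O. lra.
Qed.

Lemma null_line_or (A B : R -> Prop) : null_line A -> null_line B -> null_line (fun x => A x \/ B x).
Proof.
intros HA HB. apply (null_line_mono _ (fun x => exists j : nat, (match j with O => A | _ => B end) x)).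
- intros x [H|H]; [exists O|exists 1%nat]; exact H.
- apply null_line_union. intros [|j]; assumption.
Qed.

(** * Lipschitz functions are differentiable almost everywhere *)

Definition diff_at (h : R -> R) (x l : R) : Prop :=
  forall eps, 0 < eps -> exists delta, 0 < delta /\
    forall t, Rabs (t - x) < delta -> Rabs (h t - h x - l * (t - x)) <= eps * Rabs (t - x).

Section Lipschitz.
Variables (h : R -> R) (M : R).
Hypothesis hlip : forall s t, Rabs (h s - h t) <= M * Rabs (s - t).

Definition dyad (k i : nat) : R := INR i / 2 ^ k.
Lemma pow2_pos k : 0 < 2 ^ k. Proof. apply pow_lt; lra. Qed.

Lemma dyad_double k i : dyad (S k) (2 * i) = dyad k i.
Proof. unfold dyad. rewrite mult_INR. simpl. field. apply pow_nonzero; lra. Qed.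
Lemma dyad_double1 k i : dyad (S k) (2 * i + 1 + 1) = dyad k (i + 1).
Proof. rewrite <- (dyad_double k (i + 1)). f_equal. lia. Qed.
Lemma dyad_succ k i : dyad k (i + 1) = dyad k i + / 2 ^ k.
Proof. unfold dyad. rewrite plus_INR. simpl. field. apply pow_nonzero; lra. Qed.

Definition incr (k i : nat) : R := h (dyad k (i + 1)) - h (dyad k i).
Definition slope (k i : nat) : R := incr k i * 2 ^ k.

Lemma slope_sq k i : slope k i ^ 2 / 2 ^ k = incr k i ^ 2 * 2 ^ k.
Proof. unfold slope. field. apply pow_nonzero; lra. Qed.

Lemma incr_split k i : incr k i = incr (S k) (2 * i) + incr (S k) (2 * i + 1).
Proof. unfold incr. rewrite dyad_double1, dyad_double. ring. Qed.

(** The sum of squared slope times length over the [2^m] subcells of generation [k + m], that is,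
    the squared norm of a martingale approximation to the derivative of [h]. It increases with [m]
    because the square is convex; its limit [energy] stands for the integral of the squared
    derivative before that derivative is known to exist. *)
Fixpoint energy_upto (m k i : nat) : R :=
  match m with O => slope k i ^ 2 / 2 ^ k | S m => energy_upto m (S k) (2 * i) + energy_upto m (S k) (2 * i + 1) end.

Lemma energy_upto_incr m : forall k i, energy_upto m k i <= energy_upto (S m) k i.
Proof.
induction m; intros k i.
- change (energy_upto 1 k i) with (slope (S k) (2 * i) ^ 2 / 2 ^ S k + slope (S k) (2 * i + 1) ^ 2 / 2 ^ S k).
  change (energy_upto 0 k i) with (slope k i ^ 2 / 2 ^ k).
  rewrite !slope_sq, (incr_split k i). change (2 ^ S k) with (2 * 2 ^ k).
  set (u := incr (S k) (2 * i)). set (v := incr (S k) (2 * i + 1)).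
  assert (Q : 0 <= (u - v) ^ 2 * 2 ^ k) by (apply Rmult_le_pos; [apply pow2_ge_0|left; apply pow2_pos]).
  replace ((u - v) ^ 2 * 2 ^ k) with (u ^ 2 * (2 * 2 ^ k) + v ^ 2 * (2 * 2 ^ k) - (u + v) ^ 2 * 2 ^ k) in Q by ring.
  lra.
- change (energy_upto (S (S m)) k i) with (energy_upto (S m) (S k) (2 * i) + energy_upto (S m) (S k) (2 * i + 1)).
  change (energy_upto (S m) k i) with (energy_upto m (S k) (2 * i) + energy_upto m (S k) (2 * i + 1)).
  apply Rplus_le_compat; apply IHm.
Qed.

Lemma energy_upto_bound m : forall k i, energy_upto m k i <= M ^ 2 / 2 ^ k.
Proof.
induction m; intros k i.
- change (energy_upto 0 k i) with (slope k i ^ 2 / 2 ^ k). assert (P := pow2_pos k).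
  assert (B := hlip (dyad k (i + 1)) (dyad k i)). rewrite dyad_succ in B at 2.
  replace (dyad k i + / 2 ^ k - dyad k i) with (/ 2 ^ k) in B by ring.
  rewrite (Rabs_pos_eq (/ 2 ^ k)) in B by (left; apply Rinv_0_lt_compat; exact P). fold (incr k i) in B.
  assert (S1 : Rabs (slope k i) <= M).
  { unfold slope. rewrite Rabs_mult, (Rabs_pos_eq (2 ^ k)) by lra.
    apply (Rmult_le_compat_r (2 ^ k)) in B; [|lra]. rewrite (Rmult_assoc M), Rinv_l in B by lra. lra. }
  apply Rmult_le_compat_r; [left; apply Rinv_0_lt_compat; exact P|].
  rewrite <- (pow2_abs (slope k i)). apply pow_incr. split; [apply Rabs_pos|exact S1].
- change (energy_upto (S m) k i) with (energy_upto m (S k) (2 * i) + energy_upto m (S k) (2 * i + 1)).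
  assert (A := IHm (S k) (2 * i)%nat). assert (B := IHm (S k) (2 * i + 1)%nat).
  change (2 ^ S k) with (2 * 2 ^ k) in A, B. assert (P := pow2_pos k).
  replace (M ^ 2 / 2 ^ k) with (M ^ 2 / (2 * 2 ^ k) + M ^ 2 / (2 * 2 ^ k)) by (field; lra). lra.
Qed.

Definition energy (k i : nat) : R := real (Lim_seq (fun m => energy_upto m k i)).

Lemma energy_lim k i : is_lim_seq (fun m => energy_upto m k i) (energy k i).
Proof.
apply Lim_seq_correct'. apply (ex_finite_lim_seq_incr _ (M ^ 2 / 2 ^ k)); intros m;
 [apply energy_upto_incr|apply energy_upto_bound].
Qed.
Lemma energy_ge m k i : energy_upto m k i <= energy k i.
Proof. apply (is_lim_seq_incr_compare (fun m => energy_upto m k i)); [apply energy_lim|intros; apply energy_upto_incr]. Qed.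
Lemma energy_split k i : energy k i = energy (S k) (2 * i) + energy (S k) (2 * i + 1).
Proof.
assert (A := is_lim_seq_plus' _ _ _ _ (energy_lim (S k) (2 * i)) (energy_lim (S k) (2 * i + 1))).
assert (B := proj1 (is_lim_seq_incr_1 _ _) (energy_lim k i)).
apply is_lim_seq_unique in A. apply is_lim_seq_unique in B.
assert (E : Finite (energy k i) = Finite (energy (S k) (2 * i) + energy (S k) (2 * i + 1))) by (rewrite <- A, <- B; reflexivity).
injection E; auto.
Qed.

(* Energy of [h - c x] on a dyadic interval. *)
Definition dev (c : R) (k i : nat) : R := energy k i - 2 * c * incr k i + c ^ 2 / 2 ^ k.

Lemma dev_nonneg c k i : 0 <= dev c k i.
Proof.
assert (E := energy_ge 0 k i). change (energy_upto 0 k i) with (slope k i ^ 2 / 2 ^ k) in E. unfold dev. assert (P := pow2_pos k).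
rewrite slope_sq in E.
assert (Q : 0 <= (incr k i * 2 ^ k - c) ^ 2 / 2 ^ k) by (apply Rdiv_le_0_compat; [apply pow2_ge_0|exact P]).
replace ((incr k i * 2 ^ k - c) ^ 2 / 2 ^ k) with (incr k i ^ 2 * 2 ^ k - 2 * c * incr k i + c ^ 2 / 2 ^ k) in Q by (field; lra).
lra.
Qed.
Lemma dev_split c k i : dev c k i = dev c (S k) (2 * i) + dev c (S k) (2 * i + 1).
Proof. unfold dev. rewrite energy_split, (incr_split k i). simpl pow. field. apply pow_nonzero; lra. Qed.

Definition devsum (c : R) (k q : nat) : R := rsum (dev c k) q.

Lemma devsum_scale c r : forall k q, devsum c (k + r) (q * 2 ^ r) = devsum c k q.
Proof.
induction r; intros k q.
- simpl. rewrite Nat.add_0_r, Nat.mul_1_r. reflexivity.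
- replace (k + S r)%nat with (S k + r)%nat by lia. replace (q * 2 ^ S r)%nat with ((2 * q) * 2 ^ r)%nat by (simpl; lia).
  rewrite IHr. unfold devsum. rewrite rsum_double. apply rsum_ext. intros i _. symmetry. apply dev_split.
Qed.
Lemma devsum_mono c k p q : (p <= q)%nat -> devsum c k p <= devsum c k q.
Proof. intros H. apply rsum_mono; [exact H|]. intros; apply dev_nonneg. Qed.

Lemma devsum_eq c k q : devsum c k q = rsum (energy k) q - 2 * c * (h (dyad k q) - h (dyad k 0)) + c ^ 2 * dyad k q.
Proof.
induction q.
- unfold devsum, dyad. simpl. field. apply pow_nonzero; lra.
- unfold devsum in *. simpl rsum. rewrite IHq. unfold dev, incr. rewrite Nat.add_1_r.
  assert (E := dyad_succ k q). rewrite Nat.add_1_r in E. rewrite E. field. apply pow_nonzero; lra.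
Qed.

(** The Cauchy-Schwarz inequality for the increment of [h - c x]. The difference of the two [devsum]
    is a quadratic polynomial in [c], and its nonnegativity at the mean slope [D / l] is the
    inequality. *)
Lemma devsum_lower c k p q : (p < q)%nat ->
  (h (dyad k q) - h (dyad k p) - c * (dyad k q - dyad k p)) ^ 2 <= (devsum c k q - devsum c k p) * (dyad k q - dyad k p).
Proof.
intros Hpq.
assert (L : 0 < dyad k q - dyad k p).
{ unfold dyad. apply lt_INR in Hpq. assert (P := pow2_pos k). apply (Rmult_lt_compat_r (/ 2 ^ k)) in Hpq; [unfold Rdiv; lra|].
  apply Rinv_0_lt_compat; lra. }
set (l := dyad k q - dyad k p) in *. set (D := h (dyad k q) - h (dyad k p)).
set (A := rsum (energy k) q - rsum (energy k) p).
assert (F : forall c, devsum c k q - devsum c k p = A - 2 * c * D + c ^ 2 * l).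
{ intros. rewrite !devsum_eq. unfold A, D, l. ring. }
assert (P := devsum_mono (D / l) k p q ltac:(lia)). assert (F' := F (D / l)).
rewrite F. assert (Q : 0 <= (A - 2 * (D / l) * D + (D / l) ^ 2 * l) * l) by nra.
replace ((A - 2 * (D / l) * D + (D / l) ^ 2 * l) * l) with (A * l - D * D) in Q by (field; lra).
assert (E : (A - 2 * c * D + c ^ 2 * l) * l - (D - c * l) ^ 2 = A * l - D * D) by ring. lra.
Qed.

(* Chords through [x] inside the interval [(n,p)] whose slope is not within [lam] of the slope of that interval. *)
Definition bad_chord (lam : R) (n p : nat) (x : R) : Prop :=
  exists s t, dyad n p <= s <= x /\ x <= t <= dyad n (p + 1) /\ s < t /\
    lam * (t - s) < Rabs (h t - h s - slope n p * (t - s)).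

Definition parent_slope (n j i : nat) : R := slope n (i / 2 ^ j).
(** [dev] divided by the length of the cell is the mean square deviation from the slope of the
    ancestor of level [n]. The threshold is [lam^2 / 4] because a bad chord is charged to at most
    two cells, each less than twice as long as the chord. *)
Definition heavy (lam : R) (n j i : nat) : Prop :=
  lam ^ 2 / 4 * / 2 ^ (n + j) < dev (parent_slope n j i) (n + j) i.
(** The cell widened by two of its lengths on each side: it contains both neighbouring cells with
    their endpoints, and it lies in the widened parent cell, so points near a cell stay near all its
    ancestors. *)
Definition near_cell (k i : nat) (x : R) : Prop := (INR i - 2) / 2 ^ k < x < (INR i + 3) / 2 ^ k.

Lemma INR_pow2 k : INR (2 ^ k) = 2 ^ k.
Proof. rewrite pow_INR. reflexivity. Qed.

Lemma dyad_scale k r i : dyad (k + r) (i * 2 ^ r) = dyad k i.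
Proof. unfold dyad. rewrite mult_INR, INR_pow2, pow_add. field. split; apply pow_nonzero; lra. Qed.

Lemma dyad_le_iff k i j : dyad k i <= dyad k j <-> (i <= j)%nat.
Proof.
assert (P := pow2_pos k). unfold dyad. split.
- intros H. apply INR_le. apply (Rmult_le_reg_r (/ 2 ^ k)); [apply Rinv_0_lt_compat; exact P|exact H].
- intros H. apply le_INR in H. apply Rmult_le_compat_r; [left; apply Rinv_0_lt_compat; exact P|exact H].
Qed.

(** Both endpoints are rounded outwards to a fine dyadic grid, so that [x] remains between them; the
    strict inequality survives because [h] is Lipschitz. *)
Lemma bad_chord_dyadic lam n p x : 0 < lam -> bad_chord lam n p x -> exists r q0 q1, (q0 < q1)%nat /\
  (p * 2 ^ r <= q0)%nat /\ (q1 <= (p + 1) * 2 ^ r)%nat /\ dyad (n + r) q0 <= x <= dyad (n + r) q1 /\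
  lam * (dyad (n + r) q1 - dyad (n + r) q0) <
   Rabs (h (dyad (n + r) q1) - h (dyad (n + r) q0) - slope n p * (dyad (n + r) q1 - dyad (n + r) q0)).
Proof.
intros Hl [s [t [[Hs1 Hs2] [[Ht1 Ht2] [Hst Hb]]]]].
set (c := slope n p) in *.
set (gap := Rabs (h t - h s - c * (t - s)) - lam * (t - s)) in *.
assert (M0 : 0 <= M).
{ assert (T := hlip 1 0). replace (Rabs (1 - 0)) with 1 in T by (rewrite Rabs_pos_eq; lra).
  assert (0 <= Rabs (h 1 - h 0)) by apply Rabs_pos. lra. }
(* Each of the two endpoints moves by at most one grid step, which changes the two sides of the
   inequality by at most [M + |c| + lam] steps altogether. *)
set (K := 2 * (M + Rabs c + lam)).
assert (c0 : 0 <= Rabs c) by apply Rabs_pos.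
assert (HK : 0 < K) by (unfold K; lra).
destruct (pow_lt_1_zero (/2)) with (y := gap / K) as [r Hr].
{ rewrite Rabs_pos_eq; lra. } { apply Rdiv_lt_0_compat; unfold gap; lra. }
specialize (Hr (n + r)%nat ltac:(lia)). rewrite Rabs_pos_eq in Hr by (apply pow_le; lra). rewrite pow_inv in Hr.
set (m := (n + r)%nat) in *. assert (P := pow2_pos m).
assert (s0 : 0 <= s). { eapply Rle_trans; [|exact Hs1]. unfold dyad. apply Rdiv_le_0_compat; [apply pos_INR|apply pow2_pos]. }
destruct (nfloor_ex (s * 2 ^ m)) as [q0 [Q1 Q2]]; [nra|].
destruct (nfloor1_ex (t * 2 ^ m)) as [q1 [Q3 Q4]]; [nra|].
assert (e0 : dyad m q0 * 2 ^ m = INR q0) by (unfold dyad; field; lra).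
assert (e1 : dyad m (S q1) * 2 ^ m = INR q1 + 1) by (unfold dyad; rewrite S_INR; field; lra).
assert (Z : / 2 ^ m * 2 ^ m = 1) by (field; lra).
assert (B0 : dyad m q0 <= s < dyad m q0 + / 2 ^ m).
{ split; apply (Rmult_le_reg_r (2 ^ m)) || apply (Rmult_lt_reg_r (2 ^ m)); try exact P; rewrite ?Rmult_plus_distr_r, e0; lra. }
assert (B1 : dyad m (S q1) - / 2 ^ m < t <= dyad m (S q1)).
{ split; apply (Rmult_le_reg_r (2 ^ m)) || apply (Rmult_lt_reg_r (2 ^ m)); try exact P; rewrite ?Rmult_minus_distr_r, e1; lra. }
exists r, q0, (S q1). fold m. repeat split.
- apply INR_lt. rewrite S_INR. assert (s * 2 ^ m < t * 2 ^ m) by nra. lra.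
- apply Nat.lt_succ_r. apply INR_lt. rewrite S_INR. eapply Rle_lt_trans; [|exact Q2].
  rewrite mult_INR, INR_pow2. unfold m. rewrite pow_add. unfold dyad in Hs1.
  apply (Rmult_le_compat_r (2 ^ n)) in Hs1; [|left; apply pow2_pos].
  replace (INR p / 2 ^ n * 2 ^ n) with (INR p) in Hs1 by (field; apply pow_nonzero; lra).
  assert (P' := pow2_pos r). nra.
- apply Nat.le_succ_l. apply INR_lt. eapply Rlt_le_trans; [exact Q3|].
  rewrite mult_INR, INR_pow2. unfold m. rewrite pow_add. unfold dyad in Ht2.
  apply (Rmult_le_compat_r (2 ^ n)) in Ht2; [|left; apply pow2_pos].
  replace (INR (p + 1) / 2 ^ n * 2 ^ n) with (INR (p + 1)) in Ht2 by (field; apply pow_nonzero; lra).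
  assert (P' := pow2_pos r). nra.
- lra.
- lra.
- set (s' := dyad m q0) in *. set (t' := dyad m (S q1)) in *.
  assert (G1 := hlip t t'). assert (G2 := hlip s s').
  rewrite (Rabs_left1 (t - t')) in G1 by lra. rewrite (Rabs_pos_eq (s - s')) in G2 by lra.
  assert (KR : K * / 2 ^ m < gap).
  { apply (Rmult_lt_compat_r K) in Hr; [|lra]. replace (gap / K * K) with gap in Hr by (field; lra). lra. }
  assert (T : Rabs (h t - h s - c * (t - s)) <= Rabs (h t' - h s' - c * (t' - s')) + Rabs (h t - h t') + Rabs (h s - h s') + Rabs c * ((s - s') + (t' - t))).
  { replace (h t - h s - c * (t - s)) with ((h t' - h s' - c * (t' - s')) + (h t - h t') + - (h s - h s') + c * ((s - s') + (t' - t))) by ring.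
    eapply Rle_trans; [apply Rabs_triang|]. rewrite Rabs_mult, (Rabs_pos_eq (s - s' + (t' - t))) by lra.
    apply Rplus_le_compat_r. eapply Rle_trans; [apply Rabs_triang|]. rewrite Rabs_Ropp. apply Rplus_le_compat_r. apply Rabs_triang. }
  unfold gap, K in KR.
  assert (s - s' <= / 2 ^ m) by lra. assert (t' - t <= / 2 ^ m) by lra.
  assert (M * - (t - t') <= M * / 2 ^ m) by (apply Rmult_le_compat_l; lra).
  assert (M * (s - s') <= M * / 2 ^ m) by (apply Rmult_le_compat_l; lra).
  assert (Rabs c * (s - s' + (t' - t)) <= Rabs c * (2 * / 2 ^ m)) by (apply Rmult_le_compat_l; lra).
  assert (lam * (t' - s') <= lam * (t - s) + lam * (2 * / 2 ^ m)) by (rewrite <- Rmult_plus_distr_l; apply Rmult_le_compat_l; lra).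
  lra.
Qed.

(** By [devsum_lower] the chord of length [l] carries deviation more than [lam^2 * l]. It lies in
    two adjacent cells of length less than [2 * l], so one of them is heavy. *)
Lemma bad_chord_heavy lam n p x : 0 < lam -> (p < 2 ^ n)%nat -> bad_chord lam n p x ->
  exists j i, (i < 2 ^ (n + j))%nat /\ heavy lam n j i /\ near_cell (n + j) i x.
Proof.
intros Hl Hp Hb. destruct (bad_chord_dyadic lam n p x Hl Hb) as [r [q0 [q1 [Hq [Hq0 [Hq1 [Hx Hb']]]]]]].
set (c := slope n p) in *.
(* Cells of [2^a] grid steps are the shortest dyadic ones at least as long as the chord, so two
   adjacent cells contain it. *)
set (a := Nat.log2_up (q1 - q0)).
assert (Hspan : (q1 - q0 <= 2 ^ r)%nat) by (simpl in *; nia).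
assert (Ha : (q1 - q0 <= 2 ^ a)%nat /\ (2 ^ a < 2 * (q1 - q0))%nat).
{ unfold a. destruct (Nat.eq_dec (q1 - q0) 1) as [->|N]; [simpl; lia|].
  destruct (Nat.log2_up_spec (q1 - q0)) as [U V]; [lia|]. split; [exact V|].
  destruct (Nat.log2_up (q1 - q0)); [simpl in *; lia|]. simpl pred in U. rewrite Nat.pow_succ_r'. lia. }
assert (Har : (a <= r)%nat) by (apply Nat.log2_up_le_pow2; lia).
set (j := (r - a)%nat). replace r with (j + a)%nat in * by (unfold j; lia).
set (i := (q0 / 2 ^ a)%nat).
assert (A0 : (2 ^ a <> 0)%nat) by (apply Nat.pow_nonzero; lia).
assert (Di := Nat.div_mod q0 (2 ^ a) A0). assert (Mi := Nat.mod_upper_bound q0 (2 ^ a) A0). fold i in Di.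
assert (I1 : (i * 2 ^ a <= q0)%nat) by lia.
assert (I2 : (q1 <= (i + 2) * 2 ^ a)%nat) by lia.
rewrite Nat.pow_add_r in Hq0, Hq1.
assert (J0 : (2 ^ j <> 0)%nat) by (apply Nat.pow_nonzero; lia).
assert (I3 : (p * 2 ^ j <= i)%nat). { unfold i. apply Nat.div_le_lower_bound; [exact A0|]. lia. }
assert (I4 : (i < (p + 1) * 2 ^ j)%nat). { unfold i. apply Nat.Div0.div_lt_upper_bound. lia. }
assert (PS : forall i', (p * 2 ^ j <= i' < (p + 1) * 2 ^ j)%nat -> parent_slope n j i' = c).
{ intros i' Hi'. unfold parent_slope, c. f_equal. symmetry. apply (Nat.div_unique i' (2 ^ j) p (i' - p * 2 ^ j)); lia. }
assert (N2 : forall i', (i' < (p + 1) * 2 ^ j)%nat -> (i' < 2 ^ (n + j))%nat).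
{ intros i' Hi'. rewrite Nat.pow_add_r. assert ((p + 1) * 2 ^ j <= 2 ^ n * 2 ^ j)%nat by (apply Nat.mul_le_mono_r; lia). lia. }
set (k := (n + j)%nat) in *. replace (n + (j + a))%nat with (k + a)%nat in * by (unfold k; lia).
set (l := dyad (k + a) q1 - dyad (k + a) q0) in *.
assert (Hl1 : / 2 ^ k < 2 * l).
{ unfold l, dyad. rewrite pow_add. destruct Ha as [_ Ha]. apply lt_INR in Ha. rewrite mult_INR, INR_pow2, minus_INR in Ha by lia.
  simpl INR in Ha. assert (P1 := pow2_pos k). assert (P2 := pow2_pos a).
  apply (Rmult_lt_reg_r (2 ^ k * 2 ^ a)); [nra|].
  replace (/ 2 ^ k * (2 ^ k * 2 ^ a)) with (2 ^ a) by (field; lra).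
  replace (2 * (INR q1 / (2 ^ k * 2 ^ a) - INR q0 / (2 ^ k * 2 ^ a)) * (2 ^ k * 2 ^ a)) with (2 * (INR q1 - INR q0)) by (field; lra). lra. }
assert (P1 := pow2_pos k). assert (Hik : 0 < / 2 ^ k) by (apply Rinv_0_lt_compat; exact P1).
assert (D := devsum_lower c (k + a) q0 q1 Hq). fold l in D.
assert (D1 : lam ^ 2 * l < devsum c (k + a) q1 - devsum c (k + a) q0).
{ assert (Q : (lam * l) ^ 2 < Rabs (h (dyad (k + a) q1) - h (dyad (k + a) q0) - c * l) ^ 2).
  { assert (G : forall a y, 0 < a -> a < y -> a ^ 2 < y ^ 2) by (intros; nra).
    apply G; [apply Rmult_lt_0_compat; lra|exact Hb']. }
  rewrite pow2_abs in Q. apply (Rmult_lt_reg_r l); [lra|].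
  replace ((lam * l) ^ 2) with (lam ^ 2 * l * l) in Q by ring. lra. }
assert (near0 : near_cell k i x).
{ assert (E1 := proj2 (dyad_le_iff (k + a) _ _) I1). assert (E2 := proj2 (dyad_le_iff (k + a) _ _) I2).
  rewrite dyad_scale in E1, E2. unfold dyad in E1 at 1. unfold dyad in E2 at 2. rewrite plus_INR in E2. simpl INR in E2.
  unfold near_cell. split.
  - eapply Rlt_le_trans; [|apply Hx]. eapply Rlt_le_trans; [|exact E1]. apply Rmult_lt_compat_r; lra.
  - eapply Rle_lt_trans; [apply Hx|]. eapply Rle_lt_trans; [exact E2|]. apply Rmult_lt_compat_r; lra. }
assert (near1 : near_cell k (i + 1) x).
{ assert (E1 := proj2 (dyad_le_iff (k + a) _ _) I1). assert (E2 := proj2 (dyad_le_iff (k + a) _ _) I2).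
  rewrite dyad_scale in E1, E2. unfold dyad in E1 at 1. unfold dyad in E2 at 2. rewrite plus_INR in E2. simpl INR in E2.
  unfold near_cell. rewrite plus_INR. simpl INR. split.
  - eapply Rlt_le_trans; [|apply Hx]. eapply Rlt_le_trans; [|exact E1]. apply Rmult_lt_compat_r; lra.
  - eapply Rle_lt_trans; [apply Hx|]. eapply Rle_lt_trans; [exact E2|]. apply Rmult_lt_compat_r; lra. }
assert (L0 : devsum c k i <= devsum c (k + a) q0) by (rewrite <- (devsum_scale c a k i); apply devsum_mono; exact I1).
assert (S1 : devsum c k (i + 1) = devsum c k i + dev c k i) by (rewrite Nat.add_1_r; reflexivity).
assert (S2 : devsum c k (i + 2) = devsum c k i + dev c k i + dev c k (i + 1)).
{ replace (i + 2)%nat with (S (i + 1)) by lia. rewrite <- S1. reflexivity. }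
(* If [i] is the last cell below the ancestor [p], the chord lies in cell [i] alone; the next cell
   would be compared with the slope of another ancestor. *)
destruct (le_lt_dec ((p + 1) * 2 ^ j) (i + 1)) as [Hend|Hin].
- assert (L1 : devsum c (k + a) q1 <= devsum c k (i + 1)).
  { rewrite <- (devsum_scale c a k (i + 1)). apply devsum_mono. eapply Nat.le_trans; [exact Hq1|]. rewrite Nat.mul_assoc. apply Nat.mul_le_mono_r. exact Hend. }
  exists j, i. split; [apply N2; exact I4|]. split; [|exact near0].
  unfold heavy. fold k. rewrite PS by lia. nra.
- assert (L1 : devsum c (k + a) q1 <= devsum c k (i + 2)).
  { rewrite <- (devsum_scale c a k (i + 2)). apply devsum_mono. exact I2. }
  destruct (Rlt_dec (lam ^ 2 / 4 * / 2 ^ k) (dev c k i)).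
  + exists j, i. split; [apply N2; exact I4|]. split; [|exact near0]. unfold heavy. fold k. rewrite PS by lia. assumption.
  + exists j, (i + 1)%nat. split; [apply N2; exact Hin|]. split; [|exact near1].
    unfold heavy. fold k. rewrite PS by lia. nra.
Qed.

Fixpoint no_heavy_ancestor (lam : R) (n j i : nat) : Prop :=
  match j with O => True | S j => no_heavy_ancestor lam n j (i / 2) /\ ~ heavy lam n j (i / 2) end.

(** A stopping rule: the first heavy cell on each branch, so that selected cells do not overlap. *)
Definition selected lam n j i := no_heavy_ancestor lam n j i /\ heavy lam n j i.

Lemma near_cell_parent k i x : near_cell (S k) i x -> near_cell k (i / 2) x.
Proof.
unfold near_cell. intros [H1 H2]. assert (P := pow2_pos k). simpl pow in *.
assert (D := Nat.div_mod i 2 ltac:(lia)). assert (Mb := Nat.mod_upper_bound i 2 ltac:(lia)).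
set (q := (i / 2)%nat) in *.
assert (E : INR i = 2 * INR q + INR (i mod 2)) by (rewrite D at 1; rewrite plus_INR, mult_INR; reflexivity).
assert (R1 : 0 <= INR (i mod 2) <= 1). { split; [apply pos_INR|]. change 1 with (INR 1). apply le_INR. lia. }
assert (Ip : 0 < / (2 * 2 ^ k)) by (apply Rinv_0_lt_compat; lra).
assert (X : x = x * (2 * 2 ^ k) * / (2 * 2 ^ k)) by (field; lra).
split.
- eapply Rle_lt_trans; [|exact H1]. replace ((INR q - 2) / 2 ^ k) with ((2 * INR q - 4) / (2 * 2 ^ k)) by (field; lra).
  apply Rmult_le_compat_r; lra.
- eapply Rlt_le_trans; [exact H2|]. replace ((INR q + 3) / 2 ^ k) with ((2 * INR q + 6) / (2 * 2 ^ k)) by (field; lra).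
  apply Rmult_le_compat_r; lra.
Qed.

Lemma half_lt i k : (i < 2 ^ S k)%nat -> (i / 2 < 2 ^ k)%nat.
Proof. intros H. apply Nat.Div0.div_lt_upper_bound. rewrite <- Nat.pow_succ_r'. exact H. Qed.

Lemma heavy_selected lam n j : forall i x, (i < 2 ^ (n + j))%nat -> near_cell (n + j) i x -> ~ no_heavy_ancestor lam n j i ->
  exists j' i', (i' < 2 ^ (n + j'))%nat /\ selected lam n j' i' /\ near_cell (n + j') i' x.
Proof.
induction j; intros i x Hi Hx Hn; [exfalso; apply Hn; exact I|].
rewrite Nat.add_succ_r in Hi, Hx. apply half_lt in Hi. apply near_cell_parent in Hx.
destruct (classic (no_heavy_ancestor lam n j (i / 2))) as [A|A].
- destruct (classic (heavy lam n j (i / 2))) as [B|B].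
  + exists j, (i / 2)%nat. repeat split; auto; apply Hx.
  + exfalso. apply Hn. split; assumption.
- apply (IHj (i / 2)%nat x); assumption.
Qed.

Definition ind (P : Prop) : R := if excluded_middle_informative P then 1 else 0.
Lemma ind_true P : P -> ind P = 1.
Proof. intros H. unfold ind. destruct (excluded_middle_informative P); tauto. Qed.
Lemma ind_false P : ~ P -> ind P = 0.
Proof. intros H. unfold ind. destruct (excluded_middle_informative P); tauto. Qed.
Lemma ind_bounds P : 0 <= ind P <= 1.
Proof. unfold ind. destruct (excluded_middle_informative P); lra. Qed.

Lemma parent_slope_half n j i : parent_slope n (S j) i = parent_slope n j (i / 2).
Proof. unfold parent_slope. f_equal. rewrite Nat.pow_succ_r'. symmetry. apply Nat.Div0.div_div. Qed.

(** A maximal inequality of Doob's type. [rest j] is the deviation carried by the cells not stopped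
    before generation [j]; refinement preserves it except for the amount [sel j] removed by
    stopping, and each stopped cell removes at least [lam^2 / 4] times its length. *)
Lemma selected_total lam n J : 0 < lam ->
  rsum (fun j => rsum (fun i => ind (selected lam n j i) * / 2 ^ (n + j)) (2 ^ (n + j))) J <=
  4 / lam ^ 2 * rsum (fun p => dev (slope n p) n p) (2 ^ n).
Proof.
intros Hl.
set (rest := fun j => rsum (fun i => ind (no_heavy_ancestor lam n j i) * dev (parent_slope n j i) (n + j) i) (2 ^ (n + j))).
set (sel := fun j => rsum (fun i => ind (selected lam n j i) * dev (parent_slope n j i) (n + j) i) (2 ^ (n + j))).
assert (R0 : rest O = rsum (fun p => dev (slope n p) n p) (2 ^ n)).
{ unfold rest. rewrite Nat.add_0_r. apply rsum_ext. intros i _. rewrite ind_true by exact I.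
  unfold parent_slope. change (2 ^ 0)%nat with 1%nat. rewrite Nat.div_1_r. ring. }
assert (Rn : forall j, 0 <= rest j).
{ intros j. apply rsum_nonneg. intros i _. apply Rmult_le_pos; [apply ind_bounds|apply dev_nonneg]. }
assert (Step : forall j, rest (S j) + sel j = rest j).
{ intros j. unfold rest, sel. rewrite Nat.add_succ_r, rsum_double_pow, <- rsum_plus. apply rsum_ext. intros i _.
  rewrite !parent_slope_half. assert (NH : forall i', no_heavy_ancestor lam n (S j) i' = (no_heavy_ancestor lam n j (i' / 2) /\ ~ heavy lam n j (i' / 2))) by reflexivity.
  rewrite !NH.
  replace (2 * i / 2)%nat with i by (rewrite Nat.mul_comm, Nat.div_mul; lia).
  replace ((2 * i + 1) / 2)%nat with i by (apply (Nat.div_unique _ 2 i 1); lia).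
  rewrite (dev_split _ (n + j) i).
  assert (ind (no_heavy_ancestor lam n j i /\ ~ heavy lam n j i) + ind (selected lam n j i) = ind (no_heavy_ancestor lam n j i)).
  { unfold selected. destruct (classic (no_heavy_ancestor lam n j i)) as [A|A].
    - destruct (classic (heavy lam n j i)) as [B|B].
      + rewrite (ind_false (_ /\ ~ _)), (ind_true (_ /\ _)), ind_true by tauto. ring.
      + rewrite (ind_true (_ /\ ~ _)), (ind_false (_ /\ _)), ind_true by tauto. ring.
    - rewrite !ind_false by tauto. ring. }
  rewrite <- H. ring. }
assert (L2 : 0 < lam ^ 2) by (apply pow_lt; exact Hl).
assert (T : forall J, rsum sel J + rest J = rest O).
{ induction J0; simpl; [ring|]. rewrite <- IHJ0, <- (Step J0). ring. }
rewrite <- R0. specialize (T J). specialize (Rn J).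
assert (U : rsum (fun j => rsum (fun i => ind (selected lam n j i) * / 2 ^ (n + j)) (2 ^ (n + j))) J <= rsum (fun j => 4 / lam ^ 2 * sel j) J).
{ apply rsum_le. intros j _. unfold sel. rewrite <- rsum_scal. apply rsum_le. intros i _.
  destruct (classic (selected lam n j i)) as [A|A].
  - rewrite !ind_true by exact A. destruct A as [_ A]. unfold heavy in A.
    apply (Rmult_lt_compat_l (4 / lam ^ 2)) in A; [|apply Rdiv_lt_0_compat; lra].
    replace (4 / lam ^ 2 * (lam ^ 2 / 4 * / 2 ^ (n + j))) with (/ 2 ^ (n + j)) in A by (field; split; [apply pow_nonzero|]; lra). lra.
  - rewrite !ind_false by exact A. lra. }
rewrite rsum_scal in U. eapply Rle_trans; [exact U|]. apply Rmult_le_compat_l; [left; apply Rdiv_lt_0_compat; lra|lra].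
Qed.

Lemma rsum_energy n : rsum (energy n) (2 ^ n) = energy 0 0.
Proof.
induction n; [simpl; ring|]. rewrite rsum_double_pow, <- IHn. apply rsum_ext. intros i _. symmetry. apply energy_split.
Qed.
Lemma rsum_energy_upto n : forall m, rsum (energy_upto m n) (2 ^ n) = energy_upto (m + n) 0 0.
Proof.
induction n; intros m; [rewrite Nat.add_0_r; simpl; ring|].
rewrite rsum_double_pow. replace (m + S n)%nat with (S m + n)%nat by lia. rewrite <- (IHn (S m)). reflexivity.
Qed.

(** Relative to its own slope, a cell deviates by its energy minus the part already visible at level
    [n]. The sum is thus the distance of [energy_upto n 0 0] from its limit. *)
Lemma dev_level_small eps : 0 < eps -> exists n, rsum (fun p => dev (slope n p) n p) (2 ^ n) < eps.
Proof.
intros He. destruct (proj2 (is_lim_seq_spec _ _) (energy_lim 0 0) (mkposreal eps He)) as [n Hn].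
specialize (Hn n (le_n n)). simpl in Hn. exists n.
assert (E : rsum (fun p => dev (slope n p) n p) (2 ^ n) = energy 0 0 - energy_upto n 0 0).
{ rewrite <- (rsum_energy n). assert (T := rsum_energy_upto n 0). simpl in T. rewrite <- T.
  assert (A : rsum (energy n) (2 ^ n) = rsum (fun p => dev (slope n p) n p + slope n p ^ 2 / 2 ^ n) (2 ^ n)).
  { apply rsum_ext. intros i _. unfold dev. assert (Z : incr n i = slope n i / 2 ^ n) by (unfold slope; field; apply pow_nonzero; lra).
    rewrite Z. field. apply pow_nonzero; lra. }
  rewrite A, rsum_plus. simpl. ring. }
rewrite E. apply Rabs_def2 in Hn. lra.
Qed.

Lemma bad_chords_null lam : 0 < lam ->
  null_line (fun x => forall n, exists p, (p < 2 ^ n)%nat /\ bad_chord lam n p x).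
Proof.
intros Hl. apply null_of_double_cover. intros eps He.
assert (L2 : 0 < lam ^ 2) by (apply pow_lt; exact Hl).
(* [20 = 4 * 5]: the factor [4 / lam^2] of [selected_total], and the five cell lengths of
   [near_cell]. *)
destruct (dev_level_small (eps * lam ^ 2 / 20)) as [n Hn]; [apply Rdiv_lt_0_compat; nra|].
set (P := fun j i => (i < 2 ^ (n + j))%nat /\ selected lam n j i).
exists (fun j i => if excluded_middle_informative (P j i) then (INR i - 2) / 2 ^ (n + j) else 0),
       (fun j i => if excluded_middle_informative (P j i) then (INR i + 3) / 2 ^ (n + j) else 0).
split; [|split].
- intros j i. destruct (excluded_middle_informative (P j i)); [|lra].
  apply Rmult_le_compat_r; [left; apply Rinv_0_lt_compat, pow2_pos|lra].
- intros J K.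
  assert (W : forall j, rsum (fun i => (if excluded_middle_informative (P j i) then (INR i + 3) / 2 ^ (n + j) else 0) -
       (if excluded_middle_informative (P j i) then (INR i - 2) / 2 ^ (n + j) else 0)) K <=
     5 * rsum (fun i => ind (selected lam n j i) * / 2 ^ (n + j)) (2 ^ (n + j))).
  { intros j. rewrite <- rsum_scal.
    set (g := fun i => 5 * (ind (P j i) * / 2 ^ (n + j))).
    assert (g0 : forall i, 0 <= g i).
    { intros i. unfold g. assert (0 < / 2 ^ (n + j)) by apply Rinv_0_lt_compat, pow2_pos. assert (T := ind_bounds (P j i)). nra. }
    apply Rle_trans with (rsum g K).
    { apply rsum_le. intros i _. unfold g, ind. destruct (excluded_middle_informative (P j i)); [|lra].
      right. field. apply pow_nonzero; lra. }
    apply Rle_trans with (rsum g (2 ^ (n + j))).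
    { destruct (le_lt_dec K (2 ^ (n + j))) as [H|H]; [apply rsum_mono; auto|].
      assert (Z : forall d, rsum g (2 ^ (n + j) + d) = rsum g (2 ^ (n + j))).
      { induction d; [rewrite Nat.add_0_r; reflexivity|]. rewrite Nat.add_succ_r. simpl. rewrite IHd. unfold g.
        rewrite ind_false; [ring|]. intros [Q _]. lia. }
      replace K with (2 ^ (n + j) + (K - 2 ^ (n + j)))%nat by lia. rewrite Z. lra. }
    apply rsum_le. intros i Hi. unfold g.
    replace (ind (P j i)) with (ind (selected lam n j i)); [lra|].
    unfold P. destruct (classic (selected lam n j i)); [rewrite !ind_true by tauto|rewrite !ind_false by tauto]; reflexivity. }
  eapply Rle_trans; [apply rsum_le; intros j _; apply W|]. rewrite rsum_scal.
  assert (T := selected_total lam n J Hl).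
  assert (4 / lam ^ 2 * rsum (fun p => dev (slope n p) n p) (2 ^ n) <= 4 / lam ^ 2 * (eps * lam ^ 2 / 20)).
  { apply Rmult_le_compat_l; [left; apply Rdiv_lt_0_compat; lra|lra]. }
  replace (4 / lam ^ 2 * (eps * lam ^ 2 / 20)) with (eps / 5) in H by (field; lra). lra.
- intros x Hx. destruct (Hx n) as [p [Hp Hb]]. destruct (bad_chord_heavy lam n p x Hl Hp Hb) as [j [i [Hi [Hh Hnear]]]].
  assert (G : exists j' i', (i' < 2 ^ (n + j'))%nat /\ selected lam n j' i' /\ near_cell (n + j') i' x).
  { destruct (classic (no_heavy_ancestor lam n j i)) as [A|A].
    - exists j, i. repeat split; auto; apply Hnear.
    - apply (heavy_selected lam n j i); assumption. }
  destruct G as [j' [i' [G1 [G2 G3]]]]. exists j', i'.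
  destruct (excluded_middle_informative (P j' i')) as [Q|Q]; [exact G3|]. exfalso; apply Q; split; assumption.
Qed.

(** Two approximate slopes compared on one common chord differ by at most the sum of their
    tolerances. They form a Cauchy sequence, whose limit is the derivative. *)
Lemma diff_at_of_approx x :
  (forall j : nat, exists c d, 0 < d /\ forall t, Rabs (t - x) < d -> Rabs (h t - h x - c * (t - x)) <= / (INR j + 1) * Rabs (t - x)) ->
  exists l, diff_at h x l.
Proof.
intros H.
assert (H' : forall j : nat, exists cd : R * R, 0 < snd cd /\ forall t, Rabs (t - x) < snd cd -> Rabs (h t - h x - fst cd * (t - x)) <= / (INR j + 1) * Rabs (t - x)).
{ intros j. destruct (H j) as [c [d T]]. exists (c, d). exact T. }
apply choice in H'. destruct H' as [cd Hcd].
set (c := fun j => fst (cd j)).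
assert (C1 : forall j k, Rabs (c j - c k) <= / (INR j + 1) + / (INR k + 1)).
{ intros j k. destruct (Hcd j) as [D1 E1]. destruct (Hcd k) as [D2 E2].
  set (u := Rmin (snd (cd j)) (snd (cd k)) / 2).
  assert (U0 : 0 < Rmin (snd (cd j)) (snd (cd k))) by (apply Rmin_pos; assumption).
  assert (U1 := Rmin_l (snd (cd j)) (snd (cd k))). assert (U2 := Rmin_r (snd (cd j)) (snd (cd k))).
  assert (Hu : 0 < u) by (unfold u; lra).
  specialize (E1 (x + u)). specialize (E2 (x + u)). replace (x + u - x) with u in * by ring.
  rewrite (Rabs_pos_eq u) in * by lra. specialize (E1 ltac:(unfold u; lra)). specialize (E2 ltac:(unfold u; lra)).
  fold (c j) in E1. fold (c k) in E2.
  apply (Rmult_le_reg_r u); [exact Hu|].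
  rewrite <- (Rabs_pos_eq u) at 1 by lra. rewrite <- Rabs_mult.
  replace ((c j - c k) * u) with ((h (x + u) - h x - c k * u) - (h (x + u) - h x - c j * u)) by ring.
  eapply Rle_trans; [apply Rabs_triang|]. rewrite Rabs_Ropp. lra. }
assert (Inv : forall eps, 0 < eps -> exists N, forall j, (N <= j)%nat -> / (INR j + 1) < eps).
{ intros eps He. destruct (nfloor_ex (/ eps)) as [N [_ HN]]; [left; apply Rinv_0_lt_compat; exact He|].
  exists N. intros j Hj. apply le_INR in Hj. rewrite <- (Rinv_inv eps). apply Rinv_lt_contravar; [|lra].
  apply Rmult_lt_0_compat; [apply Rinv_0_lt_compat; exact He|assert (T := pos_INR j); lra]. }
assert (Cau : ex_finite_lim_seq c).
{ apply ex_lim_seq_cauchy_corr. intros [eps He]. destruct (Inv (eps / 2) ltac:(lra)) as [N HN]. exists N. intros n m Hn Hm. simpl.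
  assert (T := C1 n m). assert (A := HN n Hn). assert (B := HN m Hm). lra. }
destruct Cau as [l Hl]. exists l.
assert (C2 : forall j, Rabs (c j - l) <= / (INR j + 1)).
{ intros j. apply le_epsilon. intros eps He.
  destruct (proj2 (is_lim_seq_spec _ _) Hl (mkposreal (eps / 2) ltac:(lra))) as [N1 HN1].
  destruct (Inv (eps / 2) ltac:(lra)) as [N2 HN2].
  set (k := (N1 + N2)%nat). specialize (HN1 k ltac:(unfold k; lia)). specialize (HN2 k ltac:(unfold k; lia)). simpl in HN1.
  assert (T := C1 j k). replace (c j - l) with ((c j - c k) + (c k - l)) by ring.
  eapply Rle_trans; [apply Rabs_triang|]. lra. }
intros eps He. destruct (Inv (eps / 2) ltac:(lra)) as [j Hj]. specialize (Hj j (le_n j)).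
destruct (Hcd j) as [D E]. exists (snd (cd j)). split; [exact D|]. intros t Ht. specialize (E t Ht). fold (c j) in E.
specialize (C2 j).
replace (h t - h x - l * (t - x)) with ((h t - h x - c j * (t - x)) + (c j - l) * (t - x)) by ring.
eapply Rle_trans; [apply Rabs_triang|]. rewrite Rabs_mult. assert (0 <= Rabs (t - x)) by apply Rabs_pos. nra.
Qed.

(** If for each tolerance some level [n] has no bad chord through [x], the slope of the cell of [x]
    at that level is an approximate derivative. Dyadic points are set aside because [x] must be
    interior to its cell for all short chords from [x] to stay in it. *)
Theorem lipschitz_differentiable_ae : null_line (fun x => 0 <= x < 1 /\ ~ exists l, diff_at h x l).
Proof.
apply (null_line_mono _ (fun x => (exists k, exists i, x = dyad k i) \/
  (exists j : nat, forall n, exists p, (p < 2 ^ n)%nat /\ bad_chord (/ (INR j + 1)) n p x))).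
2: { apply null_line_or.
  - apply null_line_union. intros k. apply null_line_union. intros i. apply null_line_singleton.
  - apply null_line_union. intros j. apply bad_chords_null. apply Rinv_0_lt_compat. assert (T := pos_INR j). lra. }
intros x [Hx Hn].
destruct (classic (exists k i, x = dyad k i)) as [D|D]; [left; exact D|right].
apply NNPP. intros Q. apply Hn. apply diff_at_of_approx. intros j.
assert (Q' : exists n, ~ exists p, (p < 2 ^ n)%nat /\ bad_chord (/ (INR j + 1)) n p x).
{ apply not_all_ex_not. intros R. apply Q. exists j. exact R. }
destruct Q' as [n Q']. assert (P := pow2_pos n).
destruct (nfloor_ex (x * 2 ^ n)) as [p [P1 P2]]; [nra|].
assert (Hp : (p < 2 ^ n)%nat). { apply INR_lt. rewrite INR_pow2. nra. }
assert (B1 : dyad n p < x).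
{ destruct (Rle_lt_or_eq_dec (dyad n p) x) as [L|L]; [|exact L|exfalso; apply D; exists n, p; auto].
  unfold dyad. apply (Rmult_le_reg_r (2 ^ n)); [exact P|]. replace (INR p / 2 ^ n * 2 ^ n) with (INR p) by (field; lra). exact P1. }
assert (B2 : x < dyad n (p + 1)).
{ unfold dyad. rewrite plus_INR. simpl INR. apply (Rmult_lt_reg_r (2 ^ n)); [exact P|].
  replace ((INR p + 1) / 2 ^ n * 2 ^ n) with (INR p + 1) by (field; lra). exact P2. }
exists (slope n p), (Rmin (x - dyad n p) (dyad n (p + 1) - x)). split; [apply Rmin_pos; lra|].
intros t Ht.
assert (T1 := Rlt_le_trans _ _ _ Ht (Rmin_l _ _)). assert (T2 := Rlt_le_trans _ _ _ Ht (Rmin_r _ _)).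
apply Rnot_lt_le. intros W. apply Q'. exists p. split; [exact Hp|].
destruct (Rtotal_order t x) as [L|[E|L]].
- exists t, x. rewrite Rabs_left in T1, T2, W by lra. repeat split; try lra.
  rewrite <- Rabs_Ropp in W. replace (x - t) with (- (t - x)) by ring.
  replace (h x - h t - slope n p * - (t - x)) with (- (h t - h x - slope n p * (t - x))) by ring. exact W.
- exfalso. subst t. replace (h x - h x - slope n p * (x - x)) with 0 in W by ring. rewrite Rminus_diag, Rabs_R0 in W. lra.
- exists x, t. rewrite (Rabs_pos_eq (t - x)) in T1, T2, W by lra. repeat split; try lra.
Qed.

End Lipschitz.

(** * Radial limits *)

Lemma Cnorm_Cmod z : Cnorm z = Cmod z.
Proof. unfold Cnorm, Cmod. f_equal. ring. Qed.

Lemma Cscal_mult r (z : C) : Cscal r z = (RtoC r * z)%C.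
Proof. apply injective_projections; simpl; ring. Qed.

Definition rcauchy (phi : R -> C) : Prop :=
  forall eps, 0 < eps -> exists r0, r0 < 1 /\ forall r s, r0 < r < 1 -> r0 < s < 1 -> Cmod (phi r - phi s)%C <= eps.
Definition rlim (phi : R -> C) (l : C) : Prop :=
  forall eps, 0 < eps -> exists r0, r0 < 1 /\ forall r, r0 < r < 1 -> Cmod (phi r - l)%C <= eps.
Definition ray (f : C -> C) (zeta : C) (r : R) : C := f (RtoC r * zeta)%C.

Lemma rlim_cauchy phi l : rlim phi l -> rcauchy phi.
Proof.
intros H eps He. destruct (H (eps / 2) ltac:(lra)) as [r0 [R0 Hr]]. exists r0. split; auto.
intros r s Hr' Hs. assert (A := Hr r Hr'). assert (B := Hr s Hs). rewrite Cmod_minus_sym in B.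
replace (phi r - phi s)%C with ((phi r - l) + (l - phi s))%C by ring.
eapply Rle_trans; [apply Cmod_triangle|lra].
Qed.

Lemma inv_small eps : 0 < eps -> exists N, forall j, (N <= j)%nat -> / (INR j + 1) < eps.
Proof.
intros He. destruct (nfloor_ex (/ eps)) as [N [_ HN]]; [left; apply Rinv_0_lt_compat; exact He|].
exists N. intros j Hj. apply le_INR in Hj. rewrite <- (Rinv_inv eps). apply Rinv_lt_contravar; [|lra].
apply Rmult_lt_0_compat; [apply Rinv_0_lt_compat; exact He|assert (T := pos_INR j); lra].
Qed.

Lemma C_complete (u : nat -> C) :
  (forall eps, 0 < eps -> exists N, forall n m, (N <= n)%nat -> (N <= m)%nat -> Cmod (u n - u m)%C <= eps) ->
  exists l, forall eps, 0 < eps -> exists N, forall n, (N <= n)%nat -> Cmod (u n - l)%C <= eps.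
Proof.
intros H.
assert (G : forall p : C -> R, (forall z, Rabs (p z) <= Cmod z) -> (forall a b, p (a - b)%C = p a - p b) -> ex_finite_lim_seq (fun n => p (u n))).
{ intros p Hp1 Hp2. apply ex_lim_seq_cauchy_corr. intros [eps He].
  destruct (H (eps / 2) ltac:(lra)) as [N HN]. exists N. intros n m Hn Hm. simpl. rewrite <- Hp2.
  eapply Rle_lt_trans; [apply Hp1|]. specialize (HN n m Hn Hm). lra. }
destruct (G fst Rabs_fst_le (fun _ _ => eq_refl)) as [l1 L1].
destruct (G snd Rabs_snd_le (fun _ _ => eq_refl)) as [l2 L2].
exists (l1, l2). intros eps He.
destruct (proj2 (is_lim_seq_spec _ _) L1 (mkposreal (eps / 2) ltac:(lra))) as [N1 H1].
destruct (proj2 (is_lim_seq_spec _ _) L2 (mkposreal (eps / 2) ltac:(lra))) as [N2 H2].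
exists (N1 + N2)%nat. intros n Hn. specialize (H1 n ltac:(lia)). specialize (H2 n ltac:(lia)). simpl in H1, H2.
eapply Rle_trans; [apply Cmod_le_abs|]. simpl. unfold Rminus in *. lra.
Qed.

Lemma rcauchy_lim phi : rcauchy phi -> exists l, rlim phi l.
Proof.
intros H.
destruct (C_complete (fun n => phi (1 - / (INR n + 1)))) as [l Hl].
{ intros eps He. destruct (H eps He) as [r0 [R0 Hr]]. destruct (inv_small (1 - r0) ltac:(lra)) as [N HN].
  assert (P : forall n, 0 < / (INR n + 1)) by (intros n; apply Rinv_0_lt_compat; assert (T := pos_INR n); lra).
  exists N. intros n m Hn Hm. apply Hr; [specialize (HN n Hn); specialize (P n)|specialize (HN m Hm); specialize (P m)]; lra. }
exists l. intros eps He. destruct (H (eps / 2) ltac:(lra)) as [r0 [R0 Hr]]. exists r0. split; auto. intros r Hr'.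
destruct (Hl (eps / 2) ltac:(lra)) as [N1 HN1]. destruct (inv_small (1 - r0) ltac:(lra)) as [N2 HN2].
set (n := (N1 + N2)%nat). specialize (HN1 n ltac:(unfold n; lia)). specialize (HN2 n ltac:(unfold n; lia)).
assert (P : 0 < / (INR n + 1)) by (apply Rinv_0_lt_compat; assert (T := pos_INR n); lra).
assert (Q := Hr r (1 - / (INR n + 1)) Hr' ltac:(lra)).
set (s := 1 - / (INR n + 1)) in *. replace (phi r - l)%C with ((phi r - phi s) + (phi s - l))%C by ring.
eapply Rle_trans; [apply Cmod_triangle|lra].
Qed.

Lemma radial_limit_iff f zeta : radial_limit_exists f zeta <-> rcauchy (ray f zeta).
Proof.
split.
- intros [l Hl]. apply (rlim_cauchy _ l). intros eps He. destruct (Hl eps He) as [r0 [R0 Hr]]. exists r0; split; auto.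
  intros r Hr'. specialize (Hr r Hr'). rewrite Cnorm_Cmod, Cscal_mult in Hr. left. exact Hr.
- intros H. destruct (rcauchy_lim _ H) as [l Hl]. exists l. intros eps He.
  destruct (Hl (eps / 2) ltac:(lra)) as [r0 [R0 Hr]]. exists r0; split; auto.
  intros r Hr'. specialize (Hr r Hr'). rewrite Cnorm_Cmod, Cscal_mult. eapply Rle_lt_trans; [exact Hr|lra].
Qed.

Lemma circle_cis zeta : circle zeta -> exists th, - PI <= th < PI /\ zeta = cis th.
Proof.
intros H. unfold circle in H. rewrite Cnorm_Cmod in H. assert (PP := PI_RGT_0).
destruct zeta as [x y].
assert (E : x * x + y * y = 1).
{ assert (T := Cmod2_alt (x, y)). rewrite H in T. simpl in T. lra. }
assert (Hx : -1 <= x <= 1) by nra.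
assert (B := acos_bound x).
assert (S0 := sin_ge_0 (acos x) (proj1 B) (proj2 B)).
assert (Cx := cos_acos x Hx).
assert (S2 : sin (acos x) * sin (acos x) = y * y).
{ assert (T := sin2_cos2 (acos x)). unfold Rsqr in T. rewrite Cx in T. lra. }
destruct (Rle_dec 0 y) as [Hy|Hy].
- assert (Sy : sin (acos x) = y) by nra.
  (* The half-open range excludes the angle [PI], which is replaced by [- PI]. *)
  destruct (Req_dec (acos x) PI) as [Ep|Np].
  + exists (- PI). split; [lra|]. rewrite cis_opp_PI, <- Ep. unfold cis. rewrite Cx, Sy. reflexivity.
  + exists (acos x). split; [lra|]. unfold cis. rewrite Cx, Sy. reflexivity.
- assert (Sy : sin (acos x) = - y) by nra.
  assert (acos x <> 0). { intros Q. rewrite Q, sin_0 in Sy. lra. }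
  exists (- acos x). split; [lra|]. unfold cis. rewrite cos_neg, sin_neg, Cx, Sy. f_equal. ring.
Qed.

Lemma cis_circle t : circle (cis t).
Proof. unfold circle. rewrite Cnorm_Cmod. apply Cmod_cis. Qed.

Lemma Cmod_ray r t : 0 <= r -> Cmod (RtoC r * cis t)%C = r.
Proof. intros H. rewrite Cmod_mult, Cmod_cis, Cmod_R, Rabs_pos_eq; lra. Qed.

(** * Poisson's formula and Fatou's theorem *)

Definition poisson (r u : R) : R := (1 - r ^ 2) / (1 - 2 * r * cos u + r ^ 2).

Lemma poisson_den r u : 0 <= r < 1 -> 0 < 1 - 2 * r * cos u + r ^ 2.
Proof. intros Hr. assert (C := COS_bound u). nra. Qed.

Lemma cis_cos u : (cis u + cis (- u))%C = RtoC (2 * cos u).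
Proof. apply injective_projections; simpl; rewrite ?cos_neg, ?sin_neg; ring. Qed.

(** Cauchy's formula at [r] for [g z * (1 - r^2) / (1 - r z)]: the added factor equals 1 at [r], and
    on the circle it turns the Cauchy kernel into the Poisson kernel. The radius [R1] stays below
    the pole [1 / r]. *)
Lemma poisson_formula g R0 r : 1 < R0 -> (forall z, Cmod z < R0 -> cdiff g z) -> 0 <= r < 1 ->
  CInt (fun u => g (cis u) * RtoC (poisson r u))%C (- PI) PI = (RtoC (2 * PI) * g (RtoC r))%C.
Proof.
intros HR Hg Hr. assert (PP := PI_RGT_0).
set (R1 := Rmin R0 (2 / (1 + r))).
assert (HR1 : 1 < R1).
{ unfold R1. apply Rmin_glb_lt; [exact HR|]. apply (Rmult_lt_reg_r (1 + r)); [lra|]. field_simplify; lra. }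
assert (NE : forall z, Cmod z < R1 -> (1 - RtoC r * z)%C <> 0).
{ intros z Hz. apply Cmod_gt_0. assert (T := Cmod_rev_triangle 1 (RtoC r * z)).
  rewrite Cmod_1, Cmod_mult, Cmod_R, Rabs_pos_eq in T by lra.
  assert (H2 := Rlt_le_trans _ _ _ Hz (Rmin_r _ _)). assert (Z0 := Cmod_ge_0 z).
  assert (2 / (1 + r) * (1 + r) = 2) by (field; lra).
  assert (r * Cmod z <= r * (2 / (1 + r))) by (apply Rmult_le_compat_l; lra).
  assert (0 < 2 / (1 + r)) by (apply Rdiv_lt_0_compat; lra). nra. }
assert (T := cauchy_circle (fun z => g z * (RtoC (1 - r ^ 2) * / (1 - RtoC r * z)))%C R1 (RtoC r) HR1).
rewrite Cmod_R, Rabs_pos_eq in T by lra.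
assert (Hc : forall z, Cmod z < R1 -> cdiff (fun z => g z * (RtoC (1 - r ^ 2) * / (1 - RtoC r * z)))%C z).
{ intros z Hz. apply cdiff_mult.
  - apply Hg. eapply Rlt_le_trans; [exact Hz|apply Rmin_l].
  - apply cdiff_mult; [apply cdiff_const|]. apply cdiff_inv; [|apply NE; exact Hz].
    apply cdiff_minus; [apply cdiff_const|]. apply cdiff_mult; [apply cdiff_const|apply cdiff_id]. }
specialize (T Hc ltac:(lra)). cbv beta in T.
replace (g (RtoC r) * (RtoC (1 - r ^ 2) * / (1 - RtoC r * RtoC r)))%C with (g (RtoC r)) in T.
2: { replace (RtoC (1 - r ^ 2)) with (1 - RtoC r * RtoC r)%C by (rewrite <- RtoC_mult, <- RtoC_minus; f_equal; ring).
     field. apply NE. rewrite Cmod_R, Rabs_pos_eq; lra. }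
rewrite <- T. apply CInt_ext; [lra|]. intros u _. unfold cauchy_kernel.
assert (N1 : (1 - RtoC r * cis u)%C <> 0) by (apply NE; rewrite Cmod_cis; exact HR1).
assert (N2 : (1 - RtoC r * cis (- u))%C <> 0) by (apply NE; rewrite Cmod_cis; exact HR1).
assert (D := poisson_den r u Hr).
assert (E : ((1 - RtoC r * cis u) * (1 - RtoC r * cis (- u)))%C = RtoC (1 - 2 * r * cos u + r ^ 2)).
{ assert (I1 : (cis u * cis (- u))%C = 1). { rewrite cis_inv. field. apply cis_neq0. }
  transitivity (1 - RtoC r * (cis u + cis (- u)) + RtoC r * RtoC r * (cis u * cis (- u)))%C; [ring|].
  rewrite I1, cis_cos. rewrite <- !RtoC_mult, <- RtoC_minus, <- RtoC_plus. f_equal. ring. }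
unfold poisson. unfold Rdiv. rewrite RtoC_mult, RtoC_inv by lra. rewrite <- E. field. split; auto.
Qed.

Definition poisson' (r u : R) : R := - ((1 - r ^ 2) * (2 * r * sin u)) / (1 - 2 * r * cos u + r ^ 2) ^ 2.

Lemma poisson_deriv r u : 0 <= r < 1 -> is_derive (poisson r) u (poisson' r u).
Proof.
intros Hr. assert (D := poisson_den r u Hr). unfold poisson, poisson'.
auto_derive; [lra|]. field. lra.
Qed.

Lemma poisson_cont r u : 0 <= r < 1 -> continuous (poisson r) u.
Proof. intros Hr. apply (ex_derive_continuous (V:=R_NormedModule)). eexists. apply poisson_deriv; exact Hr. Qed.

Lemma poisson'_cont r u : 0 <= r < 1 -> continuous (poisson' r) u.
Proof.
intros Hr. assert (D := poisson_den r u Hr). apply (ex_derive_continuous (V:=R_NormedModule)).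
unfold poisson'. auto_derive. apply Rgt_not_eq. nra.
Qed.

Lemma poisson_PI r : 0 <= r < 1 -> 0 <= poisson r PI <= 1 - r.
Proof.
intros Hr. unfold poisson. rewrite cos_PI.
replace ((1 - r ^ 2) / (1 - 2 * r * -1 + r ^ 2)) with ((1 - r) / (1 + r)) by (field; nra).
split; [apply Rdiv_le_0_compat; lra|]. apply (Rmult_le_reg_r (1 + r)); [lra|]. unfold Rdiv. rewrite Rmult_assoc, Rinv_l by lra. nra.
Qed.
Lemma poisson_even r u : poisson r (- u) = poisson r u.
Proof. unfold poisson. rewrite cos_neg. reflexivity. Qed.

Lemma poisson_total r : 0 <= r < 1 -> RInt (poisson r) (- PI) PI = 2 * PI.
Proof.
intros Hr. assert (T := poisson_formula (fun _ => 1) 2 r ltac:(lra) (fun z _ => cdiff_const 1 z) Hr).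
apply (f_equal fst) in T. simpl in T.
transitivity (RInt (fun t => 1 * poisson r t - 0 * 0) (- PI) PI).
- assert (E : forall t, poisson r t = 1 * poisson r t - 0 * 0) by (intros; ring).
  apply RInt_ext. intros. apply E.
- assert (E2 : 2 * PI * 1 - 0 * 0 = 2 * PI) by ring. rewrite <- E2. exact T.
Qed.

(* Integrating by parts, the total mass of [|u P_r'(u)|] is at most that of [P_r]. *)
Lemma poisson'_first_moment r : 0 <= r < 1 -> RInt (fun u => - (u * poisson' r u)) (- PI) PI <= 2 * PI.
Proof.
intros Hr. assert (PP := PI_RGT_0).
assert (C1 : forall x, continuous (fun u => u * poisson' r u) x).
{ intros x. apply (continuous_mult (K:=R_AbsRing) (fun u => u)); [apply continuous_id|apply poisson'_cont; exact Hr]. }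
assert (EX1 : ex_RInt (poisson r) (- PI) PI) by (apply (ex_RInt_continuous (V:=R_CompleteNormedModule)); intros; apply poisson_cont; exact Hr).
assert (EX2 : ex_RInt (fun u => u * poisson' r u) (- PI) PI) by (apply (ex_RInt_continuous (V:=R_CompleteNormedModule)); intros; apply C1).
assert (B : RInt (fun u => poisson r u + u * poisson' r u) (- PI) PI = PI * poisson r PI - (- PI) * poisson r (- PI)).
{ apply is_RInt_unique. apply (is_RInt_derive (V:=R_CompleteNormedModule) (fun u => u * poisson r u)).
  - intros x _. replace (poisson r x + x * poisson' r x) with (1 * poisson r x + x * poisson' r x) by ring.
    apply (is_derive_Rmult (fun u => u)); [apply (is_derive_id (K:=R_AbsRing))|apply poisson_deriv; exact Hr].
  - intros x _. apply (continuous_plus (V:=R_NormedModule)); [apply poisson_cont; exact Hr|apply C1]. }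
assert (S1 : RInt (fun u => poisson r u + u * poisson' r u) (- PI) PI = RInt (poisson r) (- PI) PI + RInt (fun u => u * poisson' r u) (- PI) PI).
{ apply (RInt_plus (V:=R_CompleteNormedModule)); assumption. }
assert (S2 : RInt (fun u => - (u * poisson' r u)) (- PI) PI = - RInt (fun u => u * poisson' r u) (- PI) PI).
{ apply (RInt_opp (V:=R_CompleteNormedModule)); assumption. }
rewrite S2. rewrite poisson_total, B in S1 by exact Hr. rewrite poisson_even in S1.
assert (Q := poisson_PI r Hr). nra.
Qed.

Lemma poisson'_sign r u : 0 <= r < 1 -> - PI <= u <= PI -> Rabs u * Rabs (poisson' r u) = - (u * poisson' r u).
Proof.
intros Hr Hu. rewrite <- Rabs_mult. apply Rabs_left1.
assert (D := poisson_den r u Hr). unfold poisson'.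
assert (0 <= u * sin u).
{ destruct (Rle_dec 0 u); [assert (T := sin_ge_0 u ltac:(lra) ltac:(lra)); nra|].
  assert (T := sin_ge_0 (- u) ltac:(lra) ltac:(lra)). rewrite sin_neg in T. nra. }
replace (u * (- ((1 - r ^ 2) * (2 * r * sin u)) / (1 - 2 * r * cos u + r ^ 2) ^ 2)) with
 (- ((1 - r ^ 2) * (2 * r) * (u * sin u) / (1 - 2 * r * cos u + r ^ 2) ^ 2)) by (field; lra).
assert (0 <= (1 - r ^ 2) * (2 * r) * (u * sin u) / (1 - 2 * r * cos u + r ^ 2) ^ 2); [|lra].
apply Rdiv_le_0_compat; [|apply pow_lt; exact D]. apply Rmult_le_pos; [apply Rmult_le_pos; nra|assumption].
Qed.

Lemma poisson'_far r u delta : / 2 <= r < 1 -> 0 < delta <= PI -> delta <= Rabs u -> Rabs u <= PI ->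
  Rabs (poisson' r u) <= 4 / (1 - cos delta) ^ 2 * (1 - r).
Proof.
intros Hr Hd Hu1 Hu2. assert (PP := PI_RGT_0).
assert (Cu : cos u <= cos delta).
{ assert (E : cos u = cos (Rabs u)) by (unfold Rabs; destruct (Rcase_abs u); [rewrite cos_neg|]; reflexivity).
  rewrite E. destruct (Req_dec delta (Rabs u)) as [->|N]; [lra|]. left. apply cos_decreasing_1; lra. }
assert (Cd : cos delta < 1). { rewrite <- cos_0. apply cos_decreasing_1; lra. }
set (d := 1 - cos delta) in *. assert (0 < d) by (unfold d; lra).
unfold poisson'. set (D := 1 - 2 * r * cos u + r ^ 2).
(* [D = (1 - r)^2 + 2 r (1 - cos u)], and [2 r >= 1]. *)
assert (HD : d <= D). { unfold D, d in *. assert (0 <= 1 - cos u) by lra. nra. }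
unfold Rdiv. rewrite Rabs_mult, Rabs_Ropp, !Rabs_mult, Rabs_inv.
rewrite (Rabs_pos_eq (1 - r ^ 2)) by nra. rewrite (Rabs_pos_eq 2), (Rabs_pos_eq r), (Rabs_pos_eq (D ^ 2)) by nra.
assert (Sn : Rabs (sin u) <= 1) by (apply Rabs_le, SIN_bound). assert (S0 := Rabs_pos (sin u)).
assert (I1 : / D ^ 2 <= / d ^ 2). { apply Rinv_le_contravar; [apply pow_lt; assumption|apply pow_incr; lra]. }
assert (I2 : 0 < / D ^ 2) by (apply Rinv_0_lt_compat, pow_lt; lra).
replace (4 * / d ^ 2 * (1 - r)) with (4 * (1 - r) * / d ^ 2) by ring.
apply Rmult_le_compat; try lra.
- apply Rmult_le_pos; [nra|]. apply Rmult_le_pos; [lra|exact S0].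
- assert ((1 - r ^ 2) <= 2 * (1 - r)) by nra.
  replace (4 * (1 - r)) with (2 * (1 - r) * 2) by ring. apply Rmult_le_compat; try lra; try nra.
Qed.

Lemma CInt_bound_fun g m a b : a <= b -> CcontOn g a b -> ex_RInt m a b -> (forall t, a <= t <= b -> Cmod (g t) <= m t) ->
  Cmod (CInt g a b) <= RInt m a b.
Proof.
intros Hab Hc Hm HM. destruct (CInt_ex g a b Hab Hc) as [E1 E2].
assert (K : forall x : R * R, norm (V := prod_NormedModule R_AbsRing R_NormedModule R_NormedModule) x = Cmod x).
{ intros x. change (sqrt (Rabs (fst x) ^ 2 + Rabs (snd x) ^ 2) = sqrt (fst x ^ 2 + snd x ^ 2)).
  rewrite !pow2_abs. reflexivity. }
rewrite <- K.
apply (norm_RInt_le (V := prod_NormedModule R_AbsRing R_NormedModule R_NormedModule) g m a b); auto.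
- intros x Hx. rewrite K. auto.
- apply (is_RInt_fct_extend_pair (U:=R_NormedModule) (V:=R_NormedModule)).
  + apply (RInt_correct (V:=R_CompleteNormedModule)); auto.
  + apply (RInt_correct (V:=R_CompleteNormedModule)); auto.
- apply (RInt_correct (V:=R_CompleteNormedModule)); auto.
Qed.

Lemma CInt_FTC g a s : (forall t, Ccont g t) -> Cderiv (fun x => CInt g a x) s (g s).
Proof.
intros Hg.
assert (EX : forall (u : R -> R), (forall t, continuous u t) -> is_derive (fun x => RInt u a x) s (u s)).
{ intros u Hu. apply (is_derive_RInt (V:=R_NormedModule) u (fun x => RInt u a x) a s); [|apply Hu].
  exists (mkposreal 1 Rlt_0_1). intros y _. apply (RInt_correct (V:=R_CompleteNormedModule)).
  apply (ex_RInt_continuous (V:=R_CompleteNormedModule)). intros; apply Hu. }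
split; simpl; [apply (EX (fun t => fst (g t)))|apply (EX (fun t => snd (g t)))]; intros t; apply Hg.
Qed.

Section Fatou.
Variables (f : C -> C) (M : R).
Hypotheses (Hf : forall z, Cmod z < 1 -> cdiff f z) (HM : forall z, Cmod z < 1 -> Cmod (f z) <= M).

Let on_circle (R0 u : R) : C := f (RtoC R0 * cis u)%C.

Lemma M_nonneg : 0 <= M.
Proof. eapply Rle_trans; [apply Cmod_ge_0|apply (HM 0)]. rewrite Cmod_0. lra. Qed.

Let on_circle_cont R0 u : 0 <= R0 < 1 -> Ccont (on_circle R0) u.
Proof.
intros HR. apply (Ccont_comp f (fun s => RtoC R0 * cis s)%C).
- apply Hf. rewrite Cmod_ray; lra.
- apply Ccont_mult; [apply Ccont_const|apply cis_cont].
Qed.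

Definition arc_primitive (R0 s : R) : C := CInt (on_circle R0) 0 s.

Let arc_primitive_deriv R0 s : 0 <= R0 < 1 -> Cderiv (arc_primitive R0) s (on_circle R0 s).
Proof. intros HR. apply CInt_FTC. intros t. apply on_circle_cont; exact HR. Qed.

Let arc_primitive_diff R0 s t : 0 <= R0 < 1 -> t <= s ->
  (arc_primitive R0 s - arc_primitive R0 t)%C = CInt (on_circle R0) t s.
Proof.
intros HR Hts. symmetry. apply CInt_deriv; [exact Hts| |].
- intros; apply arc_primitive_deriv; exact HR.
- intros u _; apply on_circle_cont; exact HR.
Qed.

Let arc_primitive_lip R0 s t : 0 <= R0 < 1 -> Cmod (arc_primitive R0 s - arc_primitive R0 t)%C <= M * Rabs (s - t).
Proof.
intros HR.
assert (G : forall s t, t <= s -> Cmod (arc_primitive R0 s - arc_primitive R0 t)%C <= M * (s - t)).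
{ clear s t. intros s t Hts. rewrite arc_primitive_diff by assumption. rewrite Rmult_comm. apply CInt_bound; [exact Hts| |].
  - intros u _; apply on_circle_cont; exact HR.
  - intros u _. apply HM. rewrite Cmod_ray; lra. }
destruct (Rle_dec t s).
- rewrite Rabs_pos_eq by lra. apply G; lra.
- rewrite Cmod_minus_sym, Rabs_left by lra. replace (- (s - t)) with (t - s) by ring. apply G; lra.
Qed.

(** The boundary integral of [f z / z] over a sector of an annulus vanishes, so the two arc
    integrals differ by two radial integrals of length [R2 - R1]. The integrand there is at most
    [2 * M], the radii being at least one half. *)
Let radii_compare R1 R2 c d : / 2 <= R1 -> R1 <= R2 -> R2 < 1 -> c <= d ->
  Cmod (CInt (on_circle R2) c d - CInt (on_circle R1) c d)%C <= 4 * M * (R2 - R1).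
Proof.
intros H1 H2 H3 Hcd.
assert (B := boundary_integral_zero (fun z => f z / z)%C 0 R1 R2 c d ltac:(lra) H2 Hcd).
assert (HG : forall t th, homothety 0 t th = (RtoC t * cis th)%C) by (intros; unfold homothety; ring).
assert (NZ : forall t, / 2 <= t -> RtoC t <> 0) by (intros t Ht Q; apply RtoC_inj in Q; lra).
assert (Z : boundary_integral 0 (fun z => f z / z)%C R1 R2 c d = 0).
{ apply B. intros t th Ht _. rewrite HG. apply cdiff_div; [apply Hf; rewrite Cmod_ray; lra|apply cdiff_id|].
  apply Cmod_gt_0. rewrite Cmod_ray; lra. }
unfold boundary_integral in Z.
assert (K : forall t, / 2 <= t -> t < 1 -> CInt (fun th => f (homothety 0 t th) / homothety 0 t th * (t * (Ci * cis th)))%C c d = (Ci * CInt (on_circle t) c d)%C).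
{ intros t Ht1 Ht2. rewrite <- CInt_cmul; [|exact Hcd|intros u _; apply on_circle_cont; lra].
  apply CInt_ext; [exact Hcd|]. intros th _. rewrite HG. unfold on_circle. assert (N1 := cis_neq0 th). assert (N2 := NZ t Ht1).
  field. split; assumption. }
rewrite !K in Z by lra.
assert (S : forall th, Cmod (CInt (fun t => f (homothety 0 t th) / homothety 0 t th * (cis th - 0))%C R1 R2) <= (R2 - R1) * (2 * M)).
{ intros th.
  assert (E : CInt (fun t => f (homothety 0 t th) / homothety 0 t th * (cis th - 0))%C R1 R2 = CInt (fun t => f (RtoC t * cis th)%C * / RtoC t)%C R1 R2).
  { apply CInt_ext; [exact H2|]. intros t Ht. rewrite HG. assert (N1 := cis_neq0 th). assert (N2 := NZ t ltac:(lra)). field. split; assumption. }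
  rewrite E. apply CInt_bound; [exact H2| |].
  - intros t Ht. apply Ccont_mult.
    + apply (Ccont_comp f (fun s => RtoC s * cis th)%C); [apply Hf; rewrite Cmod_ray; lra|].
      apply Ccont_mult; [apply Ccont_RtoC, continuous_id|apply Ccont_const].
    + apply Ccont_inv; [apply NZ; lra|apply Ccont_RtoC, continuous_id].
  - intros t Ht. rewrite Cmod_mult, Cmod_inv by (apply NZ; lra). rewrite Cmod_R, Rabs_pos_eq by lra.
    rewrite Rmult_comm. apply Rmult_le_compat; [left; apply Rinv_0_lt_compat; lra|apply Cmod_ge_0| |].
    + rewrite <- (Rinv_inv 2). apply Rinv_le_contravar; lra.
    + apply HM. rewrite Cmod_ray; lra. }
assert (W : (Ci * (CInt (on_circle R2) c d - CInt (on_circle R1) c d))%C =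
  (CInt (fun t => f (homothety 0 t d) / homothety 0 t d * (cis d - 0))%C R1 R2 - CInt (fun t => f (homothety 0 t c) / homothety 0 t c * (cis c - 0))%C R1 R2)%C).
{ match type of Z with (?x - ?y - ?a + ?b)%C = _ => transitivity ((x - y - a + b) + (a - b))%C; [ring|rewrite Z; ring] end. }
assert (V : Cmod (Ci * (CInt (on_circle R2) c d - CInt (on_circle R1) c d))%C = Cmod (CInt (on_circle R2) c d - CInt (on_circle R1) c d)%C).
{ rewrite Cmod_mult, Cmod_Ci. ring. }
rewrite <- V, W. eapply Rle_trans; [apply Cmod_minus_le|]. assert (Sd := S d). assert (Sc := S c). lra.
Qed.

Let arc_primitive_radii R1 R2 s : / 2 <= R1 -> R1 <= R2 -> R2 < 1 ->
  Cmod (arc_primitive R2 s - arc_primitive R1 s)%C <= 4 * M * (R2 - R1).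
Proof.
intros H1 H2 H3. destruct (Rle_dec 0 s) as [Hs|Hs]; [apply radii_compare; assumption|].
assert (Z : forall R0, arc_primitive R0 0 = 0).
{ intros R0. unfold arc_primitive, CInt. rewrite !(RInt_point (V:=R_CompleteNormedModule)). reflexivity. }
assert (E1 := arc_primitive_diff R1 0 s ltac:(lra) ltac:(lra)). assert (E2 := arc_primitive_diff R2 0 s ltac:(lra) ltac:(lra)).
rewrite Z in E1, E2.
replace (arc_primitive R2 s - arc_primitive R1 s)%C with (- (CInt (on_circle R2) s 0 - CInt (on_circle R1) s 0))%C by (rewrite <- E1, <- E2; ring).
rewrite Cmod_opp. apply radii_compare; lra.
Qed.

(** [Psi] plays the role of a primitive of the boundary function, which itself is never
    constructed. *)
Lemma boundary_primitive_exists : exists Psi : R -> C, (forall s t, Cmod (Psi s - Psi t)%C <= M * Rabs (s - t)) /\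
  (forall R0 s, / 2 <= R0 < 1 -> Cmod (arc_primitive R0 s - Psi s)%C <= 4 * M * (1 - R0)).
Proof.
assert (M0 := M_nonneg).
assert (P : forall s, exists l, rlim (fun R0 => arc_primitive R0 s) l).
{ intros s. apply rcauchy_lim. intros eps He. exists (Rmax (/ 2) (1 - eps / (4 * M + 1))).
  assert (E0 : 0 < eps / (4 * M + 1)) by (apply Rdiv_lt_0_compat; lra).
  split; [apply Rmax_lub_lt; lra|]. intros r t Hr Ht.
  assert (E1 : (4 * M + 1) * (eps / (4 * M + 1)) = eps) by (field; lra).
  assert (A1 := Rmax_l (/ 2) (1 - eps / (4 * M + 1))). assert (A2 := Rmax_r (/ 2) (1 - eps / (4 * M + 1))).
  destruct (Rle_dec r t).
  - rewrite Cmod_minus_sym. eapply Rle_trans; [apply arc_primitive_radii; lra|]. nra.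
  - eapply Rle_trans; [apply arc_primitive_radii; lra|]. nra. }
apply choice in P. destruct P as [Psi HPsi]. exists Psi. split.
- intros s t. apply le_epsilon. intros eps He.
  destruct (HPsi s (eps / 2) ltac:(lra)) as [r1 [R1 H1]]. destruct (HPsi t (eps / 2) ltac:(lra)) as [r2 [R2 H2]].
  set (r := (1 + Rmax (/ 2) (Rmax r1 r2)) / 2).
  assert (A1 := Rmax_l (/ 2) (Rmax r1 r2)). assert (A2 := Rmax_r (/ 2) (Rmax r1 r2)).
  assert (A3 := Rmax_l r1 r2). assert (A4 := Rmax_r r1 r2).
  assert (A5 : Rmax (/ 2) (Rmax r1 r2) < 1) by (repeat apply Rmax_lub_lt; lra).
  specialize (H1 r ltac:(unfold r; lra)). specialize (H2 r ltac:(unfold r; lra)).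
  assert (L := arc_primitive_lip r s t ltac:(unfold r; lra)). rewrite Cmod_minus_sym in H1.
  replace (Psi s - Psi t)%C with ((Psi s - arc_primitive r s) + (arc_primitive r s - arc_primitive r t) + (arc_primitive r t - Psi t))%C by ring.
  eapply Rle_trans; [apply Cmod_triangle|]. eapply Rle_trans; [apply Rplus_le_compat_r, Cmod_triangle|]. lra.
- intros R0 s HR0. apply le_epsilon. intros eps He.
  destruct (HPsi s eps He) as [r1 [R1 H1]].
  set (r := (1 + Rmax R0 r1) / 2). assert (A1 := Rmax_l R0 r1). assert (A2 := Rmax_r R0 r1).
  assert (A5 : Rmax R0 r1 < 1) by (apply Rmax_lub_lt; lra).
  specialize (H1 r ltac:(unfold r; lra)).
  assert (L := arc_primitive_radii R0 r s ltac:(lra) ltac:(unfold r; lra) ltac:(unfold r; lra)). rewrite Cmod_minus_sym in L.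
  replace (arc_primitive R0 s - Psi s)%C with ((arc_primitive R0 s - arc_primitive r s) + (arc_primitive r s - Psi s))%C by ring.
  eapply Rle_trans; [apply Cmod_triangle|]. assert (4 * M * (r - R0) <= 4 * M * (1 - R0)) by (apply Rmult_le_compat_l; unfold r; lra). lra.
Qed.

Section AtPoint.
Variables (Psi : R -> C) (th0 : R) (l : C).
Hypothesis Plip : forall s t, Cmod (Psi s - Psi t)%C <= M * Rabs (s - t).
Hypothesis Pappr : forall R0 s, / 2 <= R0 < 1 -> Cmod (arc_primitive R0 s - Psi s)%C <= 4 * M * (1 - R0).
Hypothesis Pdiff : forall eps, 0 < eps -> exists d, 0 < d /\ forall u, Rabs u < d ->
  Cmod (Psi (th0 + u) - Psi th0 - RtoC u * l)%C <= eps * Rabs u.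

Let E (u : R) : C := (Psi (th0 + u) - Psi th0 - RtoC u * l)%C.

Let shift_cont u : continuous (fun s => th0 + s) u.
Proof. apply (continuous_plus (V:=R_NormedModule)); [apply continuous_const|apply continuous_id]. Qed.

Let E_cont u : Ccont E u.
Proof.
unfold E. apply Ccont_minus; [apply Ccont_minus; [|apply Ccont_const]|apply Ccont_mult; [apply Ccont_RtoC, continuous_id|apply Ccont_const]].
apply (Ccont_real_comp Psi (fun s => th0 + s)); [|apply shift_cont].
assert (M0 := M_nonneg).
apply Ccont_eps. intros eps He. exists (eps / (M + 1)). split; [apply Rdiv_lt_0_compat; lra|].
intros s Hs. eapply Rle_lt_trans; [apply Plip|].
apply (Rmult_lt_compat_r (M + 1)) in Hs; [|lra]. replace (eps / (M + 1) * (M + 1)) with eps in Hs by (field; lra).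
assert (0 <= Rabs (s - (th0 + u))) by apply Rabs_pos. nra.
Qed.

Let PC r u : 0 <= r < 1 -> Ccont (fun u => RtoC (poisson r u)) u.
Proof. intros; apply Ccont_RtoC, poisson_cont; assumption. Qed.
Let PC' r u : 0 <= r < 1 -> Ccont (fun u => RtoC (poisson' r u)) u.
Proof. intros; apply Ccont_RtoC, poisson'_cont; assumption. Qed.

(** Poisson's formula for [f (R0 * cis th0 * z) - l], which is holomorphic beyond the closed disc,
    followed by integration by parts. The term [u * l] subtracted in [A] is a primitive of the
    constant [l]. *)
Let by_parts R0 r : / 2 <= R0 < 1 -> 0 <= r < 1 ->
  let A := fun u => (arc_primitive R0 (th0 + u) - arc_primitive R0 th0 - RtoC u * l)%C in
  (RtoC (2 * PI) * (f (RtoC r * (RtoC R0 * cis th0)) - l))%C =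
  (A PI * RtoC (poisson r PI) - A (- PI)%R * RtoC (poisson r PI) - CInt (fun u => A u * RtoC (poisson' r u)) (- PI) PI)%C.
Proof.
intros HR Hr A. assert (PP := PI_RGT_0).
assert (Ad : forall u, Cderiv A u (on_circle R0 (th0 + u) - l)%C).
{ intros u. unfold A. eapply Cderiv_eq; [|apply Cderiv_minus; [apply Cderiv_minus; [|apply Cderiv_const]|apply Cderiv_mult; [apply Cderiv_RtoC, (is_derive_id (K:=R_AbsRing))|apply Cderiv_const]]].
  2: { instantiate (1 := on_circle R0 (th0 + u)). assert (T := arc_primitive_deriv R0 (th0 + u) ltac:(lra)).
       assert (Sd : is_derive (fun s => th0 + s) u 1).
       { auto_derive; [exact I|ring]. }
       destruct T as [T1 T2]. split.
       - replace (fst (on_circle R0 (th0 + u))) with (scal 1 (fst (on_circle R0 (th0 + u)))) by (unfold scal; simpl; unfold mult; simpl; ring).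
         exact (is_derive_comp (fun s => fst (arc_primitive R0 s)) (fun s => th0 + s) u _ _ T1 Sd).
       - replace (snd (on_circle R0 (th0 + u))) with (scal 1 (snd (on_circle R0 (th0 + u)))) by (unfold scal; simpl; unfold mult; simpl; ring).
         exact (is_derive_comp (fun s => snd (arc_primitive R0 s)) (fun s => th0 + s) u _ _ T2 Sd). }
  change (RtoC one) with (RtoC 1). cbv beta. ring. }
assert (Ac : forall u, Ccont A u) by (intros u; eapply Cderiv_cont; apply Ad).
assert (oc : forall u, Ccont (fun u => on_circle R0 (th0 + u) - l)%C u).
{ intros u. apply Ccont_minus; [|apply Ccont_const]. apply (Ccont_real_comp (on_circle R0) (fun s => th0 + s)); [apply on_circle_cont; lra|apply shift_cont]. }
assert (PF := poisson_formula (fun z => f (RtoC R0 * cis th0 * z) - l)%C (/ R0) r).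
assert (PF1 : CInt (fun u => (f (RtoC R0 * cis th0 * cis u)%C - l) * RtoC (poisson r u))%C (- PI) PI = (RtoC (2 * PI) * (f (RtoC R0 * cis th0 * RtoC r)%C - l))%C).
{ apply PF; [|intros z Hz|exact Hr].
  - rewrite <- Rinv_1. apply Rinv_lt_contravar; lra.
  - apply cdiff_minus; [|apply cdiff_const]. apply cdiff_scale_arg. apply Hf. rewrite !Cmod_mult, Cmod_cis, Cmod_R, Rabs_pos_eq by lra.
    apply (Rmult_lt_compat_l R0) in Hz; [|lra]. rewrite Rinv_r in Hz by lra. lra. }
replace (RtoC r * (RtoC R0 * cis th0))%C with (RtoC R0 * cis th0 * RtoC r)%C by ring.
rewrite <- PF1.
rewrite <- (poisson_even r PI) at 2.
assert (FT := CInt_deriv (fun u => A u * RtoC (poisson r u))%C (fun u => (on_circle R0 (th0 + u) - l) * RtoC (poisson r u) + A u * RtoC (poisson' r u))%C (- PI) PI ltac:(lra)).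
rewrite <- FT.
- rewrite CInt_plus; [|lra| |].
  + replace (CInt (fun u => (f (RtoC R0 * cis th0 * cis u)%C - l) * RtoC (poisson r u))%C (- PI) PI) with
     (CInt (fun t => (on_circle R0 (th0 + t) - l) * RtoC (poisson r t))%C (- PI) PI); [ring|].
    apply CInt_ext; [lra|]. intros u _. unfold on_circle. rewrite cis_add. do 3 f_equal. ring.
  + intros u _. exact (Ccont_mult _ _ u (oc u) (PC r u Hr)).
  + intros u _. exact (Ccont_mult _ _ u (Ac u) (PC' r u Hr)).
- intros u _. exact (Cderiv_mult _ _ u _ _ (Ad u) (Cderiv_RtoC _ _ _ (poisson_deriv r u Hr))).
- intros u _. exact (Ccont_plus _ _ u (Ccont_mult _ _ u (oc u) (PC r u Hr)) (Ccont_mult _ _ u (Ac u) (PC' r u Hr))).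
Qed.

(** The limit of [by_parts] as [R0] tends to 1 with [r] fixed: [A] tends uniformly to [E], and
    [poisson' r] is bounded. *)
Let boundary_formula r : 0 <= r < 1 ->
  (RtoC (2 * PI) * (f (RtoC r * cis th0) - l))%C =
  (E PI * RtoC (poisson r PI) - E (- PI)%R * RtoC (poisson r PI) - CInt (fun u => E u * RtoC (poisson' r u)) (- PI) PI)%C.
Proof.
intros Hr. assert (PP := PI_RGT_0). assert (M0 := M_nonneg). apply eq_of_Cmod_le. intros eps He.
destruct (CcontOn_bounded (fun u => RtoC (poisson' r u)) (- PI) PI ltac:(lra) (fun u _ => PC' r u Hr)) as [K HK].
assert (K0 : 0 <= K) by (eapply Rle_trans; [apply Cmod_ge_0|apply (HK 0); lra]).
assert (Hz : Cmod (RtoC r * cis th0)%C < 1) by (rewrite Cmod_ray; lra).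
assert (cf := cdiff_continuous f (RtoC r * cis th0)%C (Hf _ Hz) (eps / (4 * PI)) ltac:(apply Rdiv_lt_0_compat; lra)).
destruct cf as [d [D Hd]].
(* [A] and [E] differ by at most [8 * M * e]; this error enters the two boundary terms and,
   multiplied by the bound [K] of the kernel, an integral of length [2 * PI]. *)
set (W := 8 * M * (2 + 2 * PI * K) + 1).
assert (HW : 0 < W). { unfold W. assert (0 <= PI * K) by (apply Rmult_le_pos; lra). assert (0 <= 8 * M * (2 + 2 * PI * K)) by (apply Rmult_le_pos; lra). lra. }
set (e := Rmin (/ 2) (Rmin (d / 2) (eps / 2 / W))).
assert (He0 : 0 < e) by (unfold e; repeat apply Rmin_pos; try lra; apply Rdiv_lt_0_compat; lra).
assert (e1 : e <= / 2) by apply Rmin_l.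
assert (e2 : e <= d / 2) by (eapply Rle_trans; [apply Rmin_r|apply Rmin_l]).
assert (e3 : e <= eps / 2 / W) by (eapply Rle_trans; [apply Rmin_r|apply Rmin_r]).
assert (B := by_parts (1 - e) r ltac:(lra) Hr). cbv zeta in B.
set (A := fun u => (arc_primitive (1 - e) (th0 + u) - arc_primitive (1 - e) th0 - RtoC u * l)%C) in *.
assert (AE : forall u, Cmod (E u - A u)%C <= 8 * M * e).
{ intros u. replace (E u - A u)%C with ((arc_primitive (1 - e) th0 - Psi th0) - (arc_primitive (1 - e) (th0 + u) - Psi (th0 + u)))%C by (unfold E, A; ring).
  assert (T1 := Pappr (1 - e) th0 ltac:(lra)). assert (T2 := Pappr (1 - e) (th0 + u) ltac:(lra)).
  eapply Rle_trans; [apply Cmod_minus_le|]. lra. }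
assert (Ac : forall u, Ccont A u).
{ intros u. unfold A. apply Ccont_minus; [apply Ccont_minus; [|apply Ccont_const]|apply Ccont_mult; [apply Ccont_RtoC, continuous_id|apply Ccont_const]].
  apply (Ccont_real_comp (arc_primitive (1 - e)) (fun s => th0 + s)); [|apply shift_cont]. eapply Cderiv_cont. apply arc_primitive_deriv. lra. }
assert (I1 : Cmod (CInt (fun u => E u * RtoC (poisson' r u))%C (- PI) PI - CInt (fun u => A u * RtoC (poisson' r u))%C (- PI) PI)%C <= (PI - - PI) * (8 * M * e * K)).
{ rewrite <- CInt_minus; [|lra|intros u _; apply Ccont_mult; [apply E_cont|apply PC'; exact Hr]|intros u _; apply Ccont_mult; [apply Ac|apply PC'; exact Hr]].
  apply CInt_bound; [lra| |].
  - intros u _. apply Ccont_minus; (apply Ccont_mult; [|apply PC'; exact Hr]); [apply E_cont|apply Ac].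
  - intros u Hu. replace (E u * RtoC (poisson' r u) - A u * RtoC (poisson' r u))%C with ((E u - A u) * RtoC (poisson' r u))%C by ring.
    rewrite Cmod_mult. apply Rmult_le_compat; try apply Cmod_ge_0; [apply AE|apply HK; exact Hu]. }
assert (PPI := poisson_PI r Hr).
set (x := f (RtoC r * cis th0)%C) in *. set (y := f (RtoC r * (RtoC (1 - e) * cis th0))%C) in *.
assert (xy : Cmod (x - y)%C <= eps / (4 * PI)).
{ rewrite Cmod_minus_sym. left. apply Hd. replace (RtoC r * (RtoC (1 - e) * cis th0) - RtoC r * cis th0)%C with (- (RtoC (r * e) * cis th0))%C
   by (rewrite RtoC_minus, RtoC_mult; ring). rewrite Cmod_opp, Cmod_ray by nra. nra. }
set (IE := CInt (fun u => E u * RtoC (poisson' r u))%C (- PI) PI) in *. set (IA := CInt (fun u => A u * RtoC (poisson' r u))%C (- PI) PI) in *.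
set (p := poisson r PI) in *.
replace (RtoC (2 * PI) * (x - l) - (E PI * RtoC p - E (- PI)%R * RtoC p - IE))%C with
 (RtoC (2 * PI) * (x - y) + (- ((E PI - A PI) * RtoC p) + (E (- PI)%R - A (- PI)%R) * RtoC p + (IE - IA)) + (RtoC (2 * PI) * (y - l) - (A PI * RtoC p - A (- PI)%R * RtoC p - IA)))%C by ring.
rewrite B. replace (A PI * RtoC p - A (- PI)%R * RtoC p - IA - (A PI * RtoC p - A (- PI)%R * RtoC p - IA))%C with (RtoC 0) by ring.
rewrite Cplus_0_r.
eapply Rle_trans; [apply Cmod_triangle|]. eapply Rle_trans; [apply Rplus_le_compat_l, Cmod_triangle|].
eapply Rle_trans; [apply Rplus_le_compat_l, Rplus_le_compat_r, Cmod_triangle|].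
rewrite Cmod_opp, !Cmod_mult, !Cmod_R, (Rabs_pos_eq (2 * PI)), (Rabs_pos_eq p) by lra.
assert (T1 := AE PI). assert (T2 := AE (- PI)).
assert (0 <= Cmod (E PI - A PI)%C) by apply Cmod_ge_0. assert (0 <= Cmod (E (- PI)%R - A (- PI)%R)%C) by apply Cmod_ge_0.
assert (Cmod (E PI - A PI)%C * p <= 8 * M * e) by nra.
assert (Cmod (E (- PI)%R - A (- PI)%R)%C * p <= 8 * M * e) by nra.
assert (2 * PI * Cmod (x - y)%C <= eps / 2).
{ replace (eps / 2) with (2 * PI * (eps / (4 * PI))) by (field; lra). apply Rmult_le_compat_l; lra. }
assert (e * W <= eps / 2).
{ replace (eps / 2) with (eps / 2 / W * W) by (field; lra). apply Rmult_le_compat_r; lra. }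
unfold W in *. nra.
Qed.

(** Near [u = 0] the bound [|E u| <= eps / 2 * |u|] is integrated against [|poisson' r|], using that
    the first moment is at most [2 * PI]. Away from 0 the derivative of the kernel is of order
    [1 - r], and so are the boundary terms. *)
Lemma radial_limit_at_derivative : rlim (ray f (cis th0)) l.
Proof.
intros eps He. assert (PP := PI_RGT_0). assert (M0 := M_nonneg).
destruct (Pdiff (eps / 2) ltac:(lra)) as [d0 [D0 Hd0]].
set (d := Rmin d0 PI). assert (Hd : 0 < d <= PI) by (unfold d; split; [apply Rmin_pos; lra|apply Rmin_r]).
destruct (CcontOn_bounded E (- PI) PI ltac:(lra) (fun u _ => E_cont u)) as [K HK].
assert (K0 : 0 <= K) by (eapply Rle_trans; [apply Cmod_ge_0|apply (HK 0); lra]).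
assert (Cd : cos d < 1). { rewrite <- cos_0. apply cos_decreasing_1; lra. }
set (Q := 4 / (1 - cos d) ^ 2). assert (HQ : 0 < Q) by (apply Rdiv_lt_0_compat; [lra|apply pow_lt; lra]).
set (W := 2 * K + 2 * PI * (K * Q) + 1).
assert (0 <= K * Q) by (apply Rmult_le_pos; lra). assert (0 <= PI * (K * Q)) by (apply Rmult_le_pos; lra).
assert (HW : 0 < W) by (unfold W; lra).
exists (Rmax (/ 2) (1 - eps / W)).
assert (0 < eps / W) by (apply Rdiv_lt_0_compat; lra).
split; [apply Rmax_lub_lt; lra|]. intros r Hr.
assert (Hr1 := Rmax_l (/ 2) (1 - eps / W)). assert (Hr2 := Rmax_r (/ 2) (1 - eps / W)).
assert (B := boundary_formula r ltac:(lra)).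
set (m := fun u => eps / 2 * - (u * poisson' r u) + K * (Q * (1 - r))).
assert (C1 : forall x, continuous (fun u => - (u * poisson' r u)) x).
{ intros x. apply (continuous_opp (V:=R_NormedModule) (fun u => u * poisson' r u)).
  apply (continuous_mult (K:=R_AbsRing) (fun u => u)); [apply continuous_id|apply poisson'_cont; lra]. }
assert (EX1 : ex_RInt (fun u => - (u * poisson' r u)) (- PI) PI) by (apply (ex_RInt_continuous (V:=R_CompleteNormedModule)); intros; apply C1).
assert (EX2 : ex_RInt (fun u => eps / 2 * - (u * poisson' r u)) (- PI) PI) by (apply (ex_RInt_scal (V:=R_NormedModule) _ _ _ (eps / 2) EX1)).
assert (EX3 : ex_RInt (fun _ : R => K * (Q * (1 - r))) (- PI) PI) by apply ex_RInt_const.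
assert (IM : RInt m (- PI) PI <= eps / 2 * (2 * PI) + 2 * PI * (K * (Q * (1 - r)))).
{ assert (S1 : RInt m (- PI) PI = RInt (fun u => eps / 2 * - (u * poisson' r u)) (- PI) PI + RInt (fun _ => K * (Q * (1 - r))) (- PI) PI).
  { apply (RInt_plus (V:=R_CompleteNormedModule)); assumption. }
  assert (S2 : RInt (fun u => eps / 2 * - (u * poisson' r u)) (- PI) PI = eps / 2 * RInt (fun u => - (u * poisson' r u)) (- PI) PI).
  { apply (RInt_scal (V:=R_CompleteNormedModule) (fun u => - (u * poisson' r u))); assumption. }
  rewrite S1, S2, (RInt_const (V:=R_CompleteNormedModule)). unfold scal; simpl; unfold mult; simpl.
  assert (T := poisson'_first_moment r ltac:(lra)).
  assert (eps / 2 * RInt (fun u => - (u * poisson' r u)) (- PI) PI <= eps / 2 * (2 * PI)) by (apply Rmult_le_compat_l; lra). lra. }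
assert (IB : Cmod (CInt (fun u => E u * RtoC (poisson' r u))%C (- PI) PI) <= RInt m (- PI) PI).
{ apply CInt_bound_fun; [lra|intros u _; apply Ccont_mult; [apply E_cont|apply PC'; lra]| |].
  - apply (ex_RInt_plus (V:=R_NormedModule)); assumption.
  - intros u Hu. unfold m. rewrite Cmod_mult, Cmod_R. rewrite <- (poisson'_sign r u) by lra.
    assert (A0 := Rabs_pos u). assert (A1 := Rabs_pos (poisson' r u)).
    assert (0 <= K * (Q * (1 - r))) by (apply Rmult_le_pos; [lra|apply Rmult_le_pos; lra]).
    destruct (Rlt_dec (Rabs u) d) as [L|L].
    + assert (T := Hd0 u (Rlt_le_trans _ _ _ L (Rmin_l _ _))). fold (E u) in T.
      assert (Cmod (E u) * Rabs (poisson' r u) <= eps / 2 * Rabs u * Rabs (poisson' r u)) by (apply Rmult_le_compat_r; lra). lra.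
    + assert (T := poisson'_far r u d ltac:(lra) Hd ltac:(lra) ltac:(apply Rabs_le; lra)). fold Q in T.
      assert (T2 := HK u Hu). assert (Cmod (E u) * Rabs (poisson' r u) <= K * (Q * (1 - r))) by (apply Rmult_le_compat; try lra; apply Cmod_ge_0).
      assert (0 <= eps / 2 * (Rabs u * Rabs (poisson' r u))) by (apply Rmult_le_pos; [lra|apply Rmult_le_pos; lra]). lra. }
assert (PPI := poisson_PI r ltac:(lra)).
assert (E1 := HK PI ltac:(lra)). assert (E2 := HK (- PI) ltac:(lra)).
assert (G : Cmod (RtoC (2 * PI) * (f (RtoC r * cis th0) - l))%C <= K * (1 - r) + K * (1 - r) + (eps / 2 * (2 * PI) + 2 * PI * (K * (Q * (1 - r))))).
{ rewrite B. eapply Rle_trans; [apply Cmod_minus_le|]. apply Rplus_le_compat; [|lra].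
  eapply Rle_trans; [apply Cmod_minus_le|]. rewrite !Cmod_mult, !Cmod_R, Rabs_pos_eq by lra.
  apply Rplus_le_compat; apply Rmult_le_compat; try lra; apply Cmod_ge_0. }
rewrite Cmod_mult, Cmod_R, Rabs_pos_eq in G by lra. unfold ray.
set (X := Cmod (f (RtoC r * cis th0) - l)%C) in *.
assert (H5 : (1 - r) * W < eps).
{ replace eps with (eps / W * W) by (field; lra). apply Rmult_lt_compat_r; lra. }
assert (H6 : K * (1 - r) + K * (1 - r) + 2 * PI * (K * (Q * (1 - r))) <= (1 - r) * W) by (unfold W; nra).
assert (P3 := PI2_3_2). apply (Rmult_le_reg_l (2 * PI)); [lra|].
assert (eps * 1 <= eps * PI) by (apply Rmult_le_compat_l; lra). lra.
Qed.
End AtPoint.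

Theorem fatou : null_T (fun zeta => circle zeta /\ ~ radial_limit_exists f zeta).
Proof.
assert (PP := PI_RGT_0). assert (M0 := M_nonneg).
destruct boundary_primitive_exists as [Psi [P1 P2]].
set (ang := fun x => - PI + 2 * PI * x).
assert (LIP : forall (p : C -> R), (forall z, Rabs (p z) <= Cmod z) -> (forall a b, p (a - b)%C = p a - p b) ->
   forall s t, Rabs (p (Psi (ang s)) - p (Psi (ang t))) <= 2 * PI * M * Rabs (s - t)).
{ intros p Hp1 Hp2 s t. rewrite <- Hp2. eapply Rle_trans; [apply Hp1|]. eapply Rle_trans; [apply P1|].
  unfold ang. replace (- PI + 2 * PI * s - (- PI + 2 * PI * t)) with (2 * PI * (s - t)) by ring.
  rewrite Rabs_mult, (Rabs_pos_eq (2 * PI)) by lra. right; ring. }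
assert (N1 := lipschitz_differentiable_ae _ _ (LIP fst Rabs_fst_le (fun _ _ => eq_refl))).
assert (N2 := lipschitz_differentiable_ae _ _ (LIP snd Rabs_snd_le (fun _ _ => eq_refl))).
assert (N := null_line_or _ _ N1 N2).
(* [ang] multiplies lengths by [2 * PI], so the total becomes at most [eps / 2], which meets the
   strict inequality of [null_T]. *)
intros eps He. destruct (N (eps / (4 * PI))) as [a [b [H1 [H2 H3]]]]; [apply Rdiv_lt_0_compat; lra|].
exists (fun n => ang (a n)), (fun n => ang (b n)). split; [|split].
- intros n. unfold ang. specialize (H1 n). nra.
- intros n. rewrite rsum_sum_f_R0.
  rewrite (rsum_ext _ (fun n => 2 * PI * (b n - a n))) by (intros; unfold ang; ring).
  rewrite rsum_scal. specialize (H2 (S n)).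
  apply (Rmult_le_compat_l (2 * PI)) in H2; [|lra]. replace (2 * PI * (eps / (4 * PI))) with (eps / 2) in H2 by (field; lra). lra.
- intros z [Hz Hnl]. destruct (circle_cis z Hz) as [th [Hth Ez]].
  set (x := (th + PI) / (2 * PI)).
  assert (Ax : ang x = th) by (unfold ang, x; field; lra).
  assert (Hx : 0 <= x < 1).
  { unfold x. split; [apply Rdiv_le_0_compat; lra|]. apply (Rmult_lt_reg_r (2 * PI)); [lra|]. unfold Rdiv. rewrite Rmult_assoc, Rinv_l by lra. lra. }
  destruct (H3 x) as [n Hn].
  { apply NNPP. intros Q. apply Hnl. apply not_or_and in Q. destruct Q as [Q1 Q2].
    assert (D1 : exists l1, diff_at (fun x => fst (Psi (ang x))) x l1) by (apply NNPP; intros K; apply Q1; split; assumption).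
    assert (D2 : exists l2, diff_at (fun x => snd (Psi (ang x))) x l2) by (apply NNPP; intros K; apply Q2; split; assumption).
    destruct D1 as [l1 D1]. destruct D2 as [l2 D2].
    apply radial_limit_iff. rewrite Ez. apply (rlim_cauchy _ (l1 / (2 * PI), l2 / (2 * PI))%R).
    apply (radial_limit_at_derivative Psi th _ P1 P2). clear eps He a b H1 H2 H3.
    intros eps He. destruct (D1 (PI * eps) ltac:(nra)) as [d1 [d1p G1]]. destruct (D2 (PI * eps) ltac:(nra)) as [d2 [d2p G2]].
    exists (2 * PI * Rmin d1 d2). split; [apply Rmult_lt_0_compat; [lra|apply Rmin_pos; assumption]|].
    intros u Hu. set (t := x + u / (2 * PI)).
    assert (At : ang t = th + u) by (unfold t; rewrite <- Ax; unfold ang; field; lra).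
    assert (Et : t - x = u / (2 * PI)) by (unfold t; ring).
    assert (Abs : Rabs (t - x) = Rabs u / (2 * PI)).
    { rewrite Et. unfold Rdiv. rewrite Rabs_mult, Rabs_inv, (Rabs_pos_eq (2 * PI)) by lra. reflexivity. }
    assert (Hlt : Rabs (t - x) < Rmin d1 d2).
    { rewrite Abs. apply (Rmult_lt_reg_r (2 * PI)); [lra|]. unfold Rdiv. rewrite Rmult_assoc, Rinv_l by lra. lra. }
    specialize (G1 t (Rlt_le_trans _ _ _ Hlt (Rmin_l _ _))). specialize (G2 t (Rlt_le_trans _ _ _ Hlt (Rmin_r _ _))).
    rewrite At, Ax, Abs, Et in G1, G2.
    replace (PI * eps * (Rabs u / (2 * PI))) with (eps / 2 * Rabs u) in G1, G2 by (field; lra).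
    eapply Rle_trans; [apply Cmod_le_abs|]. cbn [fst snd Cminus Cplus Copp Cmult RtoC].
    match goal with |- Rabs ?p + Rabs ?q <= _ =>
      replace p with (fst (Psi (th + u)) - fst (Psi th) - l1 * (u / (2 * PI))) by (field; lra);
      replace q with (snd (Psi (th + u)) - snd (Psi th) - l2 * (u / (2 * PI))) by (field; lra) end.
    lra. }
  exists n, th. split; [|exact Ez]. rewrite <- Ax. unfold ang. nra.
Qed.

(** Failure of Cauchy's criterion means that for some [n] and all [m] there are two radii beyond
    [1 - / (m + 1)] with values more than [/ (n + 1)] apart. For fixed radii this strict inequality
    is an open condition on [zeta]. *)
Theorem nonexistence_G_delta_sigma : G_delta_sigma_T (fun zeta => circle zeta /\ ~ radial_limit_exists f zeta).
Proof.
set (U := fun n m zeta => circle zeta /\ exists r s, 1 - / (INR m + 1) < r < 1 /\ 1 - / (INR m + 1) < s < 1 /\ 0 <= r /\ 0 <= s /\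
   / (INR n + 1) < Cmod (ray f zeta r - ray f zeta s)%C).
assert (cont_ray : forall zeta r, circle zeta -> 0 <= r < 1 -> forall eps, 0 < eps -> exists d, 0 < d /\ forall w, Cnorm (Csub w zeta) < d ->
   Cmod (ray f w r - ray f zeta r)%C < eps).
{ intros zeta r Hz Hr eps He. unfold circle in Hz. rewrite Cnorm_Cmod in Hz.
  destruct (cdiff_continuous f (RtoC r * zeta)%C) with (eps := eps) as [d [D Hd]]; [apply Hf; rewrite Cmod_mult, Hz, Cmod_R, Rabs_pos_eq; lra|exact He|].
  exists d. split; [exact D|]. intros w Hw. rewrite Cnorm_Cmod in Hw. apply Hd.
  replace (RtoC r * w - RtoC r * zeta)%C with (RtoC r * (w - zeta))%C by ring. rewrite Cmod_mult, Cmod_R, Rabs_pos_eq by lra.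
  change (Csub w zeta) with (w - zeta)%C in Hw. assert (0 <= Cmod (w - zeta)%C) by apply Cmod_ge_0. nra. }
assert (Uo : forall n m, rel_open_T (U n m)).
{ intros n m. split; [intros z Hz; apply Hz|]. intros z [Hz [r [s [Hr [Hs [r0 [s0 Hrs]]]]]]].
  set (e := Cmod (ray f z r - ray f z s)%C - / (INR n + 1)) in *. assert (He : 0 < e) by (unfold e; lra).
  destruct (cont_ray z r Hz ltac:(lra) (e / 2) ltac:(lra)) as [d1 [D1 H1]].
  destruct (cont_ray z s Hz ltac:(lra) (e / 2) ltac:(lra)) as [d2 [D2 H2]].
  exists (Rmin d1 d2). split; [apply Rmin_pos; assumption|]. intros w Hw Hd. split; [exact Hw|].
  exists r, s. repeat split; try tauto.
  specialize (H1 w (Rlt_le_trans _ _ _ Hd (Rmin_l _ _))). specialize (H2 w (Rlt_le_trans _ _ _ Hd (Rmin_r _ _))).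
  assert (T : Cmod (ray f z r - ray f z s)%C <= Cmod (ray f w r - ray f w s)%C + Cmod (ray f w r - ray f z r)%C + Cmod (ray f w s - ray f z s)%C).
  { replace (ray f z r - ray f z s)%C with ((ray f w r - ray f w s) + - (ray f w r - ray f z r) + (ray f w s - ray f z s))%C by ring.
    eapply Rle_trans; [apply Cmod_triangle|]. apply Rplus_le_compat_r. eapply Rle_trans; [apply Cmod_triangle|]. rewrite Cmod_opp. lra. }
  unfold e in *. lra. }
exists (fun n zeta => circle zeta /\ forall m, U n m zeta). split.
- intros n. exists (U n). split; [apply Uo|]. intros z. reflexivity.
- intros z. rewrite radial_limit_iff. split.
  + intros [Hz Hn]. apply not_all_ex_not in Hn. destruct Hn as [eps Hn]. apply imply_to_and in Hn. destruct Hn as [He Hn].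
    destruct (inv_small eps He) as [n HN]. exists n. split; [exact Hz|]. intros m. apply NNPP. intros Q. apply Hn.
    assert (Ip : 0 < / (INR m + 1)) by (apply Rinv_0_lt_compat; assert (T := pos_INR m); lra).
    exists (Rmax 0 (1 - / (INR m + 1))). split; [apply Rmax_lub_lt; lra|]. intros r s Hr Hs.
    assert (A1 := Rmax_l 0 (1 - / (INR m + 1))). assert (A2 := Rmax_r 0 (1 - / (INR m + 1))).
    apply Rnot_lt_le. intros L. apply Q. split; [exact Hz|]. exists r, s. repeat split; try lra.
    specialize (HN n (le_n n)). lra.
  + intros [n [Hz Hn]]. split; [exact Hz|]. intros Hc.
    assert (Ip : 0 < / (INR n + 1)) by (apply Rinv_0_lt_compat; assert (T := pos_INR n); lra).
    destruct (Hc _ Ip) as [r0 [R0 Hr]]. destruct (inv_small (1 - r0) ltac:(lra)) as [m Hm]. specialize (Hm m (le_n m)).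
    destruct (Hn m) as [_ [r [s [Hr1 [Hs1 [_ [_ L]]]]]]]. specialize (Hr r s ltac:(lra) ltac:(lra)). lra.
Qed.
End Fatou.

(** * Integration over relatively open subsets of the circle *)

Fixpoint csum (f : nat -> C) (n : nat) : C := match n with O => 0 | S n => csum f n + f n end.

Lemma csum_ext f g n : (forall i, (i < n)%nat -> f i = g i) -> csum f n = csum g n.
Proof. induction n; intros H; simpl; [reflexivity|]. rewrite IHn, H; auto. Qed.
Lemma csum_minus f g n : csum (fun i => f i - g i)%C n = (csum f n - csum g n)%C.
Proof. induction n; simpl; [ring|]. rewrite IHn. ring. Qed.
Lemma csum_Cmod f g n : (forall i, (i < n)%nat -> Cmod (f i) <= g i) -> Cmod (csum f n) <= rsum g n.
Proof.
induction n; intros H; simpl; [rewrite Cmod_0; lra|]. eapply Rle_trans; [apply Cmod_triangle|].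
apply Rplus_le_compat; auto.
Qed.
Lemma csum_double_pow f n : csum f (2 ^ S n) = csum (fun i => f (2 * i)%nat + f (2 * i + 1)%nat)%C (2 ^ n).
Proof.
rewrite Nat.pow_succ_r'. generalize (2 ^ n)%nat. intros m.
induction m; [reflexivity|]. replace (2 * S m)%nat with (S (S (2 * m))) by lia. cbn [csum]. rewrite IHm.
replace (S (2 * m)) with (2 * m + 1)%nat by lia. ring.
Qed.
Lemma fst_csum f n : fst (csum f n) = rsum (fun i => fst (f i)) n.
Proof. induction n; simpl; [reflexivity|]. rewrite IHn. reflexivity. Qed.

Definition Clim (u : nat -> C) (l : C) : Prop :=
  forall eps, 0 < eps -> exists N, forall n, (N <= n)%nat -> Cmod (u n - l)%C <= eps.

Lemma Clim_minus u v l m : Clim u l -> Clim v m -> Clim (fun n => u n - v n)%C (l - m)%C.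
Proof.
intros Hu Hv eps He. destruct (Hu (eps / 2) ltac:(lra)) as [N1 H1]. destruct (Hv (eps / 2) ltac:(lra)) as [N2 H2].
exists (N1 + N2)%nat. intros n Hn. specialize (H1 n ltac:(lia)). specialize (H2 n ltac:(lia)).
replace (u n - v n - (l - m))%C with ((u n - l) - (v n - m))%C by ring. eapply Rle_trans; [apply Cmod_minus_le|]. lra.
Qed.
Lemma Clim_const c : Clim (fun _ => c) c.
Proof. intros eps He. exists O. intros. replace (c - c)%C with (RtoC 0) by ring. rewrite Cmod_0. lra. Qed.
Lemma Clim_bound u l w : Clim u l -> (forall eps, 0 < eps -> exists N, forall n, (N <= n)%nat -> Cmod (u n) <= w + eps) -> Cmod l <= w.
Proof.
intros Hu Hw. apply le_epsilon. intros eps He. destruct (Hu (eps / 2) ltac:(lra)) as [N HN].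
destruct (Hw (eps / 2) ltac:(lra)) as [N' HN'].
specialize (HN (N + N')%nat ltac:(lia)). specialize (HN' (N + N')%nat ltac:(lia)).
assert (T := Cmod_rev_triangle l (u (N + N')%nat)). rewrite Cmod_minus_sym in T. lra.
Qed.
Lemma Clim_fst_ge u l w : Clim u l -> (exists N, forall n, (N <= n)%nat -> w <= fst (u n)) -> w <= fst l.
Proof.
intros Hu [N' Hw]. apply le_epsilon. intros eps He. destruct (Hu eps He) as [N HN].
specialize (HN (N + N')%nat ltac:(lia)). specialize (Hw (N + N')%nat ltac:(lia)).
assert (T := Rabs_fst_le (u (N + N')%nat - l)%C). simpl in T. assert (T2 := Rle_abs (fst (u (N + N')%nat) + - fst l)). lra.
Qed.
Lemma Clim_unique u l m : Clim u l -> Clim u m -> l = m.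
Proof.
intros H1 H2. apply eq_of_Cmod_le. intros eps He. destruct (H1 (eps / 2) ltac:(lra)) as [N1 K1]. destruct (H2 (eps / 2) ltac:(lra)) as [N2 K2].
specialize (K1 (N1 + N2)%nat ltac:(lia)). specialize (K2 (N1 + N2)%nat ltac:(lia)).
rewrite Cmod_minus_sym in K1. replace (l - m)%C with ((l - u (N1 + N2)%nat) + (u (N1 + N2)%nat - m))%C by ring.
eapply Rle_trans; [apply Cmod_triangle|]. lra.
Qed.
Lemma Clim_ext u v l : (forall n, u n = v n) -> Clim u l -> Clim v l.
Proof. intros E H eps He. destruct (H eps He) as [N HN]. exists N. intros. rewrite <- E. auto. Qed.

Definition angle (n p : nat) : R := - PI + 2 * PI * dyad n p.

Lemma angle_double n p : angle (S n) (2 * p) = angle n p.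
Proof. unfold angle. rewrite dyad_double. reflexivity. Qed.
Lemma angle_double2 n p : angle (S n) (2 * p + 1 + 1) = angle n (p + 1).
Proof. unfold angle. rewrite dyad_double1. reflexivity. Qed.
Lemma angle_succ n p : angle n (p + 1) = angle n p + 2 * PI * / 2 ^ n.
Proof. unfold angle. rewrite dyad_succ. ring. Qed.
Lemma angle_le n p : angle n p <= angle n (p + 1).
Proof.
rewrite angle_succ. assert (0 < / 2 ^ n) by apply Rinv_0_lt_compat, pow2_pos. assert (PP := PI_RGT_0). nra.
Qed.

Definition inside (X : C -> Prop) (n p : nat) : Prop :=
  forall s, angle n p <= s <= angle n (p + 1) -> X (cis s).

Lemma inside_half X n p : inside X n p -> inside X (S n) (2 * p) /\ inside X (S n) (2 * p + 1).
Proof.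
intros H. assert (A := angle_le (S n) (2 * p)). assert (B := angle_le (S n) (2 * p + 1)).
assert (E1 := angle_double n p). assert (E2 := angle_double2 n p).
split; intros s Hs; apply H; lra.
Qed.
Lemma inside_mono (X Y : C -> Prop) n p : (forall z, X z -> Y z) -> inside X n p -> inside Y n p.
Proof. intros H HX s Hs. apply H, HX, Hs. Qed.

Lemma ind_mono (P Q : Prop) : (P -> Q) -> ind P <= ind Q.
Proof.
intros H. unfold ind. destruct (excluded_middle_informative P), (excluded_middle_informative Q); try lra. tauto.
Qed.

Definition test (g : R -> C) : Prop := (forall t, Ccont g t) /\ exists w, forall t, Cmod (g t) <= w.

Lemma test_minus g h : test g -> test h -> test (fun t => g t - h t)%C.
Proof.
intros [G1 [w G2]] [H1 [v H2]]. split; [intros t; apply Ccont_minus; auto|].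
exists (w + v). intros t. eapply Rle_trans; [apply Cmod_minus_le|]. apply Rplus_le_compat; auto.
Qed.

(* Normalized so that the circle has total mass [1]. *)
Definition cell_integral (g : R -> C) (n p : nat) : C := (RtoC (/ (2 * PI)) * CInt g (angle n p) (angle n (p + 1)))%C.

Lemma cell_integral_split g n p : (forall t, Ccont g t) ->
  cell_integral g n p = (cell_integral g (S n) (2 * p) + cell_integral g (S n) (2 * p + 1))%C.
Proof.
intros Hg. unfold cell_integral. rewrite angle_double, angle_double2.
rewrite (CInt_Chasles g (angle n p) (angle (S n) (2 * p + 1)) (angle n (p + 1))).
- ring.
- rewrite <- (angle_double n p). apply angle_le.
- rewrite <- (angle_double2 n p). apply angle_le.
- intros t _; apply Hg.
Qed.
Lemma cell_integral_minus g h n p : (forall t, Ccont g t) -> (forall t, Ccont h t) ->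
  cell_integral (fun t => g t - h t)%C n p = (cell_integral g n p - cell_integral h n p)%C.
Proof.
intros Hg Hh. unfold cell_integral. rewrite CInt_minus; [ring|apply angle_le|intros t _; apply Hg|intros t _; apply Hh].
Qed.
Lemma cell_integral_bound g n p w : (forall t, Ccont g t) -> (forall t, angle n p <= t <= angle n (p + 1) -> Cmod (g t) <= w) ->
  Cmod (cell_integral g n p) <= w * / 2 ^ n.
Proof.
intros Hg Hw. assert (PP := PI_RGT_0). unfold cell_integral.
rewrite Cmod_mult, Cmod_R, Rabs_pos_eq by (left; apply Rinv_0_lt_compat; lra).
assert (B := CInt_bound g _ _ w (angle_le n p) (fun t _ => Hg t) Hw).
rewrite angle_succ in B at 2. apply (Rmult_le_reg_l (2 * PI)); [lra|]. rewrite <- Rmult_assoc, Rinv_r by lra. lra.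
Qed.
Lemma CInt_fst_le g a b w : a <= b -> CcontOn g a b -> (forall t, a <= t <= b -> fst (g t) <= w) -> fst (CInt g a b) <= (b - a) * w.
Proof.
intros Hab Hg Hw. destruct (CInt_ex g a b Hab Hg) as [E1 _]. simpl.
assert (T := RInt_le (fun t => fst (g t)) (fun _ => w) a b Hab E1 (ex_RInt_const a b w)).
rewrite (RInt_const (V:=R_CompleteNormedModule)) in T. unfold scal in T; simpl in T; unfold mult in T; simpl in T.
apply T. intros; apply Hw; lra.
Qed.
Lemma cell_integral_fst_le g n p w : (forall t, Ccont g t) -> (forall t, angle n p <= t <= angle n (p + 1) -> fst (g t) <= w) ->
  fst (cell_integral g n p) <= w * / 2 ^ n.
Proof.
intros Hg Hw. assert (PP := PI_RGT_0). unfold cell_integral.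
assert (B := CInt_fst_le g _ _ w (angle_le n p) (fun t _ => Hg t) Hw). rewrite angle_succ in B at 2.
cbn [fst snd Cmult RtoC]. apply (Rmult_le_reg_l (2 * PI)); [lra|].
replace (2 * PI * (/ (2 * PI) * fst (CInt g (angle n p) (angle n (p + 1))) - 0 * snd (CInt g (angle n p) (angle n (p + 1)))))
 with (fst (CInt g (angle n p) (angle n (p + 1)))) by (field; lra). lra.
Qed.
Lemma cell_integral_fst_pos g n p : (forall t, Ccont g t) -> (forall t, 0 <= fst (g t)) -> 0 <= fst (cell_integral g n p).
Proof.
intros Hg Hw. assert (T := cell_integral_fst_le (fun t => 0 - g t)%C n p 0).
rewrite cell_integral_minus in T; [|intros; apply Ccont_const|exact Hg].
assert (Z : cell_integral (fun _ => 0) n p = 0) by (unfold cell_integral; rewrite CInt_const; ring).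
rewrite Z in T. simpl in T. simpl.
assert (T' := T ltac:(intros t; apply Ccont_minus; [apply Ccont_const|apply Hg]) ltac:(intros t _; specialize (Hw t); lra)). lra.
Qed.

(** Integration over the union of the closed dyadic cells of level [n] contained in [X]. For open
    [X] these unions exhaust [X], so integrals over open sets arise as limits of finite sums of
    Riemann integrals. *)
Definition J_level (n : nat) (X : C -> Prop) (g : R -> C) : C :=
  csum (fun p => RtoC (ind (inside X n p)) * cell_integral g n p)%C (2 ^ n).
Definition mu_level (n : nat) (X : C -> Prop) : R := rsum (fun p => ind (inside X n p) * / 2 ^ n) (2 ^ n).

Lemma inv_pow2_half n : / 2 ^ n = / 2 ^ S n + / 2 ^ S n.
Proof. simpl. field. apply pow_nonzero; lra. Qed.
Lemma inv_pow2_pos n : 0 < / 2 ^ n.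
Proof. apply Rinv_0_lt_compat, pow2_pos. Qed.

Lemma mu_level_incr n X : mu_level n X <= mu_level (S n) X.
Proof.
unfold mu_level. rewrite rsum_double_pow. apply rsum_le. intros p _.
assert (T := inv_pow2_pos (S n)). rewrite inv_pow2_half.
assert (A := ind_mono (inside X n p) _ (fun H => proj1 (inside_half X n p H))).
assert (B := ind_mono (inside X n p) _ (fun H => proj2 (inside_half X n p H))). nra.
Qed.
Lemma mu_level_le1 n X : mu_level n X <= 1.
Proof.
unfold mu_level. apply Rle_trans with (rsum (fun _ => / 2 ^ n) (2 ^ n)).
- apply rsum_le. intros p _. assert (T := inv_pow2_pos n). assert (B := ind_bounds (inside X n p)). nra.
- rewrite rsum_const, INR_pow2, Rinv_r; [lra|apply pow_nonzero; lra].
Qed.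
Lemma mu_level_mono n (X Y : C -> Prop) : (forall z, X z -> Y z) -> mu_level n X <= mu_level n Y.
Proof.
intros H. apply rsum_le. intros p _. apply Rmult_le_compat_r; [left; apply inv_pow2_pos|].
apply ind_mono. apply inside_mono. exact H.
Qed.

Definition mu (X : C -> Prop) : R := real (Lim_seq (fun n => mu_level n X)).

Lemma mu_lim X : is_lim_seq (fun n => mu_level n X) (mu X).
Proof.
apply Lim_seq_correct'. apply (ex_finite_lim_seq_incr _ 1); intros; [apply mu_level_incr|apply mu_level_le1].
Qed.
Lemma mu_ge n X : mu_level n X <= mu X.
Proof. apply (is_lim_seq_incr_compare (fun n => mu_level n X)); [apply mu_lim|intros; apply mu_level_incr]. Qed.
Lemma mu_approx X eps : 0 < eps -> exists N, forall n, (N <= n)%nat -> mu X - eps < mu_level n X.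
Proof.
intros He. destruct (proj2 (is_lim_seq_spec _ _) (mu_lim X) (mkposreal eps He)) as [N HN].
exists N. intros n Hn. specialize (HN n Hn). simpl in HN. apply Rabs_def2 in HN. lra.
Qed.
Lemma mu_le1 X : mu X <= 1.
Proof. apply le_epsilon. intros eps He. destruct (mu_approx X eps He) as [N HN]. specialize (HN N (le_n N)). assert (T := mu_level_le1 N X). lra. Qed.
Lemma mu_mono (X Y : C -> Prop) : (forall z, X z -> Y z) -> mu X <= mu Y.
Proof.
intros H. apply le_epsilon. intros eps He. destruct (mu_approx X eps He) as [N HN]. specialize (HN N (le_n N)).
assert (T := mu_level_mono N X Y H). assert (T2 := mu_ge N Y). lra.
Qed.

Lemma two_cells_bound (a b c : R) (u v : C) w h : 0 <= w * h -> c <= a -> c <= b -> Cmod u <= w * h -> Cmod v <= w * h ->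
  Cmod (RtoC a * u + RtoC b * v - RtoC c * (u + v))%C <= w * (a * h + b * h - c * (h + h)).
Proof.
intros W Ha Hb Hu Hv.
replace (RtoC a * u + RtoC b * v - RtoC c * (u + v))%C with (RtoC (a - c) * u + RtoC (b - c) * v)%C by (rewrite !RtoC_minus; ring).
eapply Rle_trans; [apply Cmod_triangle|]. rewrite !Cmod_mult, !Cmod_R, !Rabs_pos_eq by lra.
assert ((a - c) * Cmod u <= (a - c) * (w * h)) by (apply Rmult_le_compat_l; lra).
assert ((b - c) * Cmod v <= (b - c) * (w * h)) by (apply Rmult_le_compat_l; lra). lra.
Qed.

(** Cells inside [X] remain inside when halved; only half cells that enter at level [S n]
    contribute, and [mu_level] grows exactly by their measure. Convergence of [mu_level] thus
    carries over to [J_level]. *)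
Lemma J_level_step n X g w : (forall t, Ccont g t) -> (forall t, Cmod (g t) <= w) ->
  Cmod (J_level (S n) X g - J_level n X g)%C <= w * (mu_level (S n) X - mu_level n X).
Proof.
intros Hg Hw.
assert (W : 0 <= w) by (eapply Rle_trans; [apply Cmod_ge_0|apply (Hw 0)]).
unfold J_level, mu_level. rewrite csum_double_pow, rsum_double_pow. rewrite <- csum_minus.
replace (w * (rsum (fun i => ind (inside X (S n) (2 * i)) * / 2 ^ S n + ind (inside X (S n) (2 * i + 1)) * / 2 ^ S n) (2 ^ n) -
   rsum (fun p => ind (inside X n p) * / 2 ^ n) (2 ^ n))) with
 (rsum (fun i => w * (ind (inside X (S n) (2 * i)) * / 2 ^ S n + ind (inside X (S n) (2 * i + 1)) * / 2 ^ S n - ind (inside X n i) * (/ 2 ^ S n + / 2 ^ S n))) (2 ^ n)).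
- apply csum_Cmod. intros i _. rewrite (cell_integral_split g n i Hg).
  apply two_cells_bound.
  + apply Rmult_le_pos; [exact W|left; apply inv_pow2_pos].
  + apply ind_mono. intros H. apply (inside_half X n i H).
  + apply ind_mono. intros H. apply (inside_half X n i H).
  + apply cell_integral_bound; auto.
  + apply cell_integral_bound; auto.
- rewrite rsum_scal. f_equal. rewrite <- inv_pow2_half.
  replace (rsum (fun p => ind (inside X n p) * / 2 ^ n) (2 ^ n)) with (- rsum (fun p => -1 * (ind (inside X n p) * / 2 ^ n)) (2 ^ n)) by (rewrite rsum_scal; ring).
  unfold Rminus at 2. rewrite Ropp_involutive, <- rsum_plus. apply rsum_ext. intros; ring.
Qed.

Lemma J_level_steps n k X g w : (forall t, Ccont g t) -> (forall t, Cmod (g t) <= w) ->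
  Cmod (J_level (n + k) X g - J_level n X g)%C <= w * (mu_level (n + k) X - mu_level n X).
Proof.
intros Hg Hw. induction k.
- rewrite Nat.add_0_r. replace (J_level n X g - J_level n X g)%C with (RtoC 0) by ring. rewrite Cmod_0. lra.
- rewrite Nat.add_succ_r.
  replace (J_level (S (n + k)) X g - J_level n X g)%C with ((J_level (S (n + k)) X g - J_level (n + k) X g) + (J_level (n + k) X g - J_level n X g))%C by ring.
  eapply Rle_trans; [apply Cmod_triangle|]. assert (T := J_level_step (n + k) X g w Hg Hw). lra.
Qed.

Lemma J_level_converges X g : test g -> exists l, Clim (fun n => J_level n X g) l.
Proof.
intros [Hg [w Hw]]. assert (W : 0 <= w) by (eapply Rle_trans; [apply Cmod_ge_0|apply (Hw 0)]).
apply C_complete. intros eps He.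
destruct (mu_approx X (eps / (2 * (w + 1)))) as [N HN]; [apply Rdiv_lt_0_compat; lra|].
assert (G : forall n, (N <= n)%nat -> Cmod (J_level n X g - J_level N X g)%C <= eps / 2).
{ intros n Hn. replace n with (N + (n - N))%nat by lia. eapply Rle_trans; [apply (J_level_steps N _ X g w Hg Hw)|].
  assert (A := HN N (le_n N)). assert (B := mu_ge (N + (n - N)) X).
  assert (E : (w + 1) * (eps / (2 * (w + 1))) = eps / 2) by (field; lra).
  assert (0 < eps / (2 * (w + 1))) by (apply Rdiv_lt_0_compat; lra).
  assert (w * (mu_level (N + (n - N)) X - mu_level N X) <= w * (eps / (2 * (w + 1)))) by (apply Rmult_le_compat_l; lra). lra. }
exists N. intros n m Hn Hm. assert (A := G n Hn). assert (B := G m Hm). rewrite Cmod_minus_sym in B.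
replace (J_level n X g - J_level m X g)%C with ((J_level n X g - J_level N X g) + (J_level N X g - J_level m X g))%C by ring.
eapply Rle_trans; [apply Cmod_triangle|]. lra.
Qed.

(* [J X g] is the integral of [g(t) dt / 2 pi] over the open set [X]. *)
Definition J (X : C -> Prop) (g : R -> C) : C := epsilon (inhabits (RtoC 0)) (Clim (fun n => J_level n X g)).

Lemma J_lim X g : test g -> Clim (fun n => J_level n X g) (J X g).
Proof. intros H. unfold J. apply epsilon_spec. apply J_level_converges. exact H. Qed.

Lemma J_minus X g h : test g -> test h -> J X (fun t => g t - h t)%C = (J X g - J X h)%C.
Proof.
intros Hg Hh. apply (Clim_unique (fun n => J_level n X (fun t => g t - h t)%C)); [apply J_lim, test_minus; assumption|].
apply (Clim_ext (fun n => J_level n X g - J_level n X h)%C); [|apply Clim_minus; apply J_lim; assumption].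
intros n. unfold J_level. rewrite <- csum_minus. apply csum_ext. intros i _.
rewrite cell_integral_minus by (apply Hg || apply Hh). ring.
Qed.

Lemma J_level_sub n (W X : C -> Prop) g w : (forall z, W z -> X z) -> (forall t, Ccont g t) ->
  (forall p t, (p < 2 ^ n)%nat -> inside X n p -> ~ inside W n p -> angle n p <= t <= angle n (p + 1) -> Cmod (g t) <= w) ->
  Cmod (J_level n X g - J_level n W g)%C <= w * (mu_level n X - mu_level n W).
Proof.
intros HWX Hg Hw. unfold J_level, mu_level. rewrite <- csum_minus.
replace (w * (rsum (fun p => ind (inside X n p) * / 2 ^ n) (2 ^ n) - rsum (fun p => ind (inside W n p) * / 2 ^ n) (2 ^ n))) with
 (rsum (fun p => w * (ind (inside X n p) * / 2 ^ n + -1 * (ind (inside W n p) * / 2 ^ n))) (2 ^ n)) by (rewrite rsum_scal, rsum_plus, rsum_scal; ring).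
apply csum_Cmod. intros p Hp.
replace (RtoC (ind (inside X n p)) * cell_integral g n p - RtoC (ind (inside W n p)) * cell_integral g n p)%C with
 (RtoC (ind (inside X n p) - ind (inside W n p)) * cell_integral g n p)%C by (rewrite RtoC_minus; ring).
destruct (classic (inside W n p)) as [A|A].
- rewrite (ind_true (inside W n p) A), (ind_true (inside X n p)) by (eapply inside_mono; eassumption).
  replace (RtoC (1 - 1)) with (RtoC 0) by (f_equal; ring). rewrite Cmult_0_l, Cmod_0. lra.
- rewrite (ind_false (inside W n p) A). destruct (classic (inside X n p)) as [B|B].
  + rewrite (ind_true _ B). replace (RtoC (1 - 0)) with (RtoC 1) by (f_equal; ring). rewrite Cmult_1_l.
    eapply Rle_trans; [apply (cell_integral_bound g n p w Hg); intros; eapply Hw; eassumption|]. lra.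
  + rewrite (ind_false _ B). replace (RtoC (0 - 0)) with (RtoC 0) by (f_equal; ring). rewrite Cmult_0_l, Cmod_0. lra.
Qed.

Lemma J_sub (W X : C -> Prop) g w : (forall z, W z -> X z) -> test g -> (forall t, Cmod (g t) <= w) ->
  Cmod (J X g - J W g)%C <= w * (mu X - mu W).
Proof.
intros HWX Hg Hw. assert (W0 : 0 <= w) by (eapply Rle_trans; [apply Cmod_ge_0|apply (Hw 0)]).
apply (Clim_bound (fun n => J_level n X g - J_level n W g)%C); [apply Clim_minus; apply J_lim; exact Hg|].
intros eps He. destruct (mu_approx W (eps / (w + 1))) as [N HN]; [apply Rdiv_lt_0_compat; lra|].
exists N. intros n Hn. specialize (HN n Hn). eapply Rle_trans; [apply (J_level_sub n W X g w HWX); [apply Hg|intros; apply Hw]|].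
assert (T := mu_ge n X). assert (E : (w + 1) * (eps / (w + 1)) = eps) by (field; lra).
assert (0 < eps / (w + 1)) by (apply Rdiv_lt_0_compat; lra).
assert (w * (mu_level n X - mu_level n W) <= w * (mu X - mu W + eps / (w + 1))) by (apply Rmult_le_compat_l; lra). nra.
Qed.

Lemma J_fst_pos X g : test g -> (forall t, 0 <= fst (g t)) -> 0 <= fst (J X g).
Proof.
intros Hg Hp. apply (Clim_fst_ge _ _ _ (J_lim X g Hg)). exists O. intros n _. unfold J_level. rewrite fst_csum.
apply rsum_nonneg. intros p _. assert (A := cell_integral_fst_pos g n p (proj1 Hg) Hp). assert (B := ind_bounds (inside X n p)).
cbn [fst snd Cmult RtoC]. nra.
Qed.

Lemma J_level_total n g : (forall t, Ccont g t) -> csum (cell_integral g n) (2 ^ n) = (RtoC (/ (2 * PI)) * CInt g (- PI) PI)%C.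
Proof.
intros Hg. induction n.
- simpl. unfold cell_integral. replace (angle 0 0) with (- PI) by (unfold angle, dyad; simpl; field).
  replace (angle 0 (0 + 1)) with PI by (unfold angle, dyad; simpl; field). ring.
- rewrite csum_double_pow, <- IHn. apply csum_ext. intros i _. symmetry. apply cell_integral_split. exact Hg.
Qed.

(** A cell not inside [X] contains a point at distance at least [rho] from [zeta]; once cells are
    shorter than [rho / 2], all its points are at least [rho / 2] away. *)
Lemma far_cells (X : C -> Prop) zeta rho : 0 < rho -> (forall w, circle w -> Cmod (w - zeta)%C < rho -> X w) ->
  exists N, forall n, (N <= n)%nat -> forall p t, ~ inside X n p -> angle n p <= t <= angle n (p + 1) -> rho / 2 <= Cmod (cis t - zeta)%C.
Proof.
intros Hr HX. assert (PP := PI_RGT_0).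
destruct (pow_lt_1_zero (/2)) with (y := rho / (4 * PI)) as [N HN].
{ rewrite Rabs_pos_eq; lra. } { apply Rdiv_lt_0_compat; lra. }
exists N. intros n Hn p t Hi Ht. specialize (HN n Hn). rewrite Rabs_pos_eq in HN by (apply pow_le; lra). rewrite pow_inv in HN.
apply not_all_ex_not in Hi. destruct Hi as [s Hs]. apply imply_to_and in Hs. destruct Hs as [Hs1 Hs2].
assert (A : rho <= Cmod (cis s - zeta)%C). { apply Rnot_lt_le. intros L. apply Hs2, HX; [apply cis_circle|exact L]. }
assert (B := cis_lipschitz s t). assert (D : Rabs (s - t) <= 2 * PI * / 2 ^ n) by (rewrite angle_succ in *; apply Rabs_le; lra).
assert (E : 2 * PI * / 2 ^ n < rho / 2).
{ replace (rho / 2) with (2 * PI * (rho / (4 * PI))) by (field; lra). apply Rmult_lt_compat_l; lra. }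
replace (cis s - zeta)%C with ((cis s - cis t) + (cis t - zeta))%C in A by ring.
assert (T := Cmod_triangle (cis s - cis t) (cis t - zeta)). lra.
Qed.

(** For [zeta] interior to [X], the integral over [X] is the integral over the circle, known in
    closed form for kernels, minus a part far from [zeta]. This is how integrals with kernels
    singular at [zeta] are controlled. *)
Lemma J_complement X g zeta rho w : 0 < rho -> (forall w, circle w -> Cmod (w - zeta)%C < rho -> X w) -> test g -> 0 <= w ->
  (forall t, rho / 2 <= Cmod (cis t - zeta)%C -> Cmod (g t) <= w) ->
  Cmod (RtoC (/ (2 * PI)) * CInt g (- PI) PI - J X g)%C <= w.
Proof.
intros Hr HX Hg W Hw. destruct (far_cells X zeta rho Hr HX) as [N HN].
apply (Clim_bound (fun n => csum (cell_integral g n) (2 ^ n) - J_level n X g)%C).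
- apply Clim_minus; [|apply J_lim; exact Hg]. apply (Clim_ext (fun _ => RtoC (/ (2 * PI)) * CInt g (- PI) PI)%C); [|apply Clim_const].
  intros n. symmetry. apply J_level_total. apply Hg.
- intros eps He. exists N. intros n Hn. unfold J_level. rewrite <- csum_minus.
  apply Rle_trans with (rsum (fun _ => w * / 2 ^ n) (2 ^ n)).
  + apply csum_Cmod. intros p _. destruct (classic (inside X n p)) as [A|A].
    * rewrite ind_true by exact A. replace (cell_integral g n p - RtoC 1 * cell_integral g n p)%C with (RtoC 0) by ring.
      rewrite Cmod_0. apply Rmult_le_pos; [exact W|left; apply inv_pow2_pos].
    * rewrite ind_false by exact A. replace (cell_integral g n p - RtoC 0 * cell_integral g n p)%C with (cell_integral g n p) by ring.
      apply cell_integral_bound; [apply Hg|]. intros t Ht. apply Hw. eapply HN; eassumption.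
  + rewrite rsum_const, INR_pow2. replace (2 ^ n * (w * / 2 ^ n)) with w by (field; apply pow_nonzero; lra). lra.
Qed.

Lemma J_complement_fst X g zeta rho w : 0 < rho -> (forall w, circle w -> Cmod (w - zeta)%C < rho -> X w) -> test g -> 0 <= w ->
  (forall t, rho / 2 <= Cmod (cis t - zeta)%C -> fst (g t) <= w) ->
  fst (RtoC (/ (2 * PI)) * CInt g (- PI) PI)%C - w <= fst (J X g).
Proof.
intros Hr HX Hg W Hw. destruct (far_cells X zeta rho Hr HX) as [N HN].
apply (Clim_fst_ge _ _ _ (J_lim X g Hg)). exists N. intros n Hn.
rewrite <- (J_level_total n g (proj1 Hg)). unfold J_level. rewrite !fst_csum.
assert (B : rsum (fun i => fst (cell_integral g n i)) (2 ^ n) <= rsum (fun i => fst (RtoC (ind (inside X n i)) * cell_integral g n i)%C + w * / 2 ^ n) (2 ^ n)).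
{ apply rsum_le. intros p _. cbn [fst snd Cmult RtoC].
  assert (I0 := inv_pow2_pos n). destruct (classic (inside X n p)) as [A|A].
  - rewrite ind_true by exact A. assert (0 <= w * / 2 ^ n) by (apply Rmult_le_pos; lra). lra.
  - rewrite ind_false by exact A. assert (T := cell_integral_fst_le g n p w (proj1 Hg)).
    assert (T' := T (fun t Ht => Hw t (HN n Hn p t A Ht))). lra. }
rewrite rsum_plus, rsum_const, INR_pow2 in B. replace (2 ^ n * (w * / 2 ^ n)) with w in B by (field; apply pow_nonzero; lra). lra.
Qed.

(** * Adding arcs, compactness, and continuity from below *)

Lemma rsum_swap (f : nat -> nat -> R) m n : rsum (fun i => rsum (f i) n) m = rsum (fun j => rsum (fun i => f i j) m) n.
Proof.
induction m; simpl.
- rewrite rsum_const. ring.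
- rewrite IHm, <- rsum_plus. reflexivity.
Qed.

Lemma cis_period s t : cis s = cis t -> exists k : Z, t = s + 2 * PI * IZR k.
Proof.
intros H. assert (E : cis (t - s) = 1).
{ unfold Rminus. rewrite cis_add, cis_inv, H. field. apply cis_neq0. }
assert (E1 : cos (t - s) = 1) by (apply (f_equal fst) in E; exact E).
set (x := (t - s) / 2). assert (Ex : t - s = 2 * x) by (unfold x; field).
rewrite Ex, cos_2a_sin in E1. assert (S0 : sin x = 0) by nra.
destruct (sin_eq_0_0 x S0) as [k Hk]. exists k. unfold x in Hk. lra.
Qed.

(** The interval [(a, b)] may leave the basic period and wrap around the circle. Therefore integer
    indices of cells on the unwound line are counted, between the ends [A] and [B] measured in
    cells, and each of them determines one cell modulo [2^n]. *)
Lemma count_cells n a b (Q : nat -> Prop) : a <= b ->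
  (forall p, (p < 2 ^ n)%nat -> Q p -> exists s t, angle n p <= s <= angle n (p + 1) /\ a < t < b /\ cis s = cis t) ->
  rsum (fun p => ind (Q p) * / 2 ^ n) (2 ^ n) <= (b - a) / (2 * PI) + 3 * / 2 ^ n.
Proof.
intros Hab HQ. assert (PP := PI_RGT_0). assert (P2 := pow2_pos n).
set (A := (a + PI) * 2 ^ n / (2 * PI)). set (B := (b + PI) * 2 ^ n / (2 * PI)).
assert (HAB : A <= B). { unfold A, B, Rdiv. apply Rmult_le_compat_r; [left; apply Rinv_0_lt_compat; lra|]. nra. }
(* An integer in [(A - 2, A - 1]], hence not above any index counted, since those exceed [A - 1]. *)
set (m := up (A - 2)). destruct (archimed (A - 2)) as [m1 m2]. fold m in m1, m2.
destruct (archimed B) as [b1 b2].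
set (K := Z.to_nat (up B - m)).
assert (KR : INR K <= B - A + 3).
{ unfold K. rewrite INR_IZR_INZ, Z2Nat.id; [rewrite minus_IZR; lra|]. apply le_IZR. rewrite minus_IZR. lra. }
set (Np := Z.of_nat (2 ^ n)).
assert (NpR : IZR Np = 2 ^ n) by (unfold Np; rewrite <- INR_IZR_INZ; apply INR_pow2).
assert (Np0 : (0 < Np)%Z) by (apply lt_IZR; rewrite NpR; exact P2).
assert (Ex : forall p, (p < 2 ^ n)%nat -> Q p -> exists i, (i < K)%nat /\ ((m + Z.of_nat i) mod Np = Z.of_nat p)%Z).
{ intros p Hp Hq. destruct (HQ p Hp Hq) as [s [t [Hs [Ht E]]]]. destruct (cis_period s t E) as [k Hk].
  set (P := (Z.of_nat p + Np * k)%Z).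
  assert (PR : IZR P = INR p + 2 ^ n * IZR k) by (unfold P; rewrite plus_IZR, mult_IZR, NpR, <- INR_IZR_INZ; reflexivity).
  assert (T1 : INR p <= (s + PI) * 2 ^ n / (2 * PI) <= INR p + 1).
  { rewrite angle_succ in Hs. unfold angle, dyad in Hs.
    replace (INR p) with ((- PI + 2 * PI * (INR p / 2 ^ n) + PI) * 2 ^ n / (2 * PI)) at 1 by (field; lra).
    replace (INR p + 1) with ((- PI + 2 * PI * (INR p / 2 ^ n) + 2 * PI * / 2 ^ n + PI) * 2 ^ n / (2 * PI)) by (field; lra).
    assert (0 < / (2 * PI)) by (apply Rinv_0_lt_compat; lra).
    unfold Rdiv at 2 4 5. split; apply Rmult_le_compat_r; try lra; apply Rmult_le_compat_r; lra. }
  assert (T2 : (s + PI) * 2 ^ n / (2 * PI) + 2 ^ n * IZR k = (t + PI) * 2 ^ n / (2 * PI)) by (rewrite Hk; field; lra).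
  assert (T3 : A < (t + PI) * 2 ^ n / (2 * PI) < B).
  { assert (0 < / (2 * PI)) by (apply Rinv_0_lt_compat; lra). unfold A, B, Rdiv. split; apply Rmult_lt_compat_r; try lra; apply Rmult_lt_compat_r; lra. }
  assert (PA : A - 1 < IZR P < B) by lra.
  assert (Zm : (m <= P)%Z). { apply Z.lt_succ_r, lt_IZR. rewrite succ_IZR. lra. }
  assert (ZB : (P < up B)%Z) by (apply lt_IZR; lra).
  exists (Z.to_nat (P - m)). split; [unfold K; lia|].
  rewrite Z2Nat.id by lia. replace (m + (P - m))%Z with P by lia. unfold P.
  rewrite Z.mul_comm, Z.mod_add by lia. apply Z.mod_small. unfold Np. lia. }
apply Rle_trans with (INR K * / 2 ^ n).
- apply Rle_trans with (rsum (fun p => rsum (fun i => ind ((m + Z.of_nat i) mod Np = Z.of_nat p)%Z * / 2 ^ n) K) (2 ^ n)).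
  + apply rsum_le. intros p Hp. destruct (classic (Q p)) as [Hq|Hq].
    * destruct (Ex p Hp Hq) as [i [Hi Ei]].
      eapply Rle_trans; [|apply (rsum_term _ K i Hi)]; cbv beta.
      -- rewrite !ind_true by assumption. lra.
      -- intros j _. apply Rmult_le_pos; [apply ind_bounds|left; apply inv_pow2_pos].
    * rewrite ind_false, Rmult_0_l by exact Hq. apply rsum_nonneg. intros. apply Rmult_le_pos; [apply ind_bounds|left; apply inv_pow2_pos].
  + rewrite rsum_swap, <- rsum_const. apply rsum_le. intros i _.
    assert (U : forall q, rsum (fun p => ind ((m + Z.of_nat i) mod Np = Z.of_nat p)%Z * / 2 ^ n) q <=
       (if Z_lt_dec ((m + Z.of_nat i) mod Np) (Z.of_nat q) then / 2 ^ n else 0)).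
    { assert (Md := Z.mod_pos_bound (m + Z.of_nat i) Np Np0). assert (I0 := inv_pow2_pos n).
      induction q; simpl rsum.
      - destruct (Z_lt_dec _ _); lra.
      - destruct (Z.eq_dec ((m + Z.of_nat i) mod Np) (Z.of_nat q)) as [e|e].
        + rewrite ind_true by exact e. destruct (Z_lt_dec _ (Z.of_nat q)); [lia|]. destruct (Z_lt_dec _ (Z.of_nat (S q))); [lra|lia].
        + rewrite ind_false by exact e. destruct (Z_lt_dec _ (Z.of_nat q)), (Z_lt_dec _ (Z.of_nat (S q))); try lia; lra. }
    eapply Rle_trans; [apply U|]. assert (I0 := inv_pow2_pos n). destruct (Z_lt_dec _ _); lra.
- apply Rle_trans with ((B - A + 3) * / 2 ^ n).
  + apply Rmult_le_compat_r; [left; apply inv_pow2_pos|exact KR].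
  + right. unfold A, B. field. lra.
Qed.

Definition arc (a b : R) (z : C) : Prop := exists t, a < t < b /\ z = cis t.

(** A cell that becomes inside only after adding the arc meets the arc, so at fine levels it lies
    within [eta] of it and [|g| <= w] there. The number of such cells is bounded by [count_cells];
    the normalizing factor [1 / (2 PI)] is simply bounded by 1. *)
Lemma J_add_arc (W : C -> Prop) a b g w eta : a <= b -> test g -> 0 <= w -> 0 < eta ->
  (forall s t, a < t < b -> Cmod (cis s - cis t)%C <= eta -> Cmod (g s) <= w) ->
  Cmod (J (fun z => W z \/ arc a b z) g - J W g)%C <= w * (b - a).
Proof.
intros Hab Hg W0 He Hw. assert (PP := PI_RGT_0). set (X := fun z => W z \/ arc a b z).
assert (HWX : forall z, W z -> X z) by (intros; left; assumption).
apply (Clim_bound (fun n => J_level n X g - J_level n W g)%C); [apply Clim_minus; apply J_lim; exact Hg|].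
intros eps Heps.
destruct (pow_lt_1_zero (/2)) with (y := Rmin (eta / (2 * PI)) (eps / (3 * (w + 1)))) as [N HN].
{ rewrite Rabs_pos_eq; lra. } { apply Rmin_pos; apply Rdiv_lt_0_compat; lra. }
exists N. intros n Hn. specialize (HN n Hn). rewrite Rabs_pos_eq in HN by (apply pow_le; lra). rewrite pow_inv in HN.
assert (H1 := Rlt_le_trans _ _ _ HN (Rmin_l _ _)). assert (H2 := Rlt_le_trans _ _ _ HN (Rmin_r _ _)).
assert (NW : forall p, inside X n p -> ~ inside W n p -> exists s t, angle n p <= s <= angle n (p + 1) /\ a < t < b /\ cis s = cis t).
{ intros p Hx Hnw. apply not_all_ex_not in Hnw. destruct Hnw as [s Hs]. apply imply_to_and in Hs. destruct Hs as [Hs1 Hs2].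
  destruct (Hx s Hs1) as [C1|[t [Ht E]]]; [contradiction|]. exists s, t. auto. }
assert (L := J_level_sub n W X g w HWX (proj1 Hg)).
assert (L' : Cmod (J_level n X g - J_level n W g)%C <= w * (mu_level n X - mu_level n W)).
{ apply L. intros p u Hp Hx Hnw Hu. destruct (NW p Hx Hnw) as [s [t [Hs [Ht E]]]]. apply (Hw u t Ht).
  rewrite <- E. eapply Rle_trans; [apply cis_lipschitz|].
  assert (D : Rabs (u - s) <= 2 * PI * / 2 ^ n) by (rewrite angle_succ in *; apply Rabs_le; lra).
  assert (2 * PI * / 2 ^ n < eta). { replace eta with (2 * PI * (eta / (2 * PI))) by (field; lra). apply Rmult_lt_compat_l; lra. } lra. }
assert (Cn : mu_level n X - mu_level n W <= (b - a) / (2 * PI) + 3 * / 2 ^ n).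
{ eapply Rle_trans; [|apply (count_cells n a b (fun p => inside X n p /\ ~ inside W n p) Hab)].
  - unfold mu_level. apply (Rplus_le_reg_r (rsum (fun p => ind (inside W n p) * / 2 ^ n) (2 ^ n))). rewrite <- rsum_plus.
    unfold Rminus. rewrite Rplus_assoc, Rplus_opp_l, Rplus_0_r. apply rsum_le. intros p _.
    assert (I0 := inv_pow2_pos n). rewrite <- Rmult_plus_distr_r. apply Rmult_le_compat_r; [lra|].
    destruct (classic (inside W n p)) as [A|A].
    + rewrite (ind_true _ A). assert (T1 := ind_bounds (inside X n p)). assert (T2 := ind_bounds (inside X n p /\ ~ inside W n p)). lra.
    + destruct (classic (inside X n p)) as [B|B].
      * rewrite (ind_true (inside X n p)), (ind_true (_ /\ _)) by tauto. assert (T1 := ind_bounds (inside W n p)). lra.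
      * rewrite (ind_false (inside X n p)) by tauto. assert (T1 := ind_bounds (inside W n p)). assert (T2 := ind_bounds (inside X n p /\ ~ inside W n p)). lra.
  - intros p _ [Hx Hnw]. apply NW; assumption. }
eapply Rle_trans; [exact L'|].
assert (w * (mu_level n X - mu_level n W) <= w * ((b - a) / (2 * PI) + 3 * / 2 ^ n)) by (apply Rmult_le_compat_l; lra).
assert (Q1 : (b - a) / (2 * PI) <= b - a).
{ apply (Rmult_le_reg_r (2 * PI)); [lra|]. unfold Rdiv. rewrite Rmult_assoc, Rinv_l by lra. assert (P3 := PI2_3_2). nra. }
assert (Q2 : w * (3 * / 2 ^ n) <= eps).
{ assert (E : 3 * (w + 1) * (eps / (3 * (w + 1))) = eps) by (field; lra). assert (I0 := inv_pow2_pos n). nra. }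
assert (w * ((b - a) / (2 * PI)) <= w * (b - a)) by (apply Rmult_le_compat_l; lra). lra.
Qed.

(** The Heine-Borel argument: at the supremum of the points up to which a single [Y k] suffices,
    openness allows going further unless the end [b] is reached. *)
Lemma compact_increasing (Y : nat -> C -> Prop) a b : (forall k, rel_open_T (Y k)) -> (forall k z, Y k z -> Y (S k) z) ->
  (forall s, a <= s <= b -> exists k, Y k (cis s)) -> exists k, forall s, a <= s <= b -> Y k (cis s).
Proof.
intros Ho Hi Hc.
assert (Mono : forall k m z, (k <= m)%nat -> Y k z -> Y m z) by (intros k m z H; induction H; auto).
destruct (Rle_dec a b) as [Hab|Hab]; [|exists O; intros; lra].
set (S := fun x => a <= x <= b /\ exists k, forall s, a <= s <= x -> Y k (cis s)).
assert (Loc : forall x, a <= x <= b -> exists k d, 0 < d /\ forall s, Rabs (s - x) < d -> Y k (cis s)).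
{ intros x Hx. destruct (Hc x Hx) as [k Hk]. destruct (Ho k) as [_ Hop]. destruct (Hop _ Hk) as [d [D Hd]].
  exists k, d. split; [exact D|]. intros s Hs. apply Hd; [apply cis_circle|]. rewrite Cnorm_Cmod.
  eapply Rle_lt_trans; [apply (cis_lipschitz s x)|exact Hs]. }
destruct (completeness S) as [x [Hx1 Hx2]].
- exists b. intros y [Hy _]. lra.
- exists a. split; [lra|]. destruct (Hc a ltac:(lra)) as [k Hk]. exists k. intros s Hs. replace s with a by lra. exact Hk.
- assert (Sa : S a). { split; [lra|]. destruct (Hc a ltac:(lra)) as [k Hk]. exists k. intros s Hs. replace s with a by lra. exact Hk. }
  assert (Hxa : a <= x) by (apply Hx1; exact Sa).
  assert (Hxb : x <= b) by (apply Hx2; intros y [Hy _]; lra).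
  destruct (Loc x ltac:(lra)) as [k [d [D Hd]]].
  assert (Y0 : exists y, S y /\ x - d < y <= x).
  { apply NNPP. intros Q. assert (x <= x - d); [|lra]. apply Hx2. intros y Hy. apply Rnot_lt_le. intros L. apply Q. exists y.
    split; [exact Hy|]. split; [lra|apply Hx1; exact Hy]. }
  destruct Y0 as [y [[Hy [m Hm]] Hyx]].
  assert (G : forall s, a <= s < x + d -> Y (k + m)%nat (cis s)).
  { intros s Hs. destruct (Rle_dec s y).
    - apply (Mono m); [lia|]. apply Hm; lra.
    - apply (Mono k); [lia|]. apply Hd. apply Rabs_def1; lra. }
  assert (x = b).
  { apply Rle_antisym; [exact Hxb|]. apply Rnot_lt_le. intros L.
    assert (S (Rmin b (x + d / 2))).
    { split; [split; [apply Rmin_glb; lra|apply Rmin_l]|]. exists (k + m)%nat. intros s Hs. apply G.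
      assert (T := Rmin_r b (x + d / 2)). lra. }
    apply Hx1 in H. assert (x < Rmin b (x + d / 2)) by (apply Rmin_glb_lt; lra). lra. }
  exists (k + m)%nat. intros s Hs. apply G. lra.
Qed.

(** At a level where [mu_level] of the union is almost [mu], only finitely many closed cells occur,
    and by compactness one [Y k] contains them all. *)
Lemma mu_continuous_below (Y : nat -> C -> Prop) : (forall k, rel_open_T (Y k)) -> (forall k z, Y k z -> Y (S k) z) ->
  forall eps, 0 < eps -> exists k, mu (fun z => exists k, Y k z) - eps < mu (Y k).
Proof.
intros Ho Hi eps He. set (X := fun z => exists k, Y k z).
assert (Mono : forall k m z, (k <= m)%nat -> Y k z -> Y m z) by (intros k m z H; induction H; auto).
destruct (mu_approx X eps He) as [n Hn]. specialize (Hn n (le_n n)).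
assert (G : forall q, exists k, forall p, (p < q)%nat -> inside X n p -> inside (Y k) n p).
{ induction q; [exists O; intros; lia|]. destruct IHq as [k Hk].
  destruct (classic (inside X n q)) as [A|A].
  - destruct (compact_increasing Y _ _ Ho Hi A) as [m Hm]. exists (k + m)%nat. intros p Hp Hpx.
    destruct (Nat.eq_dec p q) as [->|Ne].
    + intros s Hs. apply (Mono m); [lia|]. apply Hm; exact Hs.
    + intros s Hs. apply (Mono k); [lia|]. apply (Hk p); [lia|exact Hpx|exact Hs].
  - exists k. intros p Hp Hpx. destruct (Nat.eq_dec p q) as [->|Ne]; [contradiction|]. apply Hk; [lia|exact Hpx]. }
destruct (G (2 ^ n)%nat) as [k Hk]. exists k. eapply Rlt_le_trans; [exact Hn|].
eapply Rle_trans; [|apply (mu_ge n)]. apply rsum_le. intros p Hp. apply Rmult_le_compat_r; [left; apply inv_pow2_pos|].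
apply ind_mono. apply Hk. exact Hp.
Qed.

Lemma J_continuous_below (Y : nat -> C -> Prop) g c w k0 : (forall k, rel_open_T (Y k)) -> (forall k z, Y k z -> Y (S k) z) -> test g ->
  (forall k, (k0 <= k)%nat -> Cmod (J (Y k) g - c)%C <= w) -> Cmod (J (fun z => exists k, Y k z) g - c)%C <= w.
Proof.
intros Ho Hi Hg Hk. apply le_epsilon. intros eps He. destruct Hg as [G1 [v Hv]].
assert (V : 0 <= v) by (eapply Rle_trans; [apply Cmod_ge_0|apply (Hv 0)]).
destruct (mu_continuous_below Y Ho Hi (eps / (v + 1))) as [k1 HK1]; [apply Rdiv_lt_0_compat; lra|].
assert (Mono : forall k m z, (k <= m)%nat -> Y k z -> Y m z) by (intros k m z H; induction H; auto).
set (k := (k0 + k1)%nat).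
assert (HK := Rlt_le_trans _ _ _ HK1 (mu_mono (Y k1) (Y k) (fun z => Mono k1 k z ltac:(unfold k; lia)))).
assert (B := J_sub (Y k) (fun z => exists k, Y k z) g v (fun z Hz => ex_intro _ k Hz) (conj G1 (ex_intro _ v Hv)) Hv).
specialize (Hk k ltac:(unfold k; lia)). assert (E : (v + 1) * (eps / (v + 1)) = eps) by (field; lra).
assert (0 < eps / (v + 1)) by (apply Rdiv_lt_0_compat; lra).
assert (v * (mu (fun z => exists k, Y k z) - mu (Y k)) <= v * (eps / (v + 1))) by (apply Rmult_le_compat_l; lra).
replace (J (fun z => exists k, Y k z) g - c)%C with ((J (fun z => exists k, Y k z) g - J (Y k) g) + (J (Y k) g - c))%C by ring.
eapply Rle_trans; [apply Cmod_triangle|]. nra.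
Qed.

Lemma J_level_rate n X g w : test g -> (forall t, Cmod (g t) <= w) -> Cmod (J_level n X g - J X g)%C <= w * (mu X - mu_level n X).
Proof.
intros Hg Hw. assert (W : 0 <= w) by (eapply Rle_trans; [apply Cmod_ge_0|apply (Hw 0)]).
rewrite Cmod_minus_sym. apply (Clim_bound (fun m => J_level m X g - J_level n X g)%C).
- apply Clim_minus; [apply J_lim; exact Hg|apply Clim_const].
- intros eps He. exists n. intros m Hm. replace m with (n + (m - n))%nat by lia.
  eapply Rle_trans; [apply (J_level_steps n _ X g w (proj1 Hg) Hw)|]. assert (T := mu_ge (n + (m - n)) X). nra.
Qed.

Lemma test_const c : test (fun _ => c).
Proof. split; [intros; apply Ccont_const|]. exists (Cmod c). intros; lra. Qed.

Lemma J_one X : J X (fun _ => 1) = RtoC (mu X).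
Proof.
apply (Clim_unique (fun n => J_level n X (fun _ => 1))); [apply J_lim, test_const|].
intros eps He. destruct (proj2 (is_lim_seq_spec _ _) (mu_lim X) (mkposreal eps He)) as [N HN].
exists N. intros n Hn. specialize (HN n Hn). simpl in HN.
replace (J_level n X (fun _ => 1)) with (RtoC (mu_level n X)).
- rewrite <- RtoC_minus, Cmod_R. lra.
- unfold J_level, mu_level. assert (PP := PI_RGT_0).
  assert (E : forall p, cell_integral (fun _ => 1) n p = RtoC (/ 2 ^ n)).
  { intros p. unfold cell_integral. rewrite CInt_const, angle_succ, <- !RtoC_mult. f_equal. field. split; [apply pow_nonzero|]; lra. }
  generalize (2 ^ n)%nat. intros m. induction m; simpl; [reflexivity|].
  rewrite RtoC_plus, IHm, E, RtoC_mult. reflexivity.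
Qed.

(** After rotation by [- t], a point of the circle at angle [v] is at distance at least [1 - cos v]
    from 1, so distance less than [1 - cos d] forces [|v| < d]. *)
Lemma rel_open_arc a b : rel_open_T (arc a b).
Proof.
split; [intros z [t [_ ->]]; apply cis_circle|].
intros z [t [Ht ->]]. assert (PP := PI_RGT_0).
set (d := Rmin (PI / 2) (Rmin (t - a) (b - t))).
assert (D : 0 < d) by (unfold d; repeat apply Rmin_pos; lra).
assert (D1 : d <= PI / 2) by apply Rmin_l.
assert (D2 : d <= t - a) by (eapply Rle_trans; [apply Rmin_r|apply Rmin_l]).
assert (D3 : d <= b - t) by (eapply Rle_trans; [apply Rmin_r|apply Rmin_r]).
assert (Cd : cos d < 1). { rewrite <- cos_0. apply cos_decreasing_1; lra. }
exists (1 - cos d). split; [lra|]. intros w Hw Hd. rewrite Cnorm_Cmod in Hd. change (Csub w (cis t)) with (w - cis t)%C in Hd.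
assert (Hw' : circle (w * cis (- t))%C).
{ unfold circle in *. rewrite Cnorm_Cmod in *. rewrite Cmod_mult, Cmod_cis, Hw. ring. }
destruct (circle_cis _ Hw') as [v [Hv Ev]].
assert (Ew : w = cis (t + v)).
{ assert (KEY : forall u : C, u = (cis t * (u * cis (- t)))%C) by (intros; rewrite cis_inv; field; apply cis_neq0).
  rewrite cis_add, <- Ev. apply KEY. }
exists (t + v). split; [|exact Ew].
assert (B : 1 - cos v <= Cmod (w - cis t)%C).
{ rewrite Ew, cis_add. replace (cis t * cis v - cis t)%C with (cis t * (cis v - 1))%C by ring.
  rewrite Cmod_mult, Cmod_cis, Rmult_1_l. assert (T := Rabs_fst_le (cis v - 1)%C). cbn [fst Cminus Cplus Copp cis RtoC] in T.
  rewrite Rabs_left1 in T; [lra|]. assert (Q := COS_bound v). lra. }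
assert (Rabs v < d); [|apply Rabs_def2 in H; lra].
apply Rnot_le_lt. intros L. assert (cos v <= cos d); [|lra].
assert (E : cos v = cos (Rabs v)) by (unfold Rabs; destruct (Rcase_abs v); [rewrite cos_neg|]; reflexivity).
rewrite E. assert (Rabs v <= PI) by (apply Rabs_le; lra).
destruct (Req_dec d (Rabs v)) as [<-|N]; [lra|]. left. apply cos_decreasing_1; lra.
Qed.

(** * Stability of radial limits *)

Lemma rcauchy_lipschitz phi K r0 : r0 < 1 -> (forall r s, r0 < r < 1 -> r0 < s < 1 -> Cmod (phi r - phi s)%C <= K * Rabs (r - s)) -> rcauchy phi.
Proof.
intros Hr H eps He. assert (K0 : 0 <= Rabs K) by apply Rabs_pos.
exists (Rmax r0 (1 - eps / (Rabs K + 1))). assert (0 < eps / (Rabs K + 1)) by (apply Rdiv_lt_0_compat; lra).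
split; [apply Rmax_lub_lt; lra|]. intros r s Hr' Hs.
assert (A1 := Rmax_l r0 (1 - eps / (Rabs K + 1))). assert (A2 := Rmax_r r0 (1 - eps / (Rabs K + 1))).
eapply Rle_trans; [apply H; lra|].
assert (D : Rabs (r - s) <= eps / (Rabs K + 1)) by (apply Rabs_le; lra).
assert (E : (Rabs K + 1) * (eps / (Rabs K + 1)) = eps) by (field; lra).
assert (T := Rle_abs K). assert (0 <= Rabs (r - s)) by apply Rabs_pos. nra.
Qed.

Lemma rcauchy_uniform phi : (forall eps, 0 < eps -> exists psi r0, r0 < 1 /\ rcauchy psi /\ forall r, r0 < r < 1 -> Cmod (phi r - psi r)%C <= eps) -> rcauchy phi.
Proof.
intros H eps He. destruct (H (eps / 3) ltac:(lra)) as [psi [r0 [R0 [Hc Hp]]]]. destruct (Hc (eps / 3) ltac:(lra)) as [r1 [R1 H1]].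
exists (Rmax r0 r1). split; [apply Rmax_lub_lt; lra|]. intros r s Hr Hs.
assert (A1 := Rmax_l r0 r1). assert (A2 := Rmax_r r0 r1).
assert (B1 := Hp r ltac:(lra)). assert (B2 := Hp s ltac:(lra)). assert (B3 := H1 r s ltac:(lra) ltac:(lra)). rewrite Cmod_minus_sym in B2.
replace (phi r - phi s)%C with ((phi r - psi r) + (psi r - psi s) + (psi s - phi s))%C by ring.
eapply Rle_trans; [apply Cmod_triangle|]. eapply Rle_trans; [apply Rplus_le_compat_r, Cmod_triangle|]. lra.
Qed.

Lemma inv_diff_bound (x y : C) : 1 <= Cmod x -> 1 <= Cmod y -> Cmod (/ x - / y)%C <= Cmod (x - y)%C.
Proof.
intros Hx Hy. assert (Nx : x <> 0) by (apply Cmod_gt_0; lra). assert (Ny : y <> 0) by (apply Cmod_gt_0; lra).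
replace (/ x - / y)%C with ((y - x) * (/ x * / y))%C by (field; auto).
rewrite !Cmod_mult, !Cmod_inv by assumption. rewrite Cmod_minus_sym.
assert (/ Cmod x <= 1) by (rewrite <- Rinv_1; apply Rinv_le_contravar; lra).
assert (/ Cmod y <= 1) by (rewrite <- Rinv_1; apply Rinv_le_contravar; lra).
assert (0 < / Cmod x) by (apply Rinv_0_lt_compat; lra). assert (0 < / Cmod y) by (apply Rinv_0_lt_compat; lra).
assert (0 <= Cmod (x - y)%C) by apply Cmod_ge_0.
assert (/ Cmod x * / Cmod y <= 1) by nra. nra.
Qed.

(* In terms of [s], the hypothesis on [1 / (1 + s)] says that [s] has a limit in the Riemann sphere. *)
Lemma rcauchy_inv_shift (s s' : R -> C) :
  (forall r, 0 <= r < 1 -> 1 <= Cmod (1 + s r)%C) -> (forall r, 0 <= r < 1 -> 1 <= Cmod (1 + s' r)%C) ->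
  rcauchy (fun r => / (1 + s r))%C -> rcauchy (fun r => s' r - s r)%C -> rcauchy (fun r => / (1 + s' r))%C.
Proof.
intros H1 H2 HQ HD. destruct (rcauchy_lim _ HQ) as [q Hq].
intros eps He.
destruct (classic (q = 0)) as [->|Nq].
(* Here [s] tends to infinity; [s' - s] is bounded by [K], so [s'] tends to infinity too and its
   reciprocal to 0. *)
- destruct (HD 1 Rlt_0_1) as [r1 [R1 K1]]. set (t0 := (1 + Rmax 0 r1) / 2).
  assert (M1 := Rmax_l 0 r1). assert (M2 := Rmax_r 0 r1). assert (M3 : Rmax 0 r1 < 1) by (apply Rmax_lub_lt; lra).
  set (K := Cmod (s' t0 - s t0)%C + 1). assert (K0 : 1 <= K) by (unfold K; assert (T := Cmod_ge_0 (s' t0 - s t0)%C); lra).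
  destruct (Hq (/ (K + 2 / eps))) as [r2 [R2 K2]].
  { apply Rinv_0_lt_compat. assert (0 < 2 / eps) by (apply Rdiv_lt_0_compat; lra). lra. }
  assert (M4 := Rmax_l (Rmax 0 r1) r2). assert (M5 := Rmax_r (Rmax 0 r1) r2).
  exists (Rmax (Rmax 0 r1) r2). split; [apply Rmax_lub_lt; lra|].
  assert (G : forall r, Rmax (Rmax 0 r1) r2 < r < 1 -> Cmod (/ (1 + s' r))%C <= eps / 2).
  { intros r Hr. assert (E0 : 0 < 2 / eps) by (apply Rdiv_lt_0_compat; lra).
    specialize (K2 r ltac:(lra)). replace (/ (1 + s r) - 0)%C with (/ (1 + s r))%C in K2 by ring.
    assert (P1 := H1 r ltac:(lra)). assert (P2 := H2 r ltac:(lra)).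
    rewrite Cmod_inv in K2 by (apply Cmod_gt_0; lra).
    assert (B : K + 2 / eps <= Cmod (1 + s r)%C).
    { rewrite <- (Rinv_inv (Cmod (1 + s r)%C)). rewrite <- (Rinv_inv (K + 2 / eps)). apply Rinv_le_contravar; [apply Rinv_0_lt_compat; lra|exact K2]. }
    specialize (K1 r t0 ltac:(lra) ltac:(unfold t0; lra)).
    assert (T := Cmod_triangle ((s' r - s r) - (s' t0 - s t0)) (s' t0 - s t0)).
    replace (s' r - s r - (s' t0 - s t0) + (s' t0 - s t0))%C with (s' r - s r)%C in T by ring.
    assert (T2 := Cmod_triangle (1 + s' r) (- (s' r - s r))). replace (1 + s' r + - (s' r - s r))%C with (1 + s r)%C in T2 by ring.
    rewrite Cmod_opp in T2.
    rewrite Cmod_inv by (apply Cmod_gt_0; lra). replace (eps / 2) with (/ (2 / eps)) by (field; lra).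
    apply Rinv_le_contravar; [exact E0|]. unfold K in *. lra. }
  intros r t Hr Ht. eapply Rle_trans; [apply Cmod_minus_le|]. assert (A := G r Hr). assert (B := G t Ht). lra.
(* Here [1 + s] is eventually bounded by [/ k], so oscillations of its reciprocal translate into
   those of [s] with a factor at most [1 / k^2]. *)
- assert (Q0 : 0 < Cmod q) by (apply Cmod_gt_0; exact Nq). set (k := Cmod q / 2).
  destruct (Hq k ltac:(unfold k; lra)) as [r1 [R1 K1]].
  destruct (HD (eps / 2) ltac:(lra)) as [r2 [R2 K2]].
  destruct (HQ (eps / 2 * (k * k))) as [r3 [R3 K3]]; [apply Rmult_lt_0_compat; [lra|unfold k; nra]|].
  set (r0 := Rmax (Rmax 0 r1) (Rmax r2 r3)).
  assert (M0 := Rmax_l (Rmax 0 r1) (Rmax r2 r3)). assert (M1 := Rmax_r (Rmax 0 r1) (Rmax r2 r3)). fold r0 in M0, M1.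
  assert (M2 := Rmax_l 0 r1). assert (M3 := Rmax_r 0 r1). assert (M4 := Rmax_l r2 r3). assert (M5 := Rmax_r r2 r3).
  exists r0. split; [unfold r0; repeat apply Rmax_lub_lt; lra|]. intros r t Hr Ht.
  assert (P1 := H1 r ltac:(lra)). assert (P2 := H1 t ltac:(lra)).
  assert (L : forall u, r0 < u < 1 -> Cmod (1 + s u)%C <= / k).
  { intros u Hu. specialize (K1 u ltac:(lra)). assert (T := Cmod_rev_triangle q (/ (1 + s u))). rewrite Cmod_minus_sym in T.
    assert (P := H1 u ltac:(lra)). rewrite Cmod_inv in T by (apply Cmod_gt_0; lra).
    rewrite <- (Rinv_inv (Cmod (1 + s u)%C)). apply Rinv_le_contravar; unfold k in *; lra. }
  eapply Rle_trans; [apply inv_diff_bound; apply H2; lra|].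
  replace (1 + s' r - (1 + s' t))%C with (((s' r - s r) - (s' t - s t)) + (1 + s r) * (1 + s t) * (/ (1 + s t) - / (1 + s r)))%C.
  2: { field. split; apply Cmod_gt_0; lra. }
  eapply Rle_trans; [apply Cmod_triangle|].
  specialize (K2 r t ltac:(lra) ltac:(lra)). specialize (K3 t r ltac:(lra) ltac:(lra)).
  rewrite !Cmod_mult. assert (L1 := L r Hr). assert (L2 := L t Ht).
  assert (Kp : 0 < k) by (unfold k; lra). assert (0 < / k) by (apply Rinv_0_lt_compat; exact Kp).
  assert (Cmod (1 + s r)%C * Cmod (1 + s t)%C * Cmod (/ (1 + s t) - / (1 + s r))%C <= / k * / k * (eps / 2 * (k * k))).
  { apply Rmult_le_compat; try apply Cmod_ge_0; [|apply Rmult_le_compat; try apply Cmod_ge_0; assumption|exact K3].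
    apply Rmult_le_pos; apply Cmod_ge_0. }
  replace (/ k * / k * (eps / 2 * (k * k))) with (eps / 2) in H0 by (field; lra). lra.
Qed.

(** * The Cauchy transform of an open set *)

Lemma test_kernel z : Cmod z < 1 -> test (cauchy_kernel z).
Proof. intros H. split; [intros; apply cauchy_kernel_cont; exact H|]. exists (/ (1 - Cmod z)). intros. apply cauchy_kernel_bound. exact H. Qed.

Lemma fst_Cinv (w : C) : w <> 0 -> fst (/ w)%C = fst w / Cmod w ^ 2.
Proof. intros H. rewrite Cmod2_alt. reflexivity. Qed.

Definition cauchy_of (X : C -> Prop) (z : C) : C := J X (cauchy_kernel z).
(** The transform may be unbounded, but its real part is nonnegative, so this function is bounded by
    1 and Fatou's theorem applies to it. *)
Definition recip (X : C -> Prop) (z : C) : C := (/ (1 + cauchy_of X z))%C.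

Lemma cauchy_of_fst_pos X z : Cmod z < 1 -> 0 <= fst (cauchy_of X z).
Proof.
intros Hz. apply J_fst_pos; [apply test_kernel; exact Hz|]. intros t. unfold cauchy_kernel.
assert (N := cauchy_den_neq0 z t Hz). rewrite fst_Cinv by exact N.
assert (P : 0 < Cmod (1 - z * cis (- t))%C) by (apply Cmod_gt_0; exact N).
apply Rdiv_le_0_compat; [|apply pow_lt; exact P].
assert (T := Rabs_fst_le (z * cis (- t))%C). rewrite Cmod_mult, Cmod_cis in T.
assert (T2 := Rle_abs (fst (z * cis (- t))%C)). change (fst (1 - z * cis (- t))%C) with (1 - fst (z * cis (- t))%C). lra.
Qed.

Lemma one_plus_bound (w : C) : 0 <= fst w -> 1 <= Cmod (1 + w)%C.
Proof.
intros H. eapply Rle_trans; [|apply Rabs_fst_le]. change (fst (1 + w)%C) with (1 + fst w). rewrite Rabs_pos_eq; lra.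
Qed.
Lemma one_plus_cauchy_of X z : Cmod z < 1 -> 1 <= Cmod (1 + cauchy_of X z)%C.
Proof. intros Hz. apply one_plus_bound, cauchy_of_fst_pos. exact Hz. Qed.
Lemma recip_bound X z : Cmod z < 1 -> Cmod (recip X z) <= 1.
Proof.
intros Hz. assert (P := one_plus_cauchy_of X z Hz). unfold recip. rewrite Cmod_inv by (apply Cmod_gt_0; lra).
apply Rle_trans with (/ 1); [apply Rinv_le_contravar; lra|rewrite Rinv_1; lra].
Qed.
Lemma recip_diff X Y z : Cmod z < 1 -> Cmod (recip X z - recip Y z)%C <= Cmod (cauchy_of X z - cauchy_of Y z)%C.
Proof.
intros Hz. unfold recip. eapply Rle_trans; [apply inv_diff_bound; apply one_plus_cauchy_of; exact Hz|].
right. f_equal. ring.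
Qed.

Lemma cdiff_csum (f : nat -> C -> C) n z : (forall i, (i < n)%nat -> cdiff (f i) z) -> cdiff (fun w => csum (fun i => f i w) n) z.
Proof.
induction n; intros H; simpl; [apply cdiff_const|]. apply cdiff_plus; auto.
Qed.

(** The sums over cells are holomorphic, and on [|z| <= R0] they converge uniformly, with error at
    most [(mu X - mu_level n X) / (1 - R0)]. *)
Lemma cauchy_of_cdiff X z : Cmod z < 1 -> cdiff (cauchy_of X) z.
Proof.
apply (weierstrass_limit (fun n z => J_level n X (cauchy_kernel z))).
- intros n w Hw. unfold J_level. apply cdiff_csum. intros p _. apply cdiff_mult; [apply cdiff_const|].
  unfold cell_integral. apply cdiff_mult; [apply cdiff_const|].
  apply (cdiff_ext_loc (fun z => CInt (fun t => 1 * cauchy_kernel z t)%C (angle n p) (angle n (p + 1))) _ w 1 Rlt_0_1).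
  + intros v _. apply CInt_ext; [apply angle_le|]. intros. ring.
  + apply (cauchy_integral_cdiff (fun _ => 1) _ _ 1); [apply angle_le|intros t _; apply Ccont_const|intros; rewrite Cmod_1; lra|exact Hw].
- intros R0 HR eps He. destruct (mu_approx X (eps * (1 - R0))) as [N HN]; [apply Rmult_lt_0_compat; lra|].
  exists N. intros n Hn w Hw. specialize (HN n Hn).
  eapply Rle_trans; [apply (J_level_rate n X _ (/ (1 - R0)))|].
  + apply test_kernel. lra.
  + intros t. eapply Rle_trans; [apply cauchy_kernel_bound; lra|]. apply Rinv_le_contravar; lra.
  + apply (Rmult_le_reg_l (1 - R0)); [lra|]. rewrite <- Rmult_assoc, Rinv_r by lra. lra.
Qed.
Lemma recip_cdiff X z : Cmod z < 1 -> cdiff (recip X) z.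
Proof.
intros Hz. apply cdiff_inv; [apply cdiff_plus; [apply cdiff_const|apply cauchy_of_cdiff; exact Hz]|].
apply Cmod_gt_0. assert (T := one_plus_cauchy_of X z Hz). lra.
Qed.

Lemma cauchy_of_sub (W X : C -> Prop) z : (forall z, W z -> X z) -> Cmod z < 1 -> Cmod (cauchy_of X z - cauchy_of W z)%C <= (mu X - mu W) / (1 - Cmod z).
Proof.
intros H Hz. unfold Rdiv. rewrite Rmult_comm. apply J_sub; [exact H|apply test_kernel; exact Hz|].
intros; apply cauchy_kernel_bound; exact Hz.
Qed.

Lemma Cmod_rzeta r (zeta : C) : circle zeta -> 0 <= r -> Cmod (RtoC r * zeta)%C = r.
Proof. intros Hz Hr. unfold circle in Hz. rewrite Cnorm_Cmod in Hz. rewrite Cmod_mult, Hz, Cmod_R, Rabs_pos_eq; lra. Qed.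

(** The right side is the distance from [cis s] to [r * zeta]. It is at least [1 - r] and at least
    [|cis s - zeta| - (1 - r)], hence at least half their sum. *)
Lemma kernel_den_far r (zeta : C) s : circle zeta -> 0 <= r < 1 -> Cmod (cis s - zeta)%C / 2 <= Cmod (1 - RtoC r * zeta * cis (- s))%C.
Proof.
intros Hz Hr.
assert (E : Cmod (1 - RtoC r * zeta * cis (- s))%C = Cmod (cis s - RtoC r * zeta)%C).
{ transitivity (Cmod (cis s * (1 - RtoC r * zeta * cis (- s)))%C); [rewrite Cmod_mult, Cmod_cis; ring|].
  f_equal. rewrite cis_inv. field. apply cis_neq0. }
rewrite E.
assert (T1 := Cmod_rev_triangle (cis s) (RtoC r * zeta)). rewrite Cmod_cis, Cmod_rzeta in T1 by (try assumption; lra).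
assert (T2 := Cmod_triangle (cis s - RtoC r * zeta) (RtoC (- (1 - r)) * zeta)).
replace (cis s - r * zeta + RtoC (- (1 - r)) * zeta)%C with (cis s - zeta)%C in T2 by (rewrite RtoC_opp, RtoC_minus; ring).
rewrite (Cmod_mult (RtoC (- (1 - r)))), Cmod_R, Rabs_left1 in T2 by lra.
unfold circle in Hz. rewrite Cnorm_Cmod in Hz. rewrite Hz in T2. lra.
Qed.

Lemma kernel_far r (zeta : C) s d : circle zeta -> 0 <= r < 1 -> 0 < d -> d <= Cmod (cis s - zeta)%C ->
  Cmod (cauchy_kernel (RtoC r * zeta) s) <= 2 / d.
Proof.
intros Hz Hr Hd Hs. unfold cauchy_kernel. assert (T := kernel_den_far r zeta s Hz Hr).
rewrite Cmod_inv by (apply Cmod_gt_0; lra). replace (2 / d) with (/ (d / 2)) by (field; lra).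
apply Rinv_le_contravar; lra.
Qed.

Lemma kernel_far_lip r r' (zeta : C) s d : circle zeta -> 0 <= r < 1 -> 0 <= r' < 1 -> 0 < d -> d <= Cmod (cis s - zeta)%C ->
  Cmod (cauchy_kernel (RtoC r * zeta) s - cauchy_kernel (RtoC r' * zeta) s)%C <= Rabs (r - r') * (2 / d * (2 / d)).
Proof.
intros Hz Hr Hr' Hd Hs.
assert (K1 := kernel_far r zeta s d Hz Hr Hd Hs). assert (K2 := kernel_far r' zeta s d Hz Hr' Hd Hs).
assert (N1 : (1 - RtoC r * zeta * cis (- s))%C <> 0) by (apply cauchy_den_neq0; rewrite Cmod_rzeta; try assumption; lra).
assert (N2 : (1 - RtoC r' * zeta * cis (- s))%C <> 0) by (apply cauchy_den_neq0; rewrite Cmod_rzeta; try assumption; lra).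
replace (cauchy_kernel (RtoC r * zeta) s - cauchy_kernel (RtoC r' * zeta) s)%C with
 (RtoC (r - r') * (zeta * cis (- s)) * (cauchy_kernel (RtoC r * zeta) s * cauchy_kernel (RtoC r' * zeta) s))%C.
2: { unfold cauchy_kernel. rewrite RtoC_minus. field. auto. }
unfold circle in Hz. rewrite Cnorm_Cmod in Hz.
rewrite !Cmod_mult, Hz, Cmod_cis, Cmod_R, !Rmult_1_r.
apply Rmult_le_compat_l; [apply Rabs_pos|]. apply Rmult_le_compat; try apply Cmod_ge_0; assumption.
Qed.

(** The integral of the kernel over the whole circle does not depend on the point, so the difference
    over [X] is minus the difference over the complement, at distance at least [rho / 2]. The
    constant is the square of [2 / (rho / 2)]. *)
Lemma cauchy_of_lip_inside X (zeta : C) rho r r' : circle zeta -> 0 < rho -> (forall w, circle w -> Cmod (w - zeta)%C < rho -> X w) ->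
  0 <= r < 1 -> 0 <= r' < 1 -> Cmod (cauchy_of X (RtoC r * zeta) - cauchy_of X (RtoC r' * zeta))%C <= 16 / rho ^ 2 * Rabs (r - r').
Proof.
intros Hz Hrho HX Hr Hr'. assert (PP := PI_RGT_0).
assert (A1 : Cmod (RtoC r * zeta)%C < 1) by (rewrite Cmod_rzeta; try assumption; lra).
assert (A2 : Cmod (RtoC r' * zeta)%C < 1) by (rewrite Cmod_rzeta; try assumption; lra).
unfold cauchy_of. rewrite <- J_minus by (apply test_kernel; assumption).
set (g := fun t => (cauchy_kernel (RtoC r * zeta) t - cauchy_kernel (RtoC r' * zeta) t)%C).
assert (T : CInt g (- PI) PI = 0).
{ unfold g. rewrite CInt_minus; [|lra|intros t _; apply cauchy_kernel_cont; assumption|intros t _; apply cauchy_kernel_cont; assumption].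
  rewrite !cauchy_kernel_total by assumption. ring. }
assert (B := J_complement X g zeta rho (16 / rho ^ 2 * Rabs (r - r')) Hrho HX).
rewrite T in B. replace (RtoC (/ (2 * PI)) * 0 - J X g)%C with (- J X g)%C in B by ring. rewrite Cmod_opp in B.
apply B.
- apply test_minus; apply test_kernel; assumption.
- apply Rmult_le_pos; [apply Rdiv_le_0_compat; [lra|apply pow_lt; exact Hrho]|apply Rabs_pos].
- intros t Ht. eapply Rle_trans; [apply (kernel_far_lip r r' zeta t (rho / 2)); try assumption; lra|].
  right. field. lra.
Qed.

(** The real part of [1 / (1 - u)] with [|u| = r] is [/ 2 + (1 - r^2) / (2 |1 - u|^2)]. Far from
    [zeta] it is close to [/ 2], so the complement of [X] takes at most about one half of the total
    integral 1 and [X] keeps the rest. *)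
Lemma cauchy_of_fst_inside X (zeta : C) rho r : circle zeta -> 0 < rho -> (forall w, circle w -> Cmod (w - zeta)%C < rho -> X w) ->
  0 <= r < 1 -> / 2 - 16 / rho ^ 2 * (1 - r) <= fst (cauchy_of X (RtoC r * zeta)%C).
Proof.
intros Hz Hrho HX Hr. assert (PP := PI_RGT_0).
assert (A1 : Cmod (RtoC r * zeta)%C < 1) by (rewrite Cmod_rzeta; try assumption; lra).
assert (R2 : 0 < rho ^ 2) by (apply pow_lt; exact Hrho).
assert (P16 : 0 <= 16 / rho ^ 2 * (1 - r)) by (apply Rmult_le_pos; [apply Rdiv_le_0_compat; lra|lra]).
assert (B := J_complement_fst X (cauchy_kernel (RtoC r * zeta)) zeta rho (/ 2 + 16 / rho ^ 2 * (1 - r)) Hrho HX (test_kernel _ A1) ltac:(lra)).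
rewrite cauchy_kernel_total in B by exact A1. rewrite <- RtoC_mult, Rinv_l in B by lra. cbn [fst RtoC] in B.
unfold cauchy_of. eapply Rle_trans; [|apply B]; [lra|]. clear B.
intros t Ht. unfold cauchy_kernel.
assert (N1 : (1 - RtoC r * zeta * cis (- t))%C <> 0) by (apply cauchy_den_neq0; exact A1).
rewrite fst_Cinv by exact N1. set (u := (RtoC r * zeta * cis (- t))%C) in *.
assert (Mu : Cmod u = r) by (unfold u; rewrite Cmod_mult, Cmod_cis, Cmod_rzeta by (try assumption; lra); ring).
assert (D := kernel_den_far r zeta t Hz Hr). fold u in D.
assert (P : 0 < Cmod (1 - u)%C) by (apply Cmod_gt_0; exact N1).
assert (E1 : Cmod (1 - u)%C ^ 2 = 1 - 2 * fst u + r ^ 2).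
{ rewrite <- Mu, !Cmod2_alt. simpl. ring. }
set (m := Cmod (1 - u)%C) in *. change (fst (1 - u)%C) with (1 - fst u).
assert (Hm : rho / 4 <= m) by lra.
replace (1 - fst u) with ((m ^ 2 + (1 - r ^ 2)) / 2) by lra.
replace ((m ^ 2 + (1 - r ^ 2)) / 2 / m ^ 2) with (/ 2 + (1 - r ^ 2) * / 2 * / m ^ 2) by (field; lra).
apply Rplus_le_compat_l.
assert (I1 : / m ^ 2 <= 16 / rho ^ 2).
{ replace (16 / rho ^ 2) with (/ ((rho / 4) ^ 2)) by (field; lra). apply Rinv_le_contravar; [apply pow_lt; lra|apply pow_incr; lra]. }
assert (I2 : 0 < / m ^ 2) by (apply Rinv_0_lt_compat, pow_lt; exact P).
rewrite (Rmult_comm (16 / rho ^ 2)). apply Rmult_le_compat; try lra; nra.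
Qed.

(** * Interpolation of open sets *)

Fixpoint add_arcs (B : C -> Prop) (a b : nat -> R) (k : nat) : C -> Prop :=
  match k with O => B | S k => fun z => add_arcs B a b k z \/ arc (a k) (b k) z end.

Lemma rel_open_or X Y : rel_open_T X -> rel_open_T Y -> rel_open_T (fun z => X z \/ Y z).
Proof.
intros [X1 X2] [Y1 Y2]. split; [intros z [H|H]; auto|]. intros z [H|H].
- destruct (X2 z H) as [d [D Hd]]. exists d; split; auto.
- destruct (Y2 z H) as [d [D Hd]]. exists d; split; auto.
Qed.
Lemma rel_open_ex (X : nat -> C -> Prop) : (forall k, rel_open_T (X k)) -> rel_open_T (fun z => exists k, X k z).
Proof.
intros H. split; [intros z [k Hk]; apply (H k); exact Hk|]. intros z [k Hk].
destruct (proj2 (H k) z Hk) as [d [D Hd]]. exists d; split; auto. intros w Hw Hd'. exists k; auto.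
Qed.
Lemma add_arcs_open B a b k : rel_open_T B -> rel_open_T (add_arcs B a b k).
Proof. intros HB. induction k; [exact HB|]. apply rel_open_or; [exact IHk|apply rel_open_arc]. Qed.

Lemma J_add_arcs B a b g w eta sigma : rel_open_T B -> (forall i, a i <= b i) -> test g -> 0 <= w -> 0 < eta ->
  (forall N, rsum (fun i => b i - a i) N <= sigma) ->
  (forall i s t, a i < t < b i -> Cmod (cis s - cis t)%C <= eta -> Cmod (g s) <= w) ->
  Cmod (J (fun z => exists k, add_arcs B a b k z) g - J B g)%C <= w * sigma.
Proof.
intros HB Hab Hg W He Hs Hw.
apply (J_continuous_below (add_arcs B a b) g (J B g) (w * sigma) O).
- intros k. apply add_arcs_open. exact HB.
- intros k z H. left. exact H.
- exact Hg.
- intros k _. apply Rle_trans with (w * rsum (fun i => b i - a i) k); [|apply Rmult_le_compat_l; [exact W|apply Hs]].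
  induction k.
  + simpl. replace (J B g - J B g)%C with (RtoC 0) by ring. rewrite Cmod_0. lra.
  + cbn [add_arcs rsum].
    assert (T := J_add_arc (add_arcs B a b k) (a k) (b k) g w eta (Hab k) Hg W He (Hw k)).
    replace (J (fun z => add_arcs B a b k z \/ arc (a k) (b k) z) g - J B g)%C with
     ((J (fun z => add_arcs B a b k z \/ arc (a k) (b k) z) g - J (add_arcs B a b k) g) + (J (add_arcs B a b k) g - J B g))%C by ring.
    eapply Rle_trans; [apply Cmod_triangle|]. lra.
Qed.

Definition has_ray_limit (X : C -> Prop) (zeta : C) : Prop := rcauchy (ray (recip X) zeta).

(* [W] is so thin near the complement of [V] that its Cauchy transform has radial limits there, possibly infinite ones. *)
Definition thin (W V : C -> Prop) : Prop :=
  rel_open_T W /\ rel_open_T V /\ (forall z, W z -> V z) /\ (forall zeta, circle zeta -> ~ V zeta -> has_ray_limit W zeta).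

Section Interpolation.
Variables (W V E : C -> Prop) (eps : R).
Hypotheses (HWV : thin W V) (HE : null_T E) (HEV : forall z, E z -> V z) (Heps : 0 < eps <= 1).

(** Length allotted to the arcs at distance about [2^-j] from the complement of [V]. The kernel
    there is at most [4 * 2^j], so layer [j] contributes at most [eps / (2 * 4^j)], a summable
    amount. *)
Let eps_at (j : nat) : R := eps / 8 ^ (j + 1).

Let eps_at_pos j : 0 < eps_at j.
Proof. apply Rdiv_lt_0_compat; [lra|apply pow_lt; lra]. Qed.
Let eps_at_le j : eps_at j <= / 2 ^ j / 8.
Proof.
unfold eps_at. assert (P2 := pow2_pos j). assert (P8 : 0 < 8 ^ j) by (apply pow_lt; lra).
rewrite pow_add, pow_1. apply (Rmult_le_reg_r (8 ^ j * 8)); [lra|].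
replace (eps / (8 ^ j * 8) * (8 ^ j * 8)) with eps by (field; lra).
replace (/ 2 ^ j / 8 * (8 ^ j * 8)) with (8 ^ j / 2 ^ j) by (field; lra).
apply Rle_trans with 1; [lra|]. apply (Rmult_le_reg_r (2 ^ j)); [exact P2|]. unfold Rdiv. rewrite Rmult_assoc, Rinv_l by lra.
rewrite Rmult_1_l, Rmult_1_r. apply pow_incr. lra.
Qed.

(** [E] is exhausted by its parts at distance at least [2^-j] from the complement of [V]. Part [j]
    is covered by arcs of length at most [2^-j / 8], which therefore keep the distance
    [3/4 * 2^-j]. *)
Lemma thin_cover : exists a b : nat -> nat -> R, (forall j i, a j i <= b j i) /\
  (forall j N, rsum (fun i => b j i - a j i) N <= eps / 8 ^ (j + 1)) /\
  (forall j i t, a j i < t < b j i -> V (cis t) /\ forall zeta, circle zeta -> ~ V zeta -> 3 / 4 * / 2 ^ j <= Cmod (cis t - zeta)%C) /\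
  (forall z, E z -> exists j i, arc (a j i) (b j i) z).
Proof.
assert (P : forall j, exists ab : (nat -> R) * (nat -> R), (forall i, fst ab i <= snd ab i) /\
  (forall N, rsum (fun i => snd ab i - fst ab i) N <= eps_at j) /\
  (forall i t, fst ab i < t < snd ab i -> V (cis t) /\ forall zeta, circle zeta -> ~ V zeta -> 3 / 4 * / 2 ^ j <= Cmod (cis t - zeta)%C) /\
  (forall z, E z -> (forall w, circle w -> Cmod (w - z)%C < / 2 ^ j -> V w) -> exists i, arc (fst ab i) (snd ab i) z)).
{ intros j. destruct (HE (eps_at j) (eps_at_pos j)) as [a [b [H1 [H2 H3]]]].
  set (Ej := fun z => E z /\ forall w, circle w -> Cmod (w - z)%C < / 2 ^ j -> V w).
  set (meets := fun i => exists t, a i < t < b i /\ Ej (cis t)).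
  (* Intervals that miss part [j] of [E] are collapsed to empty ones, so that each remaining arc is
     close to a point of it. *)
  exists (a, fun i => if excluded_middle_informative (meets i) then b i else a i). cbn [fst snd]. split; [|split; [|split]].
  - intros i. destruct (excluded_middle_informative _); [apply H1|lra].
  - intros N. eapply Rle_trans; [apply (rsum_le _ (fun i => b i - a i))|].
    + intros i _. destruct (excluded_middle_informative _); [lra|specialize (H1 i); lra].
    + destruct N; [simpl; left; apply eps_at_pos|]. rewrite <- rsum_sum_f_R0. left. apply H2.
  - intros i t Ht. destruct (excluded_middle_informative (meets i)) as [[u [Hu [Eu Vu]]]|Nm]; [|lra].
    assert (Li : b i - a i <= eps_at j).
    { assert (T := rsum_term (fun i => b i - a i) (S i) i (Nat.lt_succ_diag_r i) ltac:(intros k _; specialize (H1 k); lra)).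
      rewrite <- rsum_sum_f_R0 in T. specialize (H2 i). cbv beta in T. lra. }
    assert (L := cis_lipschitz t u). assert (Rabs (t - u) <= eps_at j) by (apply Rabs_le; lra).
    assert (T := eps_at_le j). assert (T2 := inv_pow2_pos j).
    split.
    + apply Vu; [apply cis_circle|]. lra.
    + intros zeta Hz Nz. assert (K : / 2 ^ j <= Cmod (zeta - cis u)%C) by (apply Rnot_lt_le; intros Q; apply Nz, Vu; assumption).
      replace (zeta - cis u)%C with ((cis t - cis u) - (cis t - zeta))%C in K by ring.
      assert (T3 := Cmod_minus_le (cis t - cis u) (cis t - zeta)). lra.
  - intros z Ez Hz. destruct (H3 z Ez) as [i [t [Ht ->]]]. exists i.
    destruct (excluded_middle_informative (meets i)) as [Y|Nm].
    + exists t. split; [exact Ht|reflexivity].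
    + exfalso. apply Nm. exists t. split; [exact Ht|]. split; assumption. }
apply choice in P. destruct P as [ab P].
exists (fun j => fst (ab j)), (fun j => snd (ab j)). split; [|split; [|split]].
- intros j. apply (P j).
- intros j. apply (P j).
- intros j. apply (P j).
- intros z Hz. destruct (proj2 (proj1 (proj2 HWV)) z (HEV z Hz)) as [d [D Hd]].
  destruct (pow_lt_1_zero (/2)) with (y := d) as [j Hj]; [rewrite Rabs_pos_eq; lra|exact D|].
  specialize (Hj j (le_n j)). rewrite Rabs_pos_eq in Hj by (apply pow_le; lra). rewrite pow_inv in Hj.
  exists j. destruct (P j) as [_ [_ [_ P4]]]. apply P4; [exact Hz|]. intros w Hw Hwz. apply Hd; [exact Hw|]. rewrite Cnorm_Cmod.
  change (Csub w z) with (w - z)%C. lra.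
Qed.

Variables (a b : nat -> nat -> R).
Hypotheses (Hab : forall j i, a j i <= b j i) (Hsum : forall j N, rsum (fun i => b j i - a j i) N <= eps / 8 ^ (j + 1))
  (Hfar : forall j i t, a j i < t < b j i -> V (cis t) /\ forall zeta, circle zeta -> ~ V zeta -> 3 / 4 * / 2 ^ j <= Cmod (cis t - zeta)%C)
  (Hcov : forall z, E z -> exists j i, arc (a j i) (b j i) z).

Fixpoint layer (j : nat) : C -> Prop :=
  match j with O => W | S j => fun z => exists k, add_arcs (layer j) (a j) (b j) k z end.
Definition layers (z : C) : Prop := exists j, layer j z.

Lemma layer_open j : rel_open_T (layer j).
Proof. induction j; [apply HWV|]. apply rel_open_ex. intros k. apply add_arcs_open. exact IHj. Qed.
Lemma layer_incr j z : layer j z -> layer (S j) z.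
Proof. intros H. exists O. exact H. Qed.
Lemma layers_open : rel_open_T layers.
Proof. apply rel_open_ex. apply layer_open. Qed.
Lemma layer_sub j z : layer j z -> V z.
Proof.
revert z. induction j; intros z H; [apply HWV; exact H|]. destruct H as [k Hk]. induction k; [apply IHj; exact Hk|].
destruct Hk as [Hk|[t [Ht ->]]]; [apply IHk; exact Hk|]. apply (Hfar _ _ _ Ht).
Qed.
Lemma layers_cover z : E z -> layers z.
Proof.
intros Hz. destruct (Hcov z Hz) as [j [i Hji]]. exists (S j), (S i). right. exact Hji.
Qed.

Lemma J_layer j g w : test g -> 0 <= w -> (forall i s t, a j i < t < b j i -> Cmod (cis s - cis t)%C <= / 2 ^ j / 4 -> Cmod (g s) <= w) ->
  Cmod (J (layer (S j)) g - J (layer j) g)%C <= w * eps_at j.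
Proof.
intros Hg W0 Hw. apply (J_add_arcs (layer j) (a j) (b j) g w (/ 2 ^ j / 4)); auto.
- apply layer_open.
- assert (T := inv_pow2_pos j). lra.
Qed.

(** The layers from [j0] on change the integral by at most the sum of
    [4 * 2^j * eps_at j = eps / (2 * 4^j)], which is dominated by the telescoping sum of
    [eps / 4^j - eps / 4^(j + 1)]. *)
Lemma J_layers j0 g : test g ->
  (forall j i s t, a j i < t < b j i -> Cmod (cis s - cis t)%C <= / 2 ^ j / 4 -> Cmod (g s) <= 4 * 2 ^ j) ->
  Cmod (J layers g - J (layer j0) g)%C <= eps / 4 ^ j0.
Proof.
intros Hg Hw. apply (J_continuous_below layer g _ _ j0); [apply layer_open|apply layer_incr|exact Hg|].
intros k Hk. assert (P4 : forall j, 0 < 4 ^ j) by (intros; apply pow_lt; lra).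
apply Rle_trans with (eps / 4 ^ j0 - eps / 4 ^ k).
- induction Hk as [|k Hk IH].
  + replace (J (layer j0) g - J (layer j0) g)%C with (RtoC 0) by ring. rewrite Cmod_0. lra.
  + assert (T := J_layer k g (4 * 2 ^ k) Hg ltac:(assert (T := pow2_pos k); lra) (Hw k)).
    replace (J (layer (S k)) g - J (layer j0) g)%C with ((J (layer (S k)) g - J (layer k) g) + (J (layer k) g - J (layer j0) g))%C by ring.
    eapply Rle_trans; [apply Cmod_triangle|].
    assert (X : 4 * 2 ^ k * eps_at k <= eps / 4 ^ k - eps / 4 ^ S k).
    { unfold eps_at. rewrite pow_add, pow_1. replace (8 ^ k) with (4 ^ k * 2 ^ k) by (rewrite <- Rpow_mult_distr; f_equal; lra).
      specialize (P4 k). assert (P2 := pow2_pos k). simpl pow.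
      replace (4 * 2 ^ k * (eps / (4 ^ k * 2 ^ k * 8))) with (/ 2 * (eps / 4 ^ k)) by (field; lra).
      replace (eps / (4 * 4 ^ k)) with (/ 4 * (eps / 4 ^ k)) by (field; lra).
      assert (0 < eps / 4 ^ k) by (apply Rdiv_lt_0_compat; lra). lra. }
    lra.
- assert (0 < eps / 4 ^ k) by (apply Rdiv_lt_0_compat; [lra|apply P4]). lra.
Qed.

Lemma layers_near_far j i s t (zeta : C) : circle zeta -> ~ V zeta -> a j i < t < b j i -> Cmod (cis s - cis t)%C <= / 2 ^ j / 4 ->
  / 2 ^ j / 2 <= Cmod (cis s - zeta)%C.
Proof.
intros Hz Nz Ht Hs. destruct (Hfar j i t Ht) as [_ F]. specialize (F zeta Hz Nz).
replace (cis t - zeta)%C with ((cis s - zeta) - (cis s - cis t))%C in F by ring.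
assert (T := Cmod_minus_le (cis s - zeta) (cis s - cis t)). lra.
Qed.

Lemma S_layers j0 (zeta : C) r : circle zeta -> ~ V zeta -> 0 <= r < 1 ->
  Cmod (cauchy_of layers (RtoC r * zeta) - cauchy_of (layer j0) (RtoC r * zeta))%C <= eps / 4 ^ j0.
Proof.
intros Hz Nz Hr. apply J_layers.
- apply test_kernel. rewrite Cmod_rzeta; try assumption; lra.
- intros j i s t Ht Hs. assert (F := layers_near_far j i s t zeta Hz Nz Ht Hs). assert (P := inv_pow2_pos j). assert (P2 := pow2_pos j).
  replace (4 * 2 ^ j) with (2 / (/ 2 ^ j / 2)) by (field; lra).
  apply kernel_far; try assumption; lra.
Qed.

Lemma mu_layers : mu layers - mu W <= eps.
Proof.
assert (T := J_layers O (fun _ => 1) (test_const 1)). rewrite !J_one in T. simpl layer in T.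
rewrite <- RtoC_minus, (Cmod_R (mu layers - mu W)) in T. replace (eps / 4 ^ 0) with eps in T by (simpl; field).
eapply Rle_trans; [apply Rle_abs|apply T]. intros j i s t _ _. rewrite Cmod_1. assert (P : 1 <= 2 ^ j) by (apply pow_R1_Rle; lra). lra.
Qed.

(** The arcs added in one layer keep a positive distance from [zeta], so their contribution to the
    transform is Lipschitz along the radius and converges; [rcauchy_inv_shift] then preserves a
    limit in the sphere. *)
Lemma layer_limit j (zeta : C) : circle zeta -> ~ V zeta -> has_ray_limit (layer j) zeta.
Proof.
intros Hz Nz.
assert (A : forall r, 0 <= r < 1 -> Cmod (RtoC r * zeta)%C < 1) by (intros r Hr; rewrite Cmod_rzeta; try assumption; lra).
induction j; [apply HWV; assumption|].
apply (rcauchy_inv_shift (fun r => cauchy_of (layer j) (RtoC r * zeta)%C) (fun r => cauchy_of (layer (S j)) (RtoC r * zeta)%C)).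
- intros r Hr. apply one_plus_cauchy_of, A, Hr.
- intros r Hr. apply one_plus_cauchy_of, A, Hr.
- exact IHj.
- set (d := / 2 ^ j / 2). assert (D : 0 < d) by (unfold d; assert (P := inv_pow2_pos j); lra).
  apply (rcauchy_lipschitz _ (2 / d * (2 / d) * eps_at j) 0 Rlt_0_1). intros r r' Hr Hr'.
  assert (T1 := test_kernel _ (A r ltac:(lra))). assert (T2 := test_kernel _ (A r' ltac:(lra))).
  set (g := fun t => (cauchy_kernel (RtoC r * zeta) t - cauchy_kernel (RtoC r' * zeta) t)%C).
  assert (B := J_layer j g (Rabs (r - r') * (2 / d * (2 / d))) (test_minus _ _ T1 T2)).
  unfold g in B. rewrite !J_minus in B by assumption. unfold cauchy_of.
  match goal with |- Cmod ?x <= _ => match type of B with _ -> _ -> Cmod ?y <= _ => replace x with y by ring end end.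
  eapply Rle_trans; [apply B|right; ring].
  + assert (0 < 2 / d) by (apply Rdiv_lt_0_compat; lra). apply Rmult_le_pos; [apply Rabs_pos|]. nra.
  + intros i s t Ht Hs. apply kernel_far_lip; try assumption; try lra. apply (layers_near_far j i s t); assumption.
Qed.

(** Along the radius the transforms of the layers converge uniformly at rate [eps / 4^j], and
    [recip] does not increase differences. *)
Lemma layers_limit (zeta : C) : circle zeta -> ~ V zeta -> has_ray_limit layers zeta.
Proof.
intros Hz Nz. apply rcauchy_uniform. intros e He.
destruct (pow_lt_1_zero (/4)) with (y := e) as [j Hj]; [rewrite Rabs_pos_eq; lra|exact He|].
specialize (Hj j (le_n j)). rewrite Rabs_pos_eq in Hj by (apply pow_le; lra). rewrite pow_inv in Hj.
exists (ray (recip (layer j)) zeta), 0. split; [lra|]. split; [apply layer_limit; assumption|].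
intros r Hr. unfold ray. eapply Rle_trans; [apply recip_diff; rewrite Cmod_rzeta; try assumption; lra|].
eapply Rle_trans; [apply S_layers; try assumption; lra|].
assert (0 < / 4 ^ j) by (apply Rinv_0_lt_compat, pow_lt; lra). unfold Rdiv. nra.
Qed.

Lemma layers_thin : thin layers V.
Proof.
split; [apply layers_open|]. split; [apply HWV|]. split; [intros z [j Hj]; apply (layer_sub j); exact Hj|]. apply layers_limit.
Qed.
End Interpolation.

Lemma no_limit_null X : null_T (fun zeta => circle zeta /\ ~ has_ray_limit X zeta).
Proof.
assert (T := fatou (recip X) 1 (fun z => recip_cdiff X z) (fun z => recip_bound X z)).
intros eps He. destruct (T eps He) as [a [b [H1 [H2 H3]]]]. exists a, b. split; [exact H1|]. split; [exact H2|].
intros z [Hz Hn]. apply H3. split; [exact Hz|]. rewrite radial_limit_iff. exact Hn.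
Qed.

(* An analogue of the Lusin-Menchoff property for the relation [thin]. *)
Theorem thin_interpolation W V eps : thin W V -> 0 < eps <= 1 -> exists X, thin W X /\ thin X V /\
  (forall zeta, circle zeta -> ~ V zeta -> forall r, 0 <= r < 1 -> Cmod (cauchy_of X (RtoC r * zeta) - cauchy_of W (RtoC r * zeta))%C <= eps) /\
  mu X - mu W <= eps.
Proof.
(* The bad points of [W] form a null set by Fatou's theorem, inside [V] because [W] is thin in [V].
   Once [X] covers them, [W] is thin in [X]. *)
intros HWV He. set (E := fun zeta => circle zeta /\ ~ has_ray_limit W zeta).
assert (HEV : forall z, E z -> V z).
{ intros z [Hz Hn]. apply NNPP. intros Q. apply Hn. apply HWV; assumption. }
destruct (thin_cover W V E eps HWV (no_limit_null W) HEV He) as [a [b [H1 [H2 [H3 H4]]]]].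
exists (layers W a b). split; [|split; [|split]].
- split; [apply HWV|]. split; [apply (layers_open W V HWV)|]. split; [intros z Hz; exists O; exact Hz|].
  intros zeta Hz Hn. apply NNPP. intros Q. apply Hn. apply (layers_cover W E a b H4). split; assumption.
- apply (layers_thin W V eps HWV He a b H1 H2 H3).
- intros zeta Hz Nz r Hr. assert (T := S_layers W V eps HWV He a b H1 H2 H3 O zeta r Hz Nz Hr). simpl layer in T.
  replace (eps / 4 ^ 0) with eps in T by (simpl; field). exact T.
- apply (mu_layers W V eps HWV He a b H1 H2).
Qed.

Lemma not_inside_empty n p : ~ inside (fun _ => False) n p.
Proof. intros H. apply (H (angle n p)). assert (T := angle_le n p). lra. Qed.
Lemma mu_empty : mu (fun _ => False) = 0.
Proof.
assert (E0 : forall n, mu_level n (fun _ => False) = 0).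
{ intros n. unfold mu_level. rewrite (rsum_ext _ (fun _ => 0)); [rewrite rsum_const; ring|]. intros p _.
  rewrite ind_false by apply not_inside_empty. ring. }
unfold mu. rewrite (Lim_seq_ext _ (fun _ => 0) E0), Lim_seq_const. reflexivity.
Qed.
Lemma cauchy_of_empty z : Cmod z < 1 -> cauchy_of (fun _ => False) z = 0.
Proof.
intros Hz. apply (Clim_unique (fun n => J_level n (fun _ => False) (cauchy_kernel z))); [apply J_lim, test_kernel; exact Hz|].
apply (Clim_ext (fun _ => RtoC 0)); [|apply Clim_const]. intros n. unfold J_level. generalize (2 ^ n)%nat. intros m.
induction m; simpl; [reflexivity|]. rewrite <- IHm, ind_false by apply not_inside_empty. ring.
Qed.
Lemma cauchy_of_bound X z : Cmod z < 1 -> Cmod (cauchy_of X z) <= mu X / (1 - Cmod z).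
Proof.
intros Hz. assert (T := cauchy_of_sub (fun _ => False) X z (fun z H => False_ind _ H) Hz). rewrite mu_empty, cauchy_of_empty, Rminus_0_r in T by exact Hz.
replace (cauchy_of X z - 0)%C with (cauchy_of X z) in T by ring. exact T.
Qed.

Theorem thin_neighbourhood E V eps : rel_open_T V -> null_T E -> (forall z, E z -> V z) -> 0 < eps <= 1 -> exists X, thin X V /\
  (forall z, E z -> X z) /\
  (forall zeta, circle zeta -> ~ V zeta -> forall r, 0 <= r < 1 -> Cmod (cauchy_of X (RtoC r * zeta))%C <= eps) /\
  mu X <= eps.
Proof.
intros HV HE HEV He. set (W := fun _ : C => False).
assert (mu0 : mu W = 0) by apply mu_empty.
assert (S0 : forall z, Cmod z < 1 -> cauchy_of W z = 0) by apply cauchy_of_empty.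
assert (HWV : thin W V).
{ split; [|split; [exact HV|split]].
  - split; intros z [].
  - intros z [].
  - intros zeta Hz _. apply (rcauchy_lipschitz _ 0 0 Rlt_0_1). intros r s Hr Hs. unfold ray, recip.
    rewrite !S0 by (rewrite Cmod_rzeta; try assumption; lra).
    match goal with |- Cmod (?x - ?x)%C <= _ => replace (x - x)%C with (RtoC 0) by ring end. rewrite Cmod_0. lra. }
destruct (thin_cover W V E eps HWV HE HEV He) as [a [b [H1 [H2 [H3 H4]]]]].
exists (layers W a b). split; [|split; [|split]].
- apply (layers_thin W V eps HWV He a b H1 H2 H3).
- apply (layers_cover W E a b H4).
- intros zeta Hz Nz r Hr. assert (T := S_layers W V eps HWV He a b H1 H2 H3 O zeta r Hz Nz Hr). simpl layer in T.
  rewrite S0 in T by (rewrite Cmod_rzeta; try assumption; lra).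
  replace (eps / 4 ^ 0) with eps in T by (simpl; field).
  assert (Z : forall x : C, (x - 0)%C = x) by (intros; ring). rewrite Z in T. exact T.
- assert (T := mu_layers W V eps HWV He a b H1 H2). lra.
Qed.

(** * Averaging over a dense chain of open sets *)

Definition is_mid (eps : R) (V W X : C -> Prop) : Prop := thin W X /\ thin X V /\
  (forall zeta, circle zeta -> ~ V zeta -> forall r, 0 <= r < 1 -> Cmod (cauchy_of X (RtoC r * zeta) - cauchy_of W (RtoC r * zeta))%C <= eps) /\
  mu X - mu W <= eps.
Definition mid (eps : R) (V W : C -> Prop) : C -> Prop := epsilon (inhabits V) (is_mid eps V W).

Lemma mid_spec eps V W : thin W V -> 0 < eps <= 1 -> is_mid eps V W (mid eps V W).
Proof. intros H He. unfold mid. apply epsilon_spec. apply thin_interpolation; assumption. Qed.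

Definition ratio (W : C -> Prop) (z : C) : C := (1 - recip W z)%C.

Lemma ratio_eq W z : Cmod z < 1 -> ratio W z = (cauchy_of W z * recip W z)%C.
Proof.
intros Hz. unfold ratio, recip. assert (P := one_plus_cauchy_of W z Hz). field. apply Cmod_gt_0. lra.
Qed.
Lemma ratio_le_cauchy_of W z : Cmod z < 1 -> Cmod (ratio W z) <= Cmod (cauchy_of W z).
Proof.
intros Hz. rewrite ratio_eq, Cmod_mult by exact Hz. assert (T := recip_bound W z Hz). assert (P := Cmod_ge_0 (cauchy_of W z)). nra.
Qed.
Lemma ratio_bound W z : Cmod z < 1 -> Cmod (ratio W z) <= 1.
Proof.
intros Hz. rewrite ratio_eq, Cmod_mult by exact Hz. unfold recip. assert (P := one_plus_cauchy_of W z Hz).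
rewrite Cmod_inv by (apply Cmod_gt_0; lra).
assert (F := cauchy_of_fst_pos W z Hz).
assert (L : Cmod (cauchy_of W z) <= Cmod (1 + cauchy_of W z)%C).
{ unfold Cmod. apply sqrt_le_1_alt. cbn [fst snd Cplus RtoC]. nra. }
apply (Rmult_le_reg_r (Cmod (1 + cauchy_of W z)%C)); [lra|]. rewrite Rmult_assoc, Rinv_l by lra. lra.
Qed.
Lemma ratio_fst W z : Cmod z < 1 -> 0 <= fst (ratio W z).
Proof.
intros Hz. assert (T := recip_bound W z Hz). assert (T2 := Rabs_fst_le (recip W z)). assert (T3 := Rle_abs (fst (recip W z))).
change (fst (ratio W z)) with (1 - fst (recip W z)). lra.
Qed.
Lemma ratio_diff X Y z : Cmod z < 1 -> Cmod (ratio X z - ratio Y z)%C <= Cmod (cauchy_of X z - cauchy_of Y z)%C.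
Proof.
intros Hz. unfold ratio. replace (1 - recip X z - (1 - recip Y z))%C with (- (recip X z - recip Y z))%C by ring. rewrite Cmod_opp. apply recip_diff. exact Hz.
Qed.
Lemma ratio_cdiff W z : Cmod z < 1 -> cdiff (ratio W) z.
Proof. intros Hz. apply cdiff_minus; [apply cdiff_const|apply recip_cdiff; exact Hz]. Qed.

Definition half (x y : C) : C := (RtoC (/ 2) * (x + y))%C.

(* The average of [ratio X] over the smaller sets [X] of the [2 ^ k] links of the chain from [W] to [V] obtained after [k] rounds
   of inserting intermediate sets. *)
Fixpoint avg (k : nat) (eps : R) (V W : C -> Prop) (z : C) : C :=
  match k with
  | O => ratio W z
  | S k => half (avg k (eps / 2) V (mid eps V W) z) (avg k (eps / 2) (mid eps V W) W z)
  end.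

Lemma half_diff x y u v : Cmod (half x y - half u v)%C <= / 2 * (Cmod (x - u)%C + Cmod (y - v)%C).
Proof.
unfold half. replace (RtoC (/ 2) * (x + y) - RtoC (/ 2) * (u + v))%C with (RtoC (/ 2) * ((x - u) + (y - v)))%C by ring.
rewrite Cmod_mult, Cmod_R, Rabs_pos_eq by lra. apply Rmult_le_compat_l; [lra|apply Cmod_triangle].
Qed.
Lemma half_same x : half x x = x.
Proof. unfold half. apply injective_projections; cbn [fst snd Cmult Cplus RtoC]; field. Qed.
Lemma half_bound x y w : Cmod x <= w -> Cmod y <= w -> Cmod (half x y) <= w.
Proof.
intros Hx Hy. unfold half. rewrite Cmod_mult, Cmod_R, Rabs_pos_eq by lra. assert (T := Cmod_triangle x y). lra.
Qed.
Lemma fst_half x y : fst (half x y) = / 2 * (fst x + fst y).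
Proof. unfold half. cbn [fst snd Cmult Cplus RtoC]. ring. Qed.

Lemma avg_cdiff k : forall eps V W z, Cmod z < 1 -> cdiff (avg k eps V W) z.
Proof.
induction k; intros eps V W z Hz; [apply ratio_cdiff; exact Hz|]. simpl. unfold half.
apply cdiff_mult; [apply cdiff_const|]. apply cdiff_plus; apply IHk; exact Hz.
Qed.
Lemma avg_bound k : forall eps V W z, Cmod z < 1 -> Cmod (avg k eps V W z) <= 1.
Proof. induction k; intros eps V W z Hz; [apply ratio_bound; exact Hz|]. simpl. apply half_bound; apply IHk; exact Hz. Qed.
Lemma avg_fst k : forall eps V W z, Cmod z < 1 -> 0 <= fst (avg k eps V W z).
Proof.
induction k; intros eps V W z Hz; [apply ratio_fst; exact Hz|]. simpl avg. rewrite fst_half.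
assert (T1 := IHk (eps / 2) V (mid eps V W) z Hz). assert (T2 := IHk (eps / 2) (mid eps V W) W z Hz). lra.
Qed.

(** Refining one link moves its term by at most the difference of the measures of its two sets over
    [1 - |z|]. These differences telescope along the chain, and every term has weight [2^-k]. *)
Lemma avg_step k : forall eps V W z, thin W V -> 0 < eps <= 1 -> Cmod z < 1 ->
  Cmod (avg (S k) eps V W z - avg k eps V W z)%C <= / 2 ^ k * ((mu V - mu W) / (1 - Cmod z)).
Proof.
induction k; intros eps V W z HWV He Hz; destruct (mid_spec eps V W HWV He) as [H1 [H2 _]].
- simpl avg. set (X := mid eps V W) in *. rewrite <- (half_same (ratio W z)) at 2.
  eapply Rle_trans; [apply half_diff|]. replace (ratio W z - ratio W z)%C with (RtoC 0) by ring. rewrite Cmod_0.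
  assert (T := cauchy_of_sub W X z (proj1 (proj2 (proj2 H1))) Hz). assert (T2 := ratio_diff X W z Hz).
  assert (M : mu X <= mu V) by (apply mu_mono; apply H2).
  assert (M2 : mu W <= mu X) by (apply mu_mono; apply H1).
  assert ((mu X - mu W) / (1 - Cmod z) <= (mu V - mu W) / (1 - Cmod z)).
  { apply Rmult_le_compat_r; [left; apply Rinv_0_lt_compat; lra|lra]. }
  assert (0 <= (mu X - mu W) / (1 - Cmod z)) by (apply Rdiv_le_0_compat; lra).
  assert (P := Cmod_ge_0 (ratio X z - ratio W z)%C). simpl pow. rewrite Rinv_1. lra.
- change (avg (S (S k)) eps V W z) with
    (half (avg (S k) (eps / 2) V (mid eps V W) z) (avg (S k) (eps / 2) (mid eps V W) W z)).
  change (avg (S k) eps V W z) with (half (avg k (eps / 2) V (mid eps V W) z) (avg k (eps / 2) (mid eps V W) W z)).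
  set (X := mid eps V W) in *. eapply Rle_trans; [apply half_diff|].
  assert (T1 := IHk (eps / 2) V X z H2 ltac:(lra) Hz). assert (T2 := IHk (eps / 2) X W z H1 ltac:(lra) Hz).
  rewrite (inv_pow2_half k) in T1, T2.
  apply Rle_trans with (/ 2 * ((/ 2 ^ S k + / 2 ^ S k) * ((mu V - mu X) / (1 - Cmod z)) +
    (/ 2 ^ S k + / 2 ^ S k) * ((mu X - mu W) / (1 - Cmod z)))); [lra|].
  right. field. split; [lra|apply pow_nonzero; lra].
Qed.

Lemma avg_rate k j eps V W z : thin W V -> 0 < eps <= 1 -> Cmod z < 1 ->
  Cmod (avg (k + j) eps V W z - avg k eps V W z)%C <= 2 * / 2 ^ k / (1 - Cmod z).
Proof.
intros HWV He Hz.
assert (Mu : (mu V - mu W) / (1 - Cmod z) <= / (1 - Cmod z)).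
{ assert (mu V <= 1) by apply mu_le1. assert (0 <= mu W) by (rewrite <- mu_empty; apply mu_mono; intros ? []).
  rewrite <- (Rmult_1_l (/ (1 - Cmod z))). apply Rmult_le_compat_r; [left; apply Rinv_0_lt_compat; lra|lra]. }
assert (IV : 0 < / (1 - Cmod z)) by (apply Rinv_0_lt_compat; lra).
apply Rle_trans with ((2 * / 2 ^ k - 2 * / 2 ^ (k + j)) * / (1 - Cmod z)).
- induction j.
  + rewrite Nat.add_0_r. match goal with |- Cmod (?x - ?x)%C <= _ => replace (x - x)%C with (RtoC 0) by ring end. rewrite Cmod_0. lra.
  + rewrite Nat.add_succ_r.
    replace (avg (S (k + j)) eps V W z - avg k eps V W z)%C with ((avg (S (k + j)) eps V W z - avg (k + j) eps V W z) + (avg (k + j) eps V W z - avg k eps V W z))%C by ring.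
    eapply Rle_trans; [apply Cmod_triangle|]. assert (T := avg_step (k + j) eps V W z HWV He Hz).
    assert (I := inv_pow2_half (k + j)). assert (P := inv_pow2_pos (k + j)).
    assert (/ 2 ^ (k + j) * ((mu V - mu W) / (1 - Cmod z)) <= / 2 ^ (k + j) * / (1 - Cmod z)) by (apply Rmult_le_compat_l; lra).
    nra.
- unfold Rdiv. apply Rmult_le_compat_r; [lra|]. assert (P := inv_pow2_pos (k + j)). lra.
Qed.

Definition chain_limit (eps : R) (V W : C -> Prop) (z : C) : C := epsilon (inhabits (RtoC 0)) (Clim (fun k => avg k eps V W z)).

Lemma chain_limit_spec eps V W z : thin W V -> 0 < eps <= 1 -> Cmod z < 1 -> Clim (fun k => avg k eps V W z) (chain_limit eps V W z).
Proof.
intros HWV He Hz. unfold chain_limit. apply epsilon_spec. apply C_complete. intros e He'.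
destruct (pow_lt_1_zero (/2)) with (y := e * (1 - Cmod z) / 4) as [N HN]; [rewrite Rabs_pos_eq; lra|apply Rdiv_lt_0_compat; [apply Rmult_lt_0_compat|]; lra|].
specialize (HN N (le_n N)). rewrite Rabs_pos_eq in HN by (apply pow_le; lra). rewrite pow_inv in HN.
assert (G : forall n, (N <= n)%nat -> Cmod (avg n eps V W z - avg N eps V W z)%C <= e / 2).
{ intros n Hn. replace n with (N + (n - N))%nat by lia. eapply Rle_trans; [apply avg_rate; assumption|].
  apply (Rmult_le_reg_r (1 - Cmod z)); [lra|]. unfold Rdiv at 1. rewrite Rmult_assoc, Rinv_l by lra. lra. }
exists N. intros n m Hn Hm. assert (A := G n Hn). assert (A' := G m Hm). rewrite Cmod_minus_sym in A'.
replace (avg n eps V W z - avg m eps V W z)%C with ((avg n eps V W z - avg N eps V W z) + (avg N eps V W z - avg m eps V W z))%C by ring.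
eapply Rle_trans; [apply Cmod_triangle|]. lra.
Qed.

Lemma chain_limit_cdiff eps V W z : thin W V -> 0 < eps <= 1 -> Cmod z < 1 -> cdiff (chain_limit eps V W) z.
Proof.
intros HWV He. apply (weierstrass_limit (fun k => avg k eps V W)).
- intros n w Hw. apply avg_cdiff. exact Hw.
- intros R0 HR e He'.
  destruct (pow_lt_1_zero (/2)) with (y := e * (1 - R0) / 2) as [N HN]; [rewrite Rabs_pos_eq; lra|apply Rdiv_lt_0_compat; [apply Rmult_lt_0_compat|]; lra|].
  exists N. intros n Hn w Hw. specialize (HN n Hn). rewrite Rabs_pos_eq in HN by (apply pow_le; lra). rewrite pow_inv in HN.
  rewrite Cmod_minus_sym. apply (Clim_bound (fun k => avg k eps V W w - avg n eps V W w)%C).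
  + apply Clim_minus; [apply chain_limit_spec; try assumption; lra|apply Clim_const].
  + intros e' He''. exists n. intros m Hm. replace m with (n + (m - n))%nat by lia.
    eapply Rle_trans; [apply avg_rate; try assumption; lra|].
    assert (2 * / 2 ^ n / (1 - Cmod w) <= e); [|lra].
    apply (Rmult_le_reg_r (1 - Cmod w)); [lra|]. unfold Rdiv. rewrite Rmult_assoc, Rinv_l by lra.
    assert (e * (1 - R0) <= e * (1 - Cmod w)) by (apply Rmult_le_compat_l; lra). lra.
Qed.

Lemma chain_limit_bound_of eps V W z c w : thin W V -> 0 < eps <= 1 -> Cmod z < 1 -> (forall k, Cmod (avg k eps V W z - c)%C <= w) ->
  Cmod (chain_limit eps V W z - c)%C <= w.
Proof.
intros HWV He Hz H. apply (Clim_bound (fun k => avg k eps V W z - c)%C).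
- apply Clim_minus; [apply chain_limit_spec; assumption|apply Clim_const].
- intros e He'. exists O. intros k _. specialize (H k). lra.
Qed.
Lemma chain_limit_bound eps V W z : thin W V -> 0 < eps <= 1 -> Cmod z < 1 -> Cmod (chain_limit eps V W z) <= 1.
Proof.
intros HWV He Hz. replace (chain_limit eps V W z) with (chain_limit eps V W z - 0)%C by ring.
apply chain_limit_bound_of; try assumption. intros k. replace (avg k eps V W z - 0)%C with (avg k eps V W z) by ring.
apply avg_bound; exact Hz.
Qed.
Lemma chain_limit_split eps V W z : thin W V -> 0 < eps <= 1 -> Cmod z < 1 ->
  chain_limit eps V W z = half (chain_limit (eps / 2) V (mid eps V W) z) (chain_limit (eps / 2) (mid eps V W) W z).
Proof.
intros HWV He Hz. destruct (mid_spec eps V W HWV He) as [H1 [H2 _]].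
apply (Clim_unique (fun k => avg (S k) eps V W z)).
- intros e He'. destruct (chain_limit_spec eps V W z HWV He Hz e He') as [N HN]. exists N. intros n Hn. apply HN. lia.
- intros e He'.
  destruct (chain_limit_spec (eps / 2) V (mid eps V W) z H2 ltac:(lra) Hz e He') as [N1 HN1].
  destruct (chain_limit_spec (eps / 2) (mid eps V W) W z H1 ltac:(lra) Hz e He') as [N2 HN2].
  exists (N1 + N2)%nat. intros n Hn. specialize (HN1 n ltac:(lia)). specialize (HN2 n ltac:(lia)).
  simpl avg. eapply Rle_trans; [apply half_diff|]. lra.
Qed.

(** Passing from [W] to the middle set costs [eps] in one of the two halves, and the tolerance is
    halved at the next round, so the errors stay below [2 * eps] for every [k]. *)
Lemma avg_near_ray k : forall eps V W zeta r, thin W V -> 0 < eps <= 1 -> circle zeta -> ~ V zeta -> 0 <= r < 1 ->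
  Cmod (avg k eps V W (RtoC r * zeta) - ratio W (RtoC r * zeta))%C <= 2 * eps.
Proof.
induction k; intros eps V W zeta r HWV He Hz Nz Hr.
- simpl. match goal with |- Cmod (?x - ?x)%C <= _ => replace (x - x)%C with (RtoC 0) by ring end. rewrite Cmod_0. lra.
- simpl avg. destruct (mid_spec eps V W HWV He) as [H1 [H2 [H3 _]]]. set (X := mid eps V W) in *.
  set (z := (RtoC r * zeta)%C) in *. assert (Az : Cmod z < 1) by (unfold z; rewrite Cmod_rzeta; try assumption; lra).
  rewrite <- (half_same (ratio W z)). eapply Rle_trans; [apply half_diff|].
  assert (T1 := IHk (eps / 2) V X zeta r H2 ltac:(lra) Hz Nz Hr).
  assert (T2 := IHk (eps / 2) X W zeta r H1 ltac:(lra) Hz ltac:(intros Q; apply Nz; apply H2; exact Q) Hr).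
  specialize (H3 zeta Hz Nz r Hr). fold z in T1, T2, H3. assert (T3 := ratio_diff X W z Az).
  assert (T4 : Cmod (avg k (eps / 2) V X z - ratio W z)%C <= Cmod (avg k (eps / 2) V X z - ratio X z)%C + Cmod (ratio X z - ratio W z)%C).
  { replace (avg k (eps / 2) V X z - ratio W z)%C with ((avg k (eps / 2) V X z - ratio X z) + (ratio X z - ratio W z))%C by ring. apply Cmod_triangle. }
  lra.
Qed.
Lemma avg_near_disc k : forall eps V W z, thin W V -> 0 < eps <= 1 -> Cmod z < 1 ->
  Cmod (avg k eps V W z - ratio W z)%C <= 2 * eps / (1 - Cmod z).
Proof.
induction k; intros eps V W z HWV He Hz; assert (IV : 0 < / (1 - Cmod z)) by (apply Rinv_0_lt_compat; lra).
- simpl. match goal with |- Cmod (?x - ?x)%C <= _ => replace (x - x)%C with (RtoC 0) by ring end. rewrite Cmod_0.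
  apply Rdiv_le_0_compat; lra.
- simpl avg. destruct (mid_spec eps V W HWV He) as [H1 [H2 [_ H4]]]. set (X := mid eps V W) in *.
  rewrite <- (half_same (ratio W z)). eapply Rle_trans; [apply half_diff|].
  assert (T1 := IHk (eps / 2) V X z H2 ltac:(lra) Hz).
  assert (T2 := IHk (eps / 2) X W z H1 ltac:(lra) Hz).
  assert (T3 := ratio_diff X W z Hz). assert (T5 := cauchy_of_sub W X z (proj1 (proj2 (proj2 H1))) Hz).
  assert (T6 : (mu X - mu W) / (1 - Cmod z) <= eps / (1 - Cmod z)) by (apply Rmult_le_compat_r; lra).
  assert (T4 : Cmod (avg k (eps / 2) V X z - ratio W z)%C <= Cmod (avg k (eps / 2) V X z - ratio X z)%C + Cmod (ratio X z - ratio W z)%C).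
  { replace (avg k (eps / 2) V X z - ratio W z)%C with ((avg k (eps / 2) V X z - ratio X z) + (ratio X z - ratio W z))%C by ring. apply Cmod_triangle. }
  replace (2 * (eps / 2) / (1 - Cmod z)) with (eps / (1 - Cmod z)) in T1, T2 by (field; lra).
  replace (2 * eps / (1 - Cmod z)) with (2 * (eps / (1 - Cmod z))) by (field; lra).
  assert (0 < eps / (1 - Cmod z)) by (apply Rdiv_lt_0_compat; lra). lra.
Qed.

(** A quantitative form of [rcauchy]: when a function is the mean of two halves, bounds for their
    oscillations average as well. *)
Definition rosc (phi : R -> C) (x : R) : Prop :=
  exists r0, 0 <= r0 < 1 /\ forall r s, r0 < r < 1 -> r0 < s < 1 -> Cmod (phi r - phi s)%C <= x.

Lemma rcauchy_rosc phi : rcauchy phi <-> forall x, 0 < x -> rosc phi x.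
Proof.
split; intros H x Hx.
- destruct (H x Hx) as [r0 [R0 Hr]]. exists (Rmax 0 r0). assert (A := Rmax_l 0 r0). assert (A2 := Rmax_r 0 r0).
  split; [split; [lra|apply Rmax_lub_lt; lra]|]. intros r s H1 H2. apply Hr; lra.
- destruct (H x Hx) as [r0 [R0 Hr]]. exists r0. split; [lra|exact Hr].
Qed.

Lemma rosc_half phi psi chi x y : (forall r, 0 <= r < 1 -> chi r = half (phi r) (psi r)) -> rosc phi x -> rosc psi y -> rosc chi (/ 2 * (x + y)).
Proof.
intros E [r0 [R0 H0]] [r1 [R1 H1]]. exists (Rmax r0 r1). assert (A := Rmax_l r0 r1). assert (A2 := Rmax_r r0 r1).
split; [split; [lra|apply Rmax_lub_lt; lra]|]. intros r s Hr Hs. rewrite !E by lra.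
eapply Rle_trans; [apply half_diff|]. specialize (H0 r s ltac:(lra) ltac:(lra)). specialize (H1 r s ltac:(lra) ltac:(lra)). lra.
Qed.

Lemma ray_split eps V W zeta : thin W V -> 0 < eps <= 1 -> circle zeta -> forall r, 0 <= r < 1 ->
  ray (chain_limit eps V W) zeta r = half (ray (chain_limit (eps / 2) V (mid eps V W)) zeta r) (ray (chain_limit (eps / 2) (mid eps V W) W) zeta r).
Proof. intros HWV He Hz r Hr. apply chain_limit_split; try assumption. rewrite Cmod_rzeta; try assumption; lra. Qed.

(** After [k] splittings each link has tolerance [eps / 2^k], and along the radius its function is
    within [2 * eps / 2^k] of [ratio] of its smaller set, which has a radial limit at [zeta] by
    thinness. *)
Lemma chain_outside k : forall eps V W zeta x, thin W V -> 0 < eps <= 1 -> circle zeta -> ~ V zeta -> 0 < x ->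
  rosc (ray (chain_limit eps V W) zeta) (4 * eps / 2 ^ k + x).
Proof.
induction k; intros eps V W zeta x HWV He Hz Nz Hx.
- assert (L := proj1 (rcauchy_rosc _) (proj2 (proj2 (proj2 HWV)) zeta Hz Nz) x Hx). destruct L as [r0 [R0 Hr]].
  exists r0. split; [exact R0|]. intros r s H1 H2.
  assert (G : forall r, r0 < r < 1 -> Cmod (ray (chain_limit eps V W) zeta r - ray (ratio W) zeta r)%C <= 2 * eps).
  { intros t Ht. apply chain_limit_bound_of; try assumption; [rewrite Cmod_rzeta; try assumption; lra|].
    intros j. apply (avg_near_ray j eps V W zeta t); try assumption; lra. }
  assert (G1 := G r H1). assert (G2 := G s H2). rewrite Cmod_minus_sym in G2. specialize (Hr r s H1 H2).
  assert (E : Cmod (ray (ratio W) zeta r - ray (ratio W) zeta s)%C = Cmod (ray (recip W) zeta r - ray (recip W) zeta s)%C).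
  { rewrite <- Cmod_opp. f_equal. unfold ray, ratio. ring. }
  set (f := ray (chain_limit eps V W) zeta) in *. set (g := ray (ratio W) zeta) in *.
  replace (f r - f s)%C with ((f r - g r) + (g r - g s) + (g s - f s))%C by ring.
  eapply Rle_trans; [apply Cmod_triangle|]. eapply Rle_trans; [apply Rplus_le_compat_r, Cmod_triangle|].
  replace (4 * eps / 2 ^ 0) with (4 * eps) by (simpl; field). lra.
- destruct (mid_spec eps V W HWV He) as [H1 [H2 _]].
  assert (A := IHk (eps / 2) V (mid eps V W) zeta x H2 ltac:(lra) Hz Nz Hx).
  assert (A2 := IHk (eps / 2) (mid eps V W) W zeta x H1 ltac:(lra) Hz ltac:(intros Q; apply Nz; apply H2; exact Q) Hx).
  assert (T := rosc_half _ _ _ _ _ (ray_split eps V W zeta HWV He Hz) A A2).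
  replace (4 * eps / 2 ^ S k + x) with (/ 2 * (4 * (eps / 2) / 2 ^ k + x + (4 * (eps / 2) / 2 ^ k + x))); [exact T|].
  simpl. field. apply pow_nonzero; lra.
Qed.

(** Every set averaged contains [W], so [cauchy_of_lip_inside] holds for all of them with the same
    [rho], and the Lipschitz constant does not depend on [k]. *)
Lemma avg_inside k : forall eps V W zeta rho r s, thin W V -> 0 < eps <= 1 -> circle zeta -> 0 < rho ->
  (forall w, circle w -> Cmod (w - zeta)%C < rho -> W w) -> 0 <= r < 1 -> 0 <= s < 1 ->
  Cmod (avg k eps V W (RtoC r * zeta) - avg k eps V W (RtoC s * zeta))%C <= 16 / rho ^ 2 * Rabs (r - s).
Proof.
induction k; intros eps V W zeta rho r s HWV He Hz Hrho HW Hr Hs.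
- simpl. unfold ratio.
  assert (A : forall r, 0 <= r < 1 -> Cmod (RtoC r * zeta)%C < 1) by (intros t Ht; rewrite Cmod_rzeta; try assumption; lra).
  replace (1 - recip W (RtoC r * zeta) - (1 - recip W (RtoC s * zeta)))%C with (- (recip W (RtoC r * zeta) - recip W (RtoC s * zeta)))%C by ring.
  rewrite Cmod_opp. unfold recip. eapply Rle_trans; [apply inv_diff_bound; apply one_plus_cauchy_of, A; lra|].
  replace (1 + cauchy_of W (RtoC r * zeta) - (1 + cauchy_of W (RtoC s * zeta)))%C with (cauchy_of W (RtoC r * zeta) - cauchy_of W (RtoC s * zeta))%C by ring.
  apply cauchy_of_lip_inside; assumption.
- simpl avg. destruct (mid_spec eps V W HWV He) as [H1 [H2 _]].
  eapply Rle_trans; [apply half_diff|].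
  assert (T1 := IHk (eps / 2) V (mid eps V W) zeta rho r s H2 ltac:(lra) Hz Hrho (fun w Hw Hd => proj1 (proj2 (proj2 H1)) w (HW w Hw Hd)) Hr Hs).
  assert (T2 := IHk (eps / 2) (mid eps V W) W zeta rho r s H1 ltac:(lra) Hz Hrho HW Hr Hs). lra.
Qed.

Lemma open_radius W zeta : rel_open_T W -> W zeta -> circle zeta /\ exists rho, 0 < rho /\ forall w, circle w -> Cmod (w - zeta)%C < rho -> W w.
Proof.
intros [H1 H2] Hz. split; [apply H1; exact Hz|]. destruct (H2 zeta Hz) as [d [D Hd]]. exists d. split; [exact D|].
intros w Hw Hwz. apply Hd; [exact Hw|]. rewrite Cnorm_Cmod. exact Hwz.
Qed.

Lemma chain_inside eps V W zeta : thin W V -> 0 < eps <= 1 -> W zeta -> rcauchy (ray (chain_limit eps V W) zeta).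
Proof.
intros HWV He Hz. destruct (open_radius W zeta (proj1 HWV) Hz) as [Hc [rho [Hrho HW]]].
apply (rcauchy_lipschitz _ (16 / rho ^ 2) 0 Rlt_0_1). intros r s Hr Hs. unfold ray.
apply (Clim_bound (fun k => avg k eps V W (RtoC r * zeta) - avg k eps V W (RtoC s * zeta))%C).
- apply Clim_minus; apply chain_limit_spec; try assumption; rewrite Cmod_rzeta; try assumption; lra.
- intros e He'. exists O. intros k _. assert (T := avg_inside k eps V W zeta rho r s HWV He Hc Hrho HW ltac:(lra) ltac:(lra)). lra.
Qed.

Lemma chain_outside_cauchy eps V W zeta : thin W V -> 0 < eps <= 1 -> circle zeta -> ~ V zeta -> rcauchy (ray (chain_limit eps V W) zeta).
Proof.
intros HWV He Hz Nz. apply rcauchy_rosc. intros x Hx.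
destruct (pow_lt_1_zero (/2)) with (y := x / 8) as [k Hk]; [rewrite Rabs_pos_eq; lra|lra|].
specialize (Hk k (le_n k)). rewrite Rabs_pos_eq in Hk by (apply pow_le; lra). rewrite pow_inv in Hk.
destruct (chain_outside k eps V W zeta (x / 2) HWV He Hz Nz ltac:(lra)) as [r0 [R0 Hr]]. exists r0. split; [exact R0|].
intros r s H1 H2. eapply Rle_trans; [apply Hr; assumption|].
assert (P := inv_pow2_pos k). assert (4 * eps / 2 ^ k <= 4 * / 2 ^ k); [|lra]. unfold Rdiv. apply Rmult_le_compat_r; lra.
Qed.

(* A point of [V \ W] lies either inside or outside the inserted set [mid eps V W], so at least one half of the chain has a
   radial limit there: each step halves the oscillation. *)
Lemma chain_between k : forall eps V W zeta x, thin W V -> 0 < eps <= 1 -> V zeta -> ~ W zeta -> 0 < x ->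
  rosc (ray (chain_limit eps V W) zeta) (2 / 2 ^ k + x).
Proof.
induction k; intros eps V W zeta x HWV He Hv Hw Hx;
  assert (Hz : circle zeta) by (apply (proj1 (proj1 (proj2 HWV))); exact Hv).
- exists 0. split; [lra|]. intros r s Hr Hs. unfold ray. eapply Rle_trans; [apply Cmod_minus_le|].
  assert (T1 := chain_limit_bound eps V W (RtoC r * zeta)%C HWV He ltac:(rewrite Cmod_rzeta; try assumption; lra)).
  assert (T2 := chain_limit_bound eps V W (RtoC s * zeta)%C HWV He ltac:(rewrite Cmod_rzeta; try assumption; lra)).
  simpl. lra.
- destruct (mid_spec eps V W HWV He) as [H1 [H2 _]].
  replace (2 / 2 ^ S k + x) with (/ 2 * (x + (2 / 2 ^ k + x))) by (simpl; field; apply pow_nonzero; lra).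
  destruct (classic (mid eps V W zeta)) as [Hm|Hm].
  + apply (rosc_half _ _ _ _ _ (ray_split eps V W zeta HWV He Hz)).
    * apply rcauchy_rosc; [apply chain_inside; try assumption; lra|exact Hx].
    * apply IHk; try assumption; lra.
  + rewrite (Rplus_comm x). apply (rosc_half _ _ _ _ _ (ray_split eps V W zeta HWV He Hz)).
    * apply IHk; try assumption; lra.
    * apply rcauchy_rosc; [apply chain_outside_cauchy; try assumption; lra|exact Hx].
Qed.

Lemma chain_radial_limit eps V W zeta : thin W V -> 0 < eps <= 1 -> circle zeta -> rcauchy (ray (chain_limit eps V W) zeta).
Proof.
intros HWV He Hz. destruct (classic (W zeta)) as [Hw|Hw]; [apply chain_inside; assumption|].
destruct (classic (V zeta)) as [Hv|Hv]; [|apply chain_outside_cauchy; assumption].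
apply rcauchy_rosc. intros x Hx.
destruct (pow_lt_1_zero (/2)) with (y := x / 4) as [k Hk]; [rewrite Rabs_pos_eq; lra|lra|].
specialize (Hk k (le_n k)). rewrite Rabs_pos_eq in Hk by (apply pow_le; lra). rewrite pow_inv in Hk.
destruct (chain_between k eps V W zeta (x / 2) HWV He Hv Hw ltac:(lra)) as [r0 [R0 Hr]]. exists r0. split; [exact R0|].
intros r s H1 H2. eapply Rle_trans; [apply Hr; assumption|]. unfold Rdiv at 1. lra.
Qed.

(** The transform has real part at least [/ 2 - / 4], so [|1 + S| >= 5/4], and [1 - 1 / (1 + S)] has
    real part at least [1 - 4/5]. *)
Lemma ratio_fst_inside W zeta rho r : circle zeta -> 0 < rho -> (forall w, circle w -> Cmod (w - zeta)%C < rho -> W w) ->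
  0 <= r < 1 -> 16 / rho ^ 2 * (1 - r) <= / 4 -> / 5 <= fst (ratio W (RtoC r * zeta)%C).
Proof.
intros Hz Hrho HW Hr Hs. assert (T := cauchy_of_fst_inside W zeta rho r Hz Hrho HW Hr).
set (z := (RtoC r * zeta)%C) in *. assert (Az : Cmod z < 1) by (unfold z; rewrite Cmod_rzeta; try assumption; lra).
assert (D : 5 / 4 <= Cmod (1 + cauchy_of W z)%C).
{ eapply Rle_trans; [|apply Rabs_fst_le]. change (fst (1 + cauchy_of W z)%C) with (1 + fst (cauchy_of W z)). rewrite Rabs_pos_eq; lra. }
assert (Qb : Cmod (recip W z) <= 4 / 5).
{ unfold recip. rewrite Cmod_inv by (apply Cmod_gt_0; lra). replace (4 / 5) with (/ (5 / 4)) by field. apply Rinv_le_contravar; lra. }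
assert (T2 := Rabs_fst_le (recip W z)). assert (T3 := Rle_abs (fst (recip W z))).
change (fst (ratio W z)) with (1 - fst (recip W z)). lra.
Qed.

Lemma avg_fst_inside k : forall eps V W zeta rho r, thin W V -> 0 < eps <= 1 -> circle zeta -> 0 < rho ->
  (forall w, circle w -> Cmod (w - zeta)%C < rho -> W w) -> 0 <= r < 1 -> 16 / rho ^ 2 * (1 - r) <= / 4 ->
  / 5 <= fst (avg k eps V W (RtoC r * zeta)%C).
Proof.
induction k; intros eps V W zeta rho r HWV He Hz Hrho HW Hr Hs; [apply (ratio_fst_inside W zeta rho); assumption|].
simpl avg. rewrite fst_half. destruct (mid_spec eps V W HWV He) as [H1 [H2 _]].
assert (T1 := IHk (eps / 2) V (mid eps V W) zeta rho r H2 ltac:(lra) Hz Hrho (fun w Hw Hd => proj1 (proj2 (proj2 H1)) w (HW w Hw Hd)) Hr Hs).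
assert (T2 := IHk (eps / 2) (mid eps V W) W zeta rho r H1 ltac:(lra) Hz Hrho HW Hr Hs). lra.
Qed.

(* Kolesnikov's lemma. *)
Theorem bounded_function_large_on_null_set E V eps : rel_open_T V -> null_T E -> (forall z, E z -> V z) -> 0 < eps <= 1 -> exists F : C -> C,
  (forall z, Cmod z < 1 -> cdiff F z) /\ (forall z, Cmod z < 1 -> 0 <= fst (F z)) /\
  (forall zeta, circle zeta -> rcauchy (ray F zeta)) /\
  (forall zeta, E zeta -> exists r0, 0 <= r0 < 1 /\ forall r, r0 < r < 1 -> / 5 <= fst (ray F zeta r)) /\
  (forall zeta, circle zeta -> ~ V zeta -> forall r, 0 <= r < 1 -> Cmod (ray F zeta r) <= 3 * eps) /\
  (forall z, Cmod z < 1 -> Cmod (F z) <= 3 * eps / (1 - Cmod z)).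
Proof.
intros HV HE HEV He. destruct (thin_neighbourhood E V eps HV HE HEV He) as [W [HWV [HEW [HS Hmu]]]].
exists (chain_limit eps V W). split; [|split; [|split; [|split; [|split]]]].
- intros z Hz. apply chain_limit_cdiff; assumption.
- intros z Hz. apply (Clim_fst_ge _ _ _ (chain_limit_spec eps V W z HWV He Hz)). exists O. intros. apply avg_fst; exact Hz.
- intros zeta Hz. apply chain_radial_limit; assumption.
- intros zeta Hz. destruct (open_radius W zeta (proj1 HWV) (HEW zeta Hz)) as [Hc [rho [Hrho HW]]].
  assert (R2 : 0 < rho ^ 2) by (apply pow_lt; exact Hrho).
  (* [64 = 16 * 4]: beyond this radius [16 / rho^2 * (1 - r) <= / 4]. *)
  exists (Rmax 0 (1 - rho ^ 2 / 64)). assert (A := Rmax_l 0 (1 - rho ^ 2 / 64)). assert (A2 := Rmax_r 0 (1 - rho ^ 2 / 64)).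
  split; [split; [lra|apply Rmax_lub_lt; lra]|]. intros r Hr. unfold ray.
  apply (Clim_fst_ge _ _ _ (chain_limit_spec eps V W (RtoC r * zeta)%C HWV He ltac:(rewrite Cmod_rzeta; try assumption; lra))).
  exists O. intros k _. apply (avg_fst_inside k eps V W zeta rho r); try assumption; try lra.
  apply (Rmult_le_reg_r (rho ^ 2)); [exact R2|]. replace (16 / rho ^ 2 * (1 - r) * rho ^ 2) with (16 * (1 - r)) by (field; lra). lra.
(* Of the [3 * eps], the distance to [ratio W] takes [2 * eps] and the transform of [W] takes
   [eps]. *)
- intros zeta Hz Nz r Hr. assert (Az : Cmod (RtoC r * zeta)%C < 1) by (rewrite Cmod_rzeta; try assumption; lra).
  assert (T := chain_limit_bound_of eps V W (RtoC r * zeta)%C (ratio W (RtoC r * zeta)%C) (2 * eps) HWV He Az (fun k => avg_near_ray k eps V W zeta r HWV He Hz Nz Hr)).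
  assert (T2 := ratio_le_cauchy_of W _ Az). specialize (HS zeta Hz Nz r Hr). unfold ray.
  assert (T3 := Cmod_rev_triangle (chain_limit eps V W (RtoC r * zeta)%C) (ratio W (RtoC r * zeta)%C)). lra.
- intros z Hz.
  assert (T := chain_limit_bound_of eps V W z (ratio W z) (2 * eps / (1 - Cmod z)) HWV He Hz (fun k => avg_near_disc k eps V W z HWV He Hz)).
  assert (T2 := ratio_le_cauchy_of W z Hz). assert (T4 := cauchy_of_bound W z Hz).
  assert (T5 : mu W / (1 - Cmod z) <= eps / (1 - Cmod z)) by (apply Rmult_le_compat_r; [left; apply Rinv_0_lt_compat; lra|lra]).
  assert (T3 := Cmod_rev_triangle (chain_limit eps V W z) (ratio W z)).
  replace (3 * eps / (1 - Cmod z)) with (2 * eps / (1 - Cmod z) + eps / (1 - Cmod z)) by (field; lra). lra.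
Qed.

(** * Geometrically convergent series *)

(** The terms are bounded by [K * (1 - q) * q^i] because these bounds sum from [n] on to exactly
    [K * q^n]. *)
Lemma csum_tail (u : nat -> C) K q n : 0 < q < 1 -> 0 <= K ->
  (forall i, (n <= i)%nat -> Cmod (u i) <= K * (1 - q) * q ^ i) ->
  forall m, (n <= m)%nat -> Cmod (csum u m - csum u n)%C <= K * q ^ n.
Proof.
intros Hq HK Hu m Hm. apply Rle_trans with (K * (q ^ n - q ^ m)).
- induction Hm.
  + match goal with |- Cmod (?x - ?x)%C <= _ => replace (x - x)%C with (RtoC 0) by ring end. rewrite Cmod_0. lra.
  + simpl csum. replace (csum u m + u m - csum u n)%C with ((csum u m - csum u n) + u m)%C by ring.
    eapply Rle_trans; [apply Cmod_triangle|]. specialize (Hu m Hm). simpl pow. nra.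
- assert (0 <= q ^ m) by (apply pow_le; lra). nra.
Qed.

Lemma geometric_small K q eps : 0 < q < 1 -> 0 <= K -> 0 < eps -> exists N, forall n, (N <= n)%nat -> K * q ^ n <= eps.
Proof.
intros Hq HK He. destruct (pow_lt_1_zero q) with (y := eps / (K + 1)) as [N HN]; [rewrite Rabs_pos_eq; lra|apply Rdiv_lt_0_compat; lra|].
exists N. intros n Hn. specialize (HN n Hn). assert (0 <= q ^ n) by (apply pow_le; lra). rewrite Rabs_pos_eq in HN by assumption.
assert (E : (K + 1) * (eps / (K + 1)) = eps) by (field; lra). nra.
Qed.

Definition cseries (u : nat -> C) : C := epsilon (inhabits (RtoC 0)) (Clim (csum u)).

Lemma cseries_spec (u : nat -> C) K q n0 : 0 < q < 1 -> 0 <= K -> (forall i, (n0 <= i)%nat -> Cmod (u i) <= K * (1 - q) * q ^ i) -> Clim (csum u) (cseries u).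
Proof.
intros Hq HK Hu. unfold cseries. apply epsilon_spec. apply C_complete. intros e He.
destruct (geometric_small K q (e / 2) Hq HK ltac:(lra)) as [N HN]. exists (N + n0)%nat.
assert (A := HN (N + n0)%nat ltac:(lia)).
assert (T : forall n, (N + n0 <= n)%nat -> Cmod (csum u n - csum u (N + n0))%C <= e / 2).
{ intros n Hn. eapply Rle_trans; [apply (csum_tail u K q); try assumption|exact A]. intros i Hi. apply Hu. lia. }
intros n m Hn Hm. assert (Tn := T n Hn). assert (Tm := T m Hm). rewrite Cmod_minus_sym in Tm.
replace (csum u n - csum u m)%C with ((csum u n - csum u (N + n0)) + (csum u (N + n0) - csum u m))%C by ring.
eapply Rle_trans; [apply Cmod_triangle|lra].
Qed.

Lemma cseries_tail (u : nat -> C) K q n : 0 < q < 1 -> 0 <= K -> (forall i, (n <= i)%nat -> Cmod (u i) <= K * (1 - q) * q ^ i) ->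
  Cmod (cseries u - csum u n)%C <= K * q ^ n.
Proof.
intros Hq HK Hu. apply (Clim_bound (fun m => csum u m - csum u n)%C).
- apply Clim_minus; [apply (cseries_spec u K q n); assumption|apply Clim_const].
- intros e He. exists n. intros m Hm. assert (T := csum_tail u K q n Hq HK Hu m Hm). lra.
Qed.

Lemma cseries_cdiff (fn : nat -> C -> C) K q : 0 < q < 1 -> 0 <= K -> (forall n z, Cmod z < 1 -> cdiff (fn n) z) ->
  (forall n z, Cmod z < 1 -> Cmod (fn n z) <= K / (1 - Cmod z) * (1 - q) * q ^ n) ->
  forall z, Cmod z < 1 -> cdiff (fun z => cseries (fun n => fn n z)) z.
Proof.
intros Hq HK Hd Hb. apply (weierstrass_limit (fun n z => csum (fun i => fn i z) n)).
- intros n z Hz. apply cdiff_csum. intros i _. apply Hd. exact Hz.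
- intros R0 HR e He. assert (KR : 0 <= K / (1 - R0)) by (apply Rdiv_le_0_compat; lra).
  destruct (geometric_small (K / (1 - R0)) q e Hq KR He) as [N HN]. exists N. intros n Hn z Hz. rewrite Cmod_minus_sym.
  eapply Rle_trans; [|apply (HN n Hn)]. apply cseries_tail; try assumption. intros i _.
  eapply Rle_trans; [apply Hb; lra|]. apply Rmult_le_compat_r; [apply pow_le; lra|]. apply Rmult_le_compat_r; [lra|].
  unfold Rdiv. apply Rmult_le_compat_l; [exact HK|]. apply Rinv_le_contravar; lra.
Qed.

Lemma rcauchy_csum (phi : nat -> R -> C) n : (forall i, (i < n)%nat -> rcauchy (phi i)) -> rcauchy (fun r => csum (fun i => phi i r) n).
Proof.
induction n; intros H e He; simpl.
- exists 0. split; [lra|]. intros r s _ _. replace (0 - 0)%C with (RtoC 0) by ring. rewrite Cmod_0. lra.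
- destruct (IHn (fun i Hi => H i ltac:(lia)) (e / 2) ltac:(lra)) as [r0 [R0 H0]].
  destruct (H n ltac:(lia) (e / 2) ltac:(lra)) as [r1 [R1 H1]].
  exists (Rmax r0 r1). assert (A := Rmax_l r0 r1). assert (A2 := Rmax_r r0 r1). split; [apply Rmax_lub_lt; lra|].
  intros r s Hr Hs. specialize (H0 r s ltac:(lra) ltac:(lra)). specialize (H1 r s ltac:(lra) ltac:(lra)). cbv beta in H0.
  set (a := csum (fun i => phi i r) n) in *. set (b := csum (fun i => phi i s) n) in *.
  replace (a + phi n r - (b + phi n s))%C with ((a - b) + (phi n r - phi n s))%C by ring.
  eapply Rle_trans; [apply Cmod_triangle|lra].
Qed.

Lemma rcauchy_cseries (phi : nat -> R -> C) K q n0 : 0 < q < 1 -> 0 <= K -> (forall i, rcauchy (phi i)) ->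
  (forall i r, (n0 <= i)%nat -> 0 <= r < 1 -> Cmod (phi i r) <= K * (1 - q) * q ^ i) ->
  rcauchy (fun r => cseries (fun i => phi i r)).
Proof.
intros Hq HK Hc Hb. apply rcauchy_uniform. intros e He.
destruct (geometric_small K q e Hq HK He) as [N HN]. exists (fun r => csum (fun i => phi i r) (N + n0)), 0.
split; [lra|split; [apply rcauchy_csum; intros; apply Hc|]]. intros r Hr.
eapply Rle_trans; [apply (cseries_tail _ K q); try assumption|apply HN; lia].
intros i Hi. apply Hb; [lia|lra].
Qed.

(** * A function with infinite radial limits exactly on a null [G_delta] *)

Lemma rel_open_initial (U : nat -> C -> Prop) n : (forall k, rel_open_T (U k)) -> rel_open_T (fun z => circle z /\ forall k, (k <= n)%nat -> U k z).
Proof.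
intros HU. split; [intros z Hz; apply Hz|]. intros z [Hc Hz].
assert (G : exists d, 0 < d /\ forall w, circle w -> Cnorm (Csub w z) < d -> forall k, (k <= n)%nat -> U k w).
{ induction n.
  - destruct (proj2 (HU O) z (Hz O (le_n _))) as [d [D Hd]]. exists d. split; [exact D|]. intros w Hw Hwz k Hk.
    replace k with O by lia. apply Hd; assumption.
  - destruct IHn as [d1 [D1 Hd1]]; [intros; apply Hz; lia|].
    destruct (proj2 (HU _) z (Hz (S n) (le_n _))) as [d [D Hd]].
    exists (Rmin d1 d). split; [apply Rmin_glb_lt; assumption|]. intros w Hw Hwz k Hk.
    assert (A := Rmin_l d1 d). assert (A2 := Rmin_r d1 d).
    destruct (Nat.eq_dec k (S n)) as [->|]; [apply Hd; [exact Hw|lra]|apply Hd1; [exact Hw|lra|lia]]. }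
destruct G as [d [D Hd]]. exists d. split; [exact D|]. intros w Hw Hwz. split; [exact Hw|apply Hd; assumption].
Qed.

Lemma fst_csum_mono (u : nat -> C) n m : (n <= m)%nat -> (forall i, 0 <= fst (u i)) -> fst (csum u n) <= fst (csum u m).
Proof.
intros H Hu. induction H; [lra|]. simpl csum. change (fst (csum u m + u m)%C) with (fst (csum u m) + fst (u m)).
specialize (Hu m). lra.
Qed.

Lemma eventually_large_sum (phi : nat -> R -> C) a n : (forall i, exists r0, 0 <= r0 < 1 /\ forall r, r0 < r < 1 -> a <= fst (phi i r)) ->
  exists r0, 0 <= r0 < 1 /\ forall r, r0 < r < 1 -> INR n * a <= fst (csum (fun i => phi i r) n).
Proof.
intros H. induction n.
- exists 0. split; [lra|]. intros. simpl. lra.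
- destruct IHn as [r0 [R0 H0]]. destruct (H n) as [r1 [R1 H1]]. exists (Rmax r0 r1).
  assert (A := Rmax_l r0 r1). assert (A2 := Rmax_r r0 r1). split; [split; [lra|apply Rmax_lub_lt; lra]|]. intros r Hr.
  specialize (H0 r ltac:(lra)). specialize (H1 r ltac:(lra)). rewrite S_INR. simpl csum.
  change (fst (csum (fun i => phi i r) n + phi n r)%C) with (fst (csum (fun i => phi i r) n) + fst (phi n r)). lra.
Qed.

(** On [G] each of the first [n] terms has real part at least [/ 5] near the end of the radius, and
    the remaining terms have nonnegative real part, so the sum eventually exceeds [n / 5] for every
    [n]. *)
Lemma infinite_on_null_G_delta G : G_delta_T G -> null_T G -> exists F : C -> C,
  (forall z, Cmod z < 1 -> cdiff F z) /\ (forall z, Cmod z < 1 -> 0 <= fst (F z)) /\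
  (forall zeta, circle zeta -> ~ G zeta -> rcauchy (ray F zeta)) /\
  (forall zeta, G zeta -> forall M, exists r0, 0 <= r0 < 1 /\ forall r, r0 < r < 1 -> M <= fst (ray F zeta r)).
Proof.
intros [U [HU HG]] HN. set (V := fun n z => circle z /\ forall k, (k <= n)%nat -> U k z).
assert (GV : forall n z, G z -> V n z) by (intros n z Hz; apply HG in Hz; split; [apply Hz|intros; apply Hz]).
assert (E : forall n, 0 < / 2 ^ n <= 1).
{ intros n. split; [apply inv_pow2_pos|]. rewrite <- Rinv_1. apply Rinv_le_contravar; [lra|]. apply pow_R1_Rle. lra. }
pose (H := fun n => bounded_function_large_on_null_set G (V n) (/ 2 ^ n) (rel_open_initial U n HU) HN (GV n) (E n)).
pose (Fn := fun n => proj1_sig (constructive_indefinite_description _ (H n))).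
assert (HF := fun n => proj2_sig (constructive_indefinite_description _ (H n))).
change (forall n, let F := Fn n in (forall z, Cmod z < 1 -> cdiff F z) /\ (forall z, Cmod z < 1 -> 0 <= fst (F z)) /\
  (forall zeta, circle zeta -> rcauchy (ray F zeta)) /\
  (forall zeta, G zeta -> exists r0, 0 <= r0 < 1 /\ forall r, r0 < r < 1 -> / 5 <= fst (ray F zeta r)) /\
  (forall zeta, circle zeta -> ~ V n zeta -> forall r, 0 <= r < 1 -> Cmod (ray F zeta r) <= 3 * / 2 ^ n) /\
  (forall z, Cmod z < 1 -> Cmod (F z) <= 3 * / 2 ^ n / (1 - Cmod z))) in HF.
cbv zeta in HF. clearbody Fn. clear H.
assert (Q : 0 < / 2 < 1) by lra.
assert (P : forall n, / 2 ^ n = (/ 2) ^ n) by (intros; symmetry; apply pow_inv).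
assert (Bd : forall n z, Cmod z < 1 -> Cmod (Fn n z) <= 6 / (1 - Cmod z) * (1 - / 2) * (/ 2) ^ n).
{ intros n z Hz. destruct (HF n) as [_ [_ [_ [_ [_ H6]]]]]. specialize (H6 z Hz). rewrite <- P.
  eapply Rle_trans; [exact H6|right; field; split; [apply pow_nonzero; lra|lra]]. }
assert (Sp : forall z, Cmod z < 1 -> Clim (csum (fun n => Fn n z)) (cseries (fun n => Fn n z))).
{ intros z Hz. apply (cseries_spec _ (6 / (1 - Cmod z)) (/ 2) O Q); [apply Rdiv_le_0_compat; lra|]. intros i _. apply Bd. exact Hz. }
assert (Pos : forall z n, Cmod z < 1 -> fst (csum (fun n => Fn n z) n) <= fst (cseries (fun n => Fn n z))).
{ intros z n Hz. apply (Clim_fst_ge _ _ _ (Sp z Hz)). exists n. intros m Hm. apply fst_csum_mono; [exact Hm|].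
  intros i. apply (HF i). exact Hz. }
exists (fun z => cseries (fun n => Fn n z)). split; [|split; [|split]].
- apply (cseries_cdiff Fn 6 (/ 2)); try assumption; [lra|]. intros n z Hz. apply (HF n). exact Hz.
- intros z Hz. apply (Pos z O Hz).
- intros zeta Hz Nz.
  assert (X : exists n0, ~ U n0 zeta).
  { apply not_all_ex_not. intros A. apply Nz, HG. split; assumption. }
  (* The sets [V i] decrease, so [zeta] lies outside all of them from [n0] on, where the terms are
     at most [3 / 2^i] along the whole radius. *)
  destruct X as [n0 Hn0]. apply (rcauchy_cseries (fun n => ray (Fn n) zeta) 6 (/ 2) n0 Q); [lra|intros i; apply (HF i); exact Hz|].
  intros i r Hi Hr. destruct (HF i) as [_ [_ [_ [_ [H5 _]]]]]. rewrite <- P.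
  replace (6 * (1 - / 2) * / 2 ^ i) with (3 * / 2 ^ i) by (field; apply pow_nonzero; lra).
  apply H5; try assumption. intros [_ Hv]. apply Hn0, Hv, Hi.
- intros zeta Hz M.
  assert (Hc : circle zeta) by (apply HG in Hz; apply Hz).
  destruct (INR_unbounded (5 * M)) as [n Hn].
  destruct (eventually_large_sum (fun n => ray (Fn n) zeta) (/ 5) n (fun i => proj1 (proj2 (proj2 (proj2 (HF i)))) zeta Hz)) as [r0 [R0 Hr0]].
  exists r0. split; [exact R0|]. intros r Hr. specialize (Hr0 r Hr). unfold ray in *.
  assert (T := Pos (RtoC r * zeta)%C n ltac:(rewrite Cmod_rzeta; try assumption; lra)). lra.
Qed.

(** * The function [exp (i Log w)] on the right half plane *)

(** For [fst w > 0] the principal argument is [atan (snd w / fst w)]. The modulus thus stays between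
    two positive constants, while the argument of the value, [ln |w|], is unbounded. *)
Definition exp_i_log (w : C) : C := (RtoC (exp (- atan (snd w / fst w))) * cis (ln (Cmod w)))%C.

Lemma differentiable_plus x y : differentiable_pt_lim (fun u v => u + v) x y 1 1.
Proof.
intros e. exists e. intros u v _ _.
replace (u + v - (x + y) - (1 * (u - x) + 1 * (v - y))) with 0 by ring. rewrite Rabs_R0.
apply Rmult_le_pos; [left; apply cond_pos|]. eapply Rle_trans; [apply Rabs_pos|apply Rmax_l].
Qed.

Lemma differentiable_mult x y : differentiable_pt_lim (fun u v => u * v) x y y x.
Proof.
intros e. exists e. intros u v Hu Hv.
replace (u * v - x * y - (y * (u - x) + x * (v - y))) with ((u - x) * (v - y)) by ring. rewrite Rabs_mult.
apply Rmult_le_compat; try apply Rabs_pos; [lra|apply Rmax_r].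
Qed.

Lemma differentiable_snd x y : differentiable_pt_lim (fun u v => v) x y 0 1.
Proof.
intros e. exists e. intros u v _ _. replace (v - y - (0 * (u - x) + 1 * (v - y))) with 0 by ring. rewrite Rabs_R0.
apply Rmult_le_pos; [left; apply cond_pos|]. eapply Rle_trans; [apply Rabs_pos|apply Rmax_l].
Qed.

Lemma differentiable_comp1 (f : R -> R) (g : R -> R -> R) x y l a b : derivable_pt_lim f (g x y) l -> differentiable_pt_lim g x y a b ->
  differentiable_pt_lim (fun u v => f (g u v)) x y (l * a) (l * b).
Proof.
intros Hf Hg. replace (l * a) with (l * a + 0 * a) by ring. replace (l * b) with (l * b + 0 * b) by ring.
apply (differentiable_pt_lim_comp (fun u _ => f u) g g); try assumption. apply differentiable_pt_lim_proj1_0. exact Hf.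
Qed.

Lemma differentiable_lim_eq f x y a b a' b' : a = a' -> b = b' -> differentiable_pt_lim f x y a b -> differentiable_pt_lim f x y a' b'.
Proof. intros -> ->. exact (fun H => H). Qed.

Lemma cauchy_riemann (f : C -> C) (z : C) a b :
  differentiable_pt_lim (fun x y => fst (f (x, y))) (fst z) (snd z) a (- b) ->
  differentiable_pt_lim (fun x y => snd (f (x, y))) (fst z) (snd z) b a -> cdiff f z.
Proof.
intros H1 H2. apply cdiff_eps. exists (a, b). intros e He.
destruct (H1 (mkposreal (e / 2) ltac:(lra))) as [d1 D1]. destruct (H2 (mkposreal (e / 2) ltac:(lra))) as [d2 D2].
exists (Rmin d1 d2). split; [apply Rmin_glb_lt; apply cond_pos|]. intros h Hh.
assert (A1 := Rmin_l d1 d2). assert (A2 := Rmin_r d1 d2). assert (B1 := Rabs_fst_le h). assert (B2 := Rabs_snd_le h).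
assert (E1 : fst z + fst h - fst z = fst h) by ring. assert (E2 : snd z + snd h - snd z = snd h) by ring.
specialize (D1 (fst z + fst h) (snd z + snd h)). specialize (D2 (fst z + fst h) (snd z + snd h)).
rewrite E1, E2 in D1, D2. specialize (D1 ltac:(lra) ltac:(lra)). specialize (D2 ltac:(lra) ltac:(lra)). simpl pos in D1, D2.
assert (M : Rmax (Rabs (fst h)) (Rabs (snd h)) <= Cmod h) by (apply Rmax_lub; assumption).
change (fst z + fst h, snd z + snd h) with (z + h)%C in D1, D2.
rewrite <- surjective_pairing in D1, D2.
eapply Rle_trans; [apply Cmod_le_abs|]. set (w := (f (z + h) - f z - (a, b) * h)%C).
assert (F1 : fst w = fst (f (z + h)%C) - fst (f z) - (a * fst h + - b * snd h)) by (unfold w; cbn [fst snd Cminus Cplus Copp Cmult]; ring).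
assert (F2 : snd w = snd (f (z + h)%C) - snd (f z) - (b * fst h + a * snd h)) by (unfold w; cbn [fst snd Cminus Cplus Copp Cmult]; ring).
rewrite F1, F2. assert (e / 2 * Rmax (Rabs (fst h)) (Rabs (snd h)) <= e / 2 * Cmod h) by (apply Rmult_le_compat_l; lra). lra.
Qed.

(* [ln |w|] is written as [ln x + ln (1 + t^2) / 2] with [t = y / x], so that only one-variable functions of [x] and [t] occur. *)
Lemma ln_Cmod_slope x y : 0 < x -> ln (Cmod (x, y)) = ln x + / 2 * ln (1 + (y * / x) * (y * / x)).
Proof.
intros Hx. assert (0 <= (y * / x) * (y * / x)) by (apply Rle_0_sqr).
assert (E : ln (Cmod (x, y)) = / 2 * ln (Cmod (x, y) ^ 2)).
{ assert (0 < Cmod (x, y)) by (eapply Rlt_le_trans; [exact Hx|]; eapply Rle_trans; [apply Rle_abs|apply (Rabs_fst_le (x, y))]).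
  set (m := Cmod (x, y)) in *. clearbody m. replace (m ^ 2) with (m * m) by ring. rewrite ln_mult by assumption. field. }
rewrite E, Cmod2_alt. cbn [Re Im fst snd].
replace (x ^ 2 + y ^ 2) with (x * x * (1 + y * / x * (y * / x))) by (field; lra).
rewrite (ln_mult (x * x)), (ln_mult x x) by nra. field.
Qed.

Lemma exp_i_log_cdiff w : 0 < fst w -> cdiff exp_i_log w.
Proof.
destruct w as [x y]. simpl. intros Hx.
set (g1 := fun u v : R => exp (- atan (v * / u))). set (lg := fun u v : R => ln u + / 2 * ln (1 + (v * / u) * (v * / u))).
set (f := fun w : C => (g1 (fst w) (snd w) * cos (lg (fst w) (snd w)), g1 (fst w) (snd w) * sin (lg (fst w) (snd w)))).
apply (cdiff_ext_loc f _ (x, y) x Hx).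
{ intros w Hw. assert (T := Rabs_fst_le (w - (x, y))%C). change (fst (w - (x, y))%C) with (fst w - x) in T.
  assert (P : 0 < fst w) by (assert (T2 := Rabs_def2 (fst w - x) x ltac:(lra)); lra).
  unfold exp_i_log, f. destruct w as [u v]. rewrite (ln_Cmod_slope u v P). fold (lg u v). simpl fst in *. simpl snd.
  unfold Rdiv. fold (g1 u v). apply injective_projections; cbn [fst snd cis RtoC Cmult]; unfold cis; simpl; ring. }
set (t := y * / x).
assert (N : 0 < x ^ 2 + y ^ 2) by nra.
assert (D : 0 < 1 + t * t) by nra.
assert (Ht : differentiable_pt_lim (fun u v => v * / u) x y (- (y / x ^ 2)) (/ x)).
{ eapply differentiable_lim_eq; [| |apply (differentiable_pt_lim_comp (fun p q => p * q) (fun u v => v) (fun u v => / u));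
   [apply differentiable_mult|apply differentiable_snd|apply (differentiable_pt_lim_proj1_0 Rinv x y (- / x ^ 2))]].
  - field. lra.
  - field. lra.
  - apply is_derive_Reals. auto_derive; [lra|field; lra]. }
assert (Ha : differentiable_pt_lim g1 x y (g1 x y * (y / (x ^ 2 + y ^ 2))) (- (g1 x y * (x / (x ^ 2 + y ^ 2))))).
{ eapply differentiable_lim_eq; [| |apply (differentiable_comp1 (fun s => exp (- atan s)) (fun u v => v * / u) x y (- (exp (- atan t) * / (1 + t * t)))); [|exact Ht]].
  - unfold g1. fold t. unfold t at 2 3. field. split; lra.
  - unfold g1. fold t. unfold t at 2 3. field. split; lra.
  - apply is_derive_Reals. fold t. auto_derive; [exact I|]. unfold Rsqr. field. lra. }
assert (Hl : differentiable_pt_lim lg x y (x / (x ^ 2 + y ^ 2)) (y / (x ^ 2 + y ^ 2))).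
{ eapply differentiable_lim_eq; [| |apply (differentiable_pt_lim_comp (fun p q => p + q) (fun u v => ln u) (fun u v => / 2 * ln (1 + v * / u * (v * / u))));
   [apply differentiable_plus|apply (differentiable_pt_lim_proj1_0 ln x y (/ x)); apply derivable_pt_lim_ln; exact Hx|
    apply (differentiable_comp1 (fun s => / 2 * ln (1 + s * s)) (fun u v => v * / u) x y (t / (1 + t * t))); [|exact Ht]]].
  - unfold t. field. split; lra.
  - unfold t. field. split; lra.
  - apply is_derive_Reals. fold t. auto_derive; [exact D|]. field. lra. }
set (c := cos (lg x y)). set (s := sin (lg x y)). set (e := g1 x y) in *. set (p := x / (x ^ 2 + y ^ 2)) in *. set (q := y / (x ^ 2 + y ^ 2)) in *.
(* The real and imaginary parts of the derivative [i exp (i Log w) / w], with [1 / w = p - i q]. *)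
apply (cauchy_riemann f (x, y) (e * (q * c - p * s)) (e * (q * s + p * c))); simpl fst; simpl snd.
- eapply differentiable_lim_eq; [| |apply (differentiable_pt_lim_comp (fun p q => p * q) g1 (fun u v => cos (lg u v)));
   [apply differentiable_mult|exact Ha|apply (differentiable_comp1 cos lg x y (- s)); [apply derivable_pt_lim_cos|exact Hl]]].
  + fold c e. ring.
  + fold c e. ring.
- eapply differentiable_lim_eq; [| |apply (differentiable_pt_lim_comp (fun p q => p * q) g1 (fun u v => sin (lg u v)));
   [apply differentiable_mult|exact Ha|apply (differentiable_comp1 sin lg x y c); [apply derivable_pt_lim_sin|exact Hl]]].
  + fold s e. ring.
  + fold s e. ring.
Qed.

Lemma exp_atan_bounds t : exp (-2) <= exp (- atan t) <= exp 2.
Proof.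
assert (B := atan_bound t). assert (P := PI_4). split; apply Rlt_le, exp_increasing; lra.
Qed.

Lemma exp_i_log_bound w : Cmod (exp_i_log w) <= exp 2.
Proof.
unfold exp_i_log. rewrite Cmod_mult, Cmod_cis, Cmod_R, Rabs_pos_eq by (left; apply exp_pos).
assert (T := exp_atan_bounds (snd w / fst w)). lra.
Qed.

(* The two arguments have logarithms of modulus differing by an odd multiple of [PI], so the values lie on opposite rays. *)
Lemma exp_i_log_opposite w w' k : ln (Cmod w) = 2 * INR k * PI -> ln (Cmod w') = PI + 2 * INR k * PI ->
  2 * exp (-2) <= Cmod (exp_i_log w - exp_i_log w')%C.
Proof.
intros H1 H2. eapply Rle_trans; [|apply Rabs_fst_le]. eapply Rle_trans; [|apply Rle_abs].
unfold exp_i_log. rewrite H1, H2. unfold cis. cbn [fst snd Cminus Cplus Copp Cmult RtoC].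
rewrite <- (Rplus_0_l (2 * INR k * PI)) at 1 2. rewrite !cos_period, cos_0, cos_PI.
assert (T := exp_atan_bounds (snd w / fst w)). assert (T' := exp_atan_bounds (snd w' / fst w')). lra.
Qed.

Lemma ray_continuous f zeta r : (forall z, Cmod z < 1 -> cdiff f z) -> circle zeta -> 0 <= r < 1 -> forall eps, 0 < eps ->
  exists d, 0 < d /\ forall s, Rabs (s - r) < d -> Cmod (ray f zeta s - ray f zeta r)%C < eps.
Proof.
intros Hf Hz Hr eps He.
assert (Az : Cmod (RtoC r * zeta)%C < 1) by (rewrite Cmod_rzeta; try assumption; lra).
destruct (cdiff_continuous f (RtoC r * zeta)%C (Hf _ Az) eps He) as [d [D Hd]].
exists d. split; [exact D|]. intros s Hs. apply Hd. unfold circle in Hz. rewrite Cnorm_Cmod in Hz.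
replace (RtoC s * zeta - RtoC r * zeta)%C with (RtoC (s - r) * zeta)%C by (rewrite RtoC_minus; ring).
rewrite Cmod_mult, Cmod_R, Hz. lra.
Qed.

Lemma ln_Cmod_ray_continuous f zeta r : (forall z, Cmod z < 1 -> cdiff f z) -> circle zeta -> 0 <= r < 1 -> ray f zeta r <> 0%C ->
  continuity_pt (fun s => ln (Cmod (ray f zeta s))) r.
Proof.
intros Hf Hz Hr N. apply (continuity_pt_comp (fun s => Cmod (ray f zeta s)) ln).
- intros eps He. destruct (ray_continuous f zeta r Hf Hz Hr eps He) as [d [D Hd]]. exists d. split; [exact D|].
  intros s [_ Hs]. simpl in *. unfold R_dist in *. specialize (Hd s Hs). eapply Rle_lt_trans; [|exact Hd].
  apply Rabs_le. assert (T1 := Cmod_rev_triangle (ray f zeta s) (ray f zeta r)). assert (T2 := Cmod_rev_triangle (ray f zeta r) (ray f zeta s)).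
  rewrite Cmod_minus_sym in T2. lra.
- apply derivable_continuous_pt. exists (/ Cmod (ray f zeta r)). apply derivable_pt_lim_ln. apply Cmod_gt_0. exact N.
Qed.

(** Off [G], a finite limit of [1 + F] lies in the open right half plane, where [exp_i_log] is
    continuous. On [G], [ln |1 + F|] is continuous along the radius and tends to infinity, so beyond
    every [r0] it takes the values [2 k PI] and [PI + 2 k PI] for some [k], at which the values of
    [exp_i_log] are opposite in direction. *)
Lemma bounded_oscillating_on_null_G_delta G : G_delta_T G -> null_T G -> exists f : C -> C,
  (forall z, Cmod z < 1 -> cdiff f z) /\ (forall z, Cmod z < 1 -> Cmod (f z) <= exp 2) /\
  (forall zeta, circle zeta -> ~ G zeta -> rcauchy (ray f zeta)) /\
  (forall zeta, G zeta -> forall r0, r0 < 1 -> exists r s, r0 < r < 1 /\ r0 < s < 1 /\ 0 <= r /\ 0 <= s /\ 2 * exp (-2) <= Cmod (ray f zeta r - ray f zeta s)%C).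
Proof.
intros HG HN. destruct (infinite_on_null_G_delta G HG HN) as [F [H1 [H2 [H3 H4]]]].
assert (H5 : forall z, Cmod z < 1 -> 1 <= fst (1 + F z)%C).
{ intros z Hz. change (fst (1 + F z)%C) with (1 + fst (F z)). specialize (H2 z Hz). lra. }
assert (H6 : forall z, Cmod z < 1 -> cdiff (fun z => 1 + F z)%C z).
{ intros z Hz. apply cdiff_plus; [apply cdiff_const|apply H1; exact Hz]. }
exists (fun z => exp_i_log (1 + F z)%C). split; [|split; [|split]].
- intros z Hz. apply (cdiff_comp exp_i_log (fun z => 1 + F z)%C); [apply exp_i_log_cdiff|apply H6; exact Hz]. specialize (H5 z Hz). lra.
- intros z Hz. apply exp_i_log_bound.
- intros zeta Hz Nz. destruct (rcauchy_lim _ (H3 zeta Hz Nz)) as [L HL].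
  (* A crude bound suffices to keep [1 + L] in the open right half plane. *)
  assert (PL : - / 2 <= fst L).
  { destruct (HL (/ 2) ltac:(lra)) as [r0 [R0 Hr0]]. set (r := (1 + Rmax 0 r0) / 2).
    assert (A := Rmax_l 0 r0). assert (A2 := Rmax_r 0 r0). assert (A3 : Rmax 0 r0 < 1) by (apply Rmax_lub_lt; lra).
    specialize (Hr0 r ltac:(unfold r; lra)). specialize (H2 (RtoC r * zeta)%C ltac:(rewrite Cmod_rzeta; unfold r; try assumption; lra)).
    assert (T := Rabs_fst_le (ray F zeta r - L)%C). change (fst (ray F zeta r - L)%C) with (fst (ray F zeta r) - fst L) in T.
    unfold ray in T at 1. assert (T2 := Rle_abs (fst (F (RtoC r * zeta)%C) - fst L)). lra. }
  apply (rlim_cauchy _ (exp_i_log (1 + L)%C)). intros e He.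
  destruct (cdiff_continuous exp_i_log (1 + L)%C) with (eps := e) as [d [D Hd]]; [apply exp_i_log_cdiff|exact He|].
  { change (fst (1 + L)%C) with (1 + fst L). lra. }
  destruct (HL (d / 2) ltac:(lra)) as [r0 [R0 Hr0]]. exists r0. split; [exact R0|]. intros r Hr. left. apply Hd.
  replace (1 + F (RtoC r * zeta) - (1 + L))%C with (ray F zeta r - L)%C by (unfold ray; ring). specialize (Hr0 r Hr). lra.
- intros zeta Hz r0 R0.
  assert (Hc : circle zeta) by (destruct HG as [U [_ HU]]; apply HU in Hz; apply Hz).
  set (w := ray (fun z => 1 + F z)%C zeta). set (u := fun r => ln (Cmod (w r))).
  assert (W : forall r, 0 <= r < 1 -> fst (w r) <= Cmod (w r) /\ 1 <= fst (w r)).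
  { intros r Hr. split; [eapply Rle_trans; [apply Rle_abs|apply Rabs_fst_le]|]. apply H5. rewrite Cmod_rzeta; try assumption; lra. }
  assert (Cu : forall r, 0 <= r < 1 -> continuity_pt u r).
  { intros r Hr. apply ln_Cmod_ray_continuous; try assumption. specialize (W r Hr). apply Cmod_gt_0. unfold w in W. lra. }
  set (a := (1 + Rmax 0 r0) / 2). assert (A := Rmax_l 0 r0). assert (A2 := Rmax_r 0 r0). assert (A3 : Rmax 0 r0 < 1) by (apply Rmax_lub_lt; lra).
  assert (Ha : 0 < a < 1 /\ r0 < a) by (unfold a; lra). clearbody a.
  assert (PP : 2 < PI) by (assert (T := PI2_1); lra).
  destruct (INR_unbounded (u a)) as [k Hk].
  assert (Hk' : u a < 2 * INR k * PI) by (assert (K0 := pos_INR k); nra).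
  destruct (H4 zeta Hz (exp (PI + 2 * INR k * PI + 1))) as [r1 [R1 Hr1]].
  set (b := (1 + Rmax a r1) / 2). assert (B := Rmax_l a r1). assert (B2 := Rmax_r a r1). assert (B3 : Rmax a r1 < 1) by (apply Rmax_lub_lt; lra).
  assert (Hb : a < b < 1 /\ r1 < b) by (unfold b; lra). clearbody b.
  assert (Hub : PI + 2 * INR k * PI < u b).
  { unfold u. rewrite <- (ln_exp (PI + 2 * INR k * PI)) at 1. apply ln_increasing; [apply exp_pos|].
    specialize (Hr1 b ltac:(lra)). destruct (W b ltac:(lra)) as [W1 _].
    assert (E : fst (w b) = 1 + fst (ray F zeta b)) by reflexivity.
    assert (T := exp_increasing (PI + 2 * INR k * PI) (PI + 2 * INR k * PI + 1) ltac:(lra)). lra. }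
  assert (IV : forall c, u a < c < u b -> exists r, a <= r <= b /\ u r = c).
  { intros c Hc'. destruct (IVT_interv (fun r => u r - c) a b) as [r [Hr Er]].
    - intros r Hr. apply (continuity_pt_minus u (fun _ => c)); [apply Cu; lra|]. apply continuity_pt_const. intros ? ?. reflexivity.
    - lra.
    - lra.
    - lra.
    - exists r. split; [exact Hr|lra]. }
  destruct (IV (2 * INR k * PI) ltac:(lra)) as [r [Hr Er]]. destruct (IV (PI + 2 * INR k * PI) ltac:(lra)) as [s [Hs Es]].
  exists r, s. split; [lra|]. split; [lra|]. split; [lra|]. split; [lra|]. apply (exp_i_log_opposite (w r) (w s) k); assumption.
Qed.

Lemma exp_2_ratio : exp 2 / 99 < exp (-2).
Proof.
assert (E : exp 2 <= 9).
{ replace 2 with (1 + 1) by ring. rewrite exp_plus. assert (T := exp_le_3). assert (P := exp_pos 1). nra. }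
assert (P := exp_pos 2). apply (Rmult_lt_reg_r (exp 2)); [exact P|].
rewrite <- exp_plus. replace (-2 + 2) with 0 by ring. rewrite exp_0.
assert (exp 2 * exp 2 <= 9 * 9) by (apply Rmult_le_compat; lra). lra.
Qed.

(* With weights [100^-n], the oscillation of the first non-convergent term, at least [2 e^-2 100^-n], exceeds that of the
   tail, at most [2 e^2 100^-n / 99], because [e^4 < 99]. *)
Lemma no_limit_on_null_G_delta_sigma E : G_delta_sigma_T E -> null_T E -> exists f : C -> C,
  (forall z, Cmod z < 1 -> cdiff f z) /\ (exists M, forall z, Cmod z < 1 -> Cmod (f z) <= M) /\
  (forall zeta, circle zeta -> (rcauchy (ray f zeta) <-> ~ E zeta)).
Proof.
intros [G [HG HE]] HN.
assert (H : forall n, exists f : C -> C, (forall z, Cmod z < 1 -> cdiff f z) /\ (forall z, Cmod z < 1 -> Cmod (f z) <= exp 2) /\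
  (forall zeta, circle zeta -> ~ G n zeta -> rcauchy (ray f zeta)) /\
  (forall zeta, G n zeta -> forall r0, r0 < 1 -> exists r s, r0 < r < 1 /\ r0 < s < 1 /\ 0 <= r /\ 0 <= s /\ 2 * exp (-2) <= Cmod (ray f zeta r - ray f zeta s)%C)).
{ intros n. apply bounded_oscillating_on_null_G_delta; [apply HG|]. intros e He. destruct (HN e He) as [a [b [A1 [A2 A3]]]].
  exists a, b. split; [exact A1|split; [exact A2|]]. intros z Hz. apply A3, HE. exists n. exact Hz. }
pose (fn := fun n => proj1_sig (constructive_indefinite_description _ (H n))).
assert (HF := fun n => proj2_sig (constructive_indefinite_description _ (H n))). cbv beta in HF. fold fn in HF.
change (forall n, (forall z, Cmod z < 1 -> cdiff (fn n) z) /\ (forall z, Cmod z < 1 -> Cmod (fn n z) <= exp 2) /\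
  (forall zeta, circle zeta -> ~ G n zeta -> rcauchy (ray (fn n) zeta)) /\
  (forall zeta, G n zeta -> forall r0, r0 < 1 -> exists r s, r0 < r < 1 /\ r0 < s < 1 /\ 0 <= r /\ 0 <= s /\ 2 * exp (-2) <= Cmod (ray (fn n) zeta r - ray (fn n) zeta s)%C)) in HF.
clearbody fn. clear H. set (q := / 100). assert (Q : 0 < q < 1) by (unfold q; lra).
(* Normalized so that [K * (1 - q)] is the bound [exp 2] of the functions [fn n]. *)
set (K := exp 2 * (100 / 99)). assert (EP := exp_pos 2). assert (HK : 0 <= K) by (unfold K; lra).
set (term := fun n z => (RtoC (q ^ n) * fn n z)%C).
assert (QP : forall n, 0 < q ^ n) by (intros; apply pow_lt; lra).
assert (Ct : forall n z, Cmod (term n z) = q ^ n * Cmod (fn n z)).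
{ intros n z. unfold term. specialize (QP n). rewrite Cmod_mult, Cmod_R, Rabs_pos_eq by lra. reflexivity. }
assert (Bd : forall n z, Cmod z < 1 -> Cmod (term n z) <= K * (1 - q) * q ^ n).
{ intros n z Hz. rewrite Ct. replace (K * (1 - q)) with (exp 2) by (unfold K, q; field). rewrite Rmult_comm.
  apply Rmult_le_compat_r; [left; apply QP|]. apply (HF n). exact Hz. }
assert (Ht : forall n zeta, rcauchy (ray (fn n) zeta) -> rcauchy (ray (term n) zeta)).
{ intros n zeta Hc e He. destruct (Hc e He) as [r0 [R0 Hr]]. exists r0. split; [exact R0|]. intros r s H1 H2. specialize (Hr r s H1 H2).
  unfold ray, term in *.
  set (x := fn n (RtoC r * zeta)%C) in *. set (y := fn n (RtoC s * zeta)%C) in *.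
  replace (RtoC (q ^ n) * x - RtoC (q ^ n) * y)%C with (RtoC (q ^ n) * (x - y))%C by ring. specialize (QP n).
  rewrite Cmod_mult, Cmod_R, Rabs_pos_eq by lra. assert (q ^ n <= 1) by (rewrite <- (pow1 n); apply pow_incr; lra).
  assert (P := Cmod_ge_0 (x - y)%C). nra. }
exists (fun z => cseries (fun n => term n z)). split; [|split].
- apply (cseries_cdiff term K q Q HK).
  + intros n z Hz. apply cdiff_mult; [apply cdiff_const|apply (HF n); exact Hz].
  + intros n z Hz. eapply Rle_trans; [apply Bd; exact Hz|]. apply Rmult_le_compat_r; [left; apply QP|].
    apply Rmult_le_compat_r; [lra|]. assert (P := Cmod_ge_0 z). rewrite <- (Rmult_1_r K) at 1. apply Rmult_le_compat_l; [exact HK|].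
    rewrite <- Rinv_1. apply Rinv_le_contravar; lra.
- exists K. intros z Hz. assert (T := cseries_tail (fun n => term n z) K q O Q HK (fun i _ => Bd i z Hz)).
  simpl in T. replace (cseries (fun n => term n z) - 0)%C with (cseries (fun n => term n z)) in T by ring. lra.
- intros zeta Hz. split.
  + intros Hc Ez. apply HE in Ez.
    (* For the least [n] with [zeta] in [G n], all earlier terms have radial limits, so the
       oscillation of term [n] can only be offset by the tail. *)
    destruct (dec_inh_nat_subset_has_unique_least_element (fun n => G n zeta) (fun n => classic _) Ez) as [n [[Gn Ln] _]].
    assert (Hp : rcauchy (fun r => csum (fun i => ray (term i) zeta r) n)).
    { apply rcauchy_csum. intros i Hi. apply Ht, (HF i); [exact Hz|]. intros Gi. specialize (Ln i Gi). lia. }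
    set (gap := 2 * exp (-2) - 2 * exp 2 / 99). assert (Gp : 0 < gap).
    { unfold gap. assert (T := exp_2_ratio). lra. }
    assert (Qn := QP n).
    destruct (Hc (gap * q ^ n / 3)) as [r0 [R0 Hr0]]; [apply Rdiv_lt_0_compat; [apply Rmult_lt_0_compat; assumption|lra]|].
    destruct (Hp (gap * q ^ n / 3)) as [r1 [R1 Hr1]]; [apply Rdiv_lt_0_compat; [apply Rmult_lt_0_compat; assumption|lra]|].
    destruct (HF n) as [_ [_ [_ H4]]].
    destruct (H4 zeta Gn (Rmax r0 r1)) as [r [s [Hr [Hs [P1 [P2 Osc]]]]]]; [apply Rmax_lub_lt; lra|].
    assert (A := Rmax_l r0 r1). assert (A2 := Rmax_r r0 r1).
    specialize (Hr0 r s ltac:(lra) ltac:(lra)). specialize (Hr1 r s ltac:(lra) ltac:(lra)).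
    assert (Tl : forall r, 0 <= r < 1 -> Cmod (cseries (fun i => term i (RtoC r * zeta)%C) - csum (fun i => term i (RtoC r * zeta)%C) (S n))%C <= exp 2 / 99 * q ^ n).
    { intros t Ht'. eapply Rle_trans; [apply (cseries_tail _ K q (S n) Q HK)|].
      - intros i _. apply Bd. rewrite Cmod_rzeta; try assumption; lra.
      - right. simpl pow. unfold K, q. field. }
    assert (T1 := Tl r ltac:(lra)). assert (T2 := Tl s ltac:(lra)). simpl csum in T1, T2. unfold ray in Hr0, Hr1, Osc.
    set (Fr := cseries (fun i => term i (RtoC r * zeta)%C)) in *. set (Fs := cseries (fun i => term i (RtoC s * zeta)%C)) in *.
    set (Pr := csum (fun i => term i (RtoC r * zeta)%C) n) in *. set (Ps := csum (fun i => term i (RtoC s * zeta)%C) n) in *.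
    assert (Od : 2 * exp (-2) * q ^ n <= Cmod (term n (RtoC r * zeta)%C - term n (RtoC s * zeta)%C)%C).
    { unfold term. set (x := fn n (RtoC r * zeta)%C) in *. set (y := fn n (RtoC s * zeta)%C) in *.
      replace (RtoC (q ^ n) * x - RtoC (q ^ n) * y)%C with (RtoC (q ^ n) * (x - y))%C by ring.
      rewrite Cmod_mult, Cmod_R, Rabs_pos_eq by lra. rewrite Rmult_comm. apply Rmult_le_compat_l; lra. }
    set (tr := term n (RtoC r * zeta)%C) in *. set (ts := term n (RtoC s * zeta)%C) in *.
    clearbody tr ts Fr Fs Pr Ps.
    assert (Tri : Cmod (tr - ts)%C <= Cmod (Fr - Fs)%C + Cmod (Pr - Ps)%C + Cmod (Fr - (Pr + tr))%C + Cmod (Fs - (Ps + ts))%C).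
    { replace (tr - ts)%C with ((Fr - Fs) + - (Pr - Ps) + - (Fr - (Pr + tr)) + (Fs - (Ps + ts)))%C by ring.
      eapply Rle_trans; [apply Cmod_triangle|]. apply Rplus_le_compat_r. eapply Rle_trans; [apply Cmod_triangle|]. rewrite Cmod_opp. apply Rplus_le_compat_r.
      eapply Rle_trans; [apply Cmod_triangle|]. rewrite Cmod_opp. lra. }
    assert (Fin : gap * q ^ n = 2 * exp (-2) * q ^ n - 2 * (exp 2 / 99 * q ^ n)) by (unfold gap; field).
    assert (0 < gap * q ^ n) by (apply Rmult_lt_0_compat; assumption). lra.
  + intros Nz. apply (rcauchy_cseries (fun n => ray (term n) zeta) K q O Q HK).
    * intros i. apply Ht, (HF i); [exact Hz|]. intros Gi. apply Nz, HE. exists i. exact Gi.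
    * intros i r _ Hr. apply Bd. rewrite Cmod_rzeta; try assumption; lra.
Qed.

(** * The characterization of the exceptional sets *)

Lemma C_differentiable_at_cdiff f z : C_differentiable_at f z <-> cdiff f z.
Proof.
rewrite cdiff_eps. split; intros [l H]; exists l; intros e He; destruct (H e He) as [d [D Hd]]; exists d; (split; [exact D|]); intros h Hh.
- specialize (Hd h). rewrite !Cnorm_Cmod in Hd. exact (Hd Hh).
- rewrite !Cnorm_Cmod in *. exact (Hd h Hh).
Qed.

Lemma Hinf_cdiff f : Hinf f <-> (forall z, Cmod z < 1 -> cdiff f z) /\ (exists M, forall z, Cmod z < 1 -> Cmod (f z) <= M).
Proof.
unfold Hinf. assert (D : forall z : C, Defs.disc z <-> Cmod z < 1) by (intros z; unfold Defs.disc; rewrite Cnorm_Cmod; reflexivity).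
split; intros [H1 [M H2]].
- split; [intros z Hz; apply C_differentiable_at_cdiff, H1, D, Hz|]. exists M. intros z Hz. rewrite <- Cnorm_Cmod. apply H2, D, Hz.
- split; [intros z Hz; apply C_differentiable_at_cdiff, H1, D, Hz|]. exists M. intros z Hz. rewrite Cnorm_Cmod. apply H2, D, Hz.
Qed.

Theorem mainTheorem5 (E : Cx -> Prop) (HE : forall z, E z -> circle z) :
  (exists f : Cx -> Cx, Hinf f /\
     forall zeta, circle zeta -> (radial_limit_exists f zeta <-> ~ E zeta))
  <-> (G_delta_sigma_T E /\ null_T E).
Proof.
split.
- intros [f [Hf Hr]]. apply Hinf_cdiff in Hf. destruct Hf as [Hd [M HM]].
  assert (X : forall z, E z <-> circle z /\ ~ radial_limit_exists f z).
  { intros z. split.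
    - intros Ez. assert (Hc := HE z Ez). split; [exact Hc|]. intros R. exact (proj1 (Hr z Hc) R Ez).
    - intros [Hc N]. apply NNPP. intros Ez. apply N, (Hr z Hc), Ez. }
  split.
  + destruct (nonexistence_G_delta_sigma f Hd) as [G [HG Hu]]. exists G. split; [exact HG|]. intros z. rewrite X. apply Hu.
  + intros e He. destruct (fatou f M Hd HM e He) as [a [b [H1 [H2 H3]]]]. exists a, b. split; [exact H1|split; [exact H2|]].
    intros z Ez. apply H3, X, Ez.
- intros [HG HN]. destruct (no_limit_on_null_G_delta_sigma E HG HN) as [f [H1 [H2 H3]]]. exists f.
  split; [apply Hinf_cdiff; split; assumption|]. intros zeta Hz. rewrite radial_limit_iff. apply H3. exact Hz.
Qed.
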